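(* Let $u_0\in\mathcal S([0,\infty))$ and $g_0,g_1\in C^\infty([0,\infty))$, and let $u(x,t)$, $(x,t)\in Q=\mathbb R^+\times\mathbb R^+$, be defined by $$\begin{aligned}2\pi u(x,t)=&\int_{-\infty}^{\infty}e^{i\lambda x-\omega(\lambda)t}\hat u_0(\lambda)\,d\lambda\\&+\int_{\Gamma_1}e^{i\lambda x-\omega(\lambda)t}\big[(2-2i)\lambda^3\widetilde g_0(\omega(\lambda),t)+(-2+2i)\lambda^2\widetilde g_1(\omega(\lambda),t)-i\hat u_0(-\lambda)+(i-1)\hat u_0(i\lambda)\big]d\lambda\\&+\int_{\Gamma_2}e^{i\lambda x-\omega(\lambda)t}\big[(-2-2i)\lambda^3\widetilde g_0(\omega(\lambda),t)+(-2-2i)\lambda^2\widetilde g_1(\omega(\lambda),t)+i\hat u_0(-\lambda)-(i+1)\hat u_0(-i\lambda)\big]d\lambda .\end{aligned}$$ Then: 1. For all $n,m=0,1,2,\dots$ the limits $W_{n,m}(x):=\lim_{t\to0^+}\frac{\partial^{n+m}u(x,t)}{\partial x^n\partial t^m}$ exist and are uniform for $x\ge x_0$ (for every $x_0>0$). Moreover the functions $W_{n,m}$ are $C^\infty$ on $(0,\infty)$. 2. For all $n,m=0,1,2,\dots$ the limits $V_{n,m}(t):=\lim_{x\to0^+}\frac{\partial^{n+m}u(x,t)}{\partial x^n\partial t^m}$ exist and are uniform for $t\ge t_0$ (for every $t_0>0$). Moreover the functions $V_{n,m}$ are $C^\infty$ on $(0,\infty)$. 3. The function $u$, extended to $\overline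 Q-\{(0,0)\}$ by setting $u^*(x,0):=u_0(x)$ for $x>0$ and $u^*(0,t):=g_0(t)$ for $t>0$, is $C^\infty$ in $\overline Q-\{(0,0)\}$. 4. For every $n\ge 0$, $\lim_{t\to0^+}\frac{\partial^nu(x,t)}{\partial x^n}=\frac{d^nu_0(x)}{dx^n}$, uniformly for $x\ge x_0$ (for every $x_0>0$). 5. For every $m\ge0$, $\lim_{x\to0^+}\frac{\partial^mu(x,t)}{\partial t^m}=\frac{d^mg_0(t)}{dt^m}$, uniformly for $t\ge t_0$ (for every $t_0>0$). 6. For every $m\ge0$, $\lim_{x\to0^+}\frac{\partial^{m+1}u(x,t)}{\partial t^m\partial x}=\frac{d^mg_1(t)}{dt^m}$, uniformly for $t\ge t_0$ (for every $t_0>0$).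
   Context: $\mathbb R^+=(0,\infty)$, $\overline Q=[0,\infty)\times[0,\infty)$. $\mathcal S([0,\infty))$ is the space of $C^\infty$ functions on $[0,\infty)$ which, together with all derivatives, are rapidly decreasing as $x\to\infty$. Here $\omega(\lambda)=\lambda^4$, $\hat u_0(\lambda)=\int_0^\infty e^{-i\lambda y}u_0(y)\,dy$ for $\lambda\in\mathbb C$, $\operatorname{Im}\lambda\le0$, and $\widetilde g_j(\omega(\lambda),t)=\int_0^te^{\omega(\lambda)\tau}g_j(\tau)\,d\tau$ for $\lambda\in\mathbb C$, $j=0,1$. Contours: $\Gamma_1$ is the boundary of the sector $\{\frac{5\pi}8\le\arg\lambda\le\frac{7\pi}8\}$, traversed from $\infty e^{i7\pi/8}$ to $0$ and then from $0$ to $\infty e^{i5\pi/8}$; $\Gamma_2$ is the boundary of the sector $\{\frac{\pi}8\le\arg\lambda\le\frac{3\pi}8\}$, traversed from $\infty e^{i3\pi/8}$ to $0$ and then from $0$ to $\infty e^{i\pi/8}$.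
   Formalization: In items 2, 5 and 6 the limits x→0+ are uniform for t0 ≤ t ≤ T (every 0 < t0 ≤ T) instead of all t ≥ t0; the literal claim fails, e.g. u0=0, g0=0, g1(t)=t, where items 5 and 6 contradict each other. *)

(* Defs.v *)
From Stdlib Require Import Reals.
From Coquelicot Require Import Coquelicot.
Open Scope R_scope.

(* Complex-valued functions of real variables are differentiated and integrated
   in C seen as a real Banach space. *)
Notation CR := C_R_CompleteNormedModule.

Definition Cexp (z : C) : C := (exp (Re z) * cos (Im z), exp (Re z) * sin (Im z)).

Definition CDerive_n (f : R -> C) (n : nat) (x : R) : C :=
  (Derive_n (fun y => Re (f y)) n x, Derive_n (fun y => Im (f y)) n x).

(* The partial derivatives are total operators (unspecified where a derivative
   fails to exist); for functions satisfying smooth2_on below they are the genuine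
   ones in the interior. *)
Definition dx (n : nat) (u : R -> R -> C) : R -> R -> C :=
  fun x t => CDerive_n (fun y => u y t) n x.

Definition dt (m : nat) (u : R -> R -> C) : R -> R -> C :=
  fun x t => CDerive_n (fun s => u x s) m t.

(* The derivative of f at x relative to A: two-sided when x is interior to A,
   one-sided at an endpoint of the interval A. Only the values of f on A and at
   x matter. *)
Definition is_derive_within (A : R -> Prop) (f : R -> C) (x : R) (l : C) : Prop :=
  filterdiff (f : R -> CR) (within A (locally x)) (fun h : R => scal h (l : CR)).

(* [D k] is the k-th derivative of f on A. *)
Definition derivatives_on (A : R -> Prop) (f : R -> C) (D : nat -> R -> C) : Prop :=
  (forall x, A x -> D 0%nat x = f x) /\
  (forall k x, A x -> is_derive_within A (D k) x (D (S k) x)).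

Definition smooth_on (A : R -> Prop) (f : R -> C) : Prop :=
  exists D, derivatives_on A f D.

Definition nonneg_half_line (x : R) : Prop := 0 <= x.
Definition pos_half_line (x : R) : Prop := 0 < x.

Definition schwartz_half_line (f : R -> C) : Prop :=
  exists D, derivatives_on nonneg_half_line f D /\
    forall j k : nat, exists M : R, forall x, 0 <= x -> x ^ j * Cmod (D k x) <= M.

(* C^infinity on a subset A of the plane, possibly containing part of its
   boundary: all the iterated partial derivatives, taken relative to A (hence
   one-sided in the normal direction at a boundary point), exist and are
   continuous on A. [D n m] is the derivative of order n in the first variable
   and m in the second one. *)
Definition smooth2_on (A : R -> R -> Prop) (f : R -> R -> C) : Prop :=
  exists D : nat -> nat -> R -> R -> C,
    (forall x t, A x t -> D 0%nat 0%nat x t = f x t) /\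
    (forall n m,
       continuous_on (fun p : R * R => A (fst p) (snd p))
         (fun p : R * R => D n m (fst p) (snd p) : CR)) /\
    (forall n m x t, A x t ->
       is_derive_within (fun y => A y t) (fun y => D n m y t) x (D (S n) m x t) /\
       is_derive_within (fun s => A x s) (fun s => D n m x s) t (D n (S m) x t)).

Definition closed_quadrant_minus_origin (x t : R) : Prop :=
  0 <= x /\ 0 <= t /\ (x, t) <> (0, 0).

(* f s y tends to w y as s -> 0+, uniformly for y in A.
   For the limits x -> 0+, A is a segment [t0, T] with 0 < t0 <= T arbitrary, and
   not [t0, +oo): boundary data may grow arbitrarily fast. For instance
   u -> g0 = 0 and d_x u -> g1 = t, both uniformly on [t0, +oo), contradict each
   other: for small fixed a < b, u b t - u a t would be bounded by the former and
   at least (t - 1) * (b - a) by the latter. *)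
Definition unif_lim_at_0 (A : R -> Prop) (f : R -> R -> C) (w : R -> C) : Prop :=
  forall eps : posreal,
    at_right 0 (fun s => forall y, A y -> Cmod (f s y - w y)%C < eps).

Definition omega (l : C) : C := (l ^ 4)%C.

(* Used only for Im l <= 0. *)
Definition hat (u0 : R -> C) (l : C) : C :=
  RInt_gen (V := CR) (fun y : R => (Cexp (- (Ci * l * y)) * u0 y)%C)
    (at_point 0) (Rbar_locally p_infty).

(* [tilde g w t] with w = omega l is the transform of g at (omega l, t). *)
Definition tilde (g : R -> C) (w : C) (t : R) : C :=
  RInt (V := CR) (fun s : R => (Cexp (w * s) * g s)%C) 0 t.

Definition int_line (F : C -> C) : C :=
  RInt_gen (V := CR) (fun r : R => F r) (Rbar_locally m_infty) (Rbar_locally p_infty).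

(* The integral of F along the ray of argument theta, from 0 to infinity. *)
Definition int_ray (theta : R) (F : C -> C) : C :=
  RInt_gen (V := CR) (fun r : R => (F (r * Cexp (Ci * theta)) * Cexp (Ci * theta))%C)
    (at_point 0) (Rbar_locally p_infty).

(* The contours come in from infinity along their first ray, hence the minus
   sign. *)
Definition int_Gamma1 (F : C -> C) : C :=
  (- int_ray (7 * PI / 8) F + int_ray (5 * PI / 8) F)%C.

Definition int_Gamma2 (F : C -> C) : C :=
  (- int_ray (3 * PI / 8) F + int_ray (PI / 8) F)%C.

(* The extension of u by its boundary values; its value at (0,0) is irrelevant. *)
Definition extend (u0 g0 : R -> C) (u : R -> R -> C) (x t : R) : C :=
  if Req_EM_T t 0 then u0 x else if Req_EM_T x 0 then g0 t else u x t.

(* Main.v *)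
Require Import Defs.
From Stdlib Require Import Reals Lra Lia Classical IndefiniteDescription FunctionalExtensionality.
From Coquelicot Require Import Coquelicot.
Open Scope R_scope.

(** The idea is to move all the contours to rays along which the integrals and all
    their derivatives converge absolutely, and to read off the boundary values there.

    Multiplied by [Cexp (- (omega l * t))], the transform [tilde g (omega l) t]
    becomes the convolution [conv g (omega l) t], which is bounded where
    Re l^4 >= 0. The contours bound sectors with Re l^4 < 0, so they may be turned, by
    Cauchy's theorem for sectors ([int_ray_rotate]), to the angles PI/16, PI/2 and
    15 PI/16. There Im l > 0 and Re l^4 > 0, and both [osc x l] = e^{ilx} and
    [heat t l] = e^{-l^4 t} decay exponentially. This gives [solution_formula]; the
    function can be differentiated under the integral sign
    ([ray_family_regular]), and it is a sum of pieces, each of which has limits of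
    all its derivatives on both edges ([solution_piece]).

    As t tends to 0 with x away from 0, [osc] provides the decay on the turned rays. On
    the real line it does not, and the decay has to come from the initial datum: each
    factor [i l] is absorbed by i l hat f = hat f' + f(0), and what remains is either
    absolutely integrable or explicit enough for the line to be bent upwards
    ([line_tlim]). The limit of u is u0: the boundary data contribute nothing because
    [conv] vanishes at t = 0, the other transforms of the initial datum because their
    contours can be closed at infinity, and the line integral gives u0 by Fourier
    inversion ([inversion]), which is again Cauchy's theorem once the transform is
    split at the point x.

    As x tends to 0 with t away from 0, [heat] provides the decay for the initial
    datum. For the boundary data one has to find the limits of the integrals of
    l^q conv g (l^4) t ([wedge_conv]). They converge absolutely for q <= 2. Larger
    powers are lowered by 4 by the integration by parts
    l^4 conv g = g(t) - heat g(0) - conv g', whose first term integrates to zero for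
    x > 0 ([wedge_conv_step]). The critical power q = 3 is where the boundary values
    come from: there one uses 1 + l^4 instead of l^4, and the coefficient of g(t) has
    the limit i PI/2 ([wedge_conv_value_3]). To evaluate the limits, the rays are turned
    onto the half-axes, on which l^4 takes the same values; all the integrals become
    multiples of a few real integrals, and the coefficients of the formula make
    everything cancel except the critical terms ([initial_cancel], [solution_xlim_0],
    [solution_xlim_1]).

    Finally, a function in the open quadrant all of whose derivatives have locally
    uniform limits on both edges is smooth up to the edges, and the limits are the
    derivatives of the extension ([piece_smooth]). Hence the limits of the derivatives
    are the derivatives of the limits, which are u0, g0 and g1. *)


(** * Complex numbers *)

Lemma C_eq (z w : C) : Re z = Re w -> Im z = Im w -> z = w.
Proof. destruct z, w; simpl; intros; subst; reflexivity. Qed.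

Lemma im_le_Cmod (z : C) : Rabs (Im z) <= Cmod z.
Proof. eapply Rle_trans; [apply Rmax_r | apply Rmax_Cmod]. Qed.

Lemma Cmod_le_sum (z : C) : Cmod z <= Rabs (Re z) + Rabs (Im z).
Proof.
  destruct z as [a b]; unfold Cmod; simpl.
  apply Rsqr_incr_0_var; [|pose proof (Rabs_pos a); pose proof (Rabs_pos b); lra].
  rewrite Rsqr_sqrt by nra.
  unfold Rsqr. pose proof (Rabs_pos a); pose proof (Rabs_pos b).
  assert (a * a = Rabs a * Rabs a) by (rewrite <- Rabs_mult, Rabs_pos_eq; nra).
  assert (b * b = Rabs b * Rabs b) by (rewrite <- Rabs_mult, Rabs_pos_eq; nra).
  nra.
Qed.

Lemma Cmod_minus_sym (z w : C) : Cmod (z - w) = Cmod (w - z).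
Proof. rewrite <- Cmod_opp. f_equal. ring. Qed.

Lemma Cmod_triangle_minus (z w : C) : Cmod (z - w) <= Cmod z + Cmod w.
Proof. unfold Cminus. eapply Rle_trans; [apply Cmod_triangle|]. rewrite Cmod_opp. lra. Qed.

(** * Curves in the complex plane *)

Definition Cder (f : R -> C) (x : R) (l : C) : Prop :=
  is_derive (fun s => Re (f s)) x (Re l) /\ is_derive (fun s => Im (f s)) x (Im l).

Definition Ccont (f : R -> C) (x : R) : Prop :=
  continuous (fun s => Re (f s)) x /\ continuous (fun s => Im (f s)) x.

Lemma continuous_CR (f : R -> C) x : continuous (f : R -> CR) x <-> Ccont f x.
Proof.
  split.
  - intros H; split.
    + apply (continuous_comp (f : R -> prod_UniformSpace R_UniformSpace R_UniformSpace) fst x H).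
      apply continuous_fst.
    + apply (continuous_comp (f : R -> prod_UniformSpace R_UniformSpace R_UniformSpace) snd x H).
      apply continuous_snd.
  - intros [H1 H2].
    apply (continuous_ext (fun s => (Re (f s), Im (f s))) f).
    + intros s; destruct (f s); reflexivity.
    + intros P [eps HP].
      destruct (proj1 (filterlim_locally _ _) H1 eps) as [d1 Hd1].
      destruct (proj1 (filterlim_locally _ _) H2 eps) as [d2 Hd2].
      assert (Hd : 0 < Rmin d1 d2) by (apply Rmin_pos; apply cond_pos).
      exists (mkposreal _ Hd); intros y Hy.
      apply HP; split; simpl.
      * apply Hd1. eapply ball_le; [|exact Hy]. apply Rmin_l.
      * apply Hd2. eapply ball_le; [|exact Hy]. apply Rmin_r.
Qed.

Lemma Cder_ext_loc f g x l :
  locally x (fun s => f s = g s) -> Cder f x l -> Cder g x l.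
Proof.
  intros H [H1 H2]; split; eapply is_derive_ext_loc; try eassumption;
  eapply filter_imp; try apply H; simpl; intros s Hs; rewrite Hs; reflexivity.
Qed.

Lemma Cder_ext f g x l : (forall s, f s = g s) -> Cder f x l -> Cder g x l.
Proof. intros H; apply Cder_ext_loc; apply filter_forall; auto. Qed.

Lemma Cder_eq f x l l' : Cder f x l -> l = l' -> Cder f x l'.
Proof. intros H <-; exact H. Qed.

Lemma Cder_const (c : C) x : Cder (fun _ => c) x 0%C.
Proof. split; simpl; apply is_derive_Reals; apply derivable_pt_lim_const. Qed.

Lemma Cder_id x : Cder (fun s => RtoC s) x 1%C.
Proof.
  split; simpl; apply is_derive_Reals.
  apply derivable_pt_lim_id. apply derivable_pt_lim_const.
Qed.

Lemma Cder_plus f g x l m : Cder f x l -> Cder g x m ->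
  Cder (fun s => f s + g s)%C x (l + m)%C.
Proof. intros [H1 H2] [H3 H4]; split; [exact (is_derive_plus _ _ _ _ _ H1 H3)|exact (is_derive_plus _ _ _ _ _ H2 H4)]. Qed.

Lemma Cder_mult f g x l m : Cder f x l -> Cder g x m ->
  Cder (fun s => f s * g s)%C x (l * g x + f x * m)%C.
Proof.
  intros [H1 H2] [H3 H4].
  apply is_derive_Reals in H1, H2, H3, H4.
  split; apply is_derive_Reals; simpl.
  - replace (_ + _) with
      (((Re l) * Re (g x) + Re (f x) * Re m) - ((Im l) * Im (g x) + Im (f x) * Im m))
      by (unfold Re, Im; simpl; ring).
    exact (derivable_pt_lim_minus _ _ _ _ _ (derivable_pt_lim_mult _ _ _ _ _ H1 H3)
            (derivable_pt_lim_mult _ _ _ _ _ H2 H4)).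
  - replace (_ + _) with
      (((Re l) * Im (g x) + Re (f x) * Im m) + ((Im l) * Re (g x) + Im (f x) * Re m))
      by (unfold Re, Im; simpl; ring).
    exact (derivable_pt_lim_plus _ _ _ _ _ (derivable_pt_lim_mult _ _ _ _ _ H1 H4)
            (derivable_pt_lim_mult _ _ _ _ _ H2 H3)).
Qed.

Lemma Cder_scal (c : C) f x l : Cder f x l -> Cder (fun s => c * f s)%C x (c * l)%C.
Proof.
  intros H; eapply Cder_eq; [apply (Cder_mult _ _ _ _ _ (Cder_const c x) H)|ring].
Qed.

Lemma Cder_minus f g x l m : Cder f x l -> Cder g x m ->
  Cder (fun s => f s - g s)%C x (l - m)%C.
Proof.
  intros H H'. eapply Cder_eq.
  - eapply Cder_ext; [|apply (Cder_plus _ _ _ _ _ H (Cder_scal (-(1))%C _ _ _ H'))].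
    intros s; simpl; ring.
  - ring.
Qed.

Lemma Cder_Cexp f x l : Cder f x l ->
  Cder (fun s => Cexp (f s)) x (l * Cexp (f x))%C.
Proof.
  intros [H1 H2]. apply is_derive_Reals in H1, H2.
  assert (E := derivable_pt_lim_comp _ _ _ _ _ H1 (derivable_pt_lim_exp (Re (f x)))).
  assert (Cs := derivable_pt_lim_comp _ _ _ _ _ H2 (derivable_pt_lim_cos (Im (f x)))).
  assert (Sn := derivable_pt_lim_comp _ _ _ _ _ H2 (derivable_pt_lim_sin (Im (f x)))).
  split; apply is_derive_Reals; simpl.
  - replace (_ - _) with
      ((exp (Re (f x)) * Re l) * cos (Im (f x)) + exp (Re (f x)) * (- sin (Im (f x)) * Im l))
      by (unfold Re, Im; simpl; ring).
    exact (derivable_pt_lim_mult _ _ _ _ _ E Cs).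
  - replace (_ + _) with
      ((exp (Re (f x)) * Re l) * sin (Im (f x)) + exp (Re (f x)) * (cos (Im (f x)) * Im l))
      by (unfold Re, Im; simpl; ring).
    exact (derivable_pt_lim_mult _ _ _ _ _ E Sn).
Qed.

Lemma Cder_Ccont f x l : Cder f x l -> Ccont f x.
Proof.
  intros [H1 H2]; split; [apply (ex_derive_continuous (fun s => Re (f s)))|apply (ex_derive_continuous (fun s => Im (f s)))]; eexists; eassumption.
Qed.

Lemma Ccont_ext f g x : (forall s, f s = g s) -> Ccont f x -> Ccont g x.
Proof.
  intros E [H1 H2]; split; [eapply continuous_ext; [|exact H1]|eapply continuous_ext; [|exact H2]];
  intros s; simpl; rewrite E; reflexivity.
Qed.

Lemma Ccont_const (c : C) x : Ccont (fun _ => c) x.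
Proof. apply (Cder_Ccont _ _ _ (Cder_const c x)). Qed.

Lemma Ccont_plus f g x : Ccont f x -> Ccont g x -> Ccont (fun s => f s + g s)%C x.
Proof. intros [H1 H2] [H3 H4]; split; [exact (continuous_plus _ _ _ H1 H3)|exact (continuous_plus _ _ _ H2 H4)]. Qed.

Lemma Ccont_mult f g x : Ccont f x -> Ccont g x -> Ccont (fun s => f s * g s)%C x.
Proof.
  intros [H1 H2] [H3 H4]; split; simpl.
  - exact (continuous_minus _ _ _ (continuous_mult _ _ _ H1 H3) (continuous_mult _ _ _ H2 H4)).
  - exact (continuous_plus _ _ _ (continuous_mult _ _ _ H1 H4) (continuous_mult _ _ _ H2 H3)).
Qed.

Lemma Ccont_opp f x : Ccont f x -> Ccont (fun s => - f s)%C x.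
Proof. intros [H1 H2]; split; [exact (continuous_opp _ _ H1)|exact (continuous_opp _ _ H2)]. Qed.

Lemma Ccont_minus f g x : Ccont f x -> Ccont g x -> Ccont (fun s => f s - g s)%C x.
Proof. intros; apply Ccont_plus; auto; apply Ccont_opp; auto. Qed.

Lemma Ccont_comp f (g : R -> R) x : continuous g x -> Ccont f (g x) -> Ccont (fun s => f (g s)) x.
Proof.
  intros Hg [H1 H2]; split.
  - apply (continuous_comp g (fun s => Re (f s))); auto.
  - apply (continuous_comp g (fun s => Im (f s))); auto.
Qed.

Lemma Ccont_RtoC (g : R -> R) x : continuous g x -> Ccont (fun s => RtoC (g s)) x.
Proof. intros H; split; simpl; auto. apply continuous_const. Qed.

(** The quantitative form in which continuity is checked for functions defined by
    integrals. *)
Lemma Ccont_lip f x (K : R) (d : posreal) :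
  (forall y, Rabs (y - x) < d -> Cmod (f y - f x) <= K * Rabs (y - x)) -> Ccont f x.
Proof.
  intros H. apply continuous_CR. apply filterlim_locally. intros eps.
  assert (HK : 0 < Rabs K + 1) by (pose proof (Rabs_pos K); lra).
  assert (Hp : 0 < Rmin d (eps / (Rabs K + 1))).
  { apply Rmin_pos. apply cond_pos. apply Rdiv_lt_0_compat; auto. apply cond_pos. }
  exists (mkposreal _ Hp). intros y Hy.
  change (Rabs (y - x) < Rmin d (eps / (Rabs K + 1))) in Hy.
  assert (H1 := H y (Rlt_le_trans _ _ _ Hy (Rmin_l _ _))).
  assert (H2 := Rlt_le_trans _ _ _ Hy (Rmin_r _ _)).
  assert (H3 : Cmod (f y - f x) < eps).
  { apply Rle_lt_trans with ((Rabs K + 1) * Rabs (y - x)).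
    - pose proof (Rle_abs K). pose proof (Rabs_pos (y - x)). nra.
    - apply Rmult_lt_compat_l with (r := Rabs K + 1) in H2; auto.
      replace ((Rabs K + 1) * (eps / (Rabs K + 1))) with (pos eps) in H2 by (field; lra).
      exact H2. }
  split.
  - change (Rabs (Re (f y - f x)) < eps). eapply Rle_lt_trans; [apply re_le_Cmod|auto].
  - change (Rabs (Im (f y - f x)) < eps). eapply Rle_lt_trans; [apply im_le_Cmod|auto].
Qed.

Lemma Ccont_eps f x : Ccont f x -> forall eps : posreal, exists d : posreal,
  forall y, Rabs (y - x) < d -> Cmod (f y - f x) < eps.
Proof.
  intros [H1 H2] eps.
  assert (He : 0 < eps / 2) by (pose proof (cond_pos eps); lra).
  destruct (proj1 (filterlim_locally _ _) H1 (mkposreal _ He)) as [d1 Hd1].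
  destruct (proj1 (filterlim_locally _ _) H2 (mkposreal _ He)) as [d2 Hd2].
  assert (Hd : 0 < Rmin d1 d2) by (apply Rmin_pos; apply cond_pos).
  exists (mkposreal _ Hd). intros y Hy; simpl in Hy.
  assert (A1 := Hd1 y (Rlt_le_trans _ _ _ Hy (Rmin_l _ _))).
  assert (A2 := Hd2 y (Rlt_le_trans _ _ _ Hy (Rmin_r _ _))).
  change (Rabs (Re (f y) - Re (f x)) < eps / 2) in A1.
  change (Rabs (Im (f y) - Im (f x)) < eps / 2) in A2.
  eapply Rle_lt_trans; [apply Cmod_le_sum|].
  change (Rabs (Re (f y) - Re (f x)) + Rabs (Im (f y) - Im (f x)) < eps). lra.
Qed.

(** The factor 2 comes from applying the real mean value theorem to the real and
    imaginary parts separately. *)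
Lemma mean_value_ineq (f f' : R -> C) (a b M : R) : a <= b ->
  (forall x, a < x < b -> Cder f x (f' x)) ->
  (forall x, a <= x <= b -> Ccont f x) ->
  (forall x, a < x < b -> Cmod (f' x) <= M) ->
  Cmod (f b - f a) <= 2 * M * (b - a).
Proof.
  intros Hab Hd Hc HM.
  destruct (Req_dec a b) as [->|Hne].
  { unfold Cminus. replace (f b + - f b)%C with (RtoC 0) by ring. rewrite Cmod_0. lra. }
  assert (Hlt : a < b) by lra.
  assert (G : forall (h h' : R -> R),
    (forall x, a < x < b -> is_derive h x (h' x)) ->
    (forall x, a <= x <= b -> continuous h x) ->
    (forall x, a < x < b -> Rabs (h' x) <= M) -> Rabs (h b - h a) <= M * (b - a)).
  { intros h h' H1 H2 H3.
    set (pr := fun c (P : a < c < b) =>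
      exist (fun l => derivable_pt_abs h c l) (h' c) (proj1 (is_derive_Reals h c (h' c)) (H1 c P))).
    destruct (MVT h id a b pr (fun c _ => derivable_pt_id c) Hlt) as [c [P Hc']].
    - intros c Hc1. apply continuity_pt_filterlim. apply H2; auto.
    - intros c _. apply derivable_continuous_pt, derivable_pt_id.
    - rewrite derive_pt_id in Hc'. unfold id in Hc'. simpl in Hc'.
      rewrite Rmult_1_r in Hc'. rewrite <- Hc'. rewrite Rabs_mult, (Rabs_pos_eq (b - a)) by lra.
      rewrite Rmult_comm. apply Rmult_le_compat_r; [lra|]. apply H3; auto. }
  eapply Rle_trans; [apply Cmod_le_sum|].
  replace (2 * M * (b - a)) with (M * (b - a) + M * (b - a)) by ring.
  apply Rplus_le_compat.
  - apply (G (fun s => Re (f s)) (fun s => Re (f' s))).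
    + intros; apply Hd; auto.
    + intros; apply Hc; auto.
    + intros; eapply Rle_trans; [apply re_le_Cmod|auto].
  - apply (G (fun s => Im (f s)) (fun s => Im (f' s))).
    + intros; apply Hd; auto.
    + intros; apply Hc; auto.
    + intros; eapply Rle_trans; [apply im_le_Cmod|auto].
Qed.

(** Quadratic remainders are used throughout because they can be integrated: this
    gives both differentiation under the integral sign and the analyticity of the
    transforms. *)
Lemma taylor2 (f f1 f2 : R -> C) (s h M : R) :
  (forall x, Rmin s (s + h) <= x <= Rmax s (s + h) -> Cder f x (f1 x)) ->
  (forall x, Rmin s (s + h) <= x <= Rmax s (s + h) -> Cder f1 x (f2 x)) ->
  (forall x, Rmin s (s + h) <= x <= Rmax s (s + h) -> Cmod (f2 x) <= M) ->
  Cmod (f (s + h)%R - f s - h * f1 s)%C <= 4 * M * (h * h).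
Proof.
  intros H0 H1 H2.
  assert (HM : 0 <= M).
  { eapply Rle_trans; [apply Cmod_ge_0|]. apply (H2 s). split. apply Rmin_l. apply Rmax_l. }
  assert (G1 : forall x y, Rmin s (s + h) <= x <= y -> y <= Rmax s (s + h) ->
             Cmod (f1 y - f1 x) <= 2 * M * (y - x)).
  { intros x y Hx Hy. apply (mean_value_ineq f1 f2); [lra| | |].
    - intros; apply H1; lra.
    - intros; eapply Cder_Ccont; apply H1; lra.
    - intros; apply H2; lra. }
  assert (G2 : forall x, Rmin s (s + h) <= x <= Rmax s (s + h) ->
             Cmod (f1 x - f1 s) <= 2 * M * Rabs h).
  { intros x Hx. unfold Rmin, Rmax in *. destruct (Rle_dec s (s + h)).
    - rewrite Rabs_pos_eq by lra. eapply Rle_trans; [apply G1; lra|nra].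
    - rewrite Rabs_left by lra. rewrite Cmod_minus_sym.
      eapply Rle_trans; [apply G1; lra|nra]. }
  set (k := fun x : R => (f x - x * f1 s)%C).
  assert (Hk : forall x, Rmin s (s + h) <= x <= Rmax s (s + h) -> Cder k x (f1 x - f1 s)%C).
  { intros x Hx. eapply Cder_eq.
    apply Cder_minus; [apply H0; auto| apply (Cder_mult _ _ _ _ _ (Cder_id x) (Cder_const (f1 s) x))].
    ring. }
  replace (f (s + h)%R - f s - h * f1 s)%C with (k (s + h)%R - k s)%C
    by (unfold k; rewrite RtoC_plus; ring).
  assert (E : h * h = Rabs h * Rabs h) by (rewrite <- Rabs_mult, Rabs_pos_eq; nra).
  unfold Rmin, Rmax in *; destruct (Rle_dec s (s + h)).
  - eapply Rle_trans.
    + apply (mean_value_ineq k (fun x => f1 x - f1 s)%C s (s + h) (2 * M * Rabs h)); [lra| | |].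
      * intros; apply Hk; lra.
      * intros; eapply Cder_Ccont; apply Hk; lra.
      * intros; apply G2; lra.
    + rewrite E. rewrite (Rabs_pos_eq h) by lra. nra.
  - rewrite Cmod_minus_sym. eapply Rle_trans.
    + apply (mean_value_ineq k (fun x => f1 x - f1 s)%C (s + h) s (2 * M * Rabs h)); [lra| | |].
      * intros; apply Hk; lra.
      * intros; eapply Cder_Ccont; apply Hk; lra.
      * intros; apply G2; lra.
    + rewrite E. rewrite (Rabs_left h) by lra. nra.
Qed.

(** * The complex exponential *)

Lemma Cexp_plus (z w : C) : Cexp (z + w) = (Cexp z * Cexp w)%C.
Proof.
  unfold Cexp; apply C_eq; unfold Re, Im; simpl; rewrite exp_plus, ?cos_plus, ?sin_plus; ring.
Qed.

Lemma Cexp_0 : Cexp 0 = 1%C.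
Proof. unfold Cexp; apply C_eq; unfold Re, Im; simpl; rewrite exp_0, ?cos_0, ?sin_0; ring. Qed.

Lemma Cmod_Cexp (z : C) : Cmod (Cexp z) = exp (Re z).
Proof.
  unfold Cmod, Cexp; simpl.
  replace (_ + _) with (exp (Re z) * exp (Re z)).
  - apply sqrt_square. left; apply exp_pos.
  - pose proof (sin2_cos2 (Im z)) as H; unfold Rsqr in H.
    replace (exp (Re z) * exp (Re z)) with
      (exp (Re z) * exp (Re z) * (sin (Im z) * sin (Im z) + cos (Im z) * cos (Im z)))
      by (rewrite H; ring). ring.
Qed.

Lemma Cexp_pow (z : C) (n : nat) : (Cexp z ^ n)%C = Cexp (INR n * z).
Proof.
  induction n.
  - simpl. rewrite Cmult_0_l. rewrite Cexp_0. reflexivity.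
  - rewrite Cpow_S, IHn, <- Cexp_plus. f_equal. rewrite S_INR, RtoC_plus. ring.
Qed.

Lemma Cder_line (z w : C) s : Cder (fun s : R => z + s * w)%C s w.
Proof.
  eapply Cder_eq.
  - apply Cder_plus; [apply Cder_const|]. apply Cder_mult; [apply Cder_id|apply Cder_const].
  - simpl; ring.
Qed.

Lemma Cder_Cexp_line (z w : C) s :
  Cder (fun s : R => Cexp (z + s * w)) s (w * Cexp (z + s * w))%C.
Proof. apply (Cder_Cexp (fun s : R => z + s * w)%C). apply Cder_line. Qed.

(** On the segment from z to w the real part stays below B, and [taylor2] applies
    along it. *)
Lemma Cexp_taylor2 (B : R) (z w : C) : Re z <= B -> Re w <= B ->
  Cmod (Cexp w - Cexp z - (w - z) * Cexp z) <= 4 * exp B * (Cmod (w - z) * Cmod (w - z)).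
Proof.
  intros Hz Hw.
  assert (H := taylor2 (fun s : R => Cexp (z + s * (w - z)))
    (fun s : R => (w - z) * Cexp (z + s * (w - z)))%C
    (fun s : R => (w - z) * ((w - z) * Cexp (z + s * (w - z))))%C 0 1
    (Cmod (w - z) * Cmod (w - z) * exp B)).
  simpl in H. rewrite Rplus_0_l in H.
  replace (z + 1 * (w - z))%C with w in H by ring.
  replace (z + 0 * (w - z))%C with z in H by ring.
  replace (Cexp w - Cexp z - 1 * ((w - z) * Cexp z))%C
    with (Cexp w - Cexp z - (w - z) * Cexp z)%C in H by ring.
  eapply Rle_trans; [apply H|].
  - intros; apply Cder_Cexp_line.
  - intros; apply Cder_scal. apply Cder_Cexp_line.
  - intros x Hx. rewrite Rmin_left, Rmax_right in Hx by lra.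
    rewrite !Cmod_mult, Cmod_Cexp, <- Rmult_assoc.
    apply Rmult_le_compat_l; [apply Rmult_le_pos; apply Cmod_ge_0|].
    assert (Re (z + x * (w - z)) <= B).
    { unfold Re in *; simpl. destruct z as [z1 z2], w as [w1 w2]; simpl in *. nra. }
    destruct (Req_dec (Re (z + x * (w - z))) B) as [->|]; [lra|left; apply exp_increasing; lra].
  - right; ring.
Qed.

Lemma Cexp_lip (B : R) (z w : C) : Re z <= B -> Re w <= B ->
  Cmod (Cexp w - Cexp z) <= 2 * exp B * Cmod (w - z).
Proof.
  intros Hz Hw.
  assert (H := mean_value_ineq (fun s : R => Cexp (z + s * (w - z)))
    (fun s : R => (w - z) * Cexp (z + s * (w - z)))%C 0 1 (Cmod (w - z) * exp B)).
  simpl in H.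
  replace (z + 1 * (w - z))%C with w in H by ring.
  replace (z + 0 * (w - z))%C with z in H by ring.
  eapply Rle_trans; [apply H|].
  - lra.
  - intros; apply Cder_Cexp_line.
  - intros; eapply Cder_Ccont; apply Cder_Cexp_line.
  - intros x Hx.
    rewrite !Cmod_mult, Cmod_Cexp.
    apply Rmult_le_compat_l; [apply Cmod_ge_0|].
    assert (Re (z + x * (w - z)) <= B).
    { unfold Re in *; simpl. destruct z as [z1 z2], w as [w1 w2]; simpl in *. nra. }
    destruct (Req_dec (Re (z + x * (w - z))) B) as [->|]; [lra|left; apply exp_increasing; lra].
  - right; ring.
Qed.

(** * Integrals of complex-valued functions *)

(** Named constants, so that the values have type [C] and not the carrier of a
    normed module, which [ring] does not recognise. *)
Definition CInt (f : R -> C) (a b : R) : C := RInt (V := CR) f a b.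

Definition half (f : R -> C) : C :=
  RInt_gen (V := CR) f (at_point 0) (Rbar_locally p_infty).

Lemma norm_CR (z : C) : norm (z : CR) = Cmod z.
Proof.
  destruct z as [a b]. unfold norm; simpl. unfold prod_norm, Cmod; simpl.
  f_equal. unfold norm; simpl. unfold abs; simpl.
  rewrite !Rmult_1_r, <- !Rabs_mult, !Rabs_pos_eq; nra.
Qed.

Lemma ball_CR (z w : C) (eps : R) : Cmod (w - z) < eps -> ball (z : CR) eps w.
Proof.
  intros H. split; simpl.
  - eapply Rle_lt_trans; [|exact H]. apply (re_le_Cmod (w - z)).
  - eapply Rle_lt_trans; [|exact H]. apply (im_le_Cmod (w - z)).
Qed.

Lemma ball_CR_inv (z w : C) (eps : R) : ball (z : CR) eps w -> Cmod (w - z) < 2 * eps.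
Proof.
  intros [H1 H2]. change (Rabs (Re (w - z)) < eps) in H1. change (Rabs (Im (w - z)) < eps) in H2.
  eapply Rle_lt_trans; [apply Cmod_le_sum|]. lra.
Qed.

Lemma ex_CInt (f : R -> C) a b :
  (forall x, Rmin a b <= x <= Rmax a b -> Ccont f x) -> ex_RInt (f : R -> CR) a b.
Proof.
  intros H. apply (ex_RInt_continuous (V := CR)). intros z Hz. apply continuous_CR. auto.
Qed.

Lemma is_CInt_parts (f : R -> C) a b (l : C) :
  is_RInt (f : R -> CR) a b l <->
  (is_RInt (fun s => Re (f s)) a b (Re l) /\ is_RInt (fun s => Im (f s)) a b (Im l)).
Proof.
  split.
  - intros H; split.
    + apply (is_RInt_fct_extend_fst (U := R_NormedModule) (V := R_NormedModule) f a b l H).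
    + apply (is_RInt_fct_extend_snd (U := R_NormedModule) (V := R_NormedModule) f a b l H).
  - intros [H1 H2].
    assert (H := is_RInt_fct_extend_pair (U := R_NormedModule) (V := R_NormedModule) f a b _ _ H1 H2).
    destruct l; exact H.
Qed.

Lemma is_CInt_scal (c : C) (f : R -> C) a b (l : C) :
  is_RInt (f : R -> CR) a b l ->
  is_RInt ((fun s => c * f s)%C : R -> CR) a b (c * l)%C.
Proof.
  intros H. apply is_CInt_parts in H. destruct H as [H1 H2]. apply is_CInt_parts. split.
  - exact (is_RInt_minus _ _ _ _ _ _ (is_RInt_scal _ _ _ (Re c) _ H1) (is_RInt_scal _ _ _ (Im c) _ H2)).
  - exact (is_RInt_plus _ _ _ _ _ _ (is_RInt_scal _ _ _ (Re c) _ H2) (is_RInt_scal _ _ _ (Im c) _ H1)).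
Qed.

Lemma CInt_scal (c : C) (f : R -> C) a b : ex_RInt (f : R -> CR) a b ->
  CInt (fun s => c * f s)%C a b = (c * CInt f a b)%C.
Proof.
  intros H. apply (is_RInt_unique (V := CR)). apply is_CInt_scal.
  apply (RInt_correct (V := CR)); auto.
Qed.

Lemma CInt_plus (f g : R -> C) a b : ex_RInt (f : R -> CR) a b -> ex_RInt (g : R -> CR) a b ->
  CInt (fun s => f s + g s)%C a b = (CInt f a b + CInt g a b)%C.
Proof. intros Hf Hg. exact (RInt_plus (V := CR) f g a b Hf Hg). Qed.

Lemma CInt_minus (f g : R -> C) a b : ex_RInt (f : R -> CR) a b -> ex_RInt (g : R -> CR) a b ->
  CInt (fun s => f s - g s)%C a b = (CInt f a b - CInt g a b)%C.
Proof. intros Hf Hg. exact (RInt_minus (V := CR) f g a b Hf Hg). Qed.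

Lemma CInt_point (f : R -> C) a : CInt f a a = 0%C.
Proof. exact (RInt_point (V := CR) a f). Qed.

Lemma CInt_Chasles (f : R -> C) a b c :
  ex_RInt (f : R -> CR) a b -> ex_RInt (f : R -> CR) b c ->
  (CInt f a b + CInt f b c)%C = CInt f a c.
Proof. exact (RInt_Chasles (V := CR) f a b c). Qed.

Lemma CInt_le (f : R -> C) (g : R -> R) a b lg : a <= b ->
  (forall x, a <= x <= b -> Cmod (f x) <= g x) ->
  ex_RInt (f : R -> CR) a b -> is_RInt g a b lg -> Cmod (CInt f a b) <= lg.
Proof.
  intros Hab Hfg Hf Hg. rewrite <- norm_CR.
  apply (norm_RInt_le (V := C_R_NormedModule) f g a b); auto.
  - intros x Hx. etransitivity; [|apply Hfg; auto]. right. apply norm_CR.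
  - apply (RInt_correct (V := CR)); auto.
Qed.

Lemma CInt_le_const (f : R -> C) (M : R) a b : a <= b ->
  (forall x, a <= x <= b -> Cmod (f x) <= M) ->
  ex_RInt (f : R -> CR) a b -> Cmod (CInt f a b) <= M * (b - a).
Proof.
  intros Hab Hf He. apply (CInt_le f (fun _ => M) a b); auto.
  replace (M * (b - a)) with (scal (b - a) M) by (unfold scal; simpl; unfold mult; simpl; ring).
  apply (is_RInt_const (V := R_NormedModule)).
Qed.

Lemma is_RInt_poisson (M a b : R) :
  is_RInt (fun r => M / (1 + r ^ 2)) a b (M * (atan b - atan a)).
Proof.
  assert (D : forall x, is_derive (fun r => M * atan r) x (M / (1 + x ^ 2))).
  { intros x. apply is_derive_Reals.
    apply (derivable_pt_lim_scal atan M). apply derivable_pt_lim_atan. }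
  replace (M * (atan b - atan a)) with (minus (M * atan b) (M * atan a))
    by (unfold minus, plus, opp; simpl; ring).
  apply (is_RInt_derive (V := R_CompleteNormedModule) (fun r => M * atan r)).
  - intros; apply D.
  - intros x _. apply (ex_derive_continuous (fun r => M / (1 + r ^ 2))).
    auto_derive. nra.
Qed.

Lemma locally_interior (a b x : R) : a < x < b -> locally x (fun y => a <= y <= b).
Proof.
  intros H. assert (0 < Rmin (x - a) (b - x)) by (apply Rmin_pos; lra).
  exists (mkposreal _ H0). intros y Hy.
  change (Rabs (y - x) < Rmin (x - a) (b - x)) in Hy.
  pose proof (Rmin_l (x - a) (b - x)). pose proof (Rmin_r (x - a) (b - x)).
  apply Rabs_def2 in Hy. lra.
Qed.

(** The difference of the integral and of f has derivative zero in the open interval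
    only, but it is continuous up to the end points. *)
Lemma CInt_derive (f f' : R -> C) (a b : R) : a <= b ->
  (forall x, a < x < b -> Cder f x (f' x)) ->
  (forall x, a <= x <= b -> Ccont f x) -> (forall x, a <= x <= b -> Ccont f' x) ->
  CInt f' a b = (f b - f a)%C.
Proof.
  intros Hab Hd Hf Hf'.
  assert (Ex : forall x y, a <= x <= b -> a <= y <= b -> ex_RInt (f' : R -> CR) x y).
  { intros x y Hx Hy. apply ex_CInt. intros z Hz. apply Hf'. unfold Rmin, Rmax in Hz.
    destruct (Rle_dec x y); lra. }
  set (k := fun x => (CInt f' a x - f x)%C).
  assert (Lip : forall x, a <= x <= b -> forall eps, 0 < eps -> exists d, 0 < d /\
     forall y, a <= y <= b -> Rabs (y - x) < d -> Cmod (k y - k x) < eps).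
  { intros x Hx eps He.
    destruct (Ccont_eps _ _ (Hf x Hx) (mkposreal (eps/2) ltac:(lra))) as [d1 H1].
    destruct (Ccont_eps _ _ (Hf' x Hx) (mkposreal 1 ltac:(lra))) as [d2 H2].
    set (M := Cmod (f' x) + 1).
    assert (HM : 0 < M) by (unfold M; pose proof (Cmod_ge_0 (f' x)); lra).
    set (d := Rmin (Rmin d1 d2) (eps / 2 / M)).
    assert (Hdp : 0 < d).
    { unfold d. repeat apply Rmin_pos; try apply cond_pos. apply Rdiv_lt_0_compat; lra. }
    exists d; split; auto. intros y Hy Hyx.
    assert (Hyx1 : Rabs (y - x) < d1).
    { eapply Rlt_le_trans; [exact Hyx|]. exact (Rle_trans _ _ _ (Rmin_l _ _) (Rmin_l _ _)). }
    assert (Hyx2 : Rabs (y - x) < d2).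
    { eapply Rlt_le_trans; [exact Hyx|]. exact (Rle_trans _ _ _ (Rmin_l _ _) (Rmin_r _ _)). }
    assert (Hyx3 : M * Rabs (y - x) < eps / 2).
    { apply Rlt_le_trans with (M * (eps / 2 / M)).
      - apply Rmult_lt_compat_l; auto. eapply Rlt_le_trans; [exact Hyx|]. apply Rmin_r.
      - right; field; lra. }
    assert (E : (k y - k x)%C = (CInt f' x y - (f y - f x))%C).
    { unfold k.
      assert (Ch := CInt_Chasles f' a x y (Ex a x ltac:(lra) Hx) (Ex x y Hx Hy)).
      rewrite <- Ch. ring. }
    rewrite E. eapply Rle_lt_trans; [apply Cmod_triangle_minus|].
    assert (B : forall p q, Rabs (y - x) = q - p -> (forall z, p <= z <= q -> a <= z <= b /\ Rabs (z - x) <= Rabs (y - x)) ->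
       p <= q -> Cmod (CInt f' p q) <= M * Rabs (y - x)).
    { intros p q Hpq Hz Hle. rewrite Hpq. apply CInt_le_const; auto.
      - intros z Hz'. destruct (Hz z Hz') as [_ Hzx].
        assert (Hb := H2 z (Rle_lt_trans _ _ _ Hzx Hyx2)). simpl in Hb.
        replace (f' z) with (f' z - f' x + f' x)%C by ring.
        eapply Rle_trans; [apply Cmod_triangle|]. unfold M; lra.
      - apply Ex; apply Hz; lra. }
    assert (Cmod (CInt f' x y) <= M * Rabs (y - x)).
    { destruct (Rle_dec x y).
      - apply B; auto. rewrite Rabs_pos_eq; lra.
        intros z Hz; rewrite !Rabs_pos_eq; lra.
      - replace (CInt f' x y) with (- CInt f' y x)%C.
        + rewrite Cmod_opp. apply B; try lra. rewrite Rabs_left; lra.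
          intros z Hz. split; [lra|]. rewrite (Rabs_left (y - x)) by lra.
          apply Rabs_le. lra.
        + exact (opp_RInt_swap (V := CR) f' _ _ (Ex _ _ Hy Hx)). }
    assert (Hfy := H1 y Hyx1). simpl in Hfy. lra. }
  assert (Hk : forall x, a < x < b -> Cder k x 0%C).
  { intros x Hx. replace (RtoC 0) with (f' x - f' x)%C by ring. apply Cder_minus; [|auto].
    assert (Hx' : a <= x <= b) by lra.
    assert (L : locally x (fun y => is_RInt (f' : R -> CR) a y (CInt f' a y))).
    { eapply filter_imp; [|apply (locally_interior a b x Hx)].
      intros y Hy. apply (RInt_correct (V := CR)). apply Ex; lra. }
    split.
    - apply (is_derive_RInt (fun s => Re (f' s)) (fun y => Re (CInt f' a y)) a x).
      + eapply filter_imp; [|exact L]. intros y Hy. apply is_CInt_parts in Hy; apply Hy.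
      + apply Hf'; auto.
    - apply (is_derive_RInt (fun s => Im (f' s)) (fun y => Im (CInt f' a y)) a x).
      + eapply filter_imp; [|exact L]. intros y Hy. apply is_CInt_parts in Hy; apply Hy.
      + apply Hf'; auto. }
  destruct (Req_dec a b) as [<-|Hne].
  { rewrite CInt_point. ring. }
  (* k is constant on [p, q] for a < p < q < b, hence on [a, b] by continuity. *)
  assert (K : Cmod (k b - k a) <= 0).
  { apply le_epsilon. intros eps He. rewrite Rplus_0_l.
    destruct (Lip a ltac:(lra) (eps / 2) ltac:(lra)) as [d1 [Hd1 L1]].
    destruct (Lip b ltac:(lra) (eps / 2) ltac:(lra)) as [d2 [Hd2 L2]].
    set (e := Rmin (Rmin d1 d2) (b - a) / 4).
    assert (0 < Rmin (Rmin d1 d2) (b - a)) by (repeat apply Rmin_pos; lra).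
    assert (He1 : 0 < e) by (unfold e; lra).
    assert (e < d1 /\ e < d2 /\ 2 * e < b - a) as [E1 [E2 E3]].
    { unfold e. pose proof (Rmin_l (Rmin d1 d2) (b - a)). pose proof (Rmin_r (Rmin d1 d2) (b - a)).
      pose proof (Rmin_l d1 d2). pose proof (Rmin_r d1 d2). lra. }
    assert (C0 : Cmod (k (b - e)%R - k (a + e)%R) <= 2 * 0 * ((b - e) - (a + e))).
    { apply (mean_value_ineq k (fun _ => 0%C)); [lra| | |].
      - intros; apply Hk; lra.
      - intros; eapply Cder_Ccont; apply Hk; lra.
      - intros; rewrite Cmod_0; lra. }
    assert (A1 := L1 (a + e) ltac:(lra) ltac:(rewrite Rabs_pos_eq; lra)).
    assert (A2 := L2 (b - e) ltac:(lra) ltac:(rewrite Rabs_left; lra)).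
    replace (k b - k a)%C with ((k b - k (b - e)%R) + (k (b - e)%R - k (a + e)%R) + (k (a + e)%R - k a))%C by ring.
    eapply Rle_trans; [apply Cmod_triangle|].
    eapply Rle_trans; [apply Rplus_le_compat_r, Cmod_triangle|].
    rewrite (Cmod_minus_sym (k b)). lra. }
  assert (K0 : (k b - k a)%C = 0%C) by (apply Cmod_eq_0; pose proof (Cmod_ge_0 (k b - k a)); lra).
  unfold k in K0. rewrite CInt_point in K0.
  replace (CInt f' a b) with ((CInt f' a b - f b - (0 - f a)) + (f b - f a))%C by ring.
  rewrite K0. ring.
Qed.

(** * Integrals over a half-line *)

Definition is_half (f : R -> C) (l : C) : Prop :=
  is_RInt_gen (V := CR) f (at_point 0) (Rbar_locally p_infty) l.

Lemma is_half_unique f l : is_half f l -> half f = l.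
Proof.
  intros H. exact (is_RInt_gen_unique (V := CR) f l H).
Qed.

Lemma is_half_intro (f : R -> C) (l : C) :
  (forall b, 0 <= b -> ex_RInt (f : R -> CR) 0 b) ->
  (forall eps, 0 < eps -> exists N, forall b, N < b -> Cmod (CInt f 0 b - l) < eps) ->
  is_half f l.
Proof.
  intros Hex Hl P [eps HP].
  destruct (Hl eps (cond_pos eps)) as [N HN].
  exists (fun x => x = 0) (fun b => Rmax 0 N < b).
  - reflexivity.
  - exists (Rmax 0 N). auto.
  - intros x b -> Hb. simpl. exists (CInt f 0 b). split.
    + apply (RInt_correct (V := CR)). apply Hex. pose proof (Rmax_l 0 N). lra.
    + apply HP. apply ball_CR. apply HN. pose proof (Rmax_r 0 N). lra.
Qed.

Lemma is_half_elim (f : R -> C) (l : C) : is_half f l ->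
  forall eps, 0 < eps -> exists N, forall b, N < b ->
    ex_RInt (f : R -> CR) 0 b /\ Cmod (CInt f 0 b - l) < eps.
Proof.
  intros H eps He.
  destruct (H (ball (l : CR) (eps / 2))) as [P Q HP HQ HPQ].
  { exists (mkposreal (eps/2) ltac:(lra)). auto. }
  destruct HQ as [N HN]. exists N. intros b Hb.
  destruct (HPQ 0 b HP (HN b Hb)) as [y [Hy1 Hy2]]. simpl in Hy1. split.
  - exists y; exact Hy1.
  - unfold CInt. rewrite (is_RInt_unique (V := CR) _ _ _ _ Hy1).
    apply ball_CR_inv in Hy2. lra.
Qed.

(** The class of integrands used throughout: continuous on the closed half-line,
    and with a bound that makes the integral absolutely convergent with an explicit
    tail. Composing with [Rmax 0] makes continuity one-sided at the origin. *)
Definition dominated (M : R) (f : R -> C) : Prop :=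
  (forall r, Ccont (fun s => f (Rmax 0 s)) r) /\
  (forall r, 0 <= r -> Cmod (f r) <= M / (1 + r ^ 2)).

Lemma CInt_Rmax (f : R -> C) a b : 0 <= a -> 0 <= b ->
  CInt f a b = CInt (fun s => f (Rmax 0 s)) a b.
Proof.
  intros Ha Hb. apply (RInt_ext (V := CR)). intros x Hx.
  rewrite Rmax_right; auto. pose proof (Rmin_glb a b 0 Ha Hb). lra.
Qed.

Lemma ex_CInt_Rmax (f : R -> C) a b : 0 <= a -> 0 <= b ->
  (forall r, Ccont (fun s => f (Rmax 0 s)) r) -> ex_RInt (f : R -> CR) a b.
Proof.
  intros Ha Hb Hc. apply (ex_RInt_ext (V := CR) (fun s => f (Rmax 0 s))).
  - intros x Hx. rewrite Rmax_right; auto. pose proof (Rmin_glb a b 0 Ha Hb). lra.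
  - apply ex_CInt. auto.
Qed.

Lemma dominated_nonneg M f : dominated M f -> 0 <= M.
Proof.
  intros [_ H]. specialize (H 0 (Rle_refl 0)).
  replace (M / (1 + 0 ^ 2)) with M in H by (field; simpl; lra).
  eapply Rle_trans; [apply Cmod_ge_0|exact H].
Qed.

Lemma dominated_segment M f a b : dominated M f -> 0 <= a <= b ->
  Cmod (CInt f a b) <= M * (atan b - atan a).
Proof.
  intros [Hc Hb] Hab.
  apply (CInt_le f (fun r => M / (1 + r ^ 2)) a b); [lra| | |apply is_RInt_poisson].
  - intros x Hx; apply Hb; lra.
  - apply ex_CInt_Rmax; auto; lra.
Qed.

Lemma atan_gap (eps : R) : 0 < eps -> exists N, 0 <= N /\ forall b, N <= b -> PI / 2 - eps < atan b < PI / 2.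
Proof.
  intros He.
  set (e := Rmin eps (PI / 4)).
  assert (0 < PI) by apply PI_RGT_0.
  assert (0 < e <= eps) by (unfold e; split; [apply Rmin_pos; lra|apply Rmin_l]).
  assert (e <= PI / 4) by apply Rmin_r.
  exists (tan (PI / 2 - e / 2)). split.
  - left. apply tan_gt_0; lra.
  - intros b Hb. split; [|apply atan_bound].
    apply Rlt_le_trans with (PI / 2 - e / 2); [lra|].
    rewrite <- (atan_tan (PI / 2 - e / 2)) by lra.
    destruct Hb as [Hb|<-]; [left; apply atan_increasing; auto|lra].
Qed.

Lemma half_ex M f : dominated M f -> is_half f (half f).
Proof.
  intros Hd.
  assert (HM := dominated_nonneg _ _ Hd).
  assert (Ex : forall a b, 0 <= a -> 0 <= b -> ex_RInt (f : R -> CR) a b).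
  { intros; apply ex_CInt_Rmax; auto; apply Hd. }
  assert (E : exists l : C, forall eps, 0 < eps -> exists N, forall b, N < b -> Cmod (CInt f 0 b - l) < eps).
  { destruct (proj1 (filterlim_locally_cauchy (U := CR) (F := Rbar_locally p_infty) (fun b => CInt f 0 b))) as [l Hl].
    - intros eps.
      destruct (atan_gap (eps / (M + 1))) as [N [HN0 HN]].
      { apply Rdiv_lt_0_compat; [apply cond_pos|lra]. }
      assert (G : forall u v, N < u -> u <= v -> Cmod (CInt f 0 v - CInt f 0 u) < eps).
      { intros u v Hu Huv.
        assert (Ch := CInt_Chasles f 0 u v (Ex 0 u ltac:(lra) ltac:(lra)) (Ex u v ltac:(lra) ltac:(lra))).
        rewrite <- Ch.
        replace (CInt f 0 u + CInt f u v - CInt f 0 u)%C with (CInt f u v) by ring.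
        eapply Rle_lt_trans; [apply (dominated_segment M); auto; lra|].
        pose proof (HN u ltac:(lra)). pose proof (HN v ltac:(lra)).
        apply Rle_lt_trans with ((M) * (eps / (M + 1))).
        - apply Rmult_le_compat_l; auto. lra.
        - apply Rlt_le_trans with ((M + 1) * (eps / (M + 1))).
          + apply Rmult_lt_compat_r; [|lra]. apply Rdiv_lt_0_compat; [apply cond_pos|lra].
          + right; field; lra. }
      exists (fun b => N < b). split; [exists N; auto|].
      intros u v Hu Hv. apply ball_CR. destruct (Rle_dec u v).
      + apply G; auto.
      + rewrite Cmod_minus_sym. apply G; lra.
    - exists l. intros eps He.
      destruct (Hl (ball (l : CR) (eps / 2))) as [N HN].
      { exists (mkposreal (eps/2) ltac:(lra)). auto. }
      exists N. intros b Hb. specialize (HN b Hb). apply ball_CR_inv in HN. lra. }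
  destruct E as [l Hl].
  assert (H : is_half f l) by (apply is_half_intro; auto; intros; apply Ex; lra).
  rewrite (is_half_unique _ _ H). exact H.
Qed.

Lemma half_tail M f L : dominated M f -> 0 <= L ->
  Cmod (half f - CInt f 0 L) <= M * (PI / 2 - atan L).
Proof.
  intros Hd HL. assert (HM := dominated_nonneg _ _ Hd).
  apply le_epsilon. intros eps He.
  destruct (is_half_elim _ _ (half_ex _ _ Hd) eps He) as [N HN].
  set (b := Rmax N L + 1).
  assert (N < b /\ L < b) as [Hb1 Hb2].
  { unfold b. pose proof (Rmax_l N L); pose proof (Rmax_r N L); lra. }
  destruct (HN b Hb1) as [_ Hb].
  assert (Ex : forall a b, 0 <= a -> 0 <= b -> ex_RInt (f : R -> CR) a b).
  { intros; apply ex_CInt_Rmax; auto; apply Hd. }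
  assert (Ch := CInt_Chasles f 0 L b (Ex 0 L ltac:(lra) ltac:(lra)) (Ex L b ltac:(lra) ltac:(lra))).
  replace (half f - CInt f 0 L)%C with ((CInt f L b) - (CInt f 0 b - half f))%C
    by (rewrite <- Ch; ring).
  eapply Rle_trans; [apply Cmod_triangle_minus|].
  assert (A := dominated_segment M f L b Hd ltac:(lra)).
  assert (M * (atan b - atan L) <= M * (PI / 2 - atan L)).
  { apply Rmult_le_compat_l; auto. pose proof (atan_bound b). lra. }
  lra.
Qed.

Lemma half_bound M f : dominated M f -> Cmod (half f) <= 2 * M.
Proof.
  intros Hd. assert (HM := dominated_nonneg _ _ Hd).
  assert (H := half_tail M f 0 Hd (Rle_refl 0)).
  rewrite CInt_point in H.
  rewrite atan_0 in H. replace (half f - 0)%C with (half f) in H by ring.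
  pose proof PI_4. nra.
Qed.

Lemma is_half_ext f g l : (forall r, 0 < r -> f r = g r) -> is_half f l -> is_half g l.
Proof.
  intros H H1. refine (is_RInt_gen_ext (V := CR) f g l _ H1).
  exists (fun x => x = 0) (fun b => 0 < b); [reflexivity|exists 0; auto|].
  intros a b -> Hb x Hx. apply H. simpl in Hx. rewrite Rmin_left in Hx by lra. lra.
Qed.

Lemma half_ext M f g : dominated M f -> (forall r, 0 < r -> f r = g r) -> half f = half g.
Proof.
  intros Hd H. symmetry. apply is_half_unique.
  apply (is_half_ext f); auto. apply (half_ex M); auto.
Qed.

Lemma is_half_plus f g l m : is_half f l -> is_half g m -> is_half (fun r => f r + g r)%C (l + m)%C.
Proof. intros H1 H2. exact (is_RInt_gen_plus (V := CR) f g l m H1 H2). Qed.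

Lemma is_half_minus f g l m : is_half f l -> is_half g m -> is_half (fun r => f r - g r)%C (l - m)%C.
Proof. intros H1 H2. exact (is_RInt_gen_minus (V := CR) f g l m H1 H2). Qed.

Lemma is_half_scal c f l : is_half f l -> is_half (fun r => c * f r)%C (c * l)%C.
Proof.
  intros H P [eps HP].
  assert (Hc : 0 < Cmod c + 1) by (pose proof (Cmod_ge_0 c); lra).
  destruct (H (ball (l : CR) (eps / 2 / (Cmod c + 1)))) as [A B HA HB HAB].
  { assert (0 < eps / 2 / (Cmod c + 1)).
    { apply Rdiv_lt_0_compat; auto. pose proof (cond_pos eps); lra. }
    exists (mkposreal _ H0). auto. }
  exists A B; auto. intros x b Hx Hb. destruct (HAB x b Hx Hb) as [y [Hy1 Hy2]].
  exists (c * y)%C. split.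
  - apply (is_CInt_scal c f); auto.
  - apply HP. apply ball_CR. apply ball_CR_inv in Hy2.
    replace (c * y - c * l)%C with (c * (y - l))%C by ring. rewrite Cmod_mult.
    apply Rle_lt_trans with ((Cmod c + 1) * Cmod (y - l)).
    + apply Rmult_le_compat_r; [apply Cmod_ge_0|lra].
    + apply Rlt_le_trans with ((Cmod c + 1) * (2 * (eps / 2 / (Cmod c + 1)))).
      * apply Rmult_lt_compat_l; auto.
      * right; field; lra.
Qed.

Lemma dominated_ext M f g : (forall r, 0 <= r -> f r = g r) -> dominated M f -> dominated M g.
Proof.
  intros E [H1 H2]. split.
  - intros r. eapply Ccont_ext; [|apply H1]. intros s; simpl. apply E. apply Rmax_l.
  - intros r Hr. rewrite <- E; auto.
Qed.

Lemma dominated_plus M N f g : dominated M f -> dominated N g -> dominated (M + N) (fun r => f r + g r)%C.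
Proof.
  intros [H1 H2] [H3 H4]; split.
  - intros; apply Ccont_plus; auto.
  - intros r Hr. eapply Rle_trans; [apply Cmod_triangle|].
    specialize (H2 r Hr); specialize (H4 r Hr). unfold Rdiv in *. lra.
Qed.

Lemma dominated_scal M c f : dominated M f -> dominated (Cmod c * M) (fun r => c * f r)%C.
Proof.
  intros [H1 H2]; split.
  - intros; apply Ccont_mult; auto. apply Ccont_const.
  - intros r Hr. rewrite Cmod_mult. unfold Rdiv. rewrite Rmult_assoc.
    apply Rmult_le_compat_l; [apply Cmod_ge_0|]. apply H2; auto.
Qed.

Lemma dominated_minus M N f g : dominated M f -> dominated N g -> dominated (M + N) (fun r => f r - g r)%C.
Proof.
  intros [H1 H2] [H3 H4]; split.
  - intros; apply Ccont_minus; auto.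
  - intros r Hr. eapply Rle_trans; [apply Cmod_triangle_minus|].
    specialize (H2 r Hr); specialize (H4 r Hr). unfold Rdiv in *. lra.
Qed.

Lemma half_plus M N f g : dominated M f -> dominated N g ->
  half (fun r => f r + g r)%C = (half f + half g)%C.
Proof. intros; apply is_half_unique, is_half_plus; eapply half_ex; eassumption. Qed.

Lemma half_minus M N f g : dominated M f -> dominated N g ->
  half (fun r => f r - g r)%C = (half f - half g)%C.
Proof. intros; apply is_half_unique, is_half_minus; eapply half_ex; eassumption. Qed.

Lemma half_scal M c f : dominated M f -> half (fun r => c * f r)%C = (c * half f)%C.
Proof. intros; apply is_half_unique, is_half_scal; eapply half_ex; eassumption. Qed.

(** Dominated convergence, uniformly in the parameter y: the common majorant controls
    the tails beyond some L, and on [0, L] the convergence is linear in s. *)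
Lemma half_unif_lim (A : R -> Prop) (F : R -> R -> R -> C) (F0 : R -> R -> C) (M : R) (s0 : R) :
  0 < s0 ->
  (forall s y, 0 < s < s0 -> A y -> dominated M (F s y)) ->
  (forall y, A y -> dominated M (F0 y)) ->
  (forall L, 0 <= L -> exists c, forall s y r, 0 < s < s0 -> A y -> 0 <= r <= L ->
      Cmod (F s y r - F0 y r) <= s * c) ->
  unif_lim_at_0 A (fun s y => half (F s y)) (fun y => half (F0 y)).
Proof.
  intros Hs0 HF HF0 Hc eps.
  destruct (classic (exists y, A y)) as [[y0 Hy0]|Hno].
  2:{ exists (mkposreal 1 ltac:(lra)). intros s _ _ y Hy. exfalso; apply Hno; eauto. }
  assert (HM : 0 <= M) by (apply (dominated_nonneg _ _ (HF0 y0 Hy0))).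
  assert (Hep := cond_pos eps).
  destruct (atan_gap (eps / 4 / (M + 1))) as [L [HL HL']].
  { apply Rdiv_lt_0_compat; lra. }
  destruct (Hc L HL) as [c Hcb].
  assert (HcL : 0 < Rabs c * L + 1) by (pose proof (Rabs_pos c); nra).
  set (d := Rmin s0 (eps / 2 / (Rabs c * L + 1))).
  assert (Hd : 0 < d) by (unfold d; apply Rmin_pos; auto; apply Rdiv_lt_0_compat; lra).
  exists (mkposreal d Hd). intros s Hs Hs1 y Hy.
  change (Rabs (s - 0) < d) in Hs. rewrite Rminus_0_r, Rabs_pos_eq in Hs by lra.
  assert (Hss : 0 < s < s0) by (split; auto; eapply Rlt_le_trans; [exact Hs|apply Rmin_l]).
  assert (D1 := HF s y Hss Hy). assert (D0 := HF0 y Hy).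
  assert (T1 := half_tail M _ L D1 HL). assert (T0 := half_tail M _ L D0 HL).
  assert (MT : M * (PI / 2 - atan L) < eps / 4).
  { apply Rle_lt_trans with (M * (eps / 4 / (M + 1))).
    - apply Rmult_le_compat_l; auto. pose proof (HL' L (Rle_refl L)). lra.
    - apply Rlt_le_trans with ((M + 1) * (eps / 4 / (M + 1))).
      + apply Rmult_lt_compat_r; [|lra]. apply Rdiv_lt_0_compat; lra.
      + right; field; lra. }
  assert (Ex : forall f, dominated M f -> ex_RInt (f : R -> CR) 0 L).
  { intros f Hf; apply ex_CInt_Rmax; try lra. apply Hf. }
  assert (S : Cmod (CInt (F s y) 0 L - CInt (F0 y) 0 L) <= s * c * (L - 0)).
  { rewrite <- CInt_minus by auto. apply CInt_le_const; auto.
    apply (ex_RInt_minus (V := CR)); auto. }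
  assert (S2 : s * c * (L - 0) < eps / 2).
  { apply Rle_lt_trans with (s * (Rabs c * L + 1)).
    - pose proof (Rle_abs c). rewrite Rmult_assoc. apply Rmult_le_compat_l; [lra|]. nra.
    - apply Rlt_le_trans with (eps / 2 / (Rabs c * L + 1) * (Rabs c * L + 1)).
      + apply Rmult_lt_compat_r; auto. eapply Rlt_le_trans; [exact Hs|apply Rmin_r].
      + right; field; lra. }
  replace (half (F s y) - half (F0 y))%C with
    ((half (F s y) - CInt (F s y) 0 L) + (CInt (F s y) 0 L - CInt (F0 y) 0 L) - (half (F0 y) - CInt (F0 y) 0 L))%C by ring.
  eapply Rle_lt_trans; [apply Cmod_triangle_minus|].
  assert (Tr := Cmod_triangle (half (F s y) - CInt (F s y) 0 L) (CInt (F s y) 0 L - CInt (F0 y) 0 L)).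
  lra.
Qed.

Lemma Cder_of_quadratic (f : R -> C) x l (K : R) (d : R) : 0 < d ->
  (forall h, Rabs h < d -> Cmod (f (x + h)%R - f x - h * l) <= K * (h * h)) -> Cder f x l.
Proof.
  intros Hd H.
  assert (G : forall (g : R -> R) m,
    (forall h, Rabs h < d -> Rabs (g (x + h) - g x - h * m) <= K * (h * h)) -> is_derive g x m).
  { intros g m Hg. apply is_derive_Reals. intros eps He.
    assert (HK : 0 < Rabs K + 1) by (pose proof (Rabs_pos K); lra).
    assert (Hp : 0 < Rmin d (eps / (Rabs K + 1))) by (apply Rmin_pos; auto; apply Rdiv_lt_0_compat; auto).
    exists (mkposreal _ Hp). intros h Hh0 Hh. simpl in Hh.
    assert (Hh1 : Rabs h < d) by (eapply Rlt_le_trans; [exact Hh|apply Rmin_l]).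
    assert (Hh2 : Rabs h < eps / (Rabs K + 1)) by (eapply Rlt_le_trans; [exact Hh|apply Rmin_r]).
    replace ((g (x + h) - g x) / h - m) with ((g (x + h) - g x - h * m) / h) by (field; auto).
    unfold Rdiv. rewrite Rabs_mult, Rabs_inv.
    assert (Hah : 0 < Rabs h) by (apply Rabs_pos_lt; auto).
    apply Rmult_lt_reg_r with (Rabs h); auto. rewrite Rmult_assoc, Rinv_l, Rmult_1_r by lra.
    eapply Rle_lt_trans; [apply Hg; auto|].
    assert (E : h * h = Rabs h * Rabs h) by (rewrite <- Rabs_mult, Rabs_pos_eq; nra).
    rewrite E.
    apply Rle_lt_trans with ((Rabs K + 1) * Rabs h * Rabs h).
    - rewrite <- Rmult_assoc. apply Rmult_le_compat_r; [lra|]. apply Rmult_le_compat_r; [lra|].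
      pose proof (Rle_abs K). lra.
    - apply Rmult_lt_compat_r; auto.
      apply Rmult_lt_compat_l with (r := Rabs K + 1) in Hh2; auto.
      replace ((Rabs K + 1) * (eps / (Rabs K + 1))) with eps in Hh2 by (field; lra). exact Hh2. }
  split; apply G; intros h Hh; eapply Rle_trans; try apply (H h Hh).
  - replace (Re (f (x + h)%R) - Re (f x) - h * Re l) with (Re (f (x + h)%R - f x - h * l)%C)
      by (unfold Re, Im; simpl; ring). apply re_le_Cmod.
  - replace (Im (f (x + h)%R) - Im (f x) - h * Im l) with (Im (f (x + h)%R - f x - h * l)%C)
      by (unfold Re, Im; simpl; ring). apply im_le_Cmod.
Qed.

(** Differentiation under the integral sign: the majorant of the second derivative F2
    controls the quadratic remainder of the integrand, hence that of the integral. *)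
Lemma half_Cder (F F1 F2 : R -> R -> C) (s d M M0 M1 : R) : 0 < d ->
  (forall y, Rabs (y - s) < d -> dominated M0 (F y)) -> dominated M1 (F1 s) ->
  (forall y r, Rabs (y - s) < d -> 0 <= r -> Cder (fun s => F s r) y (F1 y r)) ->
  (forall y r, Rabs (y - s) < d -> 0 <= r -> Cder (fun s => F1 s r) y (F2 y r)) ->
  (forall y r, Rabs (y - s) < d -> 0 <= r -> Cmod (F2 y r) <= M / (1 + r ^ 2)) ->
  Cder (fun y => half (F y)) s (half (F1 s)).
Proof.
  intros Hd D0 D1 H0 H1 H2.
  apply (Cder_of_quadratic _ _ _ (2 * (4 * M)) d Hd). intros h Hh.
  assert (Hs : Rabs (s - s) < d) by (rewrite Rminus_diag, Rabs_R0; auto).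
  assert (Hsh : Rabs (s + h - s) < d) by (replace (s + h - s) with h by ring; auto).
  rewrite <- (half_minus _ _ _ _ (D0 _ Hsh) (D0 _ Hs)).
  rewrite <- (half_scal _ h _ D1).
  rewrite <- (half_minus _ _ _ _ (dominated_minus _ _ _ _ (D0 _ Hsh) (D0 _ Hs)) (dominated_scal _ h _ D1)).
  replace (2 * (4 * M) * (h * h)) with (2 * (4 * M * (h * h))) by ring.
  apply half_bound. split.
  - intros r. apply Ccont_minus; [apply Ccont_minus|apply Ccont_mult].
    + apply (D0 _ Hsh).
    + apply (D0 _ Hs).
    + apply Ccont_const.
    + apply D1.
  - intros r Hr.
    assert (Hin : forall x, Rmin s (s + h) <= x <= Rmax s (s + h) -> Rabs (x - s) < d).
    { intros x Hx. apply Rle_lt_trans with (Rabs h); auto.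
      unfold Rmin, Rmax in Hx. destruct (Rle_dec s (s + h)).
      - rewrite !Rabs_pos_eq; lra.
      - rewrite (Rabs_left h) by lra. apply Rabs_le. lra. }
    assert (T := taylor2 (fun y => F y r) (fun y => F1 y r) (fun y => F2 y r) s h (M / (1 + r ^ 2))).
    simpl in T.
    eapply Rle_trans; [apply T; intros; auto|].
    right; simpl; unfold Rdiv; ring.
Qed.

(** * Holomorphic functions on closed sets *)

(** Differentiability with a quadratic remainder, uniform on bounded parts of [S].
    Since all the points lie in [S], this makes sense up to the boundary of a closed
    sector or half-plane, where [hat u0] is not defined on the other side. *)
Definition Hol (S : C -> Prop) (f : C -> C) : Prop :=
  exists f' : C -> C, forall rho : R, exists K : R, 0 <= K /\ forall z, S z -> Cmod z <= rho ->
    Cmod (f z) <= K /\ Cmod (f' z) <= K /\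
    forall w, S w -> Cmod w <= rho ->
      Cmod (f w - f z - (w - z) * f' z) <= K * (Cmod (w - z) * Cmod (w - z)).

Lemma Hol_subset (S T : C -> Prop) f : (forall z, T z -> S z) -> Hol S f -> Hol T f.
Proof.
  intros HST [f' H]; exists f'; intros rho; destruct (H rho) as [K [HK HKK]]; exists K; split; auto.
  intros z Hz Hzr; destruct (HKK z (HST z Hz) Hzr) as [A [B D]]; repeat split; auto.
Qed.

Lemma Hol_ext S f g : (forall z, S z -> f z = g z) -> Hol S f -> Hol S g.
Proof.
  intros E [f' H]; exists f'; intros rho; destruct (H rho) as [K [HK HKK]]; exists K; split; auto.
  intros z Hz Hzr; destruct (HKK z Hz Hzr) as [A [B D]]. rewrite <- E by auto. repeat split; auto.
  intros w Hw Hwr. rewrite <- E by auto. auto.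
Qed.

Lemma Hol_const S c : Hol S (fun _ => c).
Proof.
  exists (fun _ => RtoC 0). intros rho. exists (Cmod c). split; [apply Cmod_ge_0|].
  intros z _ _. repeat split; [lra|rewrite Cmod_0; apply Cmod_ge_0|].
  intros w _ _. replace (c - c - (w - z) * 0)%C with (RtoC 0) by ring. rewrite Cmod_0.
  apply Rmult_le_pos; [apply Cmod_ge_0|]. apply Rmult_le_pos; apply Cmod_ge_0.
Qed.

Lemma Hol_id S : Hol S (fun z => z).
Proof.
  exists (fun _ => RtoC 1). intros rho. exists (Rabs rho + 1). pose proof (Rabs_pos rho). pose proof (Rle_abs rho).
  split; [lra|].
  intros z _ Hz. repeat split; [lra|rewrite Cmod_1; lra|].
  intros w _ _. replace (w - z - (w - z) * 1)%C with (RtoC 0) by ring. rewrite Cmod_0.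
  apply Rmult_le_pos; [lra|]. apply Rmult_le_pos; apply Cmod_ge_0.
Qed.

Lemma Hol_plus S f g : Hol S f -> Hol S g -> Hol S (fun z => f z + g z)%C.
Proof.
  intros [f' Hf] [g' Hg]. exists (fun z => f' z + g' z)%C. intros rho.
  destruct (Hf rho) as [K [HK Kf]], (Hg rho) as [L [HL Kg]]. exists (K + L). split; [lra|].
  intros z Hz Hzr. destruct (Kf z Hz Hzr) as [A1 [A2 A3]], (Kg z Hz Hzr) as [B1 [B2 B3]].
  repeat split.
  - eapply Rle_trans; [apply Cmod_triangle|lra].
  - eapply Rle_trans; [apply Cmod_triangle|lra].
  - intros w Hw Hwr.
    replace (f w + g w - (f z + g z) - (w - z) * (f' z + g' z))%C with
      ((f w - f z - (w - z) * f' z) + (g w - g z - (w - z) * g' z))%C by ring.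
    eapply Rle_trans; [apply Cmod_triangle|].
    specialize (A3 w Hw Hwr). specialize (B3 w Hw Hwr). lra.
Qed.

Lemma Cmod_remainder (f0 f1 d : C) (K : R) : 0 <= K -> Cmod f1 <= K ->
  Cmod (f0 - d * f1) <= K * (Cmod d * Cmod d) -> Cmod f0 <= K * (1 + Cmod d) * Cmod d.
Proof.
  intros HK H1 H0. replace f0 with ((f0 - d * f1) + d * f1)%C by ring.
  eapply Rle_trans; [apply Cmod_triangle|]. rewrite Cmod_mult.
  pose proof (Cmod_ge_0 d). nra.
Qed.

Lemma Cmod_minus_le z w rho : Cmod z <= rho -> Cmod w <= rho -> Cmod (w - z) <= 2 * rho.
Proof. intros; eapply Rle_trans; [apply Cmod_triangle_minus|lra]. Qed.

(** What remains of [Hol] for the complex derivative; continuity along rays is deduced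
    from it. *)
Definition LocLip (S : C -> Prop) (f : C -> C) : Prop :=
  forall rho, exists K, 0 <= K /\ forall z w, S z -> S w -> Cmod z <= rho -> Cmod w <= rho ->
    Cmod (f w - f z) <= K * Cmod (w - z).

Lemma Hol_LocLip S f : Hol S f -> LocLip S f.
Proof.
  intros [f' H] rho. destruct (H rho) as [K [HK HKK]].
  exists (K * (1 + 2 * Rabs rho)). split; [pose proof (Rabs_pos rho); nra|].
  intros z w Hz Hw Hzr Hwr. destruct (HKK z Hz Hzr) as [A [B D]].
  assert (E := Cmod_remainder _ _ _ K HK B (D w Hw Hwr)).
  eapply Rle_trans; [exact E|]. apply Rmult_le_compat_r; [apply Cmod_ge_0|].
  apply Rmult_le_compat_l; auto. pose proof (Cmod_minus_le z w rho Hzr Hwr). pose proof (Rle_abs rho). lra.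
Qed.

Lemma Hol_mult S f g : Hol S f -> Hol S g -> Hol S (fun z => f z * g z)%C.
Proof.
  intros [f' Hf] [g' Hg]. exists (fun z => f' z * g z + f z * g' z)%C. intros rho.
  destruct (Hf rho) as [K [HK Kf]], (Hg rho) as [L [HL Kg]].
  exists (2 * K * L + K * (1 + 2 * Rabs rho) * (L * (1 + 2 * Rabs rho))).
  assert (Hr := Rabs_pos rho). pose proof (Rle_abs rho) as Hr2.
  assert (0 <= K * L) by nra.
  assert (0 <= K * (1 + 2 * Rabs rho)) by nra. assert (0 <= L * (1 + 2 * Rabs rho)) by nra.
  assert (P : 0 <= K * (1 + 2 * Rabs rho) * (L * (1 + 2 * Rabs rho))) by nra.
  split; [lra|].
  intros z Hz Hzr. destruct (Kf z Hz Hzr) as [A1 [A2 A3]], (Kg z Hz Hzr) as [B1 [B2 B3]].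
  assert (N1 := Cmod_ge_0 (f z)). assert (N2 := Cmod_ge_0 (g z)).
  assert (N3 := Cmod_ge_0 (f' z)). assert (N4 := Cmod_ge_0 (g' z)).
  assert (Q1 : Cmod (f z) * Cmod (g z) <= K * L) by (apply Rmult_le_compat; auto).
  assert (Q2 : Cmod (f' z) * Cmod (g z) <= K * L) by (apply Rmult_le_compat; auto).
  assert (Q3 : Cmod (f z) * Cmod (g' z) <= K * L) by (apply Rmult_le_compat; auto).
  repeat split.
  - rewrite Cmod_mult. lra.
  - eapply Rle_trans; [apply Cmod_triangle|]. rewrite !Cmod_mult. lra.
  - intros w Hw Hwr.
    replace (f w * g w - f z * g z - (w - z) * (f' z * g z + f z * g' z))%C with
      ((f w - f z - (w - z) * f' z) * g z + f z * (g w - g z - (w - z) * g' z)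
        + (f w - f z) * (g w - g z))%C by ring.
    eapply Rle_trans; [apply Cmod_triangle|].
    eapply Rle_trans; [apply Rplus_le_compat_r, Cmod_triangle|]. rewrite !Cmod_mult.
    assert (Hd := Cmod_ge_0 (w - z)).
    assert (Hd2 := Cmod_minus_le z w rho Hzr Hwr).
    assert (F := Cmod_remainder _ _ _ K HK A2 (A3 w Hw Hwr)).
    assert (G := Cmod_remainder _ _ _ L HL B2 (B3 w Hw Hwr)).
    specialize (A3 w Hw Hwr). specialize (B3 w Hw Hwr).
    set (d := Cmod (w - z)) in *.
    assert (F' : Cmod (f w - f z) <= K * (1 + 2 * Rabs rho) * d).
    { eapply Rle_trans; [exact F|]. apply Rmult_le_compat_r; auto. apply Rmult_le_compat_l; auto. lra. }
    assert (G' : Cmod (g w - g z) <= L * (1 + 2 * Rabs rho) * d).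
    { eapply Rle_trans; [exact G|]. apply Rmult_le_compat_r; auto. apply Rmult_le_compat_l; auto. lra. }
    assert (T1 : Cmod (f w - f z - (w - z) * f' z) * Cmod (g z) <= K * (d * d) * L)
      by (apply Rmult_le_compat; auto; apply Cmod_ge_0).
    assert (T2 : Cmod (f z) * Cmod (g w - g z - (w - z) * g' z) <= K * (L * (d * d)))
      by (apply Rmult_le_compat; auto; apply Cmod_ge_0).
    assert (T3 : Cmod (f w - f z) * Cmod (g w - g z) <=
       (K * (1 + 2 * Rabs rho) * d) * (L * (1 + 2 * Rabs rho) * d))
      by (apply Rmult_le_compat; auto; apply Cmod_ge_0).
    lra.
Qed.

Lemma Hol_scal S c f : Hol S f -> Hol S (fun z => c * f z)%C.
Proof. intros; apply Hol_mult; auto; apply Hol_const. Qed.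

Lemma Hol_opp S f : Hol S f -> Hol S (fun z => - f z)%C.
Proof. intros H. apply (Hol_ext S (fun z => - (1) * f z)%C); [intros; ring|apply Hol_scal; auto]. Qed.

Lemma Hol_minus S f g : Hol S f -> Hol S g -> Hol S (fun z => f z - g z)%C.
Proof. intros; apply Hol_plus; auto; apply Hol_opp; auto. Qed.

Lemma Hol_pow S f n : Hol S f -> Hol S (fun z => f z ^ n)%C.
Proof. intros H; induction n; simpl; [apply Hol_const|apply Hol_mult; auto]. Qed.

Lemma Hol_comp S T f p : Hol T f -> Hol S p -> (forall z, S z -> T (p z)) -> Hol S (fun z => f (p z)).
Proof.
  intros [f' Hf] Hp HST. assert (Hlip := Hol_LocLip _ _ Hp). destruct Hp as [p' Hp].
  exists (fun z => p' z * f' (p z))%C. intros rho.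
  destruct (Hp rho) as [L [HL Lp]]. destruct (Hlip rho) as [J [HJ Jp]].
  destruct (Hf L) as [K [HK Kf]].
  exists (K + L * K + K * (J * J)).
  assert (0 <= L * K) by nra. assert (0 <= K * (J * J)) by (apply Rmult_le_pos; nra).
  split; [lra|]. intros z Hz Hzr.
  destruct (Lp z Hz Hzr) as [B1 [B2 B3]]. destruct (Kf (p z) (HST z Hz) B1) as [A1 [A2 A3]].
  assert (Q : Cmod (p' z) * Cmod (f' (p z)) <= L * K) by (apply Rmult_le_compat; auto; apply Cmod_ge_0).
  repeat split; [lra|rewrite Cmod_mult; lra|].
  intros w Hw Hwr. specialize (B3 w Hw Hwr).
  destruct (Lp w Hw Hwr) as [B1' _]. specialize (A3 (p w) (HST w Hw) B1').
  replace (f (p w) - f (p z) - (w - z) * (p' z * f' (p z)))%C with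
    ((f (p w) - f (p z) - (p w - p z) * f' (p z)) + (p w - p z - (w - z) * p' z) * f' (p z))%C by ring.
  eapply Rle_trans; [apply Cmod_triangle|]. rewrite (Cmod_mult (p w - p z - _)).
  specialize (Jp z w Hz Hw Hzr Hwr).
  assert (Hd := Cmod_ge_0 (w - z)). set (d := Cmod (w - z)) in *.
  assert (T1 : Cmod (p w - p z - (w - z) * p' z) * Cmod (f' (p z)) <= L * (d * d) * K)
    by (apply Rmult_le_compat; auto; apply Cmod_ge_0).
  assert (T2 : Cmod (p w - p z) * Cmod (p w - p z) <= J * d * (J * d))
    by (apply Rmult_le_compat; auto; apply Cmod_ge_0).
  apply (Rmult_le_compat_l K) in T2; auto.
  assert (0 <= K * (d * d)) by (apply Rmult_le_pos; nra). nra.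
Qed.

Lemma Hol_Cexp_all : Hol (fun _ => True) Cexp.
Proof.
  exists Cexp. intros rho. exists (4 * exp rho). pose proof (exp_pos rho).
  assert (B : forall z, Cmod z <= rho -> Re z <= rho).
  { intros z Hz. eapply Rle_trans; [apply Rle_abs|]. eapply Rle_trans; [apply re_le_Cmod|auto]. }
  assert (B' : forall z, Cmod z <= rho -> Cmod (Cexp z) <= exp rho).
  { intros z Hz. rewrite Cmod_Cexp. destruct (B z Hz) as [Hlt|<-]; [left; apply exp_increasing; auto|lra]. }
  split; [lra|]. intros z _ Hz. specialize (B' z Hz) as B''.
  repeat split; try lra.
  intros w _ Hw. apply Cexp_taylor2; auto.
Qed.

Lemma Hol_Cexp S f : Hol S f -> Hol S (fun z => Cexp (f z)).
Proof. intros; apply (Hol_comp S (fun _ => True)); auto. apply Hol_Cexp_all. Qed.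

Lemma Hol_inv S f delta : 0 < delta -> (forall z, S z -> delta <= Cmod (f z)) ->
  Hol S f -> Hol S (fun z => / f z)%C.
Proof.
  intros Hdel Hlow Hf. apply (Hol_comp S (fun z => delta <= Cmod z) (fun z => / z)%C f); auto.
  exists (fun z => - (/ z * / z))%C. intros rho.
  assert (Hi := Rinv_0_lt_compat _ Hdel).
  set (e := / delta) in *.
  exists (e + e * e + e * e * e).
  assert (0 < e * e) by nra. assert (0 < e * e * e) by nra.
  split; [lra|].
  assert (NZ : forall z, delta <= Cmod z -> z <> 0%C).
  { intros z Hz. apply Cmod_gt_0. lra. }
  assert (I : forall z, delta <= Cmod z -> Cmod (/ z) <= e).
  { intros z Hz. rewrite Cmod_inv by auto. apply Rinv_le_contravar; auto. }
  intros z Hz _. assert (Iz := I z Hz). assert (Nz := NZ z Hz).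
  assert (P0 := Cmod_ge_0 (/ z)).
  repeat split; [lra|rewrite Cmod_opp, Cmod_mult; nra|].
  intros w Hw _. assert (Iw := I w Hw). assert (Nw := NZ w Hw). assert (P1 := Cmod_ge_0 (/ w)).
  replace (/ w - / z - (w - z) * - (/ z * / z))%C with ((w - z) * (w - z) * (/ z * / z * / w))%C
    by (field; auto).
  rewrite !Cmod_mult. rewrite Rmult_comm.
  apply Rmult_le_compat_r; [pose proof (Cmod_ge_0 (w - z)); nra|].
  assert (Cmod (/ z) * Cmod (/ z) <= e * e) by nra.
  assert (Cmod (/ z) * Cmod (/ z) * Cmod (/ w) <= e * e * e) by (apply Rmult_le_compat; nra).
  lra.
Qed.

(** Adding the quadratic remainders at z and at w shows that the complex derivative is
    itself locally Lipschitz. *)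
Lemma Hol_derivative S f : Hol S f -> exists f', LocLip S f' /\
  forall rho : R, exists K : R, 0 <= K /\ forall z, S z -> Cmod z <= rho ->
    Cmod (f z) <= K /\ Cmod (f' z) <= K /\
    forall w, S w -> Cmod w <= rho ->
      Cmod (f w - f z - (w - z) * f' z) <= K * (Cmod (w - z) * Cmod (w - z)).
Proof.
  intros [f' H]. exists f'. split; auto.
  intros rho. destruct (H rho) as [K [HK HKK]]. exists (2 * K). split; [lra|].
  intros z w Hz Hw Hzr Hwr.
  destruct (Req_dec (Cmod (w - z)) 0) as [E|E].
  { assert (w = z) as ->. { apply Cmod_eq_0 in E. replace w with (w - z + z)%C by ring. rewrite E; ring. }
    replace (f' z - f' z)%C with (RtoC 0) by ring. rewrite Cmod_0. pose proof (Cmod_ge_0 (z - z)); nra. }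
  destruct (HKK z Hz Hzr) as [_ [_ A]]. destruct (HKK w Hw Hwr) as [_ [_ B]].
  specialize (A w Hw Hwr). specialize (B z Hz Hzr). rewrite (Cmod_minus_sym z w) in B.
  assert (Hd := Cmod_ge_0 (w - z)).
  apply Rmult_le_reg_r with (Cmod (w - z)); [lra|].
  rewrite <- Cmod_mult.
  replace ((f' w - f' z) * (w - z))%C with
    ((f w - f z - (w - z) * f' z) + (f z - f w - (z - w) * f' w))%C by ring.
  eapply Rle_trans; [apply Cmod_triangle|]. nra.
Qed.

(** * Integrals along rays *)

Definition ray (theta r : R) : C := (r * Cexp (Ci * theta))%C.

Lemma Cmod_unit (theta : R) : Cmod (Cexp (Ci * theta)) = 1.
Proof. rewrite Cmod_Cexp. replace (Re (Ci * theta)) with 0 by (unfold Re, Ci, Cmult, RtoC; simpl; ring). apply exp_0. Qed.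

Lemma Cmod_ray theta r : 0 <= r -> Cmod (ray theta r) = r.
Proof. intros; unfold ray. rewrite Cmod_mult, Cmod_unit, Cmod_R, Rabs_pos_eq; auto; ring. Qed.

Lemma Cmod_ray_minus theta r s : Cmod (ray theta r - ray theta s) = Rabs (r - s).
Proof.
  unfold ray. replace (r * Cexp (Ci * theta) - s * Cexp (Ci * theta))%C with ((r - s)%R * Cexp (Ci * theta))%C
    by (rewrite RtoC_minus; ring).
  rewrite Cmod_mult, Cmod_unit, Cmod_R; ring.
Qed.

Definition on_ray (theta : R) (z : C) : Prop := exists r, 0 <= r /\ z = ray theta r.

Lemma Rmax_lip s r : Rabs (Rmax 0 s - Rmax 0 r) <= Rabs (s - r).
Proof.
  unfold Rmax; destruct (Rle_dec 0 s), (Rle_dec 0 r); unfold Rabs; repeat destruct Rcase_abs; lra.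
Qed.

Lemma LocLip_ray_cont theta f : LocLip (on_ray theta) f ->
  forall r, Ccont (fun s => f (ray theta (Rmax 0 s))) r.
Proof.
  intros H r. destruct (H (Rabs r + 1)) as [K [HK HKK]].
  apply (Ccont_lip _ _ K (mkposreal 1 ltac:(lra))). simpl. intros y Hy.
  assert (Py := Rmax_l 0 y). assert (Pr := Rmax_l 0 r).
  eapply Rle_trans; [apply HKK|].
  - exists (Rmax 0 r); auto.
  - exists (Rmax 0 y); auto.
  - rewrite Cmod_ray by auto. unfold Rmax; destruct (Rle_dec 0 r); pose proof (Rabs_pos r); pose proof (Rle_abs r); lra.
  - rewrite Cmod_ray by auto. assert (Rabs y <= Rabs r + 1).
    { replace y with ((y - r) + r) by ring. eapply Rle_trans; [apply Rabs_triang|lra]. }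
    unfold Rmax; destruct (Rle_dec 0 y); pose proof (Rabs_pos r); pose proof (Rle_abs y); lra.
  - apply Rmult_le_compat_l; auto. rewrite Cmod_ray_minus. apply Rmax_lip.
Qed.

Definition ray_dominated (theta M : R) (F : C -> C) : Prop :=
  (forall r, Ccont (fun s => F (ray theta (Rmax 0 s))) r) /\
  (forall r, 0 <= r -> Cmod (F (ray theta r)) <= M / (1 + r ^ 2)).

Lemma ray_dominated_intro theta M F : Hol (on_ray theta) F ->
  (forall r, 0 <= r -> Cmod (F (ray theta r)) <= M / (1 + r ^ 2)) -> ray_dominated theta M F.
Proof. intros H1 H2; split; auto. apply LocLip_ray_cont. apply Hol_LocLip; auto. Qed.

Lemma ray_dominated_half theta M F : ray_dominated theta M F ->
  dominated M (fun r => F (ray theta r) * Cexp (Ci * theta))%C.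
Proof.
  intros [H1 H2]; split.
  - intros r. apply Ccont_mult; [auto|apply Ccont_const].
  - intros r Hr. rewrite Cmod_mult, Cmod_unit, Rmult_1_r. auto.
Qed.

Lemma int_ray_half theta F : int_ray theta F = half (fun r => F (ray theta r) * Cexp (Ci * theta))%C.
Proof. reflexivity. Qed.

Lemma int_ray_bound theta M F : ray_dominated theta M F -> Cmod (int_ray theta F) <= 2 * M.
Proof. intros H. rewrite int_ray_half. apply half_bound, ray_dominated_half; auto. Qed.

Lemma ray_dominated_plus theta M N F G : ray_dominated theta M F -> ray_dominated theta N G ->
  ray_dominated theta (M + N) (fun z => F z + G z)%C.
Proof.
  intros [A B] [A' B'].
  destruct (dominated_plus M N (fun r => F (ray theta r)) (fun r => G (ray theta r)) (conj A B) (conj A' B')).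
  split; auto.
Qed.

Lemma ray_dominated_minus theta M N F G : ray_dominated theta M F -> ray_dominated theta N G ->
  ray_dominated theta (M + N) (fun z => F z - G z)%C.
Proof.
  intros [A B] [A' B'].
  destruct (dominated_minus M N (fun r => F (ray theta r)) (fun r => G (ray theta r)) (conj A B) (conj A' B')).
  split; auto.
Qed.

Lemma ray_dominated_scal theta M c F : ray_dominated theta M F ->
  ray_dominated theta (Cmod c * M) (fun z => c * F z)%C.
Proof.
  intros [A B]. destruct (dominated_scal M c (fun r => F (ray theta r)) (conj A B)). split; auto.
Qed.

Lemma int_ray_ext theta M F G : ray_dominated theta M F ->
  (forall r, 0 < r -> F (ray theta r) = G (ray theta r)) -> int_ray theta F = int_ray theta G.
Proof.
  intros H E. rewrite !int_ray_half. eapply half_ext; [apply ray_dominated_half; eassumption|].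
  intros r Hr. simpl. rewrite E; auto.
Qed.

Lemma int_ray_scal theta M c F : ray_dominated theta M F ->
  int_ray theta (fun z => c * F z)%C = (c * int_ray theta F)%C.
Proof.
  intros H. rewrite !int_ray_half. apply ray_dominated_half in H.
  rewrite <- (half_scal M) by exact H. eapply half_ext.
  - eapply dominated_ext; [|apply (dominated_scal M c); exact H]. intros; simpl; ring.
  - intros; simpl; ring.
Qed.

Lemma int_ray_plus theta M N F G : ray_dominated theta M F -> ray_dominated theta N G ->
  int_ray theta (fun z => F z + G z)%C = (int_ray theta F + int_ray theta G)%C.
Proof.
  intros H H'. rewrite !int_ray_half. apply ray_dominated_half in H, H'.
  rewrite <- (half_plus M N) by assumption. eapply half_ext.
  - eapply dominated_ext; [|apply (dominated_plus M N); [exact H|exact H']]. intros; simpl; ring.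
  - intros; simpl; ring.
Qed.

Lemma int_ray_minus theta M N F G : ray_dominated theta M F -> ray_dominated theta N G ->
  int_ray theta (fun z => F z - G z)%C = (int_ray theta F - int_ray theta G)%C.
Proof.
  intros H H'. rewrite !int_ray_half. apply ray_dominated_half in H, H'.
  rewrite <- (half_minus M N) by assumption. eapply half_ext.
  - eapply dominated_ext; [|apply (dominated_minus M N); [exact H|exact H']]. intros; simpl; ring.
  - intros; simpl; ring.
Qed.

Lemma sqr_Rabs (x : R) : x * x = Rabs x * Rabs x.
Proof. rewrite <- Rabs_mult, Rabs_pos_eq; [reflexivity|nra]. Qed.

(** A version for functions whose derivative is only controlled on a closed interval
    and which may be wild outside: they are composed with the projection onto the
    interval. *)
Lemma mean_value_ineq_quadratic (A A' : R -> C) (a b K B : R) : a <= b -> 0 <= K ->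
  (forall x y, a <= x <= b -> a <= y <= b ->
     Cmod (A y - A x - (y - x)%R * A' x) <= K * ((y - x) * (y - x))) ->
  (forall x, a <= x <= b -> Cmod (A' x) <= B) ->
  Cmod (A b - A a) <= 2 * B * (b - a).
Proof.
  intros Hab HK HA HB.
  set (clamp := fun x => Rmax a (Rmin b x)).
  assert (Cl : forall x, a <= clamp x <= b).
  { intros x. unfold clamp, Rmax, Rmin. destruct (Rle_dec b x), (Rle_dec a _); lra. }
  assert (Cid : forall x, a <= x <= b -> clamp x = x).
  { intros x Hx. unfold clamp. rewrite Rmin_right, Rmax_right; lra. }
  assert (Clip : forall x y, Rabs (clamp y - clamp x) <= Rabs (y - x)).
  { intros x y. unfold clamp, Rmax, Rmin.
    repeat destruct Rle_dec; unfold Rabs; repeat destruct Rcase_abs; lra. }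
  assert (HB0 : 0 <= B) by (eapply Rle_trans; [apply Cmod_ge_0|apply (HB a); lra]).
  rewrite <- (Cid b), <- (Cid a) by lra.
  rewrite (Cid b) at 2 by lra. rewrite (Cid a) at 2 by lra.
  apply (mean_value_ineq (fun x => A (clamp x)) A' a b B); auto.
  - intros x Hx. apply (Cder_ext_loc A).
    + eapply filter_imp; [|apply (locally_interior a b x Hx)]. intros y Hy. simpl. rewrite Cid; auto.
    + set (d := Rmin (x - a) (b - x)). assert (0 < d) by (unfold d; apply Rmin_pos; lra).
      apply (Cder_of_quadratic _ _ _ K d); auto. intros h Hh.
      assert (d <= x - a) by apply Rmin_l. assert (d <= b - x) by apply Rmin_r. apply Rabs_def2 in Hh.
      assert (T := HA x (x + h) ltac:(lra) ltac:(lra)).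
      replace (x + h - x) with h in T by ring. exact T.
  - intros x Hx. apply (Ccont_lip _ _ (B + K * (b - a)) (mkposreal 1 ltac:(lra))). intros y _.
    assert (P := Clip x y). set (p := clamp x) in *. set (q := clamp y) in *.
    assert (T := HA p q (Cl x) (Cl y)). specialize (HB p (Cl x)).
    replace (A q - A p)%C with ((A q - A p - (q - p)%R * A' p) + (q - p)%R * A' p)%C by ring.
    eapply Rle_trans; [apply Cmod_triangle|]. rewrite Cmod_mult, Cmod_R.
    assert (Hq := Cl y). assert (Hp := Cl x). fold q in Hq. fold p in Hp.
    assert (Rabs (q - p) <= b - a) by (apply Rabs_le; lra).
    assert ((q - p) * (q - p) = Rabs (q - p) * Rabs (q - p)) by (rewrite <- ?sqr_Rabs; reflexivity).
    assert (P0 := Rabs_pos (q - p)).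
    assert (Cmod (A' p) * Rabs (q - p) <= B * Rabs (q - p)) by (apply Rmult_le_compat_r; auto).
    assert (K * (Rabs (q - p) * Rabs (q - p)) <= K * ((b - a) * Rabs (q - p))).
    { apply Rmult_le_compat_l; auto. apply Rmult_le_compat_r; auto. }
    apply Rle_trans with ((B + K * (b - a)) * Rabs (q - p)); [nra|].
    apply Rmult_le_compat_l; auto. nra.
  - intros; apply HB; lra.
Qed.

Lemma unit_taylor (x y : R) : Cmod (Cexp (Ci * y) - Cexp (Ci * x) - (y - x)%R * (Ci * Cexp (Ci * x))) <= 4 * ((y - x) * (y - x)).
Proof.
  assert (R0 : forall t : R, Re (Ci * t) <= 0) by (intros; unfold Re, Ci, Cmult, RtoC; simpl; lra).
  assert (T := Cexp_taylor2 0 (Ci * x) (Ci * y) (R0 x) (R0 y)).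
  replace ((Ci * y - Ci * x) * Cexp (Ci * x))%C with ((y - x)%R * (Ci * Cexp (Ci * x)))%C in T
    by (rewrite RtoC_minus; ring).
  replace (Ci * y - Ci * x)%C with (Ci * (y - x)%R)%C in T by (rewrite RtoC_minus; ring).
  rewrite exp_0, Cmod_mult, Cmod_Ci, Cmod_R in T.
  replace ((y - x) * (y - x)) with (Rabs (y - x) * Rabs (y - x)) by (rewrite <- ?sqr_Rabs; reflexivity).
  lra.
Qed.

Lemma unit_lip (x y : R) : Cmod (Cexp (Ci * y) - Cexp (Ci * x)) <= 2 * Rabs (y - x).
Proof.
  assert (R0 : forall t : R, Re (Ci * t) <= 0) by (intros; unfold Re, Ci, Cmult, RtoC; simpl; lra).
  assert (T := Cexp_lip 0 (Ci * x) (Ci * y) (R0 x) (R0 y)).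
  replace (Ci * y - Ci * x)%C with (Ci * (y - x)%R)%C in T by (rewrite RtoC_minus; ring).
  rewrite exp_0, Cmod_mult, Cmod_Ci, Cmod_R in T. lra.
Qed.

(** The integrand is the derivative in r of [r * f (ray theta r)]; up to the factor
    [i] times a unit, it is also the derivative in theta of the integrand of
    [int_ray theta f]. *)
Lemma radial_integral (f f' : C -> C) (theta R0 : R) : 0 <= R0 ->
  LocLip (on_ray theta) f -> LocLip (on_ray theta) f' ->
  (forall rho : R, exists K : R, 0 <= K /\ forall z w, on_ray theta z -> on_ray theta w ->
     Cmod z <= rho -> Cmod w <= rho ->
     Cmod (f w - f z - (w - z) * f' z) <= K * (Cmod (w - z) * Cmod (w - z))) ->
  CInt (fun r => f (ray theta r) + ray theta r * f' (ray theta r))%C 0 R0 = (R0 * f (ray theta R0))%C.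
Proof.
  intros HR Hf Hf' Hd.
  assert (C1 := LocLip_ray_cont _ _ Hf). assert (C2 := LocLip_ray_cont _ _ Hf').
  rewrite CInt_Rmax by lra.
  assert (Cm : forall r, Ccont (fun s => RtoC (Rmax 0 s)) r).
  { intros r. apply (Ccont_lip _ _ 1 (mkposreal 1 ltac:(lra))). intros y _.
    rewrite <- RtoC_minus, Cmod_R. rewrite Rmult_1_l. apply Rmax_lip. }
  rewrite (CInt_derive (fun r => Rmax 0 r * f (ray theta (Rmax 0 r)))%C _ 0 R0); auto.
  - rewrite (Rmax_right 0 R0) by lra. rewrite Rmax_left by lra. ring.
  - intros x Hx. rewrite (Rmax_right 0 x) by lra.
    apply (Cder_ext_loc (fun r => r * f (ray theta r))%C).
    { eapply filter_imp; [|apply (locally_interior 0 R0 x Hx)]. intros y Hy. simpl. rewrite Rmax_right; [reflexivity|lra]. }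
    assert (D : Cder (fun r => f (ray theta r)) x (Cexp (Ci * theta) * f' (ray theta x))%C).
    { destruct (Hd R0) as [K [HK HKK]].
      set (d := Rmin x (R0 - x)). assert (0 < d) by (unfold d; apply Rmin_pos; lra).
      apply (Cder_of_quadratic _ _ _ K d); auto. intros h Hh.
      assert (d <= x) by apply Rmin_l. assert (d <= R0 - x) by apply Rmin_r. apply Rabs_def2 in Hh.
      assert (T := HKK (ray theta x) (ray theta (x + h))).
      rewrite !Cmod_ray_minus in T. replace (x + h - x) with h in T by ring.
      replace (ray theta (x + h) - ray theta x)%C with (h * Cexp (Ci * theta))%C in T
        by (unfold ray; rewrite RtoC_plus; ring).
      rewrite <- Cmult_assoc in T. rewrite <- Rabs_mult, Rabs_pos_eq in T by nra. apply T.
      - exists x; split; [lra|auto].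
      - exists (x + h); split; [lra|auto].
      - rewrite Cmod_ray; lra.
      - rewrite Cmod_ray; lra. }
    eapply Cder_eq; [apply (Cder_mult _ _ _ _ _ (Cder_id x) D)|]. unfold ray; ring.
  - intros x Hx. apply Ccont_mult; auto.
  - intros x Hx. apply Ccont_plus; auto. apply Ccont_mult; auto.
    unfold ray. apply Ccont_mult; [auto|apply Ccont_const].
Qed.

(** Cauchy's theorem in a sector. The derivative with respect to the angle of the
    integral over the segment of length [R] is [i] times the value of [z * f z] at the
    end point, which is [O(1/R)]. *)
Lemma int_ray_rotate (S : C -> Prop) (f : C -> C) (a b M : R) : a <= b -> Hol S f ->
  (forall r theta, 0 <= r -> a <= theta <= b -> S (ray theta r)) ->
  (forall r theta, 0 <= r -> a <= theta <= b -> Cmod (f (ray theta r)) <= M / (1 + r ^ 2)) ->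
  int_ray a f = int_ray b f.
Proof.
  intros Hab Hf HS HM.
  destruct (Hol_derivative _ _ Hf) as [f' [Lf' Hq]]. assert (Lf := Hol_LocLip _ _ Hf).
  assert (Sub : forall theta, a <= theta <= b -> forall z, on_ray theta z -> S z).
  { intros theta Ht z [r [Hr ->]]. auto. }
  assert (LL : forall g theta, a <= theta <= b -> LocLip S g -> LocLip (on_ray theta) g).
  { intros g theta Ht H rho. destruct (H rho) as [K [HK HKK]]. exists K; split; auto.
    intros; apply HKK; eauto. }
  assert (Dom : forall theta, a <= theta <= b -> ray_dominated theta M f).
  { intros theta Ht. split; [apply LocLip_ray_cont; auto|auto]. }
  assert (M0 : 0 <= M) by (apply (dominated_nonneg _ _ (ray_dominated_half _ _ _ (Dom a (conj (Rle_refl a) Hab))))).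
  assert (Fin : forall R0, 0 < R0 ->
    Cmod (CInt (fun r => f (ray b r) * Cexp (Ci * b))%C 0 R0 - CInt (fun r => f (ray a r) * Cexp (Ci * a))%C 0 R0)
      <= 2 * (R0 * (M / (1 + R0 ^ 2))) * (b - a)).
  { intros R0 HR0. destruct (Hq R0) as [K [HK HKK]].
    assert (Ex : forall theta, a <= theta <= b ->
      ex_RInt ((fun r => f (ray theta r) * Cexp (Ci * theta))%C : R -> CR) 0 R0).
    { intros theta Ht. apply ex_CInt_Rmax; [lra|lra|]. apply (ray_dominated_half theta M f (Dom theta Ht)). }
    assert (Ex' : forall theta, a <= theta <= b ->
      ex_RInt ((fun r => f (ray theta r) + ray theta r * f' (ray theta r))%C : R -> CR) 0 R0).
    { intros theta Ht. apply ex_CInt_Rmax; [lra|lra|]. intros r. apply Ccont_plus.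
      - apply (LocLip_ray_cont theta f); auto.
      - apply Ccont_mult; [|apply (LocLip_ray_cont theta f'); auto].
        unfold ray. apply Ccont_mult; [|apply Ccont_const].
        apply (Ccont_lip _ _ 1 (mkposreal 1 ltac:(lra))). intros y _.
        rewrite <- RtoC_minus, Cmod_R. rewrite Rmult_1_l. apply Rmax_lip. }
    set (K' := K * (4 * (R0 * R0)) + 4 * (R0 * K) + 4 * (R0 * K) + 4 * K).
    assert (HRK : 0 <= R0 * K) by nra. assert (0 <= K * (4 * (R0 * R0))) by (apply Rmult_le_pos; nra).
    assert (HK' : 0 <= K') by (unfold K'; nra).
    apply (mean_value_ineq_quadratic (fun theta => CInt (fun r => f (ray theta r) * Cexp (Ci * theta))%C 0 R0)
      (fun theta => Ci * Cexp (Ci * theta) * (R0 * f (ray theta R0)))%C a b (K' * R0)); auto; [nra| |].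
    - intros x y Hx Hy.
      rewrite <- (radial_integral f f' x R0); [|lra|auto|auto|].
      2:{ intros rho. destruct (Hq rho) as [K2 [HK2 HKK2]]. exists K2; split; auto.
          intros z w Hz Hw Hzr Hwr. apply (HKK2 z); eauto. }
      rewrite Cmult_assoc. rewrite <- (CInt_scal ((y - x)%R * (Ci * Cexp (Ci * x)))%C) by auto.
      assert (ES := is_CInt_scal ((y - x)%R * (Ci * Cexp (Ci * x)))%C _ _ _ _ (RInt_correct (V := CR) _ _ _ (Ex' x Hx))).
      rewrite <- CInt_minus by auto. rewrite <- CInt_minus.
      2: apply (ex_RInt_minus (V := CR)); auto.
      2: eexists; exact ES.
      replace (K' * R0 * ((y - x) * (y - x))) with (K' * ((y - x) * (y - x)) * (R0 - 0)) by ring.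
      apply CInt_le_const; [lra| |].
      2:{ apply (ex_RInt_minus (V := CR)); [apply (ex_RInt_minus (V := CR)); auto|]. eexists; exact ES. }
      intros r Hr.
      set (z := ray x r). set (w := ray y r). set (ex := Cexp (Ci * x)). set (ey := Cexp (Ci * y)).
      assert (Uy : Cmod ey = 1) by apply Cmod_unit. assert (Ux : Cmod ex = 1) by apply Cmod_unit.
      assert (T1 := unit_taylor x y). assert (T2 := unit_lip x y). fold ex ey in T1, T2.
      (* f w and ey are expanded to first order; w - z is r times the increment of ex. *)
      replace (f w * ey - f z * ex - (y - x)%R * (Ci * ex) * (f z + z * f' z))%C with
        ((f w - f z - (w - z) * f' z) * ey + (w - z) * f' z * (ey - ex)
          + f' z * ex * (r * (ey - ex - (y - x)%R * (Ci * ex)))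
          + f z * (ey - ex - (y - x)%R * (Ci * ex)))%C
        by (unfold z, w, ray; fold ex ey; ring).
      assert (Sz : S z) by (apply HS; lra). assert (Sw : S w) by (apply HS; lra).
      assert (Mz : Cmod z <= R0) by (unfold z; rewrite Cmod_ray; lra).
      assert (Mw : Cmod w <= R0) by (unfold w; rewrite Cmod_ray; lra).
      destruct (HKK z Sz Mz) as [B1 [B2 B3]]. specialize (B3 w Sw Mw).
      assert (Wz : Cmod (w - z) <= 2 * (R0 * Rabs (y - x))).
      { replace (w - z)%C with (r * (ey - ex))%C by (unfold z, w, ray; fold ex ey; ring).
        rewrite Cmod_mult, Cmod_R, Rabs_pos_eq by lra.
        pose proof (Cmod_ge_0 (ey - ex)). pose proof (Rabs_pos (y - x)). nra. }
      eapply Rle_trans; [apply Cmod_triangle|].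
      eapply Rle_trans; [apply Rplus_le_compat_r, Cmod_triangle|].
      eapply Rle_trans; [apply Rplus_le_compat_r, Rplus_le_compat_r, Cmod_triangle|].
      rewrite !Cmod_mult, Uy, Ux, Cmod_R, (Rabs_pos_eq r) by lra.
      set (q := (y - x) * (y - x)) in *. assert (q = Rabs (y - x) * Rabs (y - x)) as Eq.
      { apply sqr_Rabs. }
      assert (Pq : 0 <= q) by (exact (Rle_0_sqr (y - x))).
      assert (P0 := Rabs_pos (y - x)). set (u := Rabs (y - x)) in *.
      assert (N1 := Cmod_ge_0 (w - z)). assert (N2 := Cmod_ge_0 (ey - ex)). assert (N3 := Cmod_ge_0 (f' z)).
      assert (N4 := Cmod_ge_0 (f z)). assert (N5 := Cmod_ge_0 (ey - ex - (y - x)%R * (Ci * ex))).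
      assert (S1 : Cmod (w - z) * Cmod (w - z) <= 4 * (R0 * R0) * q).
      { rewrite Eq. replace (4 * (R0 * R0) * (u * u)) with ((2 * (R0 * u)) * (2 * (R0 * u))) by ring.
        apply Rmult_le_compat; auto. }
      assert (S1' := Rmult_le_compat_l K _ _ HK S1).
      assert (S2 : Cmod (w - z) * Cmod (f' z) * Cmod (ey - ex) <= (2 * (R0 * u)) * K * (2 * u)).
      { apply Rmult_le_compat; [apply Rmult_le_pos; auto|auto|apply Rmult_le_compat; auto|auto]. }
      assert (S3 : Cmod (f' z) * 1 * (r * Cmod (ey - ex - (y - x)%R * (Ci * ex))) <= K * 1 * (R0 * (4 * q))).
      { apply Rmult_le_compat; [lra|apply Rmult_le_pos; lra|lra|apply Rmult_le_compat; lra]. }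
      assert (S4 : Cmod (f z) * Cmod (ey - ex - (y - x)%R * (Ci * ex)) <= K * (4 * q)).
      { apply Rmult_le_compat; auto. }
      replace (2 * (R0 * u) * K * (2 * u)) with (4 * (R0 * K) * q) in S2 by (rewrite Eq; ring).
      replace (K * 1 * (R0 * (4 * q))) with (4 * (R0 * K) * q) in S3 by ring.
      unfold K'. lra.
    - intros x Hx. rewrite !Cmod_mult, Cmod_Ci, Cmod_unit, Cmod_R, Rabs_pos_eq by lra.
      rewrite !Rmult_1_l. apply Rmult_le_compat_l; [lra|]. apply HM; lra. }
  assert (Z : Cmod (int_ray b f - int_ray a f) <= 0).
  { apply le_epsilon. intros eps He. rewrite Rplus_0_l.
    destruct (is_half_elim _ _ (half_ex _ _ (ray_dominated_half b M f (Dom b (conj Hab (Rle_refl b))))) (eps / 3) ltac:(lra)) as [N1 H1].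
    destruct (is_half_elim _ _ (half_ex _ _ (ray_dominated_half a M f (Dom a (conj (Rle_refl a) Hab)))) (eps / 3) ltac:(lra)) as [N2 H2].
    (* Beyond T the bound of Fin, of order 1 / R, is at most eps / 3. *)
    set (T := 6 * M * (b - a) / eps).
    assert (HT : 0 <= T) by (unfold T; apply Rmult_le_pos; [nra|left; apply Rinv_0_lt_compat; auto]).
    set (R0 := Rmax N1 N2 + Rabs (Rmax N1 N2) + T + 1).
    assert (0 < R0 /\ N1 < R0 /\ N2 < R0 /\ T <= R0) as [R1 [R2 [R3 R4]]].
    { unfold R0. pose proof (Rmax_l N1 N2). pose proof (Rmax_r N1 N2).
      pose proof (Rle_abs (- Rmax N1 N2)). rewrite Rabs_Ropp in *. pose proof (Rabs_pos (Rmax N1 N2)). lra. }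
    destruct (H1 R0 R2) as [_ G1]. destruct (H2 R0 R3) as [_ G2]. assert (G3 := Fin R0 R1).
    rewrite !int_ray_half.
    set (hb := half _) in *. set (ha := half (fun r : R => f (ray a r) * Cexp (Ci * a))%C) in *.
    set (cb := CInt _ 0 R0) in *. set (ca := CInt (fun r : R => f (ray a r) * Cexp (Ci * a))%C 0 R0) in *.
    assert (G4 : 2 * (R0 * (M / (1 + R0 ^ 2))) * (b - a) <= eps / 3).
    { apply Rmult_le_reg_r with (1 + R0 ^ 2); [nra|].
      replace (2 * (R0 * (M / (1 + R0 ^ 2))) * (b - a) * (1 + R0 ^ 2)) with (2 * R0 * M * (b - a)) by (field; nra).
      assert (T * eps = 6 * M * (b - a)) by (unfold T; field; lra).
      assert (T * eps <= R0 * eps) by (apply Rmult_le_compat_r; lra). nra. }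
    replace (hb - ha)%C with ((cb - ca) + (ca - ha) - (cb - hb))%C by ring.
    eapply Rle_trans; [apply Cmod_triangle_minus|].
    assert (Tr := Cmod_triangle (cb - ca) (ca - ha)). lra. }
  assert (Z0 : (int_ray b f - int_ray a f)%C = 0%C) by (apply Cmod_eq_0; pose proof (Cmod_ge_0 (int_ray b f - int_ray a f)); lra).
  replace (int_ray b f) with ((int_ray b f - int_ray a f) + int_ray a f)%C by ring. rewrite Z0; ring.
Qed.

(** * Data on the half-line *)

(** A sequence of successive derivatives on the half-line, continuous up to the
    origin. Its members are continuous on the whole line, as is the case after
    composition with [Rmax 0], so that no one-sided notion is needed. *)
Definition jet (G : nat -> R -> C) : Prop :=
  (forall k x, Ccont (G k) x) /\ (forall k x, 0 < x -> Cder (G k) x (G (S k) x)).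

Definition shift (G : nat -> R -> C) : nat -> R -> C := fun k => G (S k).

Lemma jet_shift G : jet G -> jet (shift G).
Proof. intros [H1 H2]; split; intros; [apply H1|apply H2; auto]. Qed.

Lemma jet_plus F G : jet F -> jet G -> jet (fun k x => F k x + G k x)%C.
Proof. intros [A B] [A' B']; split; intros; [apply Ccont_plus; auto|apply Cder_plus; auto]. Qed.

Lemma jet_minus F G : jet F -> jet G -> jet (fun k x => F k x - G k x)%C.
Proof. intros [A B] [A' B']; split; intros; [apply Ccont_minus; auto|apply Cder_minus; auto]. Qed.

Lemma Cder_translate f a x l : Cder f (a + x) l -> Cder (fun y => f (a + y)) x l.
Proof.
  assert (G : forall (g : R -> R) m, is_derive g (a + x) m -> is_derive (fun y => g (a + y)) x m).
  { intros g m H. replace m with (scal 1 m) by (unfold scal; simpl; unfold mult; simpl; ring).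
    apply (is_derive_comp g (fun y => a + y) x); auto.
    auto_derive; auto. }
  intros [H1 H2]; split.
  - apply (G (fun s => Re (f s))); auto.
  - apply (G (fun s => Im (f s))); auto.
Qed.

Lemma continuous_translate a x : continuous (fun y : R => a + y) x.
Proof.
  apply (continuous_plus (fun _ : R => a) (fun y => y)); [apply continuous_const|apply continuous_id].
Qed.

Lemma jet_translate G a : 0 <= a -> jet G -> jet (fun k x => G k (a + x)).
Proof.
  intros Ha [A B]; split; intros.
  - apply (Ccont_comp (G k) (fun y => a + y)); auto. apply continuous_translate.
  - apply Cder_translate. apply B. lra.
Qed.

Lemma Ccont_bounded f a b : (forall x, a <= x <= b -> Ccont f x) ->
  exists B, 0 <= B /\ forall x, a <= x <= b -> Cmod (f x) <= B.
Proof.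
  intros H. destruct (bounded_continuity (V := C_R_NormedModule) f a b) as [M HM].
  - intros x Hx. apply (continuous_CR f x). auto.
  - exists (Rabs M). split; [apply Rabs_pos|]. intros x Hx. specialize (HM x Hx).
    rewrite norm_CR in HM. pose proof (Rle_abs M). lra.
Qed.

(** * The boundary data in the spectral variable *)

(** The product of [tilde g w t] with [Cexp (- w t)], which stays bounded in the
    right half-plane. *)
Definition conv (g : R -> C) (w : C) (t : R) : C :=
  CInt (fun s => Cexp (- (w * (t - s)%R)) * g s)%C 0 t.

Lemma Ccont_Cexp_affine (a b : C) x : Ccont (fun s : R => Cexp (a + s * b)) x.
Proof. eapply Cder_Ccont. apply Cder_Cexp_line. Qed.

Lemma Ccont_conv_kernel (w : C) (t : R) x : Ccont (fun s : R => Cexp (- (w * (t - s)%R))) x.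
Proof.
  eapply Ccont_ext; [|apply (Ccont_Cexp_affine (- (w * t)) w)].
  intros s; simpl. f_equal. rewrite RtoC_minus; ring.
Qed.

Lemma conv_tilde g w t : (forall x, Ccont g x) -> conv g w t = (Cexp (- (w * t)) * tilde g w t)%C.
Proof.
  intros Hg. unfold conv, tilde.
  rewrite <- (CInt_scal (Cexp (- (w * t))) (fun s : R => (Cexp (w * s) * g s)%C)).
  - apply (RInt_ext (V := CR)). intros x _. rewrite Cmult_assoc, <- Cexp_plus.
    f_equal. f_equal. rewrite RtoC_minus; ring.
  - apply ex_CInt. intros x _. apply Ccont_mult; auto.
    eapply Ccont_ext; [|apply (Ccont_Cexp_affine 0 w)]. intros s; simpl. f_equal; ring.
Qed.

Lemma Cmod_conv_kernel (w : C) (u : R) : 0 <= Re w -> 0 <= u -> Cmod (Cexp (- (w * u))) <= 1.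
Proof.
  intros Hw Hu. rewrite Cmod_Cexp, <- exp_0.
  assert (Re (- (w * u)) <= 0) by (unfold Re in *; simpl; nra).
  destruct H as [H | ->]; [left; apply exp_increasing; auto|lra].
Qed.

Lemma conv_bound g w t B : (forall x, Ccont g x) -> 0 <= t -> 0 <= Re w ->
  (forall s, 0 <= s <= t -> Cmod (g s) <= B) -> Cmod (conv g w t) <= B * t.
Proof.
  intros Hg Ht Hw HB. unfold conv. replace (B * t) with (B * (t - 0)) by ring.
  apply CInt_le_const; auto.
  - intros s Hs. rewrite Cmod_mult. rewrite <- (Rmult_1_l B).
    apply Rmult_le_compat; try apply Cmod_ge_0; auto. apply Cmod_conv_kernel; auto; lra.
  - apply ex_CInt. intros x _. apply Ccont_mult; auto. apply Ccont_conv_kernel.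
Qed.

(** Integration by parts; all the decay in w and all the recursions for the boundary
    data come from it. *)
Lemma conv_parts G w t : jet G -> 0 <= t ->
  (w * conv (G 0%nat) w t = G 0%nat t - Cexp (- (w * t)) * G 0%nat 0 - conv (G 1%nat) w t)%C.
Proof.
  intros [Hc Hd] Ht. unfold conv.
  assert (E : forall k, ex_RInt ((fun s => Cexp (- (w * (t - s)%R)) * G k s)%C : R -> CR) 0 t).
  { intros k; apply ex_CInt. intros; apply Ccont_mult; auto. apply Ccont_conv_kernel. }
  assert (D := CInt_derive (fun s => Cexp (- (w * (t - s)%R)) * G 0%nat s)%C
    (fun s => w * (Cexp (- (w * (t - s)%R)) * G 0%nat s) + Cexp (- (w * (t - s)%R)) * G 1%nat s)%C 0 t Ht).
  rewrite CInt_plus in D; [|eexists; apply is_CInt_scal; apply (RInt_correct (V := CR)); auto|auto].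
  rewrite CInt_scal in D by auto.
  replace (w * CInt (fun s : R => Cexp (- (w * (t - s)%R)) * G 0%nat s) 0 t)%C with
    ((w * CInt (fun s : R => Cexp (- (w * (t - s)%R)) * G 0%nat s) 0 t +
      CInt (fun s : R => Cexp (- (w * (t - s)%R)) * G 1%nat s) 0 t) -
      CInt (fun s : R => Cexp (- (w * (t - s)%R)) * G 1%nat s) 0 t)%C by ring.
  rewrite D.
  - replace (- (w * (t - t)%R))%C with (RtoC 0) by (rewrite RtoC_minus; ring).
    rewrite Rminus_0_r, Cexp_0. ring.
  - intros x Hx. eapply Cder_eq.
    + apply Cder_mult; [|apply Hd; lra].
      eapply Cder_ext; [|apply (Cder_Cexp_line (- (w * t)) w)].
      intros s; simpl. f_equal. rewrite RtoC_minus; ring.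
    + cbv beta. replace (- (w * (t - x)%R))%C with (- (w * t) + x * w)%C by (rewrite RtoC_minus; ring). ring.
  - intros x _. apply Ccont_mult; auto. apply Ccont_conv_kernel.
  - intros x _. apply Ccont_plus; [apply Ccont_mult; [apply Ccont_const|]|];
    apply Ccont_mult; auto; apply Ccont_conv_kernel.
Qed.

Lemma Cder_CInt f t : (forall x, Ccont f x) -> Cder (fun t => CInt f 0 t) t (f t).
Proof.
  intros Hf.
  assert (L : locally t (fun y => is_RInt (f : R -> CR) 0 y (CInt f 0 y))).
  { apply filter_forall. intros y. apply (RInt_correct (V := CR)). apply ex_CInt; auto. }
  split.
  - apply (is_derive_RInt (fun s => Re (f s)) (fun y => Re (CInt f 0 y)) 0 t).
    + eapply filter_imp; [|exact L]. intros y Hy. apply is_CInt_parts in Hy; apply Hy.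
    + apply Hf.
  - apply (is_derive_RInt (fun s => Im (f s)) (fun y => Im (CInt f 0 y)) 0 t).
    + eapply filter_imp; [|exact L]. intros y Hy. apply is_CInt_parts in Hy; apply Hy.
    + apply Hf.
Qed.

(** The derivative in t is [g t - w * conv g w t]; the integration by parts removes
    the factor w, so that the derivative is bounded for bounded t like the function
    itself. *)
Lemma conv_Cder G w t : jet G -> 0 < t ->
  Cder (fun t => conv (G 0%nat) w t) t (conv (G 1%nat) w t + Cexp (- (w * t)) * G 0%nat 0)%C.
Proof.
  intros HG Ht.
  assert (P := conv_parts G w t HG (Rlt_le _ _ Ht)). destruct HG as [Hc Hd].
  eapply Cder_ext; [intros s; symmetry; apply conv_tilde; auto|].
  assert (D : Cder (fun t => tilde (G 0%nat) w t) t (Cexp (w * t) * G 0%nat t)%C).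
  { apply (Cder_CInt (fun s : R => Cexp (w * s) * G 0%nat s)%C). intros x; apply Ccont_mult; auto.
    eapply Ccont_ext; [|apply (Ccont_Cexp_affine 0 w)]. intros s; simpl. f_equal; ring. }
  eapply Cder_eq.
  - apply Cder_mult; [|exact D].
    eapply Cder_ext; [|apply (Cder_Cexp_line 0 (- w))]. intros s; simpl. f_equal; ring.
  - simpl. replace (0 + t * - w)%C with (- (w * t))%C by ring.
    replace (- w * Cexp (- (w * t)) * tilde (G 0%nat) w t + Cexp (- (w * t)) * (Cexp (w * t) * G 0%nat t))%C
      with (- (w * (Cexp (- (w * t)) * tilde (G 0%nat) w t)) + Cexp (- (w * t)) * Cexp (w * t) * G 0%nat t)%C by ring.
    rewrite <- conv_tilde, P, <- Cexp_plus by auto.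
    replace (- (w * t) + w * t)%C with (RtoC 0) by ring. rewrite Cexp_0. ring.
Qed.

Lemma conv_0 g w : conv g w 0 = 0%C.
Proof. apply CInt_point. Qed.

(** The derivative is taken under the integral sign; the kernel is bounded because Re
    w >= 0, and so is its quadratic remainder. *)
Lemma conv_Hol g t : (forall x, Ccont g x) -> 0 <= t -> Hol (fun w => 0 <= Re w) (fun w => conv g w t).
Proof.
  intros Hg Ht. destruct (Ccont_bounded g 0 t) as [B [HB0 HB]]; auto.
  exists (fun w => CInt (fun s => - (t - s)%R * Cexp (- (w * (t - s)%R)) * g s)%C 0 t).
  assert (Ex : forall w, ex_RInt ((fun s => Cexp (- (w * (t - s)%R)) * g s)%C : R -> CR) 0 t).
  { intros w; apply ex_CInt. intros; apply Ccont_mult; auto. apply Ccont_conv_kernel. }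
  assert (Ex' : forall w, ex_RInt ((fun s => - (t - s)%R * Cexp (- (w * (t - s)%R)) * g s)%C : R -> CR) 0 t).
  { intros w; apply ex_CInt. intros x _; apply Ccont_mult; auto. apply Ccont_mult; [|apply Ccont_conv_kernel].
    apply Ccont_opp. apply Ccont_RtoC. apply (continuous_minus (fun _ : R => t) (fun y : R => y)).
    apply continuous_const. apply continuous_id. }
  intros rho. exists (B * t + t * B * t + 4 * t * t * B * t).
  assert (0 <= B * t) by nra. assert (0 <= t * B * t) by (apply Rmult_le_pos; nra).
  assert (0 <= 4 * t * t * B * t) by (apply Rmult_le_pos; auto; apply Rmult_le_pos; nra).
  split; [lra|].
  intros z Hz _. repeat split.
  - eapply Rle_trans; [apply (conv_bound g z t B); auto|lra].
  - apply Rle_trans with (t * B * (t - 0)); [|nra].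
    apply CInt_le_const; auto. intros s Hs. rewrite !Cmod_mult, Cmod_opp, Cmod_R, Rabs_pos_eq by lra.
    apply Rmult_le_compat; [| | |apply HB; auto].
    + apply Rmult_le_pos; [lra|apply Cmod_ge_0].
    + apply Cmod_ge_0.
    + apply Rle_trans with (t * 1); [|lra]. apply Rmult_le_compat; [lra|apply Cmod_ge_0|lra|].
      apply Cmod_conv_kernel; lra.
  - intros w Hw _. unfold conv.
    rewrite <- (CInt_scal (w - z)%C) by auto. rewrite <- CInt_minus by auto. rewrite <- CInt_minus.
    2: apply (ex_RInt_minus (V := CR)); auto.
    2: eexists; apply is_CInt_scal; apply (RInt_correct (V := CR)); auto.
    set (q := Cmod (w - z) * Cmod (w - z)).
    assert (0 <= q) by (unfold q; pose proof (Cmod_ge_0 (w - z)); nra).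
    apply Rle_trans with (4 * t * t * q * B * (t - 0)); [|nra].
    apply CInt_le_const; auto.
    2:{ apply (ex_RInt_minus (V := CR)); [apply (ex_RInt_minus (V := CR)); auto|].
        eexists; apply is_CInt_scal; apply (RInt_correct (V := CR)); auto. }
    intros s Hs.
    assert (Neg : forall v, 0 <= Re v -> Re (- (v * (t - s)%R)) <= 0).
    { intros v Hv. unfold Re in *; simpl. nra. }
    assert (T := Cexp_taylor2 0 (- (z * (t - s)%R)) (- (w * (t - s)%R)) (Neg z Hz) (Neg w Hw)).
    replace (- (w * (t - s)%R) - - (z * (t - s)%R))%C with (- (t - s)%R * (w - z))%C in T by ring.
    rewrite exp_0, (Cmod_mult (- (t - s)%R)), Cmod_opp, Cmod_R, (Rabs_pos_eq (t - s)) in T by lra.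
    replace (Cexp (- (w * (t - s)%R)) * g s - Cexp (- (z * (t - s)%R)) * g s -
       (w - z) * (- (t - s)%R * Cexp (- (z * (t - s)%R)) * g s))%C with
      ((Cexp (- (w * (t - s)%R)) - Cexp (- (z * (t - s)%R)) - - (t - s)%R * (w - z) * Cexp (- (z * (t - s)%R))) * g s)%C
      by ring.
    rewrite Cmod_mult. apply Rmult_le_compat; try apply Cmod_ge_0; [|apply HB; auto].
    eapply Rle_trans; [exact T|].
    replace (4 * 1 * ((t - s) * Cmod (w - z) * ((t - s) * Cmod (w - z)))) with (4 * ((t - s) * (t - s)) * q) by (unfold q; ring).
    apply Rmult_le_compat_r; auto. nra.
Qed.

(** * The initial data in the spectral variable *)

Definition schwartz (D : nat -> R -> C) : Prop :=
  jet D /\ forall j k : nat, exists M : R, forall x, 0 <= x -> x ^ j * Cmod (D k x) <= M.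

Lemma schwartz_shift D : schwartz D -> schwartz (shift D).
Proof. intros [H1 H2]; split; [apply jet_shift; auto|intros; apply H2]. Qed.

Lemma schwartz_plus D E : schwartz D -> schwartz E -> schwartz (fun k x => D k x + E k x)%C.
Proof.
  intros [H1 H2] [H3 H4]; split; [apply jet_plus; auto|].
  intros j k. destruct (H2 j k) as [M HM], (H4 j k) as [N HN]. exists (M + N). intros x Hx.
  specialize (HM x Hx); specialize (HN x Hx).
  assert (x ^ j * Cmod (D k x + E k x) <= x ^ j * (Cmod (D k x) + Cmod (E k x)))
    by (apply Rmult_le_compat_l; [apply pow_le; auto|apply Cmod_triangle]). lra.
Qed.

Lemma schwartz_translate D a : 0 <= a -> schwartz D -> schwartz (fun k x => D k (a + x)).
Proof.
  intros Ha [H1 H2]; split; [apply jet_translate; auto|].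
  intros j k. destruct (H2 j k) as [M HM]. exists M. intros x Hx.
  eapply Rle_trans; [|apply (HM (a + x)); lra].
  apply Rmult_le_compat_r; [apply Cmod_ge_0|]. apply pow_incr; lra.
Qed.

Lemma schwartz_decay D p k : schwartz D ->
  exists M, 0 <= M /\ forall y, 0 <= y -> y ^ p * Cmod (D k y) <= M / (1 + y ^ 2).
Proof.
  intros [_ H]. destruct (H p k) as [M HM], (H (p + 2)%nat k) as [N HN].
  exists (M + N). 
  assert (G : forall y, 0 <= y -> y ^ p * Cmod (D k y) * (1 + y ^ 2) <= M + N).
  { intros y Hy. specialize (HM y Hy); specialize (HN y Hy). rewrite pow_add in HN. lra. }
  split.
  - eapply Rle_trans; [|apply (G 0); lra]. apply Rmult_le_pos; [|nra].
    apply Rmult_le_pos; [apply pow_le; lra|apply Cmod_ge_0].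
  - intros y Hy. apply Rmult_le_reg_r with (1 + y ^ 2); [nra|].
    replace ((M + N) / (1 + y ^ 2) * (1 + y ^ 2)) with (M + N) by (field; nra). apply G; auto.
Qed.

Lemma Cmod_hat_kernel (z : C) (y : R) : Im z <= 0 -> 0 <= y -> Cmod (Cexp (- (Ci * z * y))) <= 1.
Proof.
  intros Hz Hy. replace (- (Ci * z * y))%C with (- ((Ci * z) * y))%C by ring.
  apply Cmod_conv_kernel; auto. unfold Re, Im in *; simpl. lra.
Qed.

Lemma Ccont_hat_kernel (z : C) x : Ccont (fun y : R => Cexp (- (Ci * z * y))) x.
Proof.
  eapply Ccont_ext; [|apply (Ccont_Cexp_affine 0 (- (Ci * z)))]. intros s; simpl. f_equal; ring.
Qed.

Lemma Ccont_hat_integrand f (z : C) x : Ccont f x -> Ccont (fun y : R => Cexp (- (Ci * z * y)) * f y)%C x.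
Proof. intros; apply Ccont_mult; auto. apply Ccont_hat_kernel. Qed.

Lemma dominated_cont M f : (forall x, Ccont f x) ->
  (forall r, 0 <= r -> Cmod (f r) <= M / (1 + r ^ 2)) -> dominated M f.
Proof.
  intros H1 H2; split; auto. intros r. apply (Ccont_comp f (Rmax 0)); auto.
  apply filterlim_locally. intros eps. exists eps. intros y Hy.
  exact (Rle_lt_trans _ _ _ (Rmax_lip y r) Hy).
Qed.

Lemma hat_dominated D : schwartz D -> exists M, 0 <= M /\ forall z, Im z <= 0 ->
  dominated M (fun y : R => Cexp (- (Ci * z * y)) * D 0%nat y)%C.
Proof.
  intros HD. destruct (schwartz_decay D 0 0 HD) as [M [HM0 HM]]. exists M. split; auto. intros z Hz.
  apply dominated_cont.
  - intros x; apply Ccont_mult; [apply Ccont_hat_kernel|apply HD].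
  - intros r Hr. rewrite Cmod_mult. specialize (HM r Hr). simpl in HM.
    pose proof (Cmod_hat_kernel z r Hz Hr). pose proof (Cmod_ge_0 (D 0%nat r)). simpl. nra.
Qed.

Lemma hat_half D z : hat D z = half (fun y : R => Cexp (- (Ci * z * y)) * D y)%C.
Proof. reflexivity. Qed.

Lemma hat_bound D : schwartz D -> exists M, 0 <= M /\ forall z, Im z <= 0 -> Cmod (hat (D 0%nat) z) <= M.
Proof.
  intros HD. destruct (hat_dominated D HD) as [M [HM0 HM]]. exists (2 * M). split; [lra|]. intros z Hz.
  rewrite hat_half. apply half_bound; auto.
Qed.

Lemma half_derive (F F' : R -> C) (M : R) (l : C) :
  (forall x, Ccont F x) -> (forall x, 0 < x -> Cder F x (F' x)) -> (forall x, Ccont F' x) ->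
  dominated M F' ->
  (forall eps, 0 < eps -> exists N, forall b, N < b -> Cmod (F b - l) < eps) ->
  half F' = (l - F 0)%C.
Proof.
  intros HF Hd HF' HM Hl. apply is_half_unique. apply is_half_intro.
  - intros; apply ex_CInt; auto.
  - intros eps He. destruct (Hl eps He) as [N HN]. exists (Rmax 0 N). intros b Hb.
    pose proof (Rmax_l 0 N); pose proof (Rmax_r 0 N).
    rewrite (CInt_derive F F' 0 b); auto; try lra.
    + replace (F b - F 0 - (l - F 0))%C with (F b - l)%C by ring. apply HN; lra.
    + intros x Hx; apply Hd; lra.
Qed.

(** Integration by parts; it trades the slow decay of [hat] for a derivative and an
    explicit boundary term. *)
Lemma hat_parts D z : schwartz D -> Im z <= 0 ->
  (Ci * z * hat (D 0%nat) z = hat (D 1%nat) z + D 0%nat 0)%C.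
Proof.
  intros HD Hz. rewrite !hat_half.
  destruct (hat_dominated D HD) as [M [HM0 HM]]. specialize (HM z Hz).
  destruct (hat_dominated _ (schwartz_shift D HD)) as [N [HN0 HN]]. specialize (HN z Hz).
  unfold shift in HN.
  assert (E := half_derive (fun y : R => Cexp (- (Ci * z * y)) * D 0%nat y)%C
    (fun y : R => Cexp (- (Ci * z * y)) * D 1%nat y - (Ci * z) * (Cexp (- (Ci * z * y)) * D 0%nat y))%C
    (N + Cmod (Ci * z) * M) 0).
  rewrite (half_minus _ _ _ _ HN (dominated_scal _ (Ci * z) _ HM)) in E.
  rewrite (half_scal _ _ _ HM) in E.
  assert (E0 := fun a b c d e => eq_sym (E a b c d e)). clear E.
  replace (Cexp (- (Ci * z * 0)) * D 0%nat 0)%C with (D 0%nat 0) in E0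
    by (replace (- (Ci * z * 0))%C with (RtoC 0) by ring; rewrite Cexp_0; ring).
  replace (half (fun y : R => Cexp (- (Ci * z * y)) * D 1%nat y) + D 0%nat 0)%C with
    (half (fun y : R => Cexp (- (Ci * z * y)) * D 1%nat y) - (0 - D 0%nat 0))%C by ring.
  rewrite E0.
  - ring.
  - intros x; apply Ccont_mult; [apply Ccont_hat_kernel|apply HD].
  - intros x Hx. eapply Cder_eq.
    + apply Cder_mult; [|apply HD; auto].
      eapply Cder_ext; [|apply (Cder_Cexp_line 0 (- (Ci * z)))]. intros s; simpl. f_equal; ring.
    + replace (0 + x * - (Ci * z))%C with (- (Ci * z * x))%C by ring. ring.
  - intros x. apply Ccont_minus; [|apply Ccont_mult; [apply Ccont_const|]];
    (apply Ccont_mult; [apply Ccont_hat_kernel|apply HD]).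
  - apply dominated_minus; auto. apply dominated_scal; auto.
  - intros eps He. destruct HD as [HJ HB]. destruct (HB 1%nat 0%nat) as [B HB1].
    assert (HB0 : 0 <= B) by (eapply Rle_trans; [|apply (HB1 0); lra]; simpl; rewrite Rmult_0_l; rewrite Rmult_0_l; lra).
    exists (B / eps). intros b Hb.
    assert (0 <= B / eps) by (apply Rmult_le_pos; auto; left; apply Rinv_0_lt_compat; auto).
    replace (Cexp (- (Ci * z * b)) * D 0%nat b - 0)%C with (Cexp (- (Ci * z * b)) * D 0%nat b)%C by ring.
    rewrite Cmod_mult. apply Rle_lt_trans with (Cmod (D 0%nat b)).
    + pose proof (Cmod_hat_kernel z b Hz ltac:(lra)). pose proof (Cmod_ge_0 (D 0%nat b)). nra.
    + specialize (HB1 b ltac:(lra)). simpl in HB1. rewrite Rmult_1_r in HB1.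
      apply Rmult_lt_reg_l with b; [lra|]. eapply Rle_lt_trans; [exact HB1|].
      apply Rmult_lt_compat_r with (r := eps) in Hb; auto.
      replace (B / eps * eps) with B in Hb by (field; lra). exact Hb.
Qed.

(** As for [conv_Hol], the extra factors y and y^2 being absorbed by the decay of the
    data. *)
Lemma hat_Hol D : schwartz D -> Hol (fun z => Im z <= 0) (hat (D 0%nat)).
Proof.
  intros HD. destruct (hat_dominated D HD) as [M [HM0 HM]].
  destruct (schwartz_decay D 1 0 HD) as [M1 [HM10 HM1]].
  destruct (schwartz_decay D 2 0 HD) as [M2 [HM20 HM2]].
  exists (fun z => half (fun y : R => - (Ci * y) * Cexp (- (Ci * z * y)) * D 0%nat y)%C).
  assert (Hmul : forall x, Ccont (fun y : R => - (Ci * y))%C x).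
  { intros x. apply Ccont_opp, Ccont_mult; [apply Ccont_const|]. apply (Cder_Ccont _ _ _ (Cder_id x)). }
  assert (Dom1 : forall z, Im z <= 0 -> dominated M1 (fun y : R => - (Ci * y) * Cexp (- (Ci * z * y)) * D 0%nat y)%C).
  { intros z Hz. apply dominated_cont.
    - intros x; apply Ccont_mult; [apply Ccont_mult; [auto|apply Ccont_hat_kernel]|apply HD].
    - intros r Hr. rewrite !Cmod_mult, Cmod_opp, Cmod_mult, Cmod_Ci, Cmod_R, Rabs_pos_eq by auto.
      specialize (HM1 r Hr). rewrite pow_1 in HM1.
      pose proof (Cmod_hat_kernel z r Hz Hr). pose proof (Cmod_ge_0 (D 0%nat r)).
      pose proof (Cmod_ge_0 (Cexp (- (Ci * z * r)))).
      assert (0 <= r * Cmod (D 0%nat r)) by nra. nra. }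
  intros rho. exists (2 * M + 2 * M1 + 2 * (4 * M2)). split; [lra|].
  intros z Hz _. repeat split.
  - rewrite hat_half. eapply Rle_trans; [apply half_bound; auto|lra].
  - eapply Rle_trans; [apply half_bound; auto|lra].
  - intros w Hw _. rewrite !hat_half.
    rewrite <- (half_scal M1 (w - z)) by auto. rewrite <- (half_minus M M) by auto.
    rewrite <- (half_minus _ _ _ _ (dominated_minus _ _ _ _ (HM w Hw) (HM z Hz)) (dominated_scal _ (w - z) _ (Dom1 z Hz))).
    set (q := Cmod (w - z) * Cmod (w - z)).
    assert (0 <= q) by (unfold q; pose proof (Cmod_ge_0 (w - z)); nra).
    apply Rle_trans with (2 * (4 * q * M2)); [|nra].
    apply half_bound. apply dominated_cont.
    + intros x. apply Ccont_minus; [apply Ccont_minus; apply Ccont_hat_integrand; apply HD|].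
      apply Ccont_mult; [apply Ccont_const|]. apply Ccont_mult; [|apply HD].
      apply Ccont_mult; [apply Hmul|apply Ccont_hat_kernel].
    + intros r Hr.
      assert (Neg : forall v, Im v <= 0 -> Re (- (Ci * v * r)) <= 0).
      { intros v Hv. unfold Re, Im in *; simpl. nra. }
      assert (T := Cexp_taylor2 0 (- (Ci * z * r)) (- (Ci * w * r)) (Neg z Hz) (Neg w Hw)).
      replace (- (Ci * w * r) - - (Ci * z * r))%C with (- (Ci * r) * (w - z))%C in T by ring.
      rewrite exp_0, (Cmod_mult (- (Ci * r))), Cmod_opp, Cmod_mult, Cmod_Ci, Cmod_R, (Rabs_pos_eq r) in T by lra.
      replace (Cexp (- (Ci * w * r)) * D 0%nat r - Cexp (- (Ci * z * r)) * D 0%nat r -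
         (w - z) * (- (Ci * r) * Cexp (- (Ci * z * r)) * D 0%nat r))%C with
        ((Cexp (- (Ci * w * r)) - Cexp (- (Ci * z * r)) - - (Ci * r) * (w - z) * Cexp (- (Ci * z * r))) * D 0%nat r)%C
        by ring.
      rewrite Cmod_mult.
      apply Rle_trans with (4 * q * (r ^ 2 * Cmod (D 0%nat r))).
      * pose proof (Cmod_ge_0 (D 0%nat r)).
        replace (4 * q * (r ^ 2 * Cmod (D 0%nat r))) with
          (4 * 1 * (1 * r * Cmod (w - z) * (1 * r * Cmod (w - z))) * Cmod (D 0%nat r)) by (unfold q; ring).
        apply Rmult_le_compat_r; auto.
      * replace (4 * q * M2 / (1 + r ^ 2)) with (4 * q * (M2 / (1 + r ^ 2))) by (unfold Rdiv; ring).
        apply Rmult_le_compat_l; [lra|]. apply HM2; auto.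
Qed.

(** Splitting the transform at the point x gives a part that is bounded in the upper
    half-plane and a part that is bounded in the lower one. *)
Lemma hat_split D z x : schwartz D -> Im z <= 0 -> 0 <= x ->
  (Cexp (Ci * z * x) * hat (D 0%nat) z = conv (D 0%nat) (- (Ci * z)) x + hat (fun y => D 0%nat (x + y)%R) z)%C.
Proof.
  intros HD Hz Hx. rewrite !hat_half.
  destruct (hat_dominated D HD) as [M [HM0 HM]]. specialize (HM z Hz).
  destruct (hat_dominated _ (schwartz_translate D x Hx HD)) as [N [HN0 HN]]. specialize (HN z Hz). simpl in HN.
  rewrite <- (half_scal M) by auto. apply is_half_unique. apply is_half_intro.
  { intros b Hb. apply ex_CInt. intros; apply Ccont_mult; [apply Ccont_const|apply Ccont_hat_integrand; apply HD]. }
  intros eps He. destruct (is_half_elim _ _ (half_ex _ _ HN) eps He) as [T HT].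
  exists (Rmax 0 T + x). intros b Hb. pose proof (Rmax_l 0 T). pose proof (Rmax_r 0 T).
  destruct (HT (b - x) ltac:(lra)) as [_ Hb'].
  assert (Ex : forall p q, ex_RInt ((fun y : R => Cexp (Ci * z * x) * (Cexp (- (Ci * z * y)) * D 0%nat y))%C : R -> CR) p q).
  { intros; apply ex_CInt. intros; apply Ccont_mult; [apply Ccont_const|apply Ccont_hat_integrand; apply HD]. }
  rewrite <- (CInt_Chasles _ 0 x b) by auto.
  replace (CInt (fun y : R => Cexp (Ci * z * x) * (Cexp (- (Ci * z * y)) * D 0%nat y))%C 0 x) with
    (conv (D 0%nat) (- (Ci * z)) x).
  2:{ unfold conv. apply (RInt_ext (V := CR)). intros y _. rewrite Cmult_assoc, <- Cexp_plus.
      f_equal. f_equal. rewrite RtoC_minus; ring. }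
  replace (CInt (fun y : R => Cexp (Ci * z * x) * (Cexp (- (Ci * z * y)) * D 0%nat y))%C x b) with
    (CInt (fun y : R => Cexp (- (Ci * z * y)) * D 0%nat (x + y)%R)%C 0 (b - x)).
  - set (A := conv _ _ _). set (B := CInt _ _ _) in *. set (E := half _) in *.
    replace (A + B - (A + E))%C with (B - E)%C by ring. exact Hb'.
  - symmetry. unfold CInt.
    assert (S := RInt_comp_lin (V := CR) (fun y : R => Cexp (Ci * z * x) * (Cexp (- (Ci * z * y)) * D 0%nat y))%C 1 x 0 (b - x)).
    replace (1 * 0 + x) with x in S by ring. replace (1 * (b - x) + x) with b in S by ring.
    rewrite <- S by apply Ex. apply (RInt_ext (V := CR)). intros y _.
    etransitivity; [apply (scal_one (V := CR))|].
    replace (1 * y + x) with (x + y) by ring.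
    rewrite Cmult_assoc, <- Cexp_plus. f_equal. f_equal. rewrite RtoC_plus; ring.
Qed.

(** * Families of functions on the open quadrant *)

(** [D n m] is the derivative of order [n] in x and [m] in t. The local bounds
    replace joint continuity, which they imply through the mean value inequality. *)
Definition regular (D : nat -> nat -> R -> R -> C) : Prop :=
  (forall n m x t, 0 < x -> 0 < t -> Cder (fun y => D n m y t) x (D (S n) m x t)) /\
  (forall n m x t, 0 < x -> 0 < t -> Cder (fun s => D n m x s) t (D n (S m) x t)) /\
  (forall n m x0 t0 T, 0 < x0 -> 0 < t0 -> exists M, forall x t, x0 <= x -> t0 <= t <= T ->
     Cmod (D n m x t) <= M).

Definition tlim (h : R -> R -> C) (a : R -> C) : Prop :=
  forall x0, 0 < x0 -> unif_lim_at_0 (fun x => x0 <= x) (fun t x => h x t) a.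

Definition xlim (h : R -> R -> C) (b : R -> C) : Prop :=
  forall t0 T, 0 < t0 -> t0 <= T -> unif_lim_at_0 (fun t => t0 <= t <= T) (fun x t => h x t) b.

Lemma unif_lim_plus A f g v w : unif_lim_at_0 A f v -> unif_lim_at_0 A g w ->
  unif_lim_at_0 A (fun s y => f s y + g s y)%C (fun y => v y + w y)%C.
Proof.
  intros Hf Hg eps. assert (He : 0 < eps / 2) by (pose proof (cond_pos eps); lra).
  specialize (Hf (mkposreal _ He)). specialize (Hg (mkposreal _ He)).
  unfold at_right, within in *. generalize (filter_and _ _ Hf Hg). apply filter_imp.
  intros s [H1 H2] Hs y Hy. specialize (H1 Hs y Hy). specialize (H2 Hs y Hy). simpl in H1, H2.
  replace (f s y + g s y - (v y + w y))%C with ((f s y - v y) + (g s y - w y))%C by ring.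
  eapply Rle_lt_trans; [apply Cmod_triangle|lra].
Qed.

Lemma unif_lim_scal A c f v : unif_lim_at_0 A f v ->
  unif_lim_at_0 A (fun s y => c * f s y)%C (fun y => c * v y)%C.
Proof.
  intros Hf eps. assert (Hc : 0 < Cmod c + 1) by (pose proof (Cmod_ge_0 c); lra).
  assert (He : 0 < eps / (Cmod c + 1)) by (apply Rdiv_lt_0_compat; auto; apply cond_pos).
  specialize (Hf (mkposreal _ He)). unfold at_right, within in *. revert Hf. apply filter_imp.
  intros s H Hs y Hy. specialize (H Hs y Hy). simpl in H.
  replace (c * f s y - c * v y)%C with (c * (f s y - v y))%C by ring. rewrite Cmod_mult.
  apply Rle_lt_trans with ((Cmod c + 1) * Cmod (f s y - v y)).
  - apply Rmult_le_compat_r; [apply Cmod_ge_0|lra].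
  - apply Rmult_lt_compat_l with (r := Cmod c + 1) in H; auto.
    replace ((Cmod c + 1) * (eps / (Cmod c + 1))) with (pos eps) in H by (field; lra). exact H.
Qed.

Lemma unif_lim_ext A f g v w : (forall s y, 0 < s -> A y -> f s y = g s y) ->
  (forall y, A y -> v y = w y) -> unif_lim_at_0 A f v -> unif_lim_at_0 A g w.
Proof.
  intros E1 E2 H eps. specialize (H eps). unfold at_right, within in *. revert H. apply filter_imp.
  intros s H Hs y Hy. rewrite <- E1, <- E2 by auto. apply H; auto.
Qed.

Lemma tlim_plus h k a b : tlim h a -> tlim k b -> tlim (fun x t => h x t + k x t)%C (fun x => a x + b x)%C.
Proof. intros H K x0 Hx0. apply (unif_lim_plus _ (fun t x => h x t) (fun t x => k x t)); auto. Qed.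

Lemma xlim_plus h k a b : xlim h a -> xlim k b -> xlim (fun x t => h x t + k x t)%C (fun x => a x + b x)%C.
Proof. intros H K t0 T H0 HT. apply (unif_lim_plus _ (fun x t => h x t) (fun x t => k x t)); auto. Qed.

Lemma tlim_scal c h a : tlim h a -> tlim (fun x t => c * h x t)%C (fun x => c * a x)%C.
Proof. intros H x0 Hx0. apply (unif_lim_scal _ c (fun t x => h x t)); auto. Qed.

Lemma xlim_scal c h a : xlim h a -> xlim (fun x t => c * h x t)%C (fun x => c * a x)%C.
Proof. intros H t0 T H0 HT. apply (unif_lim_scal _ c (fun x t => h x t)); auto. Qed.

Lemma tlim_ext h k a b : (forall x t, 0 < x -> 0 < t -> h x t = k x t) ->
  (forall x, 0 < x -> a x = b x) -> tlim h a -> tlim k b.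
Proof.
  intros E1 E2 H x0 Hx0. apply (unif_lim_ext _ (fun t x => h x t) (fun t x => k x t) a b).
  - intros; apply E1; auto; lra.
  - intros; apply E2; lra.
  - apply H; auto.
Qed.

Lemma xlim_ext h k a b : (forall x t, 0 < x -> 0 < t -> h x t = k x t) ->
  (forall x, 0 < x -> a x = b x) -> xlim h a -> xlim k b.
Proof.
  intros E1 E2 H t0 T H0 HT. apply (unif_lim_ext _ (fun x t => h x t) (fun x t => k x t) a b).
  - intros; apply E1; auto; lra.
  - intros; apply E2; lra.
  - apply H; auto.
Qed.

Lemma tlim_minus h k a b : tlim h a -> tlim k b -> tlim (fun x t => h x t - k x t)%C (fun x => a x - b x)%C.
Proof.
  intros H K. eapply tlim_ext; [| |apply (tlim_plus _ _ _ _ H (tlim_scal (- (1))%C _ _ K))]; intros; simpl; ring.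
Qed.

Lemma xlim_minus h k a b : xlim h a -> xlim k b -> xlim (fun x t => h x t - k x t)%C (fun x => a x - b x)%C.
Proof.
  intros H K. eapply xlim_ext; [| |apply (xlim_plus _ _ _ _ H (xlim_scal (- (1))%C _ _ K))]; intros; simpl; ring.
Qed.

Lemma unif_lim_pointwise A f w y : A y -> unif_lim_at_0 A f w ->
  forall eps, 0 < eps -> exists d, 0 < d /\ forall s, 0 < s < d -> Cmod (f s y - w y) < eps.
Proof.
  intros Hy H eps He. destruct (H (mkposreal eps He)) as [d Hd]. exists d. split; [apply cond_pos|].
  intros s Hs. apply (Hd s); auto; [|lra].
  change (Rabs (s - 0) < d). rewrite Rminus_0_r, Rabs_pos_eq; lra.
Qed.

Lemma unif_lim_unique A f v w y : A y -> unif_lim_at_0 A f v -> unif_lim_at_0 A f w -> v y = w y.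
Proof.
  intros Hy Hv Hw.
  assert (Z : Cmod (v y - w y) <= 0).
  { apply le_epsilon. intros eps He. rewrite Rplus_0_l.
    destruct (unif_lim_pointwise A f v y Hy Hv (eps / 2) ltac:(lra)) as [d1 [Hd1 H1]].
    destruct (unif_lim_pointwise A f w y Hy Hw (eps / 2) ltac:(lra)) as [d2 [Hd2 H2]].
    assert (0 < Rmin d1 d2) by (apply Rmin_pos; auto).
    pose proof (Rmin_l d1 d2). pose proof (Rmin_r d1 d2).
    specialize (H1 (Rmin d1 d2 / 2) ltac:(lra)). specialize (H2 (Rmin d1 d2 / 2) ltac:(lra)).
    set (d := Rmin d1 d2 / 2) in *.
    replace (v y - w y)%C with ((f d y - w y) - (f d y - v y))%C by ring.
    eapply Rle_trans; [apply Cmod_triangle_minus|lra]. }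
  assert (E : (v y - w y)%C = 0%C) by (apply Cmod_eq_0; pose proof (Cmod_ge_0 (v y - w y)); lra).
  replace (v y) with ((v y - w y) + w y)%C by ring. rewrite E; ring.
Qed.

Lemma xlim_unique h a b t : 0 < t -> xlim h a -> xlim h b -> a t = b t.
Proof.
  intros Ht Ha Hb.
  apply (unif_lim_unique (fun s => t <= s <= t) (fun x t => h x t)); [lra|apply Ha|apply Hb]; lra.
Qed.

Lemma tlim_unique h a b x : 0 < x -> tlim h a -> tlim h b -> a x = b x.
Proof.
  intros Ht Ha Hb.
  apply (unif_lim_unique (fun y => x <= y) (fun t x => h x t)); [lra|apply Ha|apply Hb]; lra.
Qed.

Lemma regular_plus D E : regular D -> regular E -> regular (fun n m x t => D n m x t + E n m x t)%C.
Proof.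
  intros [A1 [A2 A3]] [B1 [B2 B3]]. split; [|split].
  { intros n m x t Hx Ht. exact (Cder_plus _ _ _ _ _ (A1 n m x t Hx Ht) (B1 n m x t Hx Ht)). }
  { intros n m x t Hx Ht. exact (Cder_plus _ _ _ _ _ (A2 n m x t Hx Ht) (B2 n m x t Hx Ht)). }
  intros n m x0 t0 T Hx Ht. destruct (A3 n m x0 t0 T Hx Ht) as [M HM], (B3 n m x0 t0 T Hx Ht) as [N HN].
  exists (M + N). intros x t H1 H2. eapply Rle_trans; [apply Cmod_triangle|].
  specialize (HM x t H1 H2). specialize (HN x t H1 H2). lra.
Qed.

Lemma regular_scal c D : regular D -> regular (fun n m x t => c * D n m x t)%C.
Proof.
  intros [A1 [A2 A3]]. split; [|split].
  { intros n m x t Hx Ht. exact (Cder_scal c _ _ _ (A1 n m x t Hx Ht)). }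
  { intros n m x t Hx Ht. exact (Cder_scal c _ _ _ (A2 n m x t Hx Ht)). }
  intros n m x0 t0 T Hx Ht. destruct (A3 n m x0 t0 T Hx Ht) as [M HM].
  exists (Cmod c * M). intros x t H1 H2. rewrite Cmod_mult. apply Rmult_le_compat_l; [apply Cmod_ge_0|auto].
Qed.

Lemma regular_ext D E : (forall n m x t, D n m x t = E n m x t) -> regular D -> regular E.
Proof.
  intros H [A1 [A2 A3]]. split; [|split].
  { intros n m x t Hx Ht. rewrite <- H. eapply Cder_ext; [intros s; apply H|apply A1; auto]. }
  { intros n m x t Hx Ht. rewrite <- H. eapply Cder_ext; [intros s; apply H|apply A2; auto]. }
  intros n m x0 t0 T Hx Ht. destruct (A3 n m x0 t0 T Hx Ht) as [M HM]. exists M. intros. rewrite <- H; auto.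
Qed.

Lemma regular_minus D E : regular D -> regular E -> regular (fun n m x t => D n m x t - E n m x t)%C.
Proof.
  intros H K. eapply regular_ext; [|apply (regular_plus _ _ H (regular_scal (- (1))%C _ K))].
  intros; simpl; ring.
Qed.

(** * Exponential decay along rays *)

Lemma exp_le a b : a <= b -> exp a <= exp b.
Proof. intros [H| ->]; [left; apply exp_increasing; auto|lra]. Qed.

Lemma pow_le_exp (k : nat) : exists B, 0 <= B /\ forall y, 0 <= y -> y ^ k <= B * exp y.
Proof.
  destruct k as [|k].
  { exists 1. split; [lra|]. intros y Hy. simpl. rewrite Rmult_1_l, <- exp_0. apply exp_le; auto. }
  set (K := INR (S k)). assert (HK : 0 < K) by (apply lt_0_INR; lia).
  exists (K ^ S k). split; [apply pow_le; lra|]. intros y Hy.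
  replace y with (K * (y / K)) at 1 by (field; lra). rewrite Rpow_mult_distr.
  apply Rmult_le_compat_l; [apply pow_le; lra|].
  assert (Hy' : 0 <= y / K) by (apply Rmult_le_pos; auto; left; apply Rinv_0_lt_compat; auto).
  replace (exp y) with (exp (y / K) ^ S k).
  - apply pow_incr. split; auto. pose proof (exp_ineq1_le (y / K)). lra.
  - assert (E : forall n z, exp z ^ n = exp (INR n * z)).
    { intros n z. induction n. simpl. rewrite Rmult_0_l, exp_0; auto.
      rewrite S_INR. simpl. rewrite IHn, <- exp_plus. f_equal; ring. }
    rewrite E. f_equal. fold K. field; lra.
Qed.

Lemma exp_decay (p : nat) (c : R) : 0 < c -> exists M, 0 <= M /\ forall r, 0 <= r ->
  (1 + r) ^ p * exp (- (c * r)) <= M / (1 + r ^ 2).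
Proof.
  intros Hc. destruct (pow_le_exp (p + 2)) as [B [HB0 HB]].
  set (M := (/ c) ^ (p + 2) * B * exp c).
  assert (HM : 0 <= M).
  { unfold M. apply Rmult_le_pos; [apply Rmult_le_pos; auto; apply pow_le; left; apply Rinv_0_lt_compat; auto|].
    left; apply exp_pos. }
  exists M. split; auto. intros r Hr.
  apply Rmult_le_reg_r with (1 + r ^ 2); [nra|].
  replace (M / (1 + r ^ 2) * (1 + r ^ 2)) with M by (field; nra).
  apply Rle_trans with ((1 + r) ^ (p + 2) * exp (- (c * r))).
  - rewrite pow_add. assert (0 <= (1 + r) ^ p * exp (- (c * r))).
    { apply Rmult_le_pos; [apply pow_le; lra|left; apply exp_pos]. }
    replace ((1 + r) ^ p * (1 + r) ^ 2 * exp (- (c * r))) with ((1 + r) ^ p * exp (- (c * r)) * (1 + r) ^ 2) by ring.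
    apply Rmult_le_compat_l; auto. nra.
  - assert (E : (1 + r) ^ (p + 2) = (/ c) ^ (p + 2) * (c * (1 + r)) ^ (p + 2)).
    { rewrite <- Rpow_mult_distr. f_equal. field; lra. }
    rewrite E. specialize (HB (c * (1 + r)) ltac:(nra)).
    replace (exp (- (c * r))) with (exp c * / exp (c * (1 + r))).
    2:{ rewrite <- exp_Ropp, <- exp_plus. f_equal; ring. }
    assert (P := exp_pos (c * (1 + r))). unfold M.
    replace ((/ c) ^ (p + 2) * (c * (1 + r)) ^ (p + 2) * (exp c * / exp (c * (1 + r)))) with
      ((/ c) ^ (p + 2) * exp c * ((c * (1 + r)) ^ (p + 2) * / exp (c * (1 + r)))) by ring.
    replace ((/ c) ^ (p + 2) * B * exp c) with ((/ c) ^ (p + 2) * exp c * B) by ring.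
    apply Rmult_le_compat_l.
    + apply Rmult_le_pos; [apply pow_le; left; apply Rinv_0_lt_compat; auto|left; apply exp_pos].
    + apply Rmult_le_reg_r with (exp (c * (1 + r))); auto.
      rewrite Rmult_assoc, Rinv_l by lra. lra.
Qed.

Lemma exp_decay4 (p : nat) (c : R) : 0 < c -> exists M, 0 <= M /\ forall r, 0 <= r ->
  (1 + r) ^ p * exp (- (c * r ^ 4)) <= M / (1 + r ^ 2).
Proof.
  intros Hc. destruct (exp_decay p c Hc) as [M [HM0 HM]]. exists (exp c * M).
  split; [apply Rmult_le_pos; auto; left; apply exp_pos|]. intros r Hr.
  apply Rle_trans with (exp c * ((1 + r) ^ p * exp (- (c * r)))).
  - replace (exp c * ((1 + r) ^ p * exp (- (c * r)))) with ((1 + r) ^ p * exp (c + - (c * r)))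
      by (rewrite exp_plus; ring).
    apply Rmult_le_compat_l; [apply pow_le; lra|]. apply exp_le.
    assert (r - 1 <= r ^ 4).
    { pose proof (pow2_ge_0 (r ^ 2 - 1 / 2)). pose proof (pow2_ge_0 (r - 1 / 2)).
      replace (r ^ 4) with ((r ^ 2 - 1 / 2) ^ 2 + (r - 1 / 2) ^ 2 + r - 1 / 2) by field. lra. }
    nra.
  - replace (exp c * M / (1 + r ^ 2)) with (exp c * (M / (1 + r ^ 2))) by (unfold Rdiv; ring).
    apply Rmult_le_compat_l; [left; apply exp_pos|auto].
Qed.

Definition osc (x : R) (l : C) : C := Cexp (Ci * l * x).
Definition heat (t : R) (l : C) : C := Cexp (- (omega l * t)).

Lemma ray_parts theta r : Re (ray theta r) = r * cos theta /\ Im (ray theta r) = r * sin theta.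
Proof.
  assert (E : Cexp (Ci * theta) = (cos theta, sin theta)).
  { unfold Cexp. replace (Re (Ci * theta)) with 0 by (unfold Re, Ci, Cmult, RtoC; simpl; ring).
    replace (Im (Ci * theta)) with theta by (unfold Im, Ci, Cmult, RtoC; simpl; ring).
    rewrite exp_0, !Rmult_1_l. reflexivity. }
  unfold ray. rewrite E. unfold Re, Im; simpl. split; ring.
Qed.

Lemma omega_ray theta r : omega (ray theta r) = ray (4 * theta) (r ^ 4).
Proof.
  unfold omega, ray. rewrite Cpow_mult_l, Cexp_pow, RtoC_pow. f_equal. f_equal.
  rewrite RtoC_mult. simpl INR. replace (1 + 1 + 1 + 1) with 4 by ring. ring.
Qed.

Lemma Cmod_omega l : Cmod (omega l) = Cmod l ^ 4.
Proof. apply Cmod_pow. Qed.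

Lemma Re_osc_arg (l : C) (x : R) : Re (Ci * l * x) = - (Im l * x).
Proof. unfold Re, Im; simpl; ring. Qed.

Lemma Re_heat_arg (w : C) (t : R) : Re (- (w * t)) = - (Re w * t).
Proof. unfold Re; simpl; ring. Qed.

Lemma Cmod_osc theta r x : Cmod (osc x (ray theta r)) = exp (- (sin theta * x * r)).
Proof.
  unfold osc. rewrite Cmod_Cexp, Re_osc_arg. f_equal. destruct (ray_parts theta r) as [_ E].
  rewrite E. ring.
Qed.

Lemma Cmod_heat theta r t : Cmod (heat t (ray theta r)) = exp (- (cos (4 * theta) * t * r ^ 4)).
Proof.
  unfold heat. rewrite Cmod_Cexp, Re_heat_arg, omega_ray. f_equal.
  destruct (ray_parts (4 * theta) (r ^ 4)) as [E _]. rewrite E. ring.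
Qed.

Lemma exp_neg_le_1 a : 0 <= a -> exp (- a) <= 1.
Proof. intros; rewrite <- exp_0; apply exp_le; lra. Qed.

Lemma Cmod_osc_le_1 theta r x : 0 <= sin theta -> 0 <= r -> 0 <= x -> Cmod (osc x (ray theta r)) <= 1.
Proof. intros. rewrite Cmod_osc. apply exp_neg_le_1. apply Rmult_le_pos; auto. apply Rmult_le_pos; auto. Qed.

Lemma Cmod_heat_le_1 theta r t : 0 <= cos (4 * theta) -> 0 <= r -> 0 <= t -> Cmod (heat t (ray theta r)) <= 1.
Proof.
  intros. rewrite Cmod_heat. apply exp_neg_le_1. apply Rmult_le_pos; [apply Rmult_le_pos; auto|apply pow_le; auto].
Qed.

Lemma osc_minus_1 theta r x : 0 <= sin theta -> 0 <= r -> 0 <= x -> Cmod (osc x (ray theta r) - 1) <= 2 * r * x.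
Proof.
  intros Hs Hr Hx. unfold osc. rewrite <- Cexp_0.
  assert (Re (Ci * ray theta r * x) <= 0).
  { rewrite Re_osc_arg. destruct (ray_parts theta r) as [_ E]. rewrite E.
    assert (0 <= r * sin theta) by nra. nra. }
  assert (T := Cexp_lip 0 0 (Ci * ray theta r * x) ltac:(simpl; lra) H).
  replace (Ci * ray theta r * x - 0)%C with (Ci * ray theta r * x)%C in T by ring.
  rewrite exp_0, !Cmod_mult, Cmod_Ci, Cmod_ray, Cmod_R, Rabs_pos_eq in T by auto. lra.
Qed.

Lemma heat_minus_1 theta r t : 0 <= cos (4 * theta) -> 0 <= r -> 0 <= t ->
  Cmod (heat t (ray theta r) - 1) <= 2 * r ^ 4 * t.
Proof.
  intros Hs Hr Hx. unfold heat. rewrite <- Cexp_0.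
  assert (Re (- (omega (ray theta r) * t)) <= 0).
  { rewrite Re_heat_arg, omega_ray. destruct (ray_parts (4 * theta) (r ^ 4)) as [E _]. rewrite E.
    assert (0 <= r ^ 4) by (apply pow_le; auto). assert (0 <= r ^ 4 * cos (4 * theta)) by nra. nra. }
  assert (T := Cexp_lip 0 0 (- (omega (ray theta r) * t)) ltac:(simpl; lra) H).
  replace (- (omega (ray theta r) * t) - 0)%C with (- (omega (ray theta r) * t))%C in T by ring.
  rewrite exp_0, Cmod_opp, Cmod_mult, Cmod_omega, Cmod_ray, Cmod_R, Rabs_pos_eq in T by auto. lra.
Qed.

Lemma Hol_omega S : Hol S omega.
Proof. apply (Hol_pow S (fun z => z)). apply Hol_id. Qed.

Lemma Hol_osc S x : Hol S (osc x).
Proof.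
  apply Hol_Cexp. apply (Hol_ext S (fun z => (Ci * x) * z)%C); [intros; ring|]. apply Hol_scal, Hol_id.
Qed.

Lemma Hol_heat S t : Hol S (heat t).
Proof.
  apply Hol_Cexp. apply (Hol_ext S (fun z => (- t) * omega z)%C); [intros; ring|]. apply Hol_scal, Hol_omega.
Qed.

Lemma Hol_iz_pow S n : Hol S (fun l => (Ci * l) ^ n)%C.
Proof. apply (Hol_pow S (fun l => Ci * l)%C). apply Hol_scal, Hol_id. Qed.

Lemma Cmod_iz_pow theta r n : 0 <= r -> Cmod ((Ci * ray theta r) ^ n) = r ^ n.
Proof. intros. rewrite Cmod_pow, Cmod_mult, Cmod_Ci, Cmod_ray by auto. f_equal; ring. Qed.

Lemma Cder_osc l x : Cder (fun x => osc x l) x (Ci * l * osc x l)%C.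
Proof.
  eapply Cder_eq; [eapply Cder_ext; [|apply (Cder_Cexp_line 0 (Ci * l))]|].
  - intros s; unfold osc; f_equal; ring.
  - unfold osc. f_equal. f_equal. ring.
Qed.

Lemma Cder_heat l t : Cder (fun t => heat t l) t (- omega l * heat t l)%C.
Proof.
  eapply Cder_eq; [eapply Cder_ext; [|apply (Cder_Cexp_line 0 (- omega l))]|].
  - intros s; unfold heat; f_equal; ring.
  - unfold heat. f_equal. f_equal. ring.
Qed.

(** * Limits and derivatives of integrals along rays *)

(** As x tends to 0 the oscillating factor tends to 1, at the rate x on bounded parts
    of the ray, and F alone provides the majorant. *)
Lemma ray_xlim theta (F : R -> C -> C) : 0 <= sin theta ->
  (forall t, 0 < t -> Hol (on_ray theta) (F t)) ->
  (forall t0 T, 0 < t0 -> t0 <= T -> exists M, forall t r, t0 <= t <= T -> 0 <= r ->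
     Cmod (F t (ray theta r)) <= M / (1 + r ^ 2)) ->
  xlim (fun x t => int_ray theta (fun l => osc x l * F t l)%C) (fun t => int_ray theta (F t)).
Proof.
  intros Hs HF HB t0 T Ht0 HT. destruct (HB t0 T Ht0 HT) as [M HM].
  assert (HM0 : 0 <= M).
  { specialize (HM t0 0 ltac:(lra) ltac:(lra)). replace (M / (1 + 0 ^ 2)) with M in HM by (field; simpl; lra).
    eapply Rle_trans; [apply Cmod_ge_0|exact HM]. }
  apply (half_unif_lim _
    (fun x t r => osc x (ray theta r) * F t (ray theta r) * Cexp (Ci * theta))%C
    (fun t r => F t (ray theta r) * Cexp (Ci * theta))%C M 1); [lra| | |].
  - intros x t Hx Ht. apply (ray_dominated_half theta M (fun l => osc x l * F t l)%C).
    apply ray_dominated_intro; [apply Hol_mult; [apply Hol_osc|apply HF; lra]|].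
    intros r Hr. rewrite Cmod_mult. specialize (HM t r Ht Hr).
    pose proof (Cmod_osc_le_1 theta r x Hs Hr ltac:(lra)). pose proof (Cmod_ge_0 (F t (ray theta r))).
    pose proof (Cmod_ge_0 (osc x (ray theta r))). nra.
  - intros t Ht. apply (ray_dominated_half theta M (F t)). apply ray_dominated_intro; [apply HF; lra|auto].
  - intros L HL. exists (2 * L * M). intros x t r Hx Ht Hr.
    replace (osc x (ray theta r) * F t (ray theta r) * Cexp (Ci * theta) - F t (ray theta r) * Cexp (Ci * theta))%C
      with ((osc x (ray theta r) - 1) * F t (ray theta r) * Cexp (Ci * theta))%C by ring.
    rewrite !Cmod_mult, Cmod_unit, Rmult_1_r.
    assert (A := osc_minus_1 theta r x Hs ltac:(lra) ltac:(lra)).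
    assert (B : Cmod (F t (ray theta r)) <= M).
    { eapply Rle_trans; [apply HM; auto; lra|]. apply Rmult_le_reg_r with (1 + r ^ 2); [nra|].
      replace (M / (1 + r ^ 2) * (1 + r ^ 2)) with M by (field; nra). nra. }
    apply Rle_trans with ((2 * L * x) * M); [|right; ring].
    apply Rmult_le_compat; try apply Cmod_ge_0; auto. nra.
Qed.

(** Here x stays away from 0, and the oscillating factor takes part in the
    majorant. *)
Lemma ray_tlim theta (F : R -> C -> C) : 0 <= sin theta ->
  (forall t, 0 <= t <= 1 -> Hol (on_ray theta) (F t)) ->
  (forall x0, 0 < x0 -> exists M, forall x t r, x0 <= x -> 0 <= t <= 1 -> 0 <= r ->
     Cmod (osc x (ray theta r)) * Cmod (F t (ray theta r)) <= M / (1 + r ^ 2)) ->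
  (forall L, 0 <= L -> exists c, forall t r, 0 <= t <= 1 -> 0 <= r <= L ->
     Cmod (F t (ray theta r) - F 0 (ray theta r)) <= t * c) ->
  tlim (fun x t => int_ray theta (fun l => osc x l * F t l)%C) (fun x => int_ray theta (fun l => osc x l * F 0 l)%C).
Proof.
  intros Hs HF HB HC x0 Hx0. destruct (HB x0 Hx0) as [M HM].
  assert (Dom : forall x t, x0 <= x -> 0 <= t <= 1 -> ray_dominated theta M (fun l => osc x l * F t l)%C).
  { intros x t Hx Ht. apply ray_dominated_intro; [apply Hol_mult; [apply Hol_osc|apply HF; lra]|].
    intros r Hr. rewrite Cmod_mult. auto. }
  apply (half_unif_lim _
    (fun t x r => osc x (ray theta r) * F t (ray theta r) * Cexp (Ci * theta))%C
    (fun x r => osc x (ray theta r) * F 0 (ray theta r) * Cexp (Ci * theta))%C M 1); [lra| | |].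
  - intros t x Ht Hx. apply (ray_dominated_half theta M (fun l => osc x l * F t l)%C). apply Dom; auto; lra.
  - intros x Hx. apply (ray_dominated_half theta M (fun l => osc x l * F 0 l)%C). apply Dom; auto; lra.
  - intros L HL. destruct (HC L HL) as [c Hc]. exists c. intros t x r Ht Hx Hr.
    replace (osc x (ray theta r) * F t (ray theta r) * Cexp (Ci * theta) -
       osc x (ray theta r) * F 0 (ray theta r) * Cexp (Ci * theta))%C
      with (osc x (ray theta r) * (F t (ray theta r) - F 0 (ray theta r)) * Cexp (Ci * theta))%C by ring.
    rewrite !Cmod_mult, Cmod_unit, Rmult_1_r.
    specialize (Hc t r ltac:(lra) Hr).
    assert (A := Cmod_osc_le_1 theta r x Hs ltac:(lra) ltac:(lra)).
    pose proof (Cmod_ge_0 (F t (ray theta r) - F 0 (ray theta r))).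
    pose proof (Cmod_ge_0 (osc x (ray theta r))). nra.
Qed.

(** A derivative in x multiplies the integrand by [Ci * l]; the successive derivatives
    in t are supplied by the sequence [psi]. *)
Definition ray_family (theta : R) (psi : nat -> R -> C -> C) (n m : nat) (x t : R) : C :=
  int_ray theta (fun l => osc x l * ((Ci * l) ^ n * psi m t l))%C.

Lemma Cder_mult_l (f : R -> C) (c : C) x l : Cder f x l -> Cder (fun s => f s * c)%C x (l * c)%C.
Proof.
  intros H. eapply Cder_eq; [apply (Cder_mult _ _ _ _ _ H (Cder_const c x))|]. ring.
Qed.

(** Differentiation under the integral sign; the quadratic remainders are controlled
    by the majorants of orders n + 2 and m + 2. *)
Lemma ray_family_regular theta psi :
  (forall m t, 0 < t -> Hol (on_ray theta) (psi m t)) ->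
  (forall m l t, on_ray theta l -> 0 < t -> Cder (fun s => psi m s l) t (psi (S m) t l)) ->
  (forall n m x0 t0 T, 0 < x0 -> 0 < t0 -> exists M, forall x t r, x0 <= x -> t0 <= t <= T -> 0 <= r ->
     Cmod (osc x (ray theta r)) * (r ^ n * Cmod (psi m t (ray theta r))) <= M / (1 + r ^ 2)) ->
  regular (ray_family theta psi).
Proof.
  intros H1 H2 H3.
  assert (Bd : forall n m x0 t0 T, 0 < x0 -> 0 < t0 -> exists M, forall x t, x0 <= x -> t0 <= t <= T ->
    ray_dominated theta M (fun l => osc x l * ((Ci * l) ^ n * psi m t l))%C).
  { intros n m x0 t0 T Hx0 Ht0. destruct (H3 n m x0 t0 T Hx0 Ht0) as [M HM]. exists M. intros x t Hx Ht.
    apply ray_dominated_intro.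
    - apply Hol_mult; [apply Hol_osc|]. apply Hol_mult; [apply Hol_iz_pow|apply H1; lra].
    - intros r Hr. rewrite !Cmod_mult, Cmod_iz_pow by auto. auto. }
  split; [|split].
  - intros n m x t Hx Ht.
    destruct (Bd n m (x / 2) t t ltac:(lra) Ht) as [M0 HM0].
    destruct (Bd (S n) m (x / 2) t t ltac:(lra) Ht) as [M1 HM1].
    destruct (Bd (S (S n)) m (x / 2) t t ltac:(lra) Ht) as [M2 HM2].
    assert (Near : forall y, Rabs (y - x) < x / 2 -> x / 2 <= y) by (intros y Hy; apply Rabs_def2 in Hy; lra).
    apply (half_Cder (fun y r => osc y (ray theta r) * ((Ci * ray theta r) ^ n * psi m t (ray theta r)) * Cexp (Ci * theta))%C
      (fun y r => osc y (ray theta r) * ((Ci * ray theta r) ^ S n * psi m t (ray theta r)) * Cexp (Ci * theta))%C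
      (fun y r => osc y (ray theta r) * ((Ci * ray theta r) ^ S (S n) * psi m t (ray theta r)) * Cexp (Ci * theta))%C
      x (x / 2) M2 M0 M1); [lra| | | | |].
    + intros y Hy. apply (ray_dominated_half theta M0 _ (HM0 y t (Near y Hy) ltac:(lra))).
    + apply (ray_dominated_half theta M1 _ (HM1 x t ltac:(lra) ltac:(lra))).
    + intros y r Hy Hr. eapply Cder_eq; [apply Cder_mult_l, Cder_mult_l, Cder_osc|].
      cbn [Cpow]. ring.
    + intros y r Hy Hr. eapply Cder_eq; [apply Cder_mult_l, Cder_mult_l, Cder_osc|].
      cbn [Cpow]. ring.
    + intros y r Hy Hr. apply (ray_dominated_half theta M2 _ (HM2 y t (Near y Hy) ltac:(lra))); auto.
  - intros n m x t Hx Ht.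
    destruct (Bd n m x (t / 2) (2 * t) Hx ltac:(lra)) as [M0 HM0].
    destruct (Bd n (S m) x (t / 2) (2 * t) Hx ltac:(lra)) as [M1 HM1].
    destruct (Bd n (S (S m)) x (t / 2) (2 * t) Hx ltac:(lra)) as [M2 HM2].
    assert (Near : forall y, Rabs (y - t) < t / 2 -> t / 2 <= y <= 2 * t) by (intros y Hy; apply Rabs_def2 in Hy; lra).
    assert (DD : forall k y r, Rabs (y - t) < t / 2 -> 0 <= r -> Cder
       (fun s => osc x (ray theta r) * ((Ci * ray theta r) ^ n * psi k s (ray theta r)) * Cexp (Ci * theta))%C y
       (osc x (ray theta r) * ((Ci * ray theta r) ^ n * psi (S k) y (ray theta r)) * Cexp (Ci * theta))%C).
    { intros k y r Hy Hr. apply Near in Hy.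
      apply Cder_mult_l, Cder_scal, Cder_scal. apply H2; [exists r; auto|lra]. }
    apply (half_Cder (fun s r => osc x (ray theta r) * ((Ci * ray theta r) ^ n * psi m s (ray theta r)) * Cexp (Ci * theta))%C
      (fun s r => osc x (ray theta r) * ((Ci * ray theta r) ^ n * psi (S m) s (ray theta r)) * Cexp (Ci * theta))%C
      (fun s r => osc x (ray theta r) * ((Ci * ray theta r) ^ n * psi (S (S m)) s (ray theta r)) * Cexp (Ci * theta))%C
      t (t / 2) M2 M0 M1); [lra| | | | |].
    + intros y Hy. apply (ray_dominated_half theta M0 _ (HM0 x y ltac:(lra) (Near y Hy))).
    + apply (ray_dominated_half theta M1 _ (HM1 x t ltac:(lra) ltac:(lra))).
    + intros; apply DD; auto.
    + intros; apply DD; auto.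
    + intros y r Hy Hr. apply (ray_dominated_half theta M2 _ (HM2 x y ltac:(lra) (Near y Hy))); auto.
  - intros n m x0 t0 T Hx0 Ht0. destruct (Bd n m x0 t0 T Hx0 Ht0) as [M HM].
    exists (2 * M). intros x t Hx Ht. apply int_ray_bound. apply HM; auto.
Qed.

(** Polynomial growth is compensated by the oscillatory factor, which decays
    exponentially since sin theta > 0. *)
Lemma osc_decay theta p x0 B : 0 < sin theta -> 0 < x0 -> 0 <= B -> exists M, forall x r v,
  x0 <= x -> 0 <= r -> v <= B * (1 + r) ^ p ->
  Cmod (osc x (ray theta r)) * v <= M / (1 + r ^ 2).
Proof.
  intros Hs Hx0 HB. destruct (exp_decay p (sin theta * x0) ltac:(nra)) as [M [HM0 HM]].
  exists (B * M). intros x r v Hx Hr Hv. rewrite Cmod_osc.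
  assert (E : exp (- (sin theta * x * r)) <= exp (- (sin theta * x0 * r))).
  { apply exp_le. assert (0 <= sin theta * (x - x0) * r) by (apply Rmult_le_pos; auto; apply Rmult_le_pos; lra). lra. }
  assert (P := exp_pos (- (sin theta * x * r))).
  assert (Q : 0 <= B * (1 + r) ^ p) by (apply Rmult_le_pos; auto; apply pow_le; lra).
  apply Rle_trans with (exp (- (sin theta * x0 * r)) * (B * (1 + r) ^ p)).
  - apply Rle_trans with (exp (- (sin theta * x * r)) * (B * (1 + r) ^ p)).
    + apply Rmult_le_compat_l; lra.
    + apply Rmult_le_compat_r; auto.
  - specialize (HM r Hr). replace (B * M / (1 + r ^ 2)) with (B * (M / (1 + r ^ 2))) by (unfold Rdiv; ring).
    replace (exp (- (sin theta * x0 * r)) * (B * (1 + r) ^ p)) with (B * ((1 + r) ^ p * exp (- (sin theta * x0 * r)))) by ring.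
    apply Rmult_le_compat_l; auto.
Qed.

(** Likewise with the other exponential, for t away from 0. *)
Lemma heat_decay theta p t0 B : 0 < cos (4 * theta) -> 0 < t0 -> 0 <= B -> exists M, forall t r v,
  t0 <= t -> 0 <= r -> v <= B * (1 + r) ^ p ->
  Cmod (heat t (ray theta r)) * v <= M / (1 + r ^ 2).
Proof.
  intros Hs Hx0 HB. destruct (exp_decay4 p (cos (4 * theta) * t0) ltac:(nra)) as [M [HM0 HM]].
  exists (B * M). intros x r v Hx Hr Hv. rewrite Cmod_heat. assert (Hr4 := pow_le r 4 Hr).
  assert (E : exp (- (cos (4 * theta) * x * r ^ 4)) <= exp (- (cos (4 * theta) * t0 * r ^ 4))).
  { apply exp_le. assert (0 <= cos (4 * theta) * (x - t0) * r ^ 4) by (apply Rmult_le_pos; auto; apply Rmult_le_pos; lra). lra. }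
  assert (P := exp_pos (- (cos (4 * theta) * x * r ^ 4))).
  assert (Q : 0 <= B * (1 + r) ^ p) by (apply Rmult_le_pos; auto; apply pow_le; lra).
  apply Rle_trans with (exp (- (cos (4 * theta) * t0 * r ^ 4)) * (B * (1 + r) ^ p)).
  - apply Rle_trans with (exp (- (cos (4 * theta) * x * r ^ 4)) * (B * (1 + r) ^ p)).
    + apply Rmult_le_compat_l; lra.
    + apply Rmult_le_compat_r; auto.
  - specialize (HM r Hr). replace (B * M / (1 + r ^ 2)) with (B * (M / (1 + r ^ 2))) by (unfold Rdiv; ring).
    replace (exp (- (cos (4 * theta) * t0 * r ^ 4)) * (B * (1 + r) ^ p)) with
      (B * ((1 + r) ^ p * exp (- (cos (4 * theta) * t0 * r ^ 4)))) by ring.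
    apply Rmult_le_compat_l; auto.
Qed.

Lemma pow_le_1p r n : 0 <= r -> r ^ n <= (1 + r) ^ n.
Proof. intros; apply pow_incr; lra. Qed.

Lemma pow_mul_1p r n B q v : 0 <= r -> 0 <= v -> v <= B * (1 + r) ^ q -> r ^ n * v <= B * (1 + r) ^ (n + q).
Proof.
  intros Hr Hv H. rewrite pow_add. pose proof (pow_le_1p r n Hr). pose proof (pow_le r n Hr).
  apply Rle_trans with ((1 + r) ^ n * (B * (1 + r) ^ q)); [|right; ring].
  apply Rmult_le_compat; auto.
Qed.

(** The functions of t that occur under the integral sign on rays where
    [osc] decays. *)
Definition poly_growth (theta : R) (psi : R -> C -> C) : Prop :=
  forall T, exists q B, 0 <= B /\ forall t r, 0 <= t <= T -> 0 <= r ->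
    Cmod (psi t (ray theta r)) <= B * (1 + r) ^ q.

Lemma ray_family_regular_osc theta psi : 0 < sin theta ->
  (forall m t, 0 < t -> Hol (on_ray theta) (psi m t)) ->
  (forall m l t, on_ray theta l -> 0 < t -> Cder (fun s => psi m s l) t (psi (S m) t l)) ->
  (forall m, poly_growth theta (psi m)) ->
  regular (ray_family theta psi).
Proof.
  intros Hs H1 H2 H3. apply ray_family_regular; auto.
  intros n m x0 t0 T Hx0 Ht0. destruct (H3 m T) as [q [B [HB0 HB]]].
  destruct (osc_decay theta (n + q) x0 B Hs Hx0 HB0) as [M HM]. exists M.
  intros x t r Hx Ht Hr. apply HM; auto. apply pow_mul_1p; auto; [apply Cmod_ge_0|apply HB; auto; lra].
Qed.

Lemma ray_family_tlim theta psi n m : 0 < sin theta ->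
  (forall t, 0 <= t <= 1 -> Hol (on_ray theta) (psi m t)) ->
  poly_growth theta (psi m) ->
  (forall L, 0 <= L -> exists c, forall t r, 0 <= t <= 1 -> 0 <= r <= L ->
     Cmod (psi m t (ray theta r) - psi m 0 (ray theta r)) <= t * c) ->
  tlim (ray_family theta psi n m) (fun x => int_ray theta (fun l => osc x l * ((Ci * l) ^ n * psi m 0 l))%C).
Proof.
  intros Hs H1 H2 H3.
  apply (ray_tlim theta (fun t l => (Ci * l) ^ n * psi m t l)%C); [lra| | |].
  - intros; apply Hol_mult; [apply Hol_iz_pow|auto].
  - intros x0 Hx0. destruct (H2 1) as [q [B [HB0 HB]]].
    destruct (osc_decay theta (n + q) x0 B Hs Hx0 HB0) as [M HM]. exists M.
    intros x t r Hx Ht Hr. rewrite Cmod_mult, Cmod_iz_pow by auto.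
    apply HM; auto. apply pow_mul_1p; auto; [apply Cmod_ge_0].
  - intros L HL. destruct (H3 L HL) as [c Hc]. exists (L ^ n * c). intros t r Ht Hr.
    replace ((Ci * ray theta r) ^ n * psi m t (ray theta r) - (Ci * ray theta r) ^ n * psi m 0 (ray theta r))%C
      with ((Ci * ray theta r) ^ n * (psi m t (ray theta r) - psi m 0 (ray theta r)))%C by ring.
    rewrite Cmod_mult, Cmod_iz_pow by lra. specialize (Hc t r Ht Hr).
    apply Rle_trans with (L ^ n * (t * c)); [|right; ring].
    apply Rmult_le_compat; auto; [apply pow_le; lra|apply Cmod_ge_0|apply pow_incr; lra].
Qed.

(** * Kernels *)

(** The derivative of order m in t of [heat t l * rho l]. *)
Definition kernel (rho : C -> C) (m : nat) (t : R) (l : C) : C :=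
  ((- omega l) ^ m * (heat t l * rho l))%C.

Definition ray_growth (theta : R) (rho : C -> C) : Prop :=
  Hol (on_ray theta) rho /\ exists q B, 0 <= B /\ forall r, 0 <= r -> Cmod (rho (ray theta r)) <= B * (1 + r) ^ q.

Lemma Hol_kernel S rho m t : Hol S rho -> Hol S (kernel rho m t).
Proof.
  intros. apply Hol_mult; [|apply Hol_mult; [apply Hol_heat|auto]].
  apply Hol_pow, Hol_opp, Hol_omega.
Qed.

Lemma Cder_kernel rho m l t : Cder (fun s => kernel rho m s l) t (kernel rho (S m) t l).
Proof.
  unfold kernel. eapply Cder_eq; [apply Cder_scal, Cder_mult_l, Cder_heat|].
  cbn [Cpow]. ring.
Qed.

Lemma Cmod_omega_pow theta r m : 0 <= r -> Cmod ((- omega (ray theta r)) ^ m) = r ^ (4 * m).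
Proof. intros. rewrite Cmod_pow, Cmod_opp, Cmod_omega, Cmod_ray by auto. symmetry; apply pow_mult. Qed.

Lemma kernel_bound theta rho m : Hol (on_ray theta) rho -> ray_growth theta rho -> exists q B, 0 <= B /\
  forall t r, 0 <= r -> exists v, 0 <= v <= B * (1 + r) ^ q /\
  Cmod (kernel rho m t (ray theta r)) = Cmod (heat t (ray theta r)) * v.
Proof.
  intros _ [_ [q [B [HB0 HB]]]]. exists (4 * m + q)%nat, B. split; auto. intros t r Hr.
  exists (r ^ (4 * m) * Cmod (rho (ray theta r))). split.
  - split; [apply Rmult_le_pos; [apply pow_le; auto|apply Cmod_ge_0]|].
    apply pow_mul_1p; auto. apply Cmod_ge_0.
  - unfold kernel. rewrite !Cmod_mult, Cmod_omega_pow by auto. ring.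
Qed.

Lemma kernel_poly_growth theta rho m : 0 <= cos (4 * theta) -> ray_growth theta rho ->
  poly_growth theta (kernel rho m).
Proof.
  intros Hc Hr T. destruct (kernel_bound theta rho m (proj1 Hr) Hr) as [q [B [HB0 HB]]].
  exists q, B. split; auto. intros t r Ht Hr0. destruct (HB t r Hr0) as [v [Hv ->]].
  pose proof (Cmod_heat_le_1 theta r t Hc Hr0 ltac:(lra)). pose proof (Cmod_ge_0 (heat t (ray theta r))). nra.
Qed.

Lemma kernel_regular_osc theta rho : 0 < sin theta -> 0 <= cos (4 * theta) -> ray_growth theta rho ->
  regular (ray_family theta (kernel rho)).
Proof.
  intros Hs Hc Hr. apply ray_family_regular_osc; auto.
  - intros; apply Hol_kernel; apply Hr.
  - intros; apply Cder_kernel.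
  - intros; apply kernel_poly_growth; auto.
Qed.

(** For t away from 0 the heat factor provides the decay, also on the real axis, where
    [osc] does not. *)
Lemma kernel_regular_heat theta rho : 0 <= sin theta -> 0 < cos (4 * theta) -> ray_growth theta rho ->
  regular (ray_family theta (kernel rho)).
Proof.
  intros Hs Hc Hr. apply ray_family_regular.
  - intros; apply Hol_kernel; apply Hr.
  - intros; apply Cder_kernel.
  - intros n m x0 t0 T Hx0 Ht0. destruct (kernel_bound theta rho m (proj1 Hr) Hr) as [q [B [HB0 HB]]].
    destruct (heat_decay theta (n + q) t0 B Hc Ht0 HB0) as [M HM]. exists M.
    intros x t r Hx Ht Hr0. destruct (HB t r Hr0) as [v [Hv ->]].
    assert (HM' := HM t r (r ^ n * v) ltac:(lra) Hr0 (pow_mul_1p r n B q v Hr0 (proj1 Hv) (proj2 Hv))).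
    pose proof (Cmod_osc_le_1 theta r x Hs Hr0 ltac:(lra)). pose proof (Cmod_ge_0 (osc x (ray theta r))).
    assert (0 <= r ^ n * (Cmod (heat t (ray theta r)) * v)).
    { apply Rmult_le_pos; [apply pow_le; auto|]. apply Rmult_le_pos; [apply Cmod_ge_0|lra]. }
    replace (Cmod (heat t (ray theta r)) * (r ^ n * v)) with (r ^ n * (Cmod (heat t (ray theta r)) * v)) in HM' by ring.
    nra.
Qed.

Lemma kernel_tlim theta rho n m : 0 < sin theta -> 0 <= cos (4 * theta) -> ray_growth theta rho ->
  tlim (ray_family theta (kernel rho) n m)
    (fun x => int_ray theta (fun l => osc x l * ((Ci * l) ^ n * kernel rho m 0 l))%C).
Proof.
  intros Hs Hc Hr. apply ray_family_tlim; auto.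
  - intros; apply Hol_kernel; apply Hr.
  - apply kernel_poly_growth; auto.
  - intros L HL. destruct Hr as [_ [q [B [HB0 HB]]]].
    exists (L ^ (4 * m) * (2 * L ^ 4 * (B * (1 + L) ^ q))). intros t r Ht Hr. unfold kernel.
    replace ((- omega (ray theta r)) ^ m * (heat t (ray theta r) * rho (ray theta r)) -
      (- omega (ray theta r)) ^ m * (heat 0 (ray theta r) * rho (ray theta r)))%C with
      ((- omega (ray theta r)) ^ m * ((heat t (ray theta r) - heat 0 (ray theta r)) * rho (ray theta r)))%C by ring.
    replace (heat 0 (ray theta r)) with (RtoC 1).
    2:{ unfold heat. rewrite Cmult_0_r, <- Cexp_0. f_equal. ring. }
    rewrite !Cmod_mult, Cmod_omega_pow by lra.
    replace (t * (L ^ (4 * m) * (2 * L ^ 4 * (B * (1 + L) ^ q)))) with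
      (L ^ (4 * m) * ((2 * L ^ 4 * t) * (B * (1 + L) ^ q))) by ring.
    assert (HL4 := pow_incr r L 4 Hr). assert (Hr4 : 0 <= r ^ 4) by (apply pow_le; lra).
    apply Rmult_le_compat; [apply pow_le; lra|apply Rmult_le_pos; apply Cmod_ge_0|apply pow_incr; lra|].
    apply Rmult_le_compat; try apply Cmod_ge_0.
    + eapply Rle_trans; [apply heat_minus_1; auto; lra|]. nra.
    + eapply Rle_trans; [apply HB; lra|]. apply Rmult_le_compat_l; auto. apply pow_incr; lra.
Qed.

Lemma kernel_xlim theta rho n m : 0 <= sin theta -> 0 < cos (4 * theta) -> ray_growth theta rho ->
  xlim (ray_family theta (kernel rho) n m) (fun t => int_ray theta (fun l => (Ci * l) ^ n * kernel rho m t l)%C).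
Proof.
  intros Hs Hc Hr. apply (ray_xlim theta (fun t l => (Ci * l) ^ n * kernel rho m t l)%C); auto.
  - intros. apply Hol_mult; [apply Hol_iz_pow|apply Hol_kernel; apply Hr].
  - intros t0 T Ht0 _. destruct (kernel_bound theta rho m (proj1 Hr) Hr) as [q [B [HB0 HB]]].
    destruct (heat_decay theta (n + q) t0 B Hc Ht0 HB0) as [M HM]. exists M.
    intros t r Ht Hr0. rewrite Cmod_mult, Cmod_iz_pow by auto. destruct (HB t r Hr0) as [v [Hv ->]].
    assert (HM' := HM t r (r ^ n * v) ltac:(lra) Hr0 (pow_mul_1p r n B q v Hr0 (proj1 Hv) (proj2 Hv))).
    replace (Cmod (heat t (ray theta r)) * (r ^ n * v)) with (r ^ n * (Cmod (heat t (ray theta r)) * v)) in HM' by ring.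
    exact HM'.
Qed.

(** * Derivatives in t of the transformed boundary data *)

(** The derivative of order m in t of [conv (G 0) w t], obtained by iterating
    [conv_Cder]. *)
Fixpoint convm (m : nat) (G : nat -> R -> C) (w : C) (t : R) : C :=
  match m with
  | O => conv (G 0%nat) w t
  | S m' => (convm m' (shift G) w t + G 0%nat 0 * ((- w) ^ m' * Cexp (- (w * t))))%C
  end.

Lemma Cder_convm m G w t : jet G -> 0 < t -> Cder (fun s => convm m G w s) t (convm (S m) G w t).
Proof.
  revert G; induction m; intros G HG Ht.
  - eapply Cder_eq; [apply (conv_Cder G w t HG Ht)|]. simpl. unfold shift. ring.
  - cbn [convm]. eapply Cder_eq.
    + apply Cder_plus; [apply (IHm (shift G) (jet_shift G HG) Ht)|].
      apply Cder_scal, Cder_scal.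
      eapply Cder_ext; [|apply (Cder_Cexp_line 0 (- w))]. intros s; simpl. f_equal; ring.
    + cbn [convm Cpow]. replace (0 + t * - w)%C with (- (w * t))%C by ring. ring.
Qed.

Lemma convm_bound m : forall G T, jet G -> exists q B, 0 <= B /\ forall w t, 0 <= Re w -> 0 <= t <= T ->
  Cmod (convm m G w t) <= B * (1 + Cmod w) ^ q.
Proof.
  induction m; intros G T HG.
  - destruct (Ccont_bounded (G 0%nat) 0 T) as [B [HB0 HB]]; [intros; apply HG|].
    exists 0%nat, (B * Rabs T). split; [apply Rmult_le_pos; auto; apply Rabs_pos|].
    intros w t Hw Ht. simpl. rewrite Rmult_1_r.
    eapply Rle_trans; [apply (conv_bound _ w t B)|]; auto; try lra.
    + apply HG.
    + intros; apply HB; lra.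
    + apply Rmult_le_compat_l; auto. pose proof (Rle_abs T). lra.
  - destruct (IHm (shift G) T (jet_shift G HG)) as [q [B [HB0 HB]]].
    exists (q + m)%nat, (B + Cmod (G 0%nat 0)). split; [pose proof (Cmod_ge_0 (G 0%nat 0)); lra|].
    intros w t Hw Ht. cbn [convm]. eapply Rle_trans; [apply Cmod_triangle|].
    rewrite Rmult_plus_distr_r. assert (Hw0 := Cmod_ge_0 w).
    assert (P : forall i j, (1 + Cmod w) ^ i <= (1 + Cmod w) ^ (i + j)).
    { intros i j. apply Rle_pow; [lra|lia]. }
    apply Rplus_le_compat.
    + eapply Rle_trans; [apply HB; auto|]. apply Rmult_le_compat_l; auto.
    + rewrite Cmod_mult. apply Rmult_le_compat_l; [apply Cmod_ge_0|].
      rewrite Cmod_mult, Cmod_pow, Cmod_opp.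
      assert (K := Cmod_conv_kernel w t Hw ltac:(lra)).
      apply Rle_trans with ((1 + Cmod w) ^ m * 1).
      * apply Rmult_le_compat; try apply Cmod_ge_0; auto; [apply pow_le; auto|apply pow_incr; lra].
      * rewrite Rmult_1_r, Nat.add_comm. apply P.
Qed.

Lemma convm_at_0 m : forall G L, jet G -> 0 <= L -> exists c, forall w t, 0 <= Re w -> Cmod w <= L -> 0 <= t <= 1 ->
  Cmod (convm m G w t - convm m G w 0) <= t * c.
Proof.
  induction m; intros G L HG HL.
  - destruct (Ccont_bounded (G 0%nat) 0 1) as [B [HB0 HB]]; [intros; apply HG|].
    exists B. intros w t Hw _ Ht. cbn [convm]. rewrite conv_0.
    replace (conv (G 0%nat) w t - 0)%C with (conv (G 0%nat) w t) by ring. rewrite Rmult_comm.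
    apply conv_bound; auto; try lra; [apply HG|intros; apply HB; lra].
  - destruct (IHm (shift G) L (jet_shift G HG) HL) as [c Hc].
    exists (c + Cmod (G 0%nat 0) * (L ^ m * (2 * L))). intros w t Hw HwL Ht. cbn [convm].
    replace (- (w * 0))%C with (RtoC 0) by ring.
    replace (convm m (shift G) w t + G 0%nat 0 * ((- w) ^ m * Cexp (- (w * t))) -
      (convm m (shift G) w 0 + G 0%nat 0 * ((- w) ^ m * Cexp 0)))%C with
      ((convm m (shift G) w t - convm m (shift G) w 0) + G 0%nat 0 * ((- w) ^ m * (Cexp (- (w * t)) - Cexp 0)))%C by ring.
    eapply Rle_trans; [apply Cmod_triangle|]. rewrite Rmult_plus_distr_l. apply Rplus_le_compat; [auto|].
    rewrite !Cmod_mult, Cmod_pow, Cmod_opp.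
    assert (N : Re (- (w * t)) <= 0) by (unfold Re in *; simpl; nra).
    assert (T := Cexp_lip 0 0 (- (w * t)) ltac:(simpl; lra) N).
    replace (- (w * t) - 0)%C with (- (w * t))%C in T by ring.
    rewrite exp_0, Cmod_opp, Cmod_mult, Cmod_R, Rabs_pos_eq in T by lra.
    assert (Hw0 := Cmod_ge_0 w).
    replace (t * (Cmod (G 0%nat 0) * (L ^ m * (2 * L)))) with (Cmod (G 0%nat 0) * (L ^ m * (2 * L * t))) by ring.
    apply Rmult_le_compat_l; [apply Cmod_ge_0|].
    apply Rmult_le_compat; [apply pow_le; auto|apply Cmod_ge_0|apply pow_incr; lra|nra].
Qed.

Lemma Hol_convm m : forall G t, jet G -> 0 <= t -> Hol (fun w => 0 <= Re w) (fun w => convm m G w t).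
Proof.
  induction m; intros G t HG Ht; cbn [convm].
  - apply conv_Hol; auto. apply HG.
  - apply Hol_plus; [apply IHm; auto; apply jet_shift; auto|]. apply Hol_scal. apply Hol_mult.
    + apply Hol_pow, Hol_opp, Hol_id.
    + apply Hol_Cexp. apply (Hol_ext _ (fun w => (- t) * w)%C); [intros; ring|]. apply Hol_scal, Hol_id.
Qed.

(** The transformed boundary data with the power of l that the representation formula
    attaches to them, and their derivatives in t. *)
Definition bdata (p : nat) (G : nat -> R -> C) (m : nat) (t : R) (l : C) : C :=
  (l ^ p * convm m G (omega l) t)%C.

Lemma Re_omega_ray theta r : 0 <= cos (4 * theta) -> 0 <= Re (omega (ray theta r)).
Proof.
  intros. rewrite omega_ray. destruct (ray_parts (4 * theta) (r ^ 4)) as [-> _].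
  apply Rmult_le_pos; auto. replace (r ^ 4) with ((r * r) * (r * r)) by ring. nra.
Qed.

Lemma Hol_bdata S p G m t : (forall z, S z -> 0 <= Re (omega z)) -> jet G -> 0 <= t -> Hol S (bdata p G m t).
Proof.
  intros HS HG Ht. apply Hol_mult; [apply (Hol_pow S (fun z => z)), Hol_id|].
  apply (Hol_comp S (fun w => 0 <= Re w) (fun w => convm m G w t) omega); auto.
  - apply Hol_convm; auto.
  - apply Hol_omega.
Qed.

Lemma bdata_poly_growth theta p G m : 0 <= cos (4 * theta) -> jet G -> poly_growth theta (bdata p G m).
Proof.
  intros Hc HG T. destruct (convm_bound m G T HG) as [q [B [HB0 HB]]].
  exists (p + 4 * q)%nat, B. split; auto. intros t r Ht Hr. unfold bdata.
  rewrite Cmod_mult, Cmod_pow, Cmod_ray by auto.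
  apply pow_mul_1p; auto; [apply Cmod_ge_0|].
  eapply Rle_trans; [apply HB; auto; apply Re_omega_ray; auto|].
  apply Rmult_le_compat_l; auto. rewrite Cmod_omega, Cmod_ray by auto. rewrite pow_mult.
  apply pow_incr. assert (0 <= r ^ 4) by (apply pow_le; auto). split; [lra|].
  assert (0 <= r * r) by nra. assert (0 <= r * r * r) by nra.
  replace ((1 + r) ^ 4) with (1 + 4 * r + 6 * (r * r) + 4 * (r * r * r) + r ^ 4) by ring. lra.
Qed.

Lemma on_ray_Re_omega theta : 0 <= cos (4 * theta) -> forall z, on_ray theta z -> 0 <= Re (omega z).
Proof. intros H z [r [Hr ->]]. apply Re_omega_ray; auto. Qed.

Lemma bdata_regular theta p G : 0 < sin theta -> 0 <= cos (4 * theta) -> jet G ->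
  regular (ray_family theta (bdata p G)).
Proof.
  intros Hs Hc HG. apply ray_family_regular_osc; auto.
  - intros; apply Hol_bdata; auto; [apply on_ray_Re_omega; auto|lra].
  - intros; unfold bdata. apply Cder_scal. apply Cder_convm; auto.
  - intros; apply bdata_poly_growth; auto.
Qed.

Lemma bdata_tlim theta p G n m : 0 < sin theta -> 0 <= cos (4 * theta) -> jet G ->
  tlim (ray_family theta (bdata p G) n m)
    (fun x => int_ray theta (fun l => osc x l * ((Ci * l) ^ n * bdata p G m 0 l))%C).
Proof.
  intros Hs Hc HG. apply ray_family_tlim; auto.
  - intros; apply Hol_bdata; auto; [apply on_ray_Re_omega; auto|lra].
  - apply bdata_poly_growth; auto.
  - intros L HL. destruct (convm_at_0 m G (L ^ 4) HG ltac:(apply pow_le; auto)) as [c Hc'].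
    exists (L ^ p * c). intros t r Ht Hr. unfold bdata.
    replace (ray theta r ^ p * convm m G (omega (ray theta r)) t - ray theta r ^ p * convm m G (omega (ray theta r)) 0)%C
      with (ray theta r ^ p * (convm m G (omega (ray theta r)) t - convm m G (omega (ray theta r)) 0))%C by ring.
    rewrite Cmod_mult, Cmod_pow, Cmod_ray by lra.
    replace (t * (L ^ p * c)) with (L ^ p * (t * c)) by ring.
    apply Rmult_le_compat; [apply pow_le; lra|apply Cmod_ge_0|apply pow_incr; lra|].
    apply Hc'; auto; [apply Re_omega_ray; auto|]. rewrite Cmod_omega, Cmod_ray by lra. apply pow_incr; lra.
Qed.

(** * The integral over the real line *)

Lemma mul_le_1 a b : a <= 1 -> 0 <= b -> a * b <= b.
Proof. intros; nra. Qed.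

Lemma poisson_le_Rabs M r : M / (1 + r ^ 2) <= Rabs M.
Proof.
  pose proof (pow2_ge_0 r). apply Rmult_le_reg_r with (1 + r ^ 2); [lra|].
  replace (M / (1 + r ^ 2) * (1 + r ^ 2)) with M by (field; lra).
  pose proof (Rle_abs M). pose proof (Rabs_pos M).
  assert (0 <= Rabs M * r ^ 2) by (apply Rmult_le_pos; auto). lra.
Qed.

Lemma Cmod_sqr (z : C) : Cmod z * Cmod z = Re z * Re z + Im z * Im z.
Proof. pose proof (Cmod2_alt z). simpl in H. lra. Qed.

Lemma Cmod_lower (z : C) (c : R) : 0 <= c -> c * c <= Re z * Re z + Im z * Im z -> c <= Cmod z.
Proof. intros Hc H. rewrite <- Cmod_sqr in H. pose proof (Cmod_ge_0 z). nra. Qed.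

Lemma unit_circle theta : cos theta * cos theta + sin theta * sin theta = 1.
Proof. pose proof (sin2_cos2 theta). unfold Rsqr in H. lra. Qed.

Lemma one_plus_il_sqr theta r : Cmod (1 + Ci * ray theta r) * Cmod (1 + Ci * ray theta r) = 1 - 2 * r * sin theta + r * r.
Proof.
  rewrite Cmod_sqr. destruct (ray_parts theta r) as [E1 E2]. pose proof (unit_circle theta).
  replace (Re (1 + Ci * ray theta r)) with (1 - Im (ray theta r)) by (unfold Re, Im; simpl; ring).
  replace (Im (1 + Ci * ray theta r)) with (Re (ray theta r)) by (unfold Re, Im; simpl; ring).
  rewrite E1, E2.
  replace ((1 - r * sin theta) * (1 - r * sin theta) + r * cos theta * (r * cos theta)) with
    (1 - 2 * r * sin theta + r * r * (cos theta * cos theta + sin theta * sin theta)) by ring.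
  rewrite H. ring.
Qed.

Lemma one_minus_il_sqr theta r : Cmod (1 - Ci * ray theta r) * Cmod (1 - Ci * ray theta r) = 1 + 2 * r * sin theta + r * r.
Proof.
  rewrite Cmod_sqr. destruct (ray_parts theta r) as [E1 E2]. pose proof (unit_circle theta).
  replace (Re (1 - Ci * ray theta r)) with (1 + Im (ray theta r)) by (unfold Re, Im; simpl; ring).
  replace (Im (1 - Ci * ray theta r)) with (- Re (ray theta r)) by (unfold Re, Im; simpl; ring).
  rewrite E1, E2.
  replace ((1 + r * sin theta) * (1 + r * sin theta) + - (r * cos theta) * - (r * cos theta)) with
    (1 + 2 * r * sin theta + r * r * (cos theta * cos theta + sin theta * sin theta)) by ring.
  rewrite H. ring.
Qed.

Lemma ray_sqr theta r : (ray theta r * ray theta r)%C = ray (2 * theta) (r * r).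
Proof.
  unfold ray. replace (Ci * (2 * theta)%R)%C with (Ci * theta + Ci * theta)%C by (rewrite RtoC_mult; ring).
  rewrite Cexp_plus, RtoC_mult. ring.
Qed.

Lemma one_plus_sqr_sqr theta r : Cmod (1 + ray theta r * ray theta r) * Cmod (1 + ray theta r * ray theta r)
  = 1 + 2 * (r * r) * cos (2 * theta) + r * r * (r * r).
Proof.
  rewrite ray_sqr, Cmod_sqr. destruct (ray_parts (2 * theta) (r * r)) as [E1 E2]. pose proof (unit_circle (2 * theta)).
  replace (Re (1 + ray (2 * theta) (r * r))) with (1 + Re (ray (2 * theta) (r * r))) by (unfold Re, Im; simpl; ring).
  replace (Im (1 + ray (2 * theta) (r * r))) with (Im (ray (2 * theta) (r * r))) by (unfold Re, Im; simpl; ring).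
  rewrite E1, E2.
  replace ((1 + r * r * cos (2 * theta)) * (1 + r * r * cos (2 * theta)) + r * r * sin (2 * theta) * (r * r * sin (2 * theta)))
    with (1 + 2 * (r * r) * cos (2 * theta) + r * r * (r * r) * (cos (2 * theta) * cos (2 * theta) + sin (2 * theta) * sin (2 * theta))) by ring.
  rewrite H. ring.
Qed.

Lemma Rsqr_le_inv (a b : R) : 0 <= b -> a * a <= b * b -> a <= b.
Proof. intros; nra. Qed.

Lemma Cmod_pos_neq z c : 0 < c -> c <= Cmod z -> z <> 0%C.
Proof. intros H1 H2. apply Cmod_gt_0. lra. Qed.

(** Used where one factor decays by integration by parts and the other one is the
    inverse of 1 + il or 1 - il. *)
Lemma two_factors (a b : C) (A B r : R) : 0 <= r -> 0 <= A -> 0 < B ->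
  (1 + r) * Cmod a <= A -> B * (1 + r) <= Cmod b -> Cmod (a / b) <= A / B / (1 + r ^ 2).
Proof.
  intros Hr HA HB Ha Hb. assert (Hb0 : 0 < Cmod b) by nra.
  assert (b <> 0%C) by (apply Cmod_gt_0; auto). rewrite Cmod_div by auto.
  apply Rmult_le_reg_r with (Cmod b * B * (1 + r ^ 2)); [apply Rmult_lt_0_compat; nra|].
  replace (Cmod a / Cmod b * (Cmod b * B * (1 + r ^ 2))) with (Cmod a * B * (1 + r ^ 2)) by (field; lra).
  replace (A / B / (1 + r ^ 2) * (Cmod b * B * (1 + r ^ 2))) with (A * Cmod b) by (field; split; nra).
  pose proof (Cmod_ge_0 a).
  assert (Cmod a * (1 + r ^ 2) <= Cmod a * ((1 + r) * (1 + r))) by (apply Rmult_le_compat_l; auto; nra).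
  assert (Cmod a * ((1 + r) * (1 + r)) * B <= A * (B * (1 + r))).
  { replace (Cmod a * ((1 + r) * (1 + r)) * B) with ((1 + r) * Cmod a * (B * (1 + r))) by ring.
    apply Rmult_le_compat_r; [nra|auto]. }
  assert (A * (B * (1 + r)) <= A * Cmod b) by (apply Rmult_le_compat_l; auto). nra.
Qed.

Lemma two_factors_mul (a b : C) (A B r : R) : 0 <= r -> 0 <= A -> 0 < B ->
  (1 + r) * Cmod a <= A -> B * (1 + r) <= Cmod b -> Cmod (a * / b) <= A / B / (1 + r ^ 2).
Proof. intros. apply two_factors; auto. Qed.

Lemma one_plus_il_lower theta r : 0 <= r -> sin theta <= 0 -> / 2 * (1 + r) <= Cmod (1 + Ci * ray theta r).
Proof.
  intros Hr Hs. apply Rsqr_le_inv; [apply Cmod_ge_0|]. rewrite one_plus_il_sqr. nra.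
Qed.

Lemma one_minus_il_lower theta r : 0 <= r -> 0 <= sin theta -> / 2 * (1 + r) <= Cmod (1 - Ci * ray theta r).
Proof.
  intros Hr Hs. apply Rsqr_le_inv; [apply Cmod_ge_0|]. rewrite one_minus_il_sqr. nra.
Qed.

(** Valid on both sides of the real axis, away from the pole i. *)
Lemma one_plus_il_lower' theta r : / 2 <= cos theta * cos theta -> / 2 <= Cmod (1 + Ci * ray theta r).
Proof.
  intros Hc. apply Rsqr_le_inv; [apply Cmod_ge_0|]. rewrite one_plus_il_sqr.
  pose proof (unit_circle theta). pose proof (Rle_0_sqr (r - sin theta)). unfold Rsqr in *. nra.
Qed.

Lemma one_plus_sqr_lower theta r : 0 <= cos (2 * theta) -> / 2 * (1 + r * r) <= Cmod (1 + ray theta r * ray theta r).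
Proof.
  intros Hc. apply Rsqr_le_inv; [apply Cmod_ge_0|]. rewrite one_plus_sqr_sqr.
  assert (0 <= r * r * cos (2 * theta)) by (apply Rmult_le_pos; nra).
  pose proof (Rle_0_sqr (r * r - 1)). unfold Rsqr in *. nra.
Qed.

(** ** Special rays *)

Lemma Cexp_i_0 : Cexp (Ci * 0) = 1%C.
Proof. rewrite Cmult_0_r. apply Cexp_0. Qed.

Lemma Cexp_i (theta : R) : Cexp (Ci * theta) = (cos theta, sin theta).
Proof.
  destruct (ray_parts theta 1) as [E1 E2]. unfold ray in *. rewrite Cmult_1_l in *. rewrite Rmult_1_l in *.
  apply C_eq; auto.
Qed.

Lemma Cexp_i_PI : Cexp (Ci * PI) = (- (1))%C.
Proof. rewrite Cexp_i, cos_PI, sin_PI. apply C_eq; simpl; ring. Qed.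

Lemma Cexp_i_PI2 : Cexp (Ci * (PI / 2)%R) = Ci.
Proof. rewrite Cexp_i, cos_PI2, sin_PI2. reflexivity. Qed.

Lemma ray_0 r : ray 0 r = r.
Proof. unfold ray. rewrite Cexp_i_0. ring. Qed.
Lemma ray_PI r : ray PI r = (- r)%C.
Proof. unfold ray. rewrite Cexp_i_PI. ring. Qed.
Lemma ray_PI2 r : ray (PI / 2) r = (Ci * r)%C.
Proof. unfold ray. rewrite Cexp_i_PI2. ring. Qed.

(** The real line as a pair of rays. *)
Definition int_real (F : C -> C) : C := (int_ray 0 F - int_ray PI F)%C.

(** The negative half-line is the ray of angle PI, traversed backwards. *)
Lemma int_line_real M F : ray_dominated 0 M F -> ray_dominated PI M F -> int_line F = int_real F.
Proof.
  intros H0 HP. apply ray_dominated_half in H0, HP.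
  assert (A := half_ex _ _ H0). assert (B := half_ex _ _ HP).
  unfold int_real. rewrite !int_ray_half.
  set (a := half _) in *. set (b := half (fun r : R => F (ray PI r) * Cexp (Ci * PI))%C) in *.
  assert (A' : is_half (fun r : R => F r) a).
  { eapply is_half_ext; [|exact A]. intros r Hr; simpl. rewrite ray_0, Cexp_i_0. ring. }
  refine (is_RInt_gen_unique (V := CR) (fun r : R => F r) (a - b)%C _).
  replace (a - b)%C with (- b + a)%C by ring.
  refine (is_RInt_gen_Chasles (V := CR) (fun r : R => F r) 0 (- b)%C a _ A').
  intros P [eps HPe].
  destruct (B (fun y => ball (b : CR) eps y)) as [Q1 Q2 HQ1 HQ2 HQ].
  { exists eps; auto. }
  destruct HQ2 as [N HN].
  exists (fun x => x < - N) (fun y => y = 0); [exists (- N); auto|reflexivity|].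
  intros x y Hx ->. destruct (HQ 0 (- x) HQ1 (HN (- x) ltac:(lra))) as [v [Hv1 Hv2]]. simpl in Hv1.
  exists (- v)%C. split.
  - simpl.
    assert (C1 := is_RInt_comp_opp (V := CR) (fun r : R => F (ray PI r) * Cexp (Ci * PI))%C x 0 v).
    rewrite Ropp_0 in C1. assert (C2 := is_RInt_swap (V := CR) _ _ _ _ Hv1).
    assert (C3 := is_RInt_comp_opp (V := CR) (fun r : R => F (ray PI r) * Cexp (Ci * PI))%C x 0 (opp v)).
    rewrite Ropp_0 in C3. specialize (C3 C2).
    refine (is_RInt_ext (V := CR) _ _ _ _ _ _ C3).
    intros r _. rewrite ray_PI, Cexp_i_PI. rewrite RtoC_opp.
    change (- (F (- - r) * - (1)) = F r)%C. replace (- - r)%C with (RtoC r) by ring. ring.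
  - apply HPe. destruct Hv2 as [V1 V2]. split.
    + change (Rabs (- fst v - - fst b) < eps). change (Rabs (fst v - fst b) < eps) in V1.
      rewrite <- Rabs_Ropp. replace (- (- fst v - - fst b)) with (fst v - fst b) by ring. exact V1.
    + change (Rabs (- snd v - - snd b) < eps). change (Rabs (snd v - snd b) < eps) in V2.
      rewrite <- Rabs_Ropp. replace (- (- snd v - - snd b)) with (snd v - snd b) by ring. exact V2.
Qed.

Lemma int_ray_same (theta theta' : R) F : Cexp (Ci * theta) = Cexp (Ci * theta') -> int_ray theta F = int_ray theta' F.
Proof. intros E. unfold int_ray. rewrite E. reflexivity. Qed.

(** ** Angles *)

Lemma sin_sector theta : PI / 16 <= theta <= 15 * PI / 16 -> sin (PI / 16) <= sin theta.
Proof.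
  intros H. pose proof PI_RGT_0 as HPI. destruct (Rle_dec theta (PI / 2)).
  - apply sin_incr_1; lra.
  - rewrite <- (sin_PI_x theta). apply sin_incr_1; lra.
Qed.

Lemma sin_PI16_pos : 0 < sin (PI / 16).
Proof. pose proof PI_RGT_0 as HPI. apply sin_gt_0; lra. Qed.

Lemma cos_period (x : R) (k : nat) : cos (x - 2 * INR k * PI) = cos x.
Proof. rewrite <- (cos_period (x - 2 * INR k * PI) k). f_equal. ring. Qed.

Lemma cos4_nonneg theta : 0 <= theta <= PI / 8 \/ 3 * PI / 8 <= theta <= 5 * PI / 8 \/ 7 * PI / 8 <= theta <= PI ->
  0 <= cos (4 * theta).
Proof.
  pose proof PI_RGT_0 as HPI. intros [H|[H|H]].
  - apply cos_ge_0; lra.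
  - rewrite <- (cos_period (4 * theta) 1). simpl. apply cos_ge_0; lra.
  - rewrite <- (cos_period (4 * theta) 2). simpl. apply cos_ge_0; lra.
Qed.

Lemma cos4_pos theta : 0 <= theta <= PI / 16 \/ theta = PI / 2 \/ 15 * PI / 16 <= theta <= PI ->
  cos (PI / 4) <= cos (4 * theta).
Proof.
  pose proof PI_RGT_0 as HPI. intros [H|[H|H]].
  - apply cos_decr_1; lra.
  - rewrite <- (cos_period (4 * theta) 1). simpl. apply cos_decr_1; lra.
  - rewrite <- (cos_period (4 * theta) 2). simpl. rewrite <- (cos_neg (4 * theta - _)). apply cos_decr_1; lra.
Qed.

Lemma cos_PI4_pos : 0 < cos (PI / 4).
Proof. pose proof PI_RGT_0 as HPI. apply cos_gt_0; lra. Qed.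

Lemma cos2_nonneg theta : 0 <= theta <= PI / 4 \/ 3 * PI / 4 <= theta <= PI -> 0 <= cos (2 * theta).
Proof.
  pose proof PI_RGT_0 as HPI. intros [H|H].
  - apply cos_ge_0; lra.
  - rewrite <- (cos_period (2 * theta) 1). simpl. apply cos_ge_0; lra.
Qed.

Lemma cos_sqr_half theta : 0 <= cos (2 * theta) -> / 2 <= cos theta * cos theta.
Proof. rewrite cos_2a_cos. intros. lra. Qed.

Definition upper (z : C) : Prop := 0 <= Im z.
Definition lower (z : C) : Prop := Im z <= 0.

Lemma ray_upper theta r : 0 <= theta <= PI -> 0 <= r -> upper (ray theta r).
Proof.
  intros H Hr. unfold upper. destruct (ray_parts theta r) as [_ ->]. apply Rmult_le_pos; auto.
  apply sin_ge_0; lra.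
Qed.

Lemma on_ray_upper theta z : 0 <= theta <= PI -> on_ray theta z -> upper z.
Proof. intros H [r [Hr ->]]. apply ray_upper; auto. Qed.

Lemma ray_real_lower theta r : sin theta = 0 -> lower (ray theta r).
Proof. intros H. unfold lower. destruct (ray_parts theta r) as [_ ->]. rewrite H. lra. Qed.

Lemma Hol_one_plus_il S : Hol S (fun l => 1 + Ci * l)%C.
Proof. apply Hol_plus; [apply Hol_const|apply Hol_scal, Hol_id]. Qed.

Lemma Hol_one_minus_il S : Hol S (fun l => 1 - Ci * l)%C.
Proof. apply Hol_minus; [apply Hol_const|apply Hol_scal, Hol_id]. Qed.

Lemma Hol_one_plus_sqr S : Hol S (fun l => 1 + l * l)%C.
Proof. apply Hol_plus; [apply Hol_const|apply Hol_mult; apply Hol_id]. Qed.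

Definition sector (a b : R) (z : C) : Prop := exists theta r, a <= theta <= b /\ 0 <= r /\ z = ray theta r.

Lemma sector_rotate (f : C -> C) (a b M : R) : a <= b -> Hol (sector a b) f ->
  (forall r theta, 0 <= r -> a <= theta <= b -> Cmod (f (ray theta r)) <= M / (1 + r ^ 2)) ->
  int_ray a f = int_ray b f.
Proof.
  intros Hab Hf HM. apply (int_ray_rotate (sector a b) f a b M); auto.
  intros r theta Hr Ht. exists theta, r; auto.
Qed.

Lemma sector_Hol_inv a b (f : C -> C) d : 0 < d ->
  (forall r theta, 0 <= r -> a <= theta <= b -> d <= Cmod (f (ray theta r))) ->
  Hol (sector a b) f -> Hol (sector a b) (fun z => / f z)%C.
Proof. intros Hd H Hf. apply (Hol_inv _ _ d); auto. intros z [theta [r [Ht [Hr ->]]]]. auto. Qed.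

Lemma sector_on_ray a b theta : a <= theta <= b -> forall z, on_ray theta z -> sector a b z.
Proof. intros H z [r [Hr ->]]. exists theta, r; auto. Qed.

(** Decay that is uniform in the angle, as the rotation of rays requires. *)
Lemma osc_sector_bound a b p x B c : 0 < c -> 0 < x -> 0 <= B -> 
  (forall theta, a <= theta <= b -> c <= sin theta) ->
  exists M, forall r theta v, 0 <= r -> a <= theta <= b -> v <= B * (1 + r) ^ p ->
    Cmod (osc x (ray theta r)) * v <= M / (1 + r ^ 2).
Proof.
  intros Hc Hx HB Hs. destruct (exp_decay p (c * x) ltac:(nra)) as [M [HM0 HM]].
  exists (B * M). intros r theta v Hr Ht Hv. rewrite Cmod_osc. specialize (Hs theta Ht).
  assert (E : exp (- (sin theta * x * r)) <= exp (- (c * x * r))).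
  { apply exp_le. assert (0 <= (sin theta - c) * x * r) by (apply Rmult_le_pos; auto; apply Rmult_le_pos; lra). lra. }
  assert (P := exp_pos (- (sin theta * x * r))).
  assert (Q : 0 <= B * (1 + r) ^ p) by (apply Rmult_le_pos; auto; apply pow_le; lra).
  apply Rle_trans with (exp (- (c * x * r)) * (B * (1 + r) ^ p)).
  - apply Rle_trans with (exp (- (sin theta * x * r)) * (B * (1 + r) ^ p)).
    + apply Rmult_le_compat_l; lra.
    + apply Rmult_le_compat_r; auto.
  - specialize (HM r Hr). replace (B * M / (1 + r ^ 2)) with (B * (M / (1 + r ^ 2))) by (unfold Rdiv; ring).
    replace (exp (- (c * x * r)) * (B * (1 + r) ^ p)) with (B * ((1 + r) ^ p * exp (- (c * x * r)))) by ring.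
    apply Rmult_le_compat_l; auto.
Qed.

Lemma heat_sector_bound a b p t B c : 0 < c -> 0 < t -> 0 <= B ->
  (forall theta, a <= theta <= b -> c <= cos (4 * theta)) ->
  exists M, forall r theta v, 0 <= r -> a <= theta <= b -> v <= B * (1 + r) ^ p ->
    Cmod (heat t (ray theta r)) * v <= M / (1 + r ^ 2).
Proof.
  intros Hc Hx HB Hs. destruct (exp_decay4 p (c * t) ltac:(nra)) as [M [HM0 HM]].
  exists (B * M). intros r theta v Hr Ht Hv. rewrite Cmod_heat. specialize (Hs theta Ht).
  assert (Hr4 := pow_le r 4 Hr).
  assert (E : exp (- (cos (4 * theta) * t * r ^ 4)) <= exp (- (c * t * r ^ 4))).
  { apply exp_le. assert (0 <= (cos (4 * theta) - c) * t * r ^ 4) by (apply Rmult_le_pos; auto; apply Rmult_le_pos; lra). lra. }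
  assert (P := exp_pos (- (cos (4 * theta) * t * r ^ 4))).
  assert (Q : 0 <= B * (1 + r) ^ p) by (apply Rmult_le_pos; auto; apply pow_le; lra).
  apply Rle_trans with (exp (- (c * t * r ^ 4)) * (B * (1 + r) ^ p)).
  - apply Rle_trans with (exp (- (cos (4 * theta) * t * r ^ 4)) * (B * (1 + r) ^ p)).
    + apply Rmult_le_compat_l; lra.
    + apply Rmult_le_compat_r; auto.
  - specialize (HM r Hr). replace (B * M / (1 + r ^ 2)) with (B * (M / (1 + r ^ 2))) by (unfold Rdiv; ring).
    replace (exp (- (c * t * r ^ 4)) * (B * (1 + r) ^ p)) with (B * ((1 + r) ^ p * exp (- (c * t * r ^ 4)))) by ring.
    apply Rmult_le_compat_l; auto.
Qed.

(** Near the real axis the heat factor alone justifies the rotation, so that x = 0 is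
    allowed and [rho] may grow. *)
Lemma kernel_rotate a b rho n x t q B : a <= b -> 0 <= x -> 0 < t -> 0 <= B ->
  (forall theta, a <= theta <= b -> 0 <= sin theta /\ cos (PI / 4) <= cos (4 * theta)) ->
  Hol (sector a b) rho ->
  (forall r theta, 0 <= r -> a <= theta <= b -> Cmod (rho (ray theta r)) <= B * (1 + r) ^ q) ->
  ray_family a (kernel rho) n 0 x t = ray_family b (kernel rho) n 0 x t.
Proof.
  intros Hab Hx Ht HB Hang Hrho Hb.
  destruct (heat_sector_bound a b (n + q) t B (cos (PI / 4)) cos_PI4_pos Ht HB) as [M HM].
  { intros; apply Hang; auto. }
  apply (sector_rotate _ a b M); auto.
  - apply Hol_mult; [apply Hol_osc|]. apply Hol_mult; [apply Hol_iz_pow|]. apply Hol_kernel; auto.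
  - intros r theta Hr Hth. destruct (Hang theta Hth) as [Hs _].
    specialize (HM r theta (r ^ n * Cmod (rho (ray theta r))) Hr Hth
      (pow_mul_1p r n B q _ Hr (Cmod_ge_0 _) (Hb r theta Hr Hth))).
    unfold kernel. rewrite !Cmod_mult, Cmod_iz_pow by auto. simpl. rewrite Cmod_1.
    pose proof (Cmod_osc_le_1 theta r x Hs Hr Hx). pose proof (Cmod_ge_0 (osc x (ray theta r))).
    assert (0 <= Cmod (heat t (ray theta r)) * (r ^ n * Cmod (rho (ray theta r)))).
    { apply Rmult_le_pos; [apply Cmod_ge_0|]. apply Rmult_le_pos; [apply pow_le; auto|apply Cmod_ge_0]. }
    replace (Cmod (osc x (ray theta r)) * (r ^ n * (1 * (Cmod (heat t (ray theta r)) * Cmod (rho (ray theta r))))))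
      with (Cmod (osc x (ray theta r)) * (Cmod (heat t (ray theta r)) * (r ^ n * Cmod (rho (ray theta r))))) by ring.
    eapply Rle_trans; [apply mul_le_1; auto|exact HM].
Qed.

(** The real line bent upwards, so that [osc] decays along it as well. *)
Definition int_bent (F : C -> C) : C := (int_ray (PI / 16) F - int_ray (15 * PI / 16) F)%C.

Definition line_family (rho : C -> C) (n m : nat) (x t : R) : C :=
  (ray_family 0 (kernel rho) n m x t - ray_family PI (kernel rho) n m x t)%C.

Definition bent_family (rho : C -> C) (n m : nat) (x t : R) : C :=
  (ray_family (PI / 16) (kernel rho) n m x t - ray_family (15 * PI / 16) (kernel rho) n m x t)%C.

Lemma line_bent rho n x t B : 0 <= x -> 0 < t -> 0 <= B ->
  Hol (sector 0 (PI / 16)) rho -> Hol (sector (15 * PI / 16) PI) rho ->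
  (forall r theta, 0 <= r -> (0 <= theta <= PI / 16 \/ 15 * PI / 16 <= theta <= PI) -> Cmod (rho (ray theta r)) <= B) ->
  line_family rho n 0 x t = bent_family rho n 0 x t.
Proof.
  intros Hx Ht HB H1 H2 Hb. pose proof PI_RGT_0 as HPI. unfold line_family, bent_family.
  assert (E1 : ray_family 0 (kernel rho) n 0 x t = ray_family (PI / 16) (kernel rho) n 0 x t).
  { apply (kernel_rotate 0 (PI / 16) rho n x t 0 B); auto; try lra.
    + intros theta Hth. split; [apply sin_ge_0; lra|apply cos4_pos; auto].
    + intros r theta Hr Hth. simpl. rewrite Rmult_1_r. auto. }
  assert (E2 : ray_family (15 * PI / 16) (kernel rho) n 0 x t = ray_family PI (kernel rho) n 0 x t).
  { apply (kernel_rotate (15 * PI / 16) PI rho n x t 0 B); auto; try lra.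
    + intros theta Hth. split; [apply sin_ge_0; lra|apply cos4_pos; auto].
    + intros r theta Hr Hth. simpl. rewrite Rmult_1_r. auto. }
  rewrite E1, E2. reflexivity.
Qed.

Lemma bent_tlim rho n : ray_growth (PI / 16) rho -> ray_growth (15 * PI / 16) rho ->
  tlim (bent_family rho n 0) (fun x => int_bent (fun l => osc x l * ((Ci * l) ^ n * kernel rho 0 0 l))%C).
Proof.
  intros H1 H2. pose proof PI_RGT_0 as HPI. pose proof sin_PI16_pos.
  apply (tlim_minus _ _ _ _ (kernel_tlim (PI / 16) rho n 0 ltac:(lra) ltac:(apply cos4_nonneg; lra) H1)
    (kernel_tlim (15 * PI / 16) rho n 0 ltac:(pose proof (sin_sector (15 * PI / 16) ltac:(lra)); lra) ltac:(apply cos4_nonneg; lra) H2)).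
Qed.

(** ** The limit of the integral over the real line as t tends to 0 *)

(** The combinations f + f' and f - f' are what is left when [1 + i z] multiplies
    [hat f], and when [1 + w] multiplies [conv f w], respectively. *)
Definition sum_jet (D : nat -> R -> C) : nat -> R -> C := fun k x => (D k x + shift D k x)%C.
Definition diff_jet (D : nat -> R -> C) : nat -> R -> C := fun k x => (D k x - shift D k x)%C.

Lemma schwartz_sum_jet D : schwartz D -> schwartz (sum_jet D).
Proof. intros H. apply schwartz_plus; auto. apply schwartz_shift; auto. Qed.

Lemma hat_plus D E z : schwartz D -> schwartz E -> Im z <= 0 ->
  hat (fun x => D 0%nat x + E 0%nat x)%C z = (hat (D 0%nat) z + hat (E 0%nat) z)%C.
Proof.
  intros HD HE Hz. destruct (hat_dominated D HD) as [M [_ HM]], (hat_dominated E HE) as [N [_ HN]].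
  rewrite !hat_half. rewrite <- (half_plus M N) by auto.
  apply (half_ext (M + N)).
  - eapply dominated_ext; [|apply (dominated_plus M N); [apply (HM z Hz)|apply (HN z Hz)]]. intros; simpl; ring.
  - intros; simpl; ring.
Qed.

Lemma hat_sum_jet D z : schwartz D -> Im z <= 0 ->
  ((1 + Ci * z) * hat (D 0%nat) z = D 0%nat 0 + hat (sum_jet D 0%nat) z)%C.
Proof.
  intros HD Hz. assert (P := hat_parts D z HD Hz).
  replace (hat (sum_jet D 0%nat) z) with (hat (D 0%nat) z + hat (shift D 0%nat) z)%C.
  - unfold shift. replace ((1 + Ci * z) * hat (D 0%nat) z)%C with (hat (D 0%nat) z + Ci * z * hat (D 0%nat) z)%C by ring.
    rewrite P. ring.
  - rewrite <- (hat_plus D (shift D)); auto. apply schwartz_shift; auto.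
Qed.

Lemma hat_decay D : schwartz D -> exists M, 0 <= M /\ forall z, Im z <= 0 ->
  (1 + Cmod z) * Cmod (hat (D 0%nat) z) <= M.
Proof.
  intros HD. destruct (hat_bound D HD) as [M [HM0 HM]]. destruct (hat_bound _ (schwartz_shift D HD)) as [N [HN0 HN]].
  exists (M + (N + Cmod (D 0%nat 0))). pose proof (Cmod_ge_0 (D 0%nat 0)). split; [lra|]. intros z Hz.
  assert (P := hat_parts D z HD Hz). specialize (HM z Hz). specialize (HN z Hz). unfold shift in HN.
  assert (E : Cmod z * Cmod (hat (D 0%nat) z) = Cmod (Ci * z * hat (D 0%nat) z)).
  { rewrite !Cmod_mult, Cmod_Ci. ring. }
  rewrite P in E. pose proof (Cmod_triangle (hat (D 1%nat) z) (D 0%nat 0)). lra.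
Qed.

Lemma conv_decay G T : jet G -> exists M, 0 <= M /\ forall w t, 0 <= Re w -> 0 <= t <= T ->
  (1 + Cmod w) * Cmod (conv (G 0%nat) w t) <= M.
Proof.
  intros HG. destruct (Ccont_bounded (G 0%nat) 0 T) as [A [HA0 HA]]; [intros; apply HG|].
  destruct (Ccont_bounded (G 1%nat) 0 T) as [B [HB0 HB]]; [intros; apply HG|].
  exists (A * Rabs T + (A + A + B * Rabs T)). pose proof (Rabs_pos T) as HT. pose proof (Rle_abs T) as HT'.
  assert (0 <= A * Rabs T) by nra. assert (0 <= B * Rabs T) by nra. split; [lra|]. intros w t Hw Ht.
  assert (P := conv_parts G w t HG (proj1 Ht)).
  assert (E : Cmod w * Cmod (conv (G 0%nat) w t) = Cmod (w * conv (G 0%nat) w t)) by (rewrite Cmod_mult; ring).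
  rewrite P in E.
  assert (C0 := conv_bound (G 0%nat) w t A ltac:(apply HG) (proj1 Ht) Hw ltac:(intros; apply HA; lra)).
  assert (C1 := conv_bound (G 1%nat) w t B ltac:(apply HG) (proj1 Ht) Hw ltac:(intros; apply HB; lra)).
  assert (A * t <= A * Rabs T) by nra. assert (B * t <= B * Rabs T) by nra.
  assert (T1 := Cmod_triangle_minus (G 0%nat t - Cexp (- (w * t)) * G 0%nat 0) (conv (G 1%nat) w t)).
  assert (T2 := Cmod_triangle_minus (G 0%nat t) (Cexp (- (w * t)) * G 0%nat 0)).
  rewrite Cmod_mult in T2. assert (K := Cmod_conv_kernel w t Hw (proj1 Ht)).
  assert (A1 := HA t ltac:(lra)). assert (A2 := HA 0 ltac:(lra)). pose proof (Cmod_ge_0 (G 0%nat 0)).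
  pose proof (Cmod_ge_0 (Cexp (- (w * t)))).
  assert (Cmod (Cexp (- (w * t))) * Cmod (G 0%nat 0) <= 1 * A) by (apply Rmult_le_compat; auto).
  lra.
Qed.

Lemma real_ray_lower theta : theta = 0 \/ theta = PI -> sin theta = 0.
Proof. intros [-> | ->]; [apply sin_0|apply sin_PI]. Qed.

Lemma real_ray_cos4 theta : theta = 0 \/ theta = PI -> cos (4 * theta) = 1.
Proof.
  intros [-> | ->]; [rewrite Rmult_0_r; apply cos_0|].
  rewrite <- (cos_period (4 * PI) 2). simpl. replace (4 * PI - _) with 0 by ring. apply cos_0.
Qed.

Lemma ray_growth_hat D theta : theta = 0 \/ theta = PI -> schwartz D -> ray_growth theta (hat (D 0%nat)).
Proof.
  intros Ht HD. split.
  - apply (Hol_subset (fun z => Im z <= 0)); [|apply hat_Hol; auto].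
    intros z [r [Hr ->]]. apply ray_real_lower, real_ray_lower; auto.
  - destruct (hat_bound D HD) as [M [HM0 HM]]. exists 0%nat, M. split; auto. intros r Hr. simpl. rewrite Rmult_1_r.
    apply HM. apply ray_real_lower, real_ray_lower; auto.
Qed.

(** By [hat_sum_jet], [hat f] is the sum of this absolutely integrable function and of
    [f 0 / (1 + i l)]. *)
Definition hat_rest (D : nat -> R -> C) (l : C) : C := (hat (sum_jet D 0%nat) l * / (1 + Ci * l))%C.

Lemma hat_rest_dominated D : schwartz D -> exists M, forall theta r, (theta = 0 \/ theta = PI) -> 0 <= r ->
  Cmod (hat_rest D (ray theta r)) <= M / (1 + r ^ 2).
Proof.
  intros HD. destruct (hat_decay _ (schwartz_sum_jet D HD)) as [M [HM0 HM]].
  exists (M / / 2). intros theta r Ht Hr. assert (Hs := real_ray_lower theta Ht).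
  apply two_factors_mul; auto; [lra| |apply one_plus_il_lower; auto; lra].
  specialize (HM (ray theta r) (ray_real_lower theta r Hs)). rewrite Cmod_ray in HM; auto.
Qed.

Lemma hat_rest_Hol D theta : (theta = 0 \/ theta = PI) -> schwartz D -> Hol (on_ray theta) (hat_rest D).
Proof.
  intros Ht HD. assert (Hs := real_ray_lower theta Ht). apply Hol_mult.
  - apply (ray_growth_hat (sum_jet D)); auto. apply schwartz_sum_jet; auto.
  - apply (Hol_inv _ (fun l => 1 + Ci * l)%C (/ 2)); [lra| |apply Hol_one_plus_il].
    intros z [r [Hr ->]]. pose proof (one_plus_il_lower theta r Hr ltac:(lra)). lra.
Qed.

(** It is not absolutely integrable on the real line, and is integrated over the bent
    line instead. *)
Definition pole_i (l : C) : C := (/ (1 + Ci * l))%C.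

Lemma pole_i_bent theta : (0 <= theta <= PI / 16 \/ 15 * PI / 16 <= theta <= PI) -> forall r, / 2 <= Cmod (1 + Ci * ray theta r).
Proof.
  intros H r. pose proof PI_RGT_0 as HPI. apply one_plus_il_lower'. apply cos_sqr_half. apply cos2_nonneg. lra.
Qed.

Lemma pole_i_bound theta : (0 <= theta <= PI / 16 \/ 15 * PI / 16 <= theta <= PI) -> forall r, Cmod (pole_i (ray theta r)) <= 2.
Proof.
  intros H r. assert (L := pole_i_bent theta H r). unfold pole_i.
  rewrite Cmod_inv by (apply (Cmod_pos_neq _ (/ 2)); auto; lra).
  replace 2 with (/ / 2) by field. apply Rinv_le_contravar; lra.
Qed.

Lemma pole_i_sector : Hol (sector 0 (PI / 16)) pole_i /\ Hol (sector (15 * PI / 16) PI) pole_i.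
Proof.
  split; apply (sector_Hol_inv _ _ (fun l => 1 + Ci * l)%C (/ 2)); try lra; try apply Hol_one_plus_il;
  intros; apply pole_i_bent; auto.
Qed.

Lemma pole_i_growth : ray_growth (PI / 16) pole_i /\ ray_growth (15 * PI / 16) pole_i.
Proof.
  pose proof PI_RGT_0 as HPI. destruct pole_i_sector as [H1 H2].
  split; (split; [|exists 0%nat, 2; split; [lra|]; intros; simpl; rewrite Rmult_1_r; apply pole_i_bound; lra]).
  - eapply Hol_subset; [|exact H1]. apply sector_on_ray; lra.
  - eapply Hol_subset; [|exact H2]. apply sector_on_ray; lra.
Qed.

Lemma heat_0 l : heat 0 l = 1%C.
Proof. unfold heat. rewrite Cmult_0_r, <- Cexp_0. f_equal. ring. Qed.

Lemma osc_0 l : osc 0 l = 1%C.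
Proof. unfold osc. rewrite Cmult_0_r. apply Cexp_0. Qed.

Lemma rest_ray_tlim D theta : (theta = 0 \/ theta = PI) -> schwartz D ->
  tlim (ray_family theta (kernel (hat_rest D)) 0 0) (fun x => int_ray theta (fun l => osc x l * hat_rest D l)%C).
Proof.
  intros Ht HD. assert (Hs := real_ray_lower theta Ht). assert (Hc := real_ray_cos4 theta Ht).
  destruct (hat_rest_dominated D HD) as [M HM].
  assert (T := ray_tlim theta (fun t l => (Ci * l) ^ 0 * kernel (hat_rest D) 0 t l)%C).
  eapply tlim_ext; [| |apply T].
  - intros; reflexivity.
  - intros x Hx. symmetry. apply (int_ray_ext theta M).
    + apply ray_dominated_intro; [apply Hol_mult; [apply Hol_osc|apply hat_rest_Hol; auto]|].
      intros r Hr. rewrite Cmod_mult. specialize (HM theta r Ht Hr).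
      pose proof (Cmod_osc_le_1 theta r x ltac:(lra) Hr ltac:(lra)). pose proof (Cmod_ge_0 (hat_rest D (ray theta r))).
      pose proof (Cmod_ge_0 (osc x (ray theta r))). nra.
    + intros r Hr. unfold kernel. rewrite heat_0. simpl. ring.
  - lra.
  - intros; apply Hol_mult; [apply Hol_iz_pow|]. apply Hol_kernel. apply hat_rest_Hol; auto.
  - intros x0 Hx0. exists M. intros x t r Hx Htt Hr. unfold kernel. rewrite !Cmod_mult. simpl. rewrite Cmod_1.
    specialize (HM theta r Ht Hr). 
    pose proof (Cmod_osc_le_1 theta r x ltac:(lra) Hr ltac:(lra)). pose proof (Cmod_heat_le_1 theta r t ltac:(lra) Hr ltac:(lra)).
    pose proof (Cmod_ge_0 (hat_rest D (ray theta r))). pose proof (Cmod_ge_0 (osc x (ray theta r))).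
    pose proof (Cmod_ge_0 (heat t (ray theta r))).
    assert (Cmod (heat t (ray theta r)) * Cmod (hat_rest D (ray theta r)) <= Cmod (hat_rest D (ray theta r)))
      by (apply mul_le_1; auto).
    assert (0 <= Cmod (heat t (ray theta r)) * Cmod (hat_rest D (ray theta r))) by (apply Rmult_le_pos; auto).
    simpl in HM. rewrite !Rmult_1_l. eapply Rle_trans; [apply mul_le_1; auto|]. lra.
  - intros L HL. exists (2 * L ^ 4 * Rabs M). intros t r Htt Hr. unfold kernel. rewrite heat_0.
    replace ((Ci * ray theta r) ^ 0 * ((- omega (ray theta r)) ^ 0 * (heat t (ray theta r) * hat_rest D (ray theta r))) -
      (Ci * ray theta r) ^ 0 * ((- omega (ray theta r)) ^ 0 * (1 * hat_rest D (ray theta r))))%C with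
      ((heat t (ray theta r) - 1) * hat_rest D (ray theta r))%C by (simpl; ring).
    rewrite Cmod_mult.
    assert (A := heat_minus_1 theta r t ltac:(lra) ltac:(lra) ltac:(lra)).
    specialize (HM theta r Ht ltac:(lra)).
    assert (B : Cmod (hat_rest D (ray theta r)) <= Rabs M).
    { eapply Rle_trans; [exact HM|apply poisson_le_Rabs]. }
    apply Rle_trans with ((2 * L ^ 4 * t) * Rabs M); [|right; ring].
    apply Rmult_le_compat; try apply Cmod_ge_0; auto.
    eapply Rle_trans; [exact A|]. assert (r ^ 4 <= L ^ 4) by (apply pow_incr; auto). nra.
Qed.

Lemma ray_family_kernel_dominated theta rho n m x t : 0 <= sin theta -> 0 < cos (4 * theta) -> 0 <= x -> 0 < t ->
  ray_growth theta rho -> exists M, ray_dominated theta M (fun l => osc x l * ((Ci * l) ^ n * kernel rho m t l))%C.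
Proof.
  intros Hs Hc Hx Ht Hr. destruct (kernel_bound theta rho m (proj1 Hr) Hr) as [q [B [HB0 HB]]].
  destruct (heat_decay theta (n + q) t B Hc Ht HB0) as [M HM]. exists M.
  apply ray_dominated_intro.
  - apply Hol_mult; [apply Hol_osc|]. apply Hol_mult; [apply Hol_iz_pow|apply Hol_kernel; apply Hr].
  - intros r Hr0. rewrite !Cmod_mult, Cmod_iz_pow by auto. destruct (HB t r Hr0) as [v [Hv ->]].
    assert (HM' := HM t r (r ^ n * v) ltac:(lra) Hr0 (pow_mul_1p r n B q v Hr0 (proj1 Hv) (proj2 Hv))).
    pose proof (Cmod_osc_le_1 theta r x Hs Hr0 Hx). pose proof (Cmod_ge_0 (osc x (ray theta r))).
    assert (0 <= r ^ n * (Cmod (heat t (ray theta r)) * v)).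
    { apply Rmult_le_pos; [apply pow_le; auto|]. apply Rmult_le_pos; [apply Cmod_ge_0|lra]. }
    replace (Cmod (heat t (ray theta r)) * (r ^ n * v)) with (r ^ n * (Cmod (heat t (ray theta r)) * v)) in HM' by ring.
    nra.
Qed.

Lemma line_family_split rho rho1 rho2 c n n' x t : 0 <= x -> 0 < t ->
  (forall theta, theta = 0 \/ theta = PI -> ray_growth theta rho1 /\ ray_growth theta rho2 /\
     forall r, 0 <= r -> ((Ci * ray theta r) ^ n * rho (ray theta r) =
        (Ci * ray theta r) ^ n' * (c * rho1 (ray theta r) + rho2 (ray theta r)))%C) ->
  line_family rho n 0 x t = (c * line_family rho1 n' 0 x t + line_family rho2 n' 0 x t)%C.
Proof.
  intros Hx Ht H.
  assert (G : forall theta, theta = 0 \/ theta = PI ->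
    ray_family theta (kernel rho) n 0 x t =
    (c * ray_family theta (kernel rho1) n' 0 x t + ray_family theta (kernel rho2) n' 0 x t)%C).
  { intros theta Hth. destruct (H theta Hth) as [G1 [G2 E]].
    assert (Hs := real_ray_lower theta Hth). assert (Hc := real_ray_cos4 theta Hth).
    destruct (ray_family_kernel_dominated theta rho1 n' 0 x t ltac:(lra) ltac:(lra) Hx Ht G1) as [M1 D1].
    destruct (ray_family_kernel_dominated theta rho2 n' 0 x t ltac:(lra) ltac:(lra) Hx Ht G2) as [M2 D2].
    unfold ray_family. rewrite <- (int_ray_scal theta M1) by auto.
    assert (DS := ray_dominated_scal theta M1 c _ D1).
    rewrite <- (int_ray_plus theta _ M2 _ _ DS D2). symmetry.
    apply (int_ray_ext theta (Cmod c * M1 + M2)); [apply ray_dominated_plus; auto|].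
    intros r Hr. specialize (E r (Rlt_le _ _ Hr)). unfold kernel.
    replace ((Ci * ray theta r) ^ n * ((- omega (ray theta r)) ^ 0 * (heat t (ray theta r) * rho (ray theta r))))%C
      with (heat t (ray theta r) * ((Ci * ray theta r) ^ n * rho (ray theta r)))%C by (simpl; ring).
    rewrite E. simpl. ring. }
  unfold line_family. rewrite (G 0), (G PI) by auto. ring.
Qed.

Definition one_C (l : C) : C := 1%C.

Lemma ray_growth_one theta : ray_growth theta one_C.
Proof.
  split; [apply Hol_const|]. exists 0%nat, 1. split; [lra|]. intros. unfold one_C. rewrite Cmod_1. simpl. lra.
Qed.

(** For t > 0 the line may be bent, and there the limit is taken by dominated
    convergence. *)
Lemma line_tlim_bent rho n B : 0 <= B -> Hol (sector 0 (PI / 16)) rho -> Hol (sector (15 * PI / 16) PI) rho ->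
  (forall r theta, 0 <= r -> (0 <= theta <= PI / 16 \/ 15 * PI / 16 <= theta <= PI) -> Cmod (rho (ray theta r)) <= B) ->
  tlim (line_family rho n 0) (fun x => int_bent (fun l => osc x l * ((Ci * l) ^ n * kernel rho 0 0 l))%C).
Proof.
  intros HB H1 H2 Hb. pose proof PI_RGT_0 as HPI. eapply tlim_ext; [| |apply bent_tlim].
  - intros x t Hx Ht. symmetry. apply (line_bent rho n x t B); auto; lra.
  - reflexivity.
  - split; [eapply Hol_subset; [|exact H1]; apply sector_on_ray; lra|].
    exists 0%nat, B. split; auto. intros r Hr. simpl. rewrite Rmult_1_r. apply Hb; auto; lra.
  - split; [eapply Hol_subset; [|exact H2]; apply sector_on_ray; lra|].
    exists 0%nat, B. split; auto. intros r Hr. simpl. rewrite Rmult_1_r. apply Hb; auto; lra.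
Qed.

(** The part [f 0 / (1 + i l)] of the transform is treated on the bent line, and the
    rest on the real axis. The limit is kept explicit for the inversion formula. *)
Lemma line_tlim_0 D : schwartz D ->
  tlim (line_family (hat (D 0%nat)) 0 0)
    (fun x => D 0%nat 0 * int_bent (fun l => osc x l * ((Ci * l) ^ 0 * kernel pole_i 0 0 l))
              + int_real (fun l => osc x l * hat_rest D l))%C.
Proof.
  intros HD. destruct pole_i_sector as [P1 P2].
  eapply tlim_ext; [| |apply (tlim_plus _ _ _ _ (tlim_scal (D 0%nat 0) _ _ (line_tlim_bent pole_i 0 2 ltac:(lra) P1 P2
      (fun r theta _ H => pole_i_bound theta H r)))
    (tlim_minus _ _ _ _ (rest_ray_tlim D 0 (or_introl eq_refl) HD) (rest_ray_tlim D PI (or_intror eq_refl) HD)))].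
  - intros x t Hx Ht. symmetry. apply line_family_split; auto; [lra|].
    intros theta Hth. pose proof PI_RGT_0 as HPI. assert (Hs := real_ray_lower theta Hth). split; [|split].
    + split; [destruct Hth as [-> | ->]; [eapply Hol_subset; [|exact P1]|eapply Hol_subset; [|exact P2]]; apply sector_on_ray; lra|].
      exists 0%nat, 2. split; [lra|]. intros. simpl. rewrite Rmult_1_r. apply pole_i_bound. lra.
    + split; [apply hat_rest_Hol; auto|]. destruct (hat_rest_dominated D HD) as [M HM].
      exists 0%nat, (Rabs M). split; [apply Rabs_pos|]. intros r Hr. eapply Rle_trans; [apply HM; auto|].
      rewrite pow_O, Rmult_1_r. apply poisson_le_Rabs.
    + intros r Hr. f_equal. unfold hat_rest, pole_i.
      assert (E := hat_sum_jet D (ray theta r) HD (ray_real_lower theta r Hs)).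
      assert (NZ : (1 + Ci * ray theta r)%C <> 0%C).
      { apply (Cmod_pos_neq _ (/ 2)); [lra|]. pose proof (one_plus_il_lower theta r Hr ltac:(lra)). lra. }
      replace (hat (D 0%nat) (ray theta r)) with ((1 + Ci * ray theta r) * hat (D 0%nat) (ray theta r) * / (1 + Ci * ray theta r))%C by (field; auto).
      rewrite E. ring.
  - reflexivity.
Qed.

(** Each factor [i l] is absorbed by [hat_parts], at the price of a constant, which is
    integrated over the bent line. *)
Lemma line_tlim n : forall D, schwartz D -> exists a, tlim (line_family (hat (D 0%nat)) n 0) a.
Proof.
  induction n; intros D HD.
  - eexists. apply line_tlim_0; auto.
  - destruct (IHn (shift D) (schwartz_shift D HD)) as [a Ha].
    assert (B := line_tlim_bent one_C n 1 ltac:(lra) (Hol_const _ _) (Hol_const _ _)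
      ltac:(intros; unfold one_C; rewrite Cmod_1; lra)).
    eexists. eapply tlim_ext; [| |apply (tlim_plus _ _ _ _ (tlim_scal (D 0%nat 0) _ _ B) Ha)]; [|reflexivity].
    intros x t Hx Ht. symmetry. apply line_family_split; [lra|auto|].
    intros theta Hth. split; [apply ray_growth_one|split].
    + apply (ray_growth_hat (shift D)); auto. apply schwartz_shift; auto.
    + intros r Hr. cbn [Cpow]. unfold one_C, shift.
      assert (E := hat_parts D (ray theta r) HD (ray_real_lower theta r (real_ray_lower theta Hth))).
      replace (Ci * ray theta r * (Ci * ray theta r) ^ n * hat (D 0%nat) (ray theta r))%C with
        ((Ci * ray theta r) ^ n * (Ci * ray theta r * hat (D 0%nat) (ray theta r)))%C by ring.
      rewrite E. ring.
Qed.

(** Up to the sign, a derivative in t is four derivatives in x. *)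
Lemma ray_family_kernel_time theta rho n m x t : 
  (exists M, ray_dominated theta M (fun l => osc x l * ((Ci * l) ^ n * kernel rho m t l))%C) ->
  (exists M, ray_dominated theta M (fun l => osc x l * ((Ci * l) ^ (n + 4 * m) * kernel rho 0 t l))%C) ->
  ray_family theta (kernel rho) n m x t = ((- (1)) ^ m * ray_family theta (kernel rho) (n + 4 * m) 0 x t)%C.
Proof.
  intros [M HM] [N HN]. unfold ray_family. rewrite <- (int_ray_scal theta N) by auto.
  apply (int_ray_ext theta M); auto. intros r Hr. unfold kernel.
  rewrite (Cpow_add_r _ n (4 * m)), (Cpow_mult_r _ 4 m).
  replace ((Ci * ray theta r) ^ 4)%C with (omega (ray theta r)).
  2:{ unfold omega. rewrite Cpow_mult_l. replace (Ci ^ 4)%C with (RtoC 1); [ring|].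
      apply C_eq; simpl; ring. }
  replace (- omega (ray theta r))%C with (- (1) * omega (ray theta r))%C by ring.
  rewrite (Cpow_mult_l _ _ m). simpl. ring.
Qed.

Lemma line_family_tlim D n m : schwartz D -> exists a, tlim (line_family (hat (D 0%nat)) n m) a.
Proof.
  intros HD. destruct (line_tlim (n + 4 * m) D HD) as [a Ha].
  eexists. eapply tlim_ext; [| |apply (tlim_scal ((- (1)) ^ m)%C _ _ Ha)]; [|reflexivity].
  intros x t Hx Ht. unfold line_family.
  assert (G : forall theta, theta = 0 \/ theta = PI -> ray_family theta (kernel (hat (D 0%nat))) n m x t =
    ((- (1)) ^ m * ray_family theta (kernel (hat (D 0%nat))) (n + 4 * m) 0 x t)%C).
  { intros theta Hth. assert (Hs := real_ray_lower theta Hth). assert (Hc := real_ray_cos4 theta Hth).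
    apply ray_family_kernel_time; apply ray_family_kernel_dominated; auto; try lra; apply ray_growth_hat; auto. }
  rewrite (G 0), (G PI) by auto. ring.
Qed.

(** * Fourier inversion *)

(** Cauchy's theorem in a half-plane: one of the two rays that make up the real line
    is turned onto the other one. *)
Lemma int_real_upper F M : Hol upper F ->
  (forall r theta, 0 <= r -> 0 <= theta <= PI -> Cmod (F (ray theta r)) <= M / (1 + r ^ 2)) ->
  int_real F = 0%C.
Proof.
  intros H HM. pose proof PI_RGT_0. unfold int_real.
  rewrite (int_ray_rotate upper F 0 PI M); auto; [ring|lra|].
  intros r theta Hr Ht. apply ray_upper; auto.
Qed.

Lemma int_real_lower F M : Hol lower F ->
  (forall r theta, 0 <= r -> - PI <= theta <= 0 -> Cmod (F (ray theta r)) <= M / (1 + r ^ 2)) ->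
  int_real F = 0%C.
Proof.
  intros H HM. pose proof PI_RGT_0. unfold int_real.
  rewrite (int_ray_same PI (- PI)).
  - rewrite (int_ray_rotate lower F (- PI) 0 M); auto; [ring|lra|].
    intros r theta Hr Ht. unfold lower. destruct (ray_parts theta r) as [_ ->].
    assert (sin theta <= 0).
    { replace theta with (- (- theta)) by ring. rewrite sin_neg. pose proof (sin_ge_0 (- theta)). lra. }
    nra.
  - rewrite Cexp_i_PI, Cexp_i, cos_neg, sin_neg, cos_PI, sin_PI. apply C_eq; simpl; ring.
Qed.

Lemma int_real_plus M N F G : ray_dominated 0 M F -> ray_dominated PI M F ->
  ray_dominated 0 N G -> ray_dominated PI N G ->
  int_real (fun z => F z + G z)%C = (int_real F + int_real G)%C.
Proof.
  intros A B A' B'. unfold int_real. rewrite (int_ray_plus 0 M N), (int_ray_plus PI M N) by auto. ring.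
Qed.

Lemma int_real_scal M c F : ray_dominated 0 M F -> ray_dominated PI M F ->
  int_real (fun z => c * F z)%C = (c * int_real F)%C.
Proof. intros A B. unfold int_real. rewrite (int_ray_scal 0 M), (int_ray_scal PI M) by auto. ring. Qed.

Lemma half_poisson (c : C) (k : R) : half (fun r => c * (k / (1 + r ^ 2))%R)%C = (c * (k * (PI / 2)))%C.
Proof.
  assert (D : dominated (Cmod (c * k)) (fun r => c * (k / (1 + r ^ 2))%R)%C).
  { apply dominated_cont.
    - intros x. apply Ccont_mult; [apply Ccont_const|]. apply Ccont_RtoC.
      apply (ex_derive_continuous (fun r => k / (1 + r ^ 2))). auto_derive. nra.
    - intros r Hr. assert (0 < 1 + r ^ 2) by nra.
      rewrite !Cmod_mult, !Cmod_R. unfold Rdiv. rewrite Rabs_mult, (Rabs_pos_eq (/ _)); [lra|].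
      left; apply Rinv_0_lt_compat; auto. }
  rewrite (half_derive (fun r => c * (k * atan r)%R)%C _ (Cmod (c * k)) (c * (k * (PI / 2))%R)%C).
  - rewrite atan_0. rewrite !RtoC_mult, RtoC_div by lra. ring.
  - intros x. apply Ccont_mult; [apply Ccont_const|]. apply Ccont_RtoC.
    apply (ex_derive_continuous (fun r => k * atan r)). eexists. apply is_derive_Reals.
    apply (derivable_pt_lim_scal atan k). apply derivable_pt_lim_atan.
  - intros x Hx. apply Cder_scal. split.
    + apply is_derive_Reals. apply (derivable_pt_lim_scal atan k). apply derivable_pt_lim_atan.
    + apply is_derive_Reals. apply derivable_pt_lim_const.
  - intros x. apply Ccont_mult; [apply Ccont_const|]. apply Ccont_RtoC.
    apply (ex_derive_continuous (fun r => k / (1 + r ^ 2))). auto_derive. nra.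
  - exact D.
  - intros eps He. set (q := Cmod c * Rabs k + 1).
    assert (Hq : 0 < q) by (unfold q; pose proof (Cmod_ge_0 c); pose proof (Rabs_pos k); nra).
    destruct (atan_gap (eps / q)) as [N [_ HN]]; [apply Rdiv_lt_0_compat; auto|].
    exists N. intros b Hb. specialize (HN b (Rlt_le _ _ Hb)).
    replace (c * (k * atan b)%R - c * (k * (PI / 2))%R)%C with (c * (k * (atan b - PI / 2))%R)%C
      by (rewrite !RtoC_mult, RtoC_minus; ring).
    rewrite Cmod_mult, Cmod_R, Rabs_mult, <- Rmult_assoc, (Rabs_left (atan b - PI / 2)) by lra.
    apply Rle_lt_trans with (q * (- (atan b - PI / 2))).
    + apply Rmult_le_compat_r; [lra|]. unfold q; lra.
    + apply Rlt_le_trans with (q * (eps / q)); [|right; field; lra]. apply Rmult_lt_compat_l; auto. lra.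
Qed.

Lemma poisson_ray_Hol theta : 0 <= cos (2 * theta) -> Hol (on_ray theta) (fun l => / (1 + l * l))%C.
Proof.
  intros Hc. apply (Hol_inv _ (fun l => 1 + l * l)%C (/ 2)); [lra| |apply Hol_one_plus_sqr].
  intros z [r [Hr ->]]. pose proof (one_plus_sqr_lower theta r Hc). nra.
Qed.

Lemma poisson_bound theta r : 0 <= cos (2 * theta) -> Cmod (/ (1 + ray theta r * ray theta r)) <= 2 / (1 + r ^ 2).
Proof.
  intros Hc. assert (L := one_plus_sqr_lower theta r Hc).
  rewrite Cmod_inv by (apply (Cmod_pos_neq _ (/ 2 * (1 + r * r))); auto; nra).
  replace (2 / (1 + r ^ 2)) with (/ (/ 2 * (1 + r * r))) by (field; nra). apply Rinv_le_contravar; nra.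
Qed.

Lemma cos2_real theta : theta = 0 \/ theta = PI -> cos (2 * theta) = 1.
Proof. intros [-> | ->]; [rewrite Rmult_0_r; apply cos_0|apply cos_2PI]. Qed.

Lemma poisson_dominated theta : theta = 0 \/ theta = PI -> ray_dominated theta 2 (fun l => / (1 + l * l))%C.
Proof.
  intros Ht. assert (Hc := cos2_real theta Ht). apply ray_dominated_intro; [apply poisson_ray_Hol; lra|].
  intros r Hr. apply poisson_bound; lra.
Qed.

Lemma osc_poisson_dominated theta x : theta = 0 \/ theta = PI -> 0 <= x ->
  ray_dominated theta 2 (fun l => osc x l * / (1 + l * l))%C.
Proof.
  intros Ht Hx. assert (Hc := cos2_real theta Ht). assert (Hs := real_ray_lower theta Ht).
  apply ray_dominated_intro; [apply Hol_mult; [apply Hol_osc|apply poisson_ray_Hol; lra]|].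
  intros r Hr. rewrite Cmod_mult. eapply Rle_trans; [apply mul_le_1|apply poisson_bound; lra].
  - apply Cmod_osc_le_1; auto; lra.
  - apply Cmod_ge_0.
Qed.

Lemma int_real_poisson : int_real (fun l => / (1 + l * l))%C = PI.
Proof.
  assert (R1 : forall r : R, (/ (1 + r * r))%C = (1 / (1 + r ^ 2))%R).
  { intros r. assert (1 + r ^ 2 <> 0) by nra. rewrite <- RtoC_mult, <- RtoC_plus.
    replace (1 + r * r) with (1 + r ^ 2) by ring. rewrite <- RtoC_inv by auto. f_equal. field; auto. }
  assert (E0 : int_ray 0 (fun l => / (1 + l * l))%C = (1 * (1 * (PI / 2)))%C).
  { rewrite <- half_poisson. rewrite int_ray_half.
    apply (half_ext 2); [apply (ray_dominated_half 0 2 (fun l => / (1 + l * l))%C); apply poisson_dominated; auto|].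
    intros r Hr. rewrite ray_0, Cexp_i_0, R1. ring. }
  assert (E1 : int_ray PI (fun l => / (1 + l * l))%C = (- (1) * (1 * (PI / 2)))%C).
  { rewrite <- half_poisson. rewrite int_ray_half.
    apply (half_ext 2); [apply (ray_dominated_half PI 2 (fun l => / (1 + l * l))%C); apply poisson_dominated; auto|].
    intros r Hr. rewrite ray_PI, Cexp_i_PI. replace (- r * - r)%C with (r * r)%C by ring. rewrite R1. ring. }
  unfold int_real. rewrite E0, E1. field.
Qed.

(** Since 1/(1+il) + 1/(1-il) = 2/(1+l^2), the pole at i is replaced by the pole at
    -i, which contributes nothing, at the price of the absolutely convergent Poisson
    kernel. *)
Lemma int_bent_pole x : 0 < x ->
  int_bent (fun l => osc x l * ((Ci * l) ^ 0 * kernel pole_i 0 0 l))%C =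
  (2 * int_real (fun l => osc x l * / (1 + l * l)))%C.
Proof.
  intros Hx. pose proof PI_RGT_0 as HPI. pose proof sin_PI16_pos as Hs0.
  destruct pole_i_growth as [[G1 _] [G2 _]].
  assert (SS := sin_sector).
  assert (Low : forall r theta, 0 <= r -> PI / 16 <= theta <= 15 * PI / 16 -> / 2 <= Cmod (1 - Ci * ray theta r)).
  { intros r theta Hr Ht. pose proof (SS theta Ht). pose proof (one_minus_il_lower theta r Hr ltac:(lra)). lra. }
  set (F1 := fun l => (osc x l * / (1 + Ci * l))%C). set (F2 := fun l => (osc x l * / (1 - Ci * l))%C).
  set (F3 := fun l => (osc x l * / (1 + l * l))%C).
  destruct (osc_sector_bound (PI / 16) (15 * PI / 16) 0 x 2 (sin (PI / 16)) Hs0 Hx ltac:(lra) SS) as [M HM].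
  assert (H2 : Hol (sector (PI / 16) (15 * PI / 16)) F2).
  { apply Hol_mult; [apply Hol_osc|]. apply (sector_Hol_inv _ _ (fun l => 1 - Ci * l)%C (/ 2)); auto; [lra|apply Hol_one_minus_il]. }
  assert (B2 : forall r theta, 0 <= r -> PI / 16 <= theta <= 15 * PI / 16 -> Cmod (F2 (ray theta r)) <= M / (1 + r ^ 2)).
  { intros r theta Hr Ht. unfold F2. rewrite Cmod_mult. apply HM; auto. simpl. rewrite Rmult_1_r.
    specialize (Low r theta Hr Ht). rewrite Cmod_inv by (apply (Cmod_pos_neq _ (/ 2)); auto; lra).
    replace 2 with (/ / 2) by field. apply Rinv_le_contravar; lra. }
  assert (R2 := sector_rotate F2 (PI / 16) (15 * PI / 16) M ltac:(lra) H2 B2).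
  assert (D2 : forall theta, theta = PI / 16 \/ theta = 15 * PI / 16 -> ray_dominated theta M F2).
  { intros theta Ht. apply ray_dominated_intro.
    - eapply Hol_subset; [|exact H2]. apply sector_on_ray. lra.
    - intros r Hr. apply B2; auto; lra. }
  assert (D1 : forall theta, theta = PI / 16 \/ theta = 15 * PI / 16 -> ray_dominated theta M F1).
  { intros theta Ht. apply ray_dominated_intro.
    - apply Hol_mult; [apply Hol_osc|]. destruct Ht as [-> | ->]; auto.
    - intros r Hr. unfold F1. rewrite Cmod_mult. apply HM; auto; [lra|]. simpl. rewrite Rmult_1_r.
      apply pole_i_bound; lra. }
  assert (E12 : forall theta, theta = PI / 16 \/ theta = 15 * PI / 16 ->
    (int_ray theta F1 + int_ray theta F2)%C = (2 * int_ray theta F3)%C).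
  { intros theta Ht. assert (C2 : 0 <= cos (2 * theta)) by (apply cos2_nonneg; lra).
    assert (Ts : 0 <= sin theta) by (apply sin_ge_0; lra).
    assert (D3 : ray_dominated theta 2 F3).
    { apply ray_dominated_intro; [apply Hol_mult; [apply Hol_osc|apply poisson_ray_Hol; auto]|].
      intros r Hr. unfold F3. rewrite Cmod_mult. eapply Rle_trans; [apply mul_le_1|apply poisson_bound; auto].
      - apply Cmod_osc_le_1; auto; lra.
      - apply Cmod_ge_0. }
    rewrite <- (int_ray_plus theta M M) by auto. rewrite <- (int_ray_scal theta 2) by auto.
    apply (int_ray_ext theta (M + M)); [apply ray_dominated_plus; auto|].
    intros r Hr. unfold F1, F2, F3.
    assert (N1 : (1 + Ci * ray theta r)%C <> 0%C).
    { apply (Cmod_pos_neq _ (/ 2)); [lra|]. apply pole_i_bent; lra. }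
    assert (N2 : (1 - Ci * ray theta r)%C <> 0%C).
    { apply (Cmod_pos_neq _ (/ 2)); [lra|]. apply Low; lra. }
    assert (E : (1 + ray theta r * ray theta r)%C = ((1 + Ci * ray theta r) * (1 - Ci * ray theta r))%C).
    { replace ((1 + Ci * ray theta r) * (1 - Ci * ray theta r))%C with (1 - (Ci * Ci) * (ray theta r * ray theta r))%C by ring.
      replace (Ci * Ci)%C with (- (1))%C by (apply C_eq; simpl; ring). ring. }
    rewrite E. field. auto. }
  assert (R3 : forall a b, a <= b -> (forall theta, a <= theta <= b -> 0 <= cos (2 * theta) /\ 0 <= sin theta) -> int_ray a F3 = int_ray b F3).
  { intros a b Hab Hang. apply (sector_rotate F3 a b 2); auto.
    - apply Hol_mult; [apply Hol_osc|]. apply (sector_Hol_inv _ _ (fun l => 1 + l * l)%C (/ 2)); [lra| |apply Hol_one_plus_sqr].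
      intros r theta Hr Ht. pose proof (one_plus_sqr_lower theta r (proj1 (Hang theta Ht))). nra.
    - intros r theta Hr Ht. destruct (Hang theta Ht) as [A B]. unfold F3. rewrite Cmod_mult.
      eapply Rle_trans; [apply mul_le_1|apply poisson_bound; auto].
      + apply Cmod_osc_le_1; auto; lra.
      + apply Cmod_ge_0. }
  assert (R3a : int_ray 0 F3 = int_ray (PI / 16) F3).
  { apply R3; [lra|]. intros theta Ht. split; [apply cos2_nonneg; lra|apply sin_ge_0; lra]. }
  assert (R3b : int_ray (15 * PI / 16) F3 = int_ray PI F3).
  { apply R3; [lra|]. intros theta Ht. split; [apply cos2_nonneg; lra|apply sin_ge_0; lra]. }
  assert (EF : forall theta, theta = PI / 16 \/ theta = 15 * PI / 16 ->
    int_ray theta (fun l => osc x l * ((Ci * l) ^ 0 * kernel pole_i 0 0 l))%C = int_ray theta F1).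
  { intros theta Ht. symmetry. apply (int_ray_ext theta M); auto.
    intros r Hr. unfold F1, kernel, pole_i. rewrite heat_0. simpl. ring. }
  (* The Poisson kernel is moved back to the real line, and F2 has the same integral
     over both rays. *)
  unfold int_bent, int_real. rewrite !EF by auto. fold F3. rewrite R3a, <- R3b.
  replace (2 * (int_ray (PI / 16) F3 - int_ray (15 * PI / 16) F3))%C with
    (2 * int_ray (PI / 16) F3 - 2 * int_ray (15 * PI / 16) F3)%C by ring.
  rewrite <- !E12 by auto. rewrite R2. ring.
Qed.

(** The parts of the transform on both sides of the point x are continued analytically
    into opposite half-planes, each with decay of order 1/l^2. *)
Lemma hat_rest_split D x theta r : schwartz D -> 0 < x -> theta = 0 \/ theta = PI -> 0 <= r ->
  let l := ray theta r in
  (osc x l * hat_rest D l =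
     2 * (D 0%nat x * / (1 + l * l)) + - (2) * D 0%nat 0 * (osc x l * / (1 + l * l))
     + conv (diff_jet D 0%nat) (- (Ci * l)) x * / (1 - Ci * l)
     + hat (fun y => sum_jet D 0%nat (x + y)) l * / (1 + Ci * l))%C.
Proof.
  intros HD Hx Ht Hr l. assert (Hs := real_ray_lower theta Ht).
  assert (Hl : Im l <= 0) by (apply ray_real_lower; auto).
  assert (HJ : jet D) by apply HD.
  set (w := (- (Ci * l))%C).
  assert (N1 : (1 + Ci * l)%C <> 0%C).
  { apply (Cmod_pos_neq _ (/ 2)); [lra|]. pose proof (one_plus_il_lower theta r Hr ltac:(lra)). unfold l; lra. }
  assert (N2 : (1 - Ci * l)%C <> 0%C).
  { apply (Cmod_pos_neq _ (/ 2)); [lra|]. pose proof (one_minus_il_lower theta r Hr ltac:(lra)). unfold l; lra. }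
  assert (E : (1 + l * l)%C = ((1 + Ci * l) * (1 - Ci * l))%C).
  { replace ((1 + Ci * l) * (1 - Ci * l))%C with (1 - (Ci * Ci) * (l * l))%C by ring.
    replace (Ci * Ci)%C with (- (1))%C by (apply C_eq; simpl; ring). ring. }
  assert (Ew : Cexp (- (w * x)) = osc x l) by (unfold osc, w; f_equal; ring).
  assert (P := conv_parts D w x HJ (Rlt_le _ _ Hx)). rewrite Ew in P.
  assert (Ex : forall k, ex_RInt ((fun s => Cexp (- (w * (x - s)%R)) * D k s)%C : R -> CR) 0 x).
  { intros k. apply ex_CInt. intros y _. apply Ccont_mult; [apply Ccont_conv_kernel|apply HJ]. }
  assert (S : conv (sum_jet D 0%nat) w x = (conv (D 0%nat) w x + conv (D 1%nat) w x)%C).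
  { unfold conv. rewrite <- CInt_plus by auto. unfold CInt. apply (RInt_ext (V := CR)). intros y _.
    unfold sum_jet, shift. change (@eq C (Cexp (- (w * (x - y)%R)) * (D 0%nat y + D 1%nat y))
      (Cexp (- (w * (x - y)%R)) * D 0%nat y + Cexp (- (w * (x - y)%R)) * D 1%nat y))%C. ring. }
  assert (T : conv (diff_jet D 0%nat) w x = (conv (D 0%nat) w x - conv (D 1%nat) w x)%C).
  { unfold conv. rewrite <- CInt_minus by auto. unfold CInt. apply (RInt_ext (V := CR)). intros y _.
    unfold diff_jet, shift. change (@eq C (Cexp (- (w * (x - y)%R)) * (D 0%nat y - D 1%nat y))
      (Cexp (- (w * (x - y)%R)) * D 0%nat y - Cexp (- (w * (x - y)%R)) * D 1%nat y))%C. ring. }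
  assert (HS := hat_split (sum_jet D) l x (schwartz_sum_jet D HD) Hl (Rlt_le _ _ Hx)).
  change (Cexp (Ci * l * x)) with (osc x l) in HS. fold w in HS. rewrite S in HS.
  unfold hat_rest. rewrite Cmult_assoc, HS, T, E.
  (* With c0, c1 the two convolutions, -i l c0 = f(x) - osc f(0) - c1. *)
  set (c0 := conv (D 0%nat) w x) in *. set (c1 := conv (D 1%nat) w x) in *.
  set (o := osc x l) in *. set (h := hat _ l).
  assert (C1 : c1 = (D 0%nat x - o * D 0%nat 0 - w * c0)%C) by (rewrite P; ring).
  rewrite C1. unfold w. field. auto.
Qed.

(** After [hat_rest_split] the two continued parts integrate to zero by Cauchy's
    theorem, the terms with [osc x l / (1 + l^2)] cancel against [int_bent_pole], and
    [2 f(x) / (1 + l^2)] integrates to [2 PI f(x)]. *)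
Lemma inversion D x : schwartz D -> 0 < x ->
  (D 0%nat 0 * int_bent (fun l => osc x l * ((Ci * l) ^ 0 * kernel pole_i 0 0 l))
   + int_real (fun l => osc x l * hat_rest D l))%C = (2 * PI * D 0%nat x)%C.
Proof.
  intros HD Hx. rewrite (int_bent_pole x Hx).
  assert (HT := schwartz_translate _ x (Rlt_le _ _ Hx) (schwartz_sum_jet D HD)).
  assert (HJ : jet (diff_jet D)) by (apply jet_minus; [apply HD|apply jet_shift, HD]).
  set (F1 := fun l => (/ (1 + l * l))%C). set (F2 := fun l => (osc x l * / (1 + l * l))%C).
  set (F3 := fun l => (conv (diff_jet D 0%nat) (- (Ci * l)) x * / (1 - Ci * l))%C).
  set (F4 := fun l => (hat (fun y => sum_jet D 0%nat (x + y)%R) l * / (1 + Ci * l))%C).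
  assert (Re_w : forall l, upper l -> 0 <= Re (- (Ci * l))).
  { intros l Hl. unfold upper, Re, Im in *. simpl. lra. }
  assert (H3 : Hol upper F3).
  { apply Hol_mult.
    - apply (Hol_comp upper (fun w => 0 <= Re w) (fun w => conv (diff_jet D 0%nat) w x) (fun l => - (Ci * l))%C); auto.
      + apply conv_Hol; [apply HJ|lra].
      + apply Hol_opp, Hol_scal, Hol_id.
    - apply (Hol_inv _ (fun l => 1 - Ci * l)%C 1); [lra| |apply Hol_one_minus_il].
      intros z Hz. apply Cmod_lower; [lra|]. unfold upper, Re, Im in *. simpl.
      replace (1 + - (0 * fst z - 1 * snd z)) with (1 + snd z) by ring.
      pose proof (Rle_0_sqr (0 + - (0 * snd z + 1 * fst z))). unfold Rsqr in *. nra. }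
  destruct (conv_decay (diff_jet D) x HJ) as [A [HA0 HA]].
  assert (B3 : forall r theta, 0 <= r -> 0 <= theta <= PI -> Cmod (F3 (ray theta r)) <= A / / 2 / (1 + r ^ 2)).
  { intros r theta Hr Ht. apply two_factors_mul; auto; [lra| |apply one_minus_il_lower; auto; apply sin_ge_0; lra].
    specialize (HA (- (Ci * ray theta r))%C x (Re_w _ (ray_upper theta r Ht Hr)) ltac:(lra)).
    rewrite Cmod_opp, Cmod_mult, Cmod_Ci, Cmod_ray, Rmult_1_l in HA by auto. exact HA. }
  assert (H4 : Hol lower F4).
  { apply Hol_mult; [apply (hat_Hol _ HT)|].
    apply (Hol_inv _ (fun l => 1 + Ci * l)%C 1); [lra| |apply Hol_one_plus_il].
    intros z Hz. apply Cmod_lower; [lra|]. unfold lower, Re, Im in *. simpl.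
    replace (1 + (0 * fst z - 1 * snd z)) with (1 - snd z) by ring.
    pose proof (Rle_0_sqr (0 + (0 * snd z + 1 * fst z))). unfold Rsqr in *. nra. }
  destruct (hat_decay _ HT) as [B [HB0 HB]].
  assert (Sn : forall theta, - PI <= theta <= 0 -> sin theta <= 0).
  { intros theta Ht. replace theta with (- (- theta)) by ring. rewrite sin_neg. pose proof (sin_ge_0 (- theta)). lra. }
  assert (Lw : forall theta r, sin theta <= 0 -> 0 <= r -> Im (ray theta r) <= 0).
  { intros theta r Hs Hr. destruct (ray_parts theta r) as [_ ->]. nra. }
  assert (B4 : forall r theta, 0 <= r -> sin theta <= 0 -> Cmod (F4 (ray theta r)) <= B / / 2 / (1 + r ^ 2)).
  { intros r theta Hr Ht. apply two_factors_mul; auto; [lra| |apply one_plus_il_lower; auto].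
    specialize (HB (ray theta r) (Lw theta r Ht Hr)). rewrite Cmod_ray in HB by auto. exact HB. }
  pose proof PI_RGT_0 as HPI.
  assert (D3 : forall theta, theta = 0 \/ theta = PI -> ray_dominated theta (A / / 2) F3).
  { intros theta Ht. apply ray_dominated_intro.
    - eapply Hol_subset; [|exact H3]. intros z Hz. apply (on_ray_upper theta); auto. lra.
    - intros r Hr. apply B3; auto. lra. }
  assert (D4 : forall theta, theta = 0 \/ theta = PI -> ray_dominated theta (B / / 2) F4).
  { intros theta Ht. assert (Hs := real_ray_lower theta Ht). apply ray_dominated_intro.
    - eapply Hol_subset; [|exact H4]. intros z [r [Hr ->]]. apply ray_real_lower; auto.
    - intros r Hr. apply B4; auto. lra. }
  assert (D1 : forall theta, theta = 0 \/ theta = PI -> ray_dominated theta 2 F1) by apply poisson_dominated.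
  assert (D2 : forall theta, theta = 0 \/ theta = PI -> ray_dominated theta 2 F2).
  { intros; apply osc_poisson_dominated; auto; lra. }
  pose proof (fun theta Ht => ray_dominated_scal theta 2 (2 * D 0%nat x)%C F1 (D1 theta Ht)) as D1'.
  pose proof (fun theta Ht => ray_dominated_scal theta 2 (- (2) * D 0%nat 0)%C F2 (D2 theta Ht)) as D2'.
  pose proof (fun theta Ht => ray_dominated_plus theta _ _ _ _ (D1' theta Ht) (D2' theta Ht)) as D12.
  pose proof (fun theta Ht => ray_dominated_plus theta _ _ _ _ (D12 theta Ht) (D3 theta Ht)) as D123.
  pose proof (fun theta Ht => ray_dominated_plus theta _ _ _ _ (D123 theta Ht) (D4 theta Ht)) as D1234.
  cbv beta in D12, D123, D1234.
  assert (E : int_real (fun l => osc x l * hat_rest D l)%C =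
    int_real (fun l => 2 * D 0%nat x * F1 l + - (2) * D 0%nat 0 * F2 l + F3 l + F4 l)%C).
  { unfold int_real.
    assert (G : forall theta, theta = 0 \/ theta = PI -> int_ray theta (fun l => osc x l * hat_rest D l)%C =
      int_ray theta (fun l => 2 * D 0%nat x * F1 l + - (2) * D 0%nat 0 * F2 l + F3 l + F4 l)%C).
    { intros theta Ht. symmetry. eapply int_ray_ext; [apply D1234; auto|].
      intros r Hr. cbv beta. rewrite (hat_rest_split D x theta r HD Hx Ht (Rlt_le _ _ Hr)).
      unfold F1, F2, F3, F4. ring. }
    rewrite !G by auto. reflexivity. }
  rewrite E.
  erewrite int_real_plus; [|apply D123; auto|apply D123; auto|apply D4; auto|apply D4; auto].
  erewrite int_real_plus; [|apply D12; auto|apply D12; auto|apply D3; auto|apply D3; auto].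
  erewrite int_real_plus; [|apply D1'; auto|apply D1'; auto|apply D2'; auto|apply D2'; auto].
  erewrite !int_real_scal; [|apply D2; auto|apply D2; auto|apply D1; auto|apply D1; auto].
  rewrite (int_real_upper F3 _ H3 B3).
  rewrite (int_real_lower F4 (B / / 2) H4) by (intros; apply B4; auto).
  unfold F1. rewrite int_real_poisson. fold F2. ring.
Qed.

Lemma line_tlim_value D : schwartz D ->
  tlim (line_family (hat (D 0%nat)) 0 0) (fun x => 2 * PI * D 0%nat x)%C.
Proof.
  intros HD. eapply tlim_ext; [| |apply (line_tlim_0 D HD)]; [reflexivity|].
  intros x Hx. cbv beta. apply inversion; auto.
Qed.

(** * Boundary values of the contribution of the boundary data *)

(** A contour that comes in from infinity along the ray of angle a and leaves along
    the ray of angle b. *)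
Definition wedge (b a : R) (F : C -> C) : C := (int_ray b F - int_ray a F)%C.

Lemma wedge_plus b a M N F G : ray_dominated b M F -> ray_dominated a M F ->
  ray_dominated b N G -> ray_dominated a N G -> wedge b a (fun z => F z + G z)%C = (wedge b a F + wedge b a G)%C.
Proof. intros. unfold wedge. rewrite (int_ray_plus b M N), (int_ray_plus a M N) by auto. ring. Qed.

Lemma wedge_minus b a M N F G : ray_dominated b M F -> ray_dominated a M F ->
  ray_dominated b N G -> ray_dominated a N G -> wedge b a (fun z => F z - G z)%C = (wedge b a F - wedge b a G)%C.
Proof. intros. unfold wedge. rewrite (int_ray_minus b M N), (int_ray_minus a M N) by auto. ring. Qed.

Lemma wedge_scal b a M c F : ray_dominated b M F -> ray_dominated a M F ->
  wedge b a (fun z => c * F z)%C = (c * wedge b a F)%C.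
Proof. intros. unfold wedge. rewrite (int_ray_scal b M), (int_ray_scal a M) by auto. ring. Qed.

Lemma wedge_ext b a M F G : ray_dominated b M F -> ray_dominated a M F ->
  (forall theta r, theta = b \/ theta = a -> 0 < r -> F (ray theta r) = G (ray theta r)) ->
  wedge b a F = wedge b a G.
Proof. intros H1 H2 E. unfold wedge. rewrite (int_ray_ext b M F G), (int_ray_ext a M F G); auto. Qed.

(** Rays along which both exponentials decay. *)
Definition good_angle (theta : R) : Prop := 0 < sin theta /\ 0 < cos (4 * theta).

Definition good_wedge (b a : R) : Prop :=
  b <= a /\ good_angle b /\ good_angle a /\ forall theta, b <= theta <= a -> sin (PI / 16) <= sin theta.

Lemma good_angles : good_angle (PI / 16) /\ good_angle (PI / 2) /\ good_angle (15 * PI / 16).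
Proof.
  pose proof PI_RGT_0. pose proof cos_PI4_pos. pose proof sin_PI16_pos.
  assert (A : forall theta, PI / 16 <= theta <= 15 * PI / 16 ->
    (0 <= theta <= PI / 16 \/ theta = PI / 2 \/ 15 * PI / 16 <= theta <= PI) -> good_angle theta).
  { intros theta H2 H3. split; [pose proof (sin_sector theta H2)|pose proof (cos4_pos theta H3)]; lra. }
  split; [|split]; apply A; lra.
Qed.

Lemma good_wedges : good_wedge (PI / 2) (15 * PI / 16) /\ good_wedge (PI / 16) (PI / 2).
Proof.
  pose proof PI_RGT_0. destruct good_angles as [A1 [A2 A3]].
  split; (split; [lra|split; [auto|split; [auto|intros; apply sin_sector; lra]]]).
Qed.

(** For x > 0 Cauchy's theorem closes the contour at infinity. *)
Lemma wedge_closed b a F x p B : good_wedge b a -> 0 < x -> 0 <= B -> Hol (sector b a) F ->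
  (forall r theta, 0 <= r -> b <= theta <= a -> Cmod (F (ray theta r)) <= B * (1 + r) ^ p) ->
  wedge b a (fun l => osc x l * F l)%C = 0%C.
Proof.
  intros [Hab [_ [_ Hs]]] Hx HB HF Hb.
  destruct (osc_sector_bound b a p x B _ sin_PI16_pos Hx HB Hs) as [M HM].
  unfold wedge. rewrite (sector_rotate (fun l => osc x l * F l)%C b a M); auto; [ring| |].
  - apply Hol_mult; [apply Hol_osc|auto].
  - intros r theta Hr Ht. rewrite Cmod_mult. apply HM; auto.
Qed.

(** On a good ray any factor of polynomial growth is admissible for x > 0. *)
Lemma good_ray_osc_dominated theta F x p B : good_angle theta -> 0 < x -> 0 <= B -> Hol (on_ray theta) F ->
  (forall r, 0 <= r -> Cmod (F (ray theta r)) <= B * (1 + r) ^ p) ->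
  exists M, ray_dominated theta M (fun l => osc x l * F l)%C.
Proof.
  intros [Hs _] Hx HB HF Hb. destruct (osc_decay theta p x B Hs Hx HB) as [M HM]. exists M.
  apply ray_dominated_intro; [apply Hol_mult; [apply Hol_osc|auto]|].
  intros r Hr. rewrite Cmod_mult. apply HM; auto; lra.
Qed.

Lemma ray_dominated_le theta M N F : M <= N -> ray_dominated theta M F -> ray_dominated theta N F.
Proof.
  intros H [H1 H2]; split; auto. intros r Hr. eapply Rle_trans; [apply H2; auto|].
  apply Rmult_le_compat_r; auto. left; apply Rinv_0_lt_compat. nra.
Qed.

Lemma good_wedge_osc_dominated b a F x : good_wedge b a -> 0 < x ->
  ray_growth b F -> ray_growth a F ->
  exists M, ray_dominated b M (fun l => osc x l * F l)%C /\ ray_dominated a M (fun l => osc x l * F l)%C.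
Proof.
  intros [_ [Gb [Ga _]]] Hx [H1 [q1 [B1 [HB1 HB1']]]] [H2 [q2 [B2 [HB2 HB2']]]].
  destruct (good_ray_osc_dominated b F x q1 B1 Gb Hx HB1 H1 HB1') as [M1 D1].
  destruct (good_ray_osc_dominated a F x q2 B2 Ga Hx HB2 H2 HB2') as [M2 D2].
  exists (Rmax M1 M2). split; eapply ray_dominated_le; try eassumption; [apply Rmax_l|apply Rmax_r].
Qed.

Lemma ray_growth_mult theta F G : ray_growth theta F -> ray_growth theta G -> ray_growth theta (fun l => F l * G l)%C.
Proof.
  intros [H1 [q1 [B1 [HB1 HB1']]]] [H2 [q2 [B2 [HB2 HB2']]]]. split; [apply Hol_mult; auto|].
  exists (q1 + q2)%nat, (B1 * B2). split; [nra|]. intros r Hr. rewrite Cmod_mult, pow_add.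
  replace (B1 * B2 * ((1 + r) ^ q1 * (1 + r) ^ q2)) with (B1 * (1 + r) ^ q1 * (B2 * (1 + r) ^ q2)) by ring.
  apply Rmult_le_compat; auto; apply Cmod_ge_0.
Qed.

Lemma ray_growth_pow theta q : ray_growth theta (fun l => l ^ q)%C.
Proof.
  split; [apply (Hol_pow _ (fun l => l)), Hol_id|]. exists q, 1. split; [lra|]. intros r Hr.
  rewrite Cmod_pow, Cmod_ray, Rmult_1_l by auto. apply pow_incr; lra.
Qed.

Lemma ray_growth_heat theta t : 0 <= cos (4 * theta) -> 0 <= t -> ray_growth theta (heat t).
Proof.
  intros Hc Ht. split; [apply Hol_heat|]. exists 0%nat, 1. split; [lra|]. intros r Hr. simpl. rewrite Rmult_1_r.
  apply Cmod_heat_le_1; auto.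
Qed.

Lemma ray_growth_conv theta m G t : 0 <= cos (4 * theta) -> jet G -> 0 <= t ->
  ray_growth theta (fun l => convm m G (omega l) t).
Proof.
  intros Hc HG Ht. split.
  - apply (Hol_comp _ (fun w => 0 <= Re w) (fun w => convm m G w t) omega); [apply Hol_convm; auto|apply Hol_omega|].
    apply on_ray_Re_omega; auto.
  - destruct (bdata_poly_growth theta 0 G m Hc HG t) as [q [B [HB0 HB]]].
    exists q, B. split; auto. intros r Hr. specialize (HB t r ltac:(lra) Hr). unfold bdata in HB.
    simpl in HB. rewrite Cmult_1_l in HB. exact HB.
Qed.

Lemma ray_growth_const theta c : ray_growth theta (fun _ => c).
Proof.
  split; [apply Hol_const|]. exists 0%nat, (Cmod c). split; [apply Cmod_ge_0|]. intros. simpl. lra.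
Qed.

(** The contribution of a boundary datum; q is its power of l in the formula increased
    by the number of derivatives in x. *)
Definition wedge_conv (b a : R) (m q : nat) (G : nat -> R -> C) (x t : R) : C :=
  wedge b a (fun l => osc x l * (l ^ q * convm m G (omega l) t))%C.

Lemma cos4_good theta : good_angle theta -> 0 <= cos (4 * theta).
Proof. intros [_ H]; lra. Qed.

Lemma wedge_conv_growth theta m q G t : good_angle theta -> jet G -> 0 <= t ->
  ray_growth theta (fun l => l ^ q * convm m G (omega l) t)%C.
Proof.
  intros Ha HG Ht. apply (ray_growth_mult theta (fun l => l ^ q)%C); [apply ray_growth_pow|].
  apply ray_growth_conv; auto. apply cos4_good; auto.
Qed.

(** By [conv_decay], [conv] gains a factor 1/(1 + |l|^4); this makes the integrals
    with q <= 2 absolutely convergent for x = 0. *)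
Lemma pow_conv_dominated q G T : (q <= 2)%nat -> jet G -> exists M, forall theta t r,
  0 <= cos (4 * theta) -> 0 <= t <= T -> 0 <= r ->
  Cmod (ray theta r ^ q * conv (G 0%nat) (omega (ray theta r)) t) <= M / (1 + r ^ 2).
Proof.
  intros Hq HG. destruct (conv_decay G T HG) as [M [HM0 HM]]. exists (2 * M).
  intros theta t r Hc Ht Hr. specialize (HM (omega (ray theta r)) t (Re_omega_ray theta r Hc) Ht).
  rewrite Cmod_omega, Cmod_ray in HM by auto. rewrite Cmod_mult, Cmod_pow, Cmod_ray by auto.
  set (v := Cmod (conv (G 0%nat) (omega (ray theta r)) t)) in *.
  assert (Hv : 0 <= v) by apply Cmod_ge_0.
  apply Rmult_le_reg_r with (1 + r ^ 2); [nra|].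
  replace (2 * M / (1 + r ^ 2) * (1 + r ^ 2)) with (2 * M) by (field; nra).
  assert (K : r ^ q * (1 + r ^ 2) <= 2 * (1 + r ^ 4)).
  { assert (S2 : r ^ 2 <= 1 + r ^ 4).
    { replace (r ^ 4) with (r ^ 2 * r ^ 2) by ring. pose proof (pow2_ge_0 (r ^ 2 - 1)).
      pose proof (pow2_ge_0 r). nra. }
    assert (P4 : 0 <= r ^ 4) by (apply pow_le; auto).
    destruct q as [|[|[|]]]; [| | |lia].
    - simpl (r ^ 0). lra.
    - rewrite pow_1. assert (r <= (1 + r ^ 2) / 2) by (pose proof (pow2_ge_0 (r - 1)); lra).
      assert (Q : r * (1 + r ^ 2) <= (1 + r ^ 2) / 2 * (1 + r ^ 2)) by (apply Rmult_le_compat_r; [nra|auto]).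
      replace ((1 + r ^ 2) / 2 * (1 + r ^ 2)) with ((1 + 2 * r ^ 2 + r ^ 4) / 2) in Q by field. lra.
    - replace (r ^ 2 * (1 + r ^ 2)) with (r ^ 2 + r ^ 4) by ring. lra. }
  replace (r ^ q * v * (1 + r ^ 2)) with (r ^ q * (1 + r ^ 2) * v) by ring.
  apply Rle_trans with (2 * (1 + r ^ 4) * v); [apply Rmult_le_compat_r; auto|lra].
Qed.

Lemma wedge_xlim b a (F : R -> C -> C) : good_angle b -> good_angle a ->
  (forall theta t, good_angle theta -> 0 < t -> Hol (on_ray theta) (F t)) ->
  (forall T, exists M, forall theta t r, good_angle theta -> 0 < t <= T -> 0 <= r ->
     Cmod (F t (ray theta r)) <= M / (1 + r ^ 2)) ->
  xlim (fun x t => wedge b a (fun l => osc x l * F t l)%C) (fun t => wedge b a (F t)).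
Proof.
  intros Gb Ga HF HB.
  apply xlim_minus; apply ray_xlim; auto.
  1,3: apply Rlt_le; [apply Gb || apply Ga].
  - intros t0 T Ht0 HT. destruct (HB T) as [M HM]. exists M. intros; apply HM; auto; lra.
  - intros t0 T Ht0 HT. destruct (HB T) as [M HM]. exists M. intros; apply HM; auto; lra.
Qed.

Lemma conv_comp_Hol theta m G t : 0 <= cos (4 * theta) -> jet G -> 0 <= t ->
  Hol (on_ray theta) (fun l => convm m G (omega l) t).
Proof. intros; apply ray_growth_conv; auto. Qed.

Lemma wedge_conv_xlim_low b a q G : good_wedge b a -> (q <= 2)%nat -> jet G ->
  xlim (wedge_conv b a 0 q G) (fun t => wedge b a (fun l => l ^ q * conv (G 0%nat) (omega l) t)%C).
Proof.
  intros [_ [Gb [Ga _]]] Hq HG.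
  apply (wedge_xlim b a (fun t l => l ^ q * conv (G 0%nat) (omega l) t)%C); auto.
  - intros theta t Gt Ht. apply (wedge_conv_growth theta 0 q G t); auto. lra.
  - intros T. destruct (pow_conv_dominated q G T Hq HG) as [M HM]. exists M.
    intros theta t r Gt Ht Hr. apply HM; auto; [apply cos4_good; auto|lra].
Qed.

(** The factor [(Ci * l) ^ 0] gives the integrand the shape of a [ray_family]. *)
Definition wedge_heat (b a : R) (rho : C -> C) (m : nat) (x t : R) : C :=
  wedge b a (fun l => osc x l * ((Ci * l) ^ 0 * kernel rho m t l))%C.

Lemma wedge_heat_xlim b a rho m : good_wedge b a -> ray_growth b rho -> ray_growth a rho ->
  xlim (wedge_heat b a rho m) (fun t => wedge b a (fun l => (Ci * l) ^ 0 * kernel rho m t l)%C).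
Proof.
  intros [_ [[Sb Cb] [[Sa Ca] _]]] H1 H2.
  exact (xlim_minus _ _ _ _ (kernel_xlim b rho 0 m (Rlt_le _ _ Sb) Cb H1) (kernel_xlim a rho 0 m (Rlt_le _ _ Sa) Ca H2)).
Qed.

Lemma wedge_heat_growth theta rho m t : good_angle theta -> 0 <= t -> ray_growth theta rho ->
  ray_growth theta (fun l => (Ci * l) ^ 0 * kernel rho m t l)%C.
Proof.
  intros Ga Ht Hr. apply (ray_growth_mult theta (fun l => (Ci * l) ^ 0)%C); [exact (ray_growth_const theta 1%C)|].
  split; [apply Hol_kernel; apply Hr|]. destruct (kernel_poly_growth theta rho m (cos4_good _ Ga) Hr t) as [q [B [HB0 HB]]].
  exists q, B. split; auto. intros; apply HB; auto; lra.
Qed.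

(** By [conv_parts], l^4 C[g] = g(t) - e^{-l^4 t} g(0) - C[g'], where C[g] stands for
    [conv] at l^4, and the first term integrates to 0 by [wedge_closed]. *)
Lemma wedge_conv_step b a q G x t : good_wedge b a -> jet G -> 0 < x -> 0 < t ->
  wedge_conv b a 0 (4 + q) G x t =
  (- (G 0%nat 0) * wedge_heat b a (fun l => l ^ q)%C 0 x t + - (1) * wedge_conv b a 0 q (shift G) x t)%C.
Proof.
  intros HW HG Hx Ht. assert (HW' := HW). destruct HW' as [Hab [Gb [Ga Hs]]].
  assert (HS := jet_shift G HG).
  destruct (good_wedge_osc_dominated b a (fun l => l ^ q)%C x HW Hx (ray_growth_pow b q) (ray_growth_pow a q)) as [M1 [A1 B1]].
  destruct (good_wedge_osc_dominated b a (fun l => (Ci * l) ^ 0 * kernel (fun l => l ^ q) 0 t l)%C x HW Hx) as [M2 [A2 B2]].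
  1,2: apply wedge_heat_growth; auto; try lra; apply ray_growth_pow.
  destruct (good_wedge_osc_dominated b a (fun l => l ^ q * convm 0 (shift G) (omega l) t)%C x HW Hx) as [M3 [A3 B3]].
  1,2: apply wedge_conv_growth; auto; lra.
  destruct (good_wedge_osc_dominated b a (fun l => l ^ (4 + q) * convm 0 G (omega l) t)%C x HW Hx) as [M0 [A0 B0]].
  1,2: apply wedge_conv_growth; auto; lra.
  assert (Z : wedge b a (fun l => osc x l * l ^ q)%C = 0%C).
  { apply (wedge_closed b a (fun l => l ^ q)%C x q 1 HW Hx); [lra|apply (Hol_pow _ (fun l => l)), Hol_id|].
    intros r theta Hr _. rewrite Cmod_pow, Cmod_ray, Rmult_1_l by auto. apply pow_incr; lra. }
  replace (- G 0%nat 0 * wedge_heat b a (fun l => l ^ q)%C 0 x t + - (1) * wedge_conv b a 0 q (shift G) x t)%C with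
    (G 0%nat t * wedge b a (fun l => osc x l * l ^ q) + - G 0%nat 0 * wedge_heat b a (fun l => l ^ q)%C 0 x t
     + - (1) * wedge_conv b a 0 q (shift G) x t)%C by (rewrite Z; ring).
  unfold wedge_heat, wedge_conv.
  rewrite <- (wedge_scal b a M1 (G 0%nat t)) by auto. rewrite <- (wedge_scal b a M2 (- G 0%nat 0)%C) by auto.
  rewrite <- (wedge_scal b a M3 (- (1))%C) by auto.
  rewrite <- (wedge_plus b a _ _ _ _ (ray_dominated_scal b M1 (G 0%nat t) _ A1) (ray_dominated_scal a M1 (G 0%nat t) _ B1)
     (ray_dominated_scal b M2 (- G 0%nat 0)%C _ A2) (ray_dominated_scal a M2 (- G 0%nat 0)%C _ B2)).
  rewrite <- (wedge_plus b a _ _ _ _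
     (ray_dominated_plus b _ _ _ _ (ray_dominated_scal b M1 (G 0%nat t) _ A1) (ray_dominated_scal b M2 (- G 0%nat 0)%C _ A2))
     (ray_dominated_plus a _ _ _ _ (ray_dominated_scal a M1 (G 0%nat t) _ B1) (ray_dominated_scal a M2 (- G 0%nat 0)%C _ B2))
     (ray_dominated_scal b M3 (- (1))%C _ A3) (ray_dominated_scal a M3 (- (1))%C _ B3)).
  apply (wedge_ext b a M0); auto.
  intros theta r _ Hr. set (l := ray theta r). assert (P := conv_parts G (omega l) t HG (Rlt_le _ _ Ht)).
  cbn [convm]. unfold kernel, shift, heat.
  replace (l ^ (4 + q) * conv (G 0%nat) (omega l) t)%C with (l ^ q * (omega l * conv (G 0%nat) (omega l) t))%C.
  - rewrite P. simpl. ring.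
  - rewrite Cpow_add_r. unfold omega. ring.
Qed.

Lemma wedge_conv_xlim_step b a q G v : good_wedge b a -> jet G -> xlim (wedge_conv b a 0 q (shift G)) v ->
  xlim (wedge_conv b a 0 (4 + q) G)
    (fun t => - (G 0%nat 0) * wedge b a (fun l => (Ci * l) ^ 0 * kernel (fun l => l ^ q) 0 t l) + - (1) * v t)%C.
Proof.
  intros HW HG Hv.
  eapply xlim_ext; [| |apply (xlim_plus _ _ _ _ (xlim_scal (- (G 0%nat 0))%C _ _
     (wedge_heat_xlim b a (fun l => l ^ q)%C 0 HW (ray_growth_pow b q) (ray_growth_pow a q)))
     (xlim_scal (- (1))%C _ _ Hv))]; [|reflexivity].
  intros x t Hx Ht. symmetry. apply wedge_conv_step; auto.
Qed.

(** ** The critical power *)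

(** The multiplier l^3/(1+l^4) is not absolutely integrable. For x > 0 it may be
    corrected by l/(l^2 + si), which is holomorphic in the wedge for the right sign s,
    and the difference is absolutely integrable up to x = 0. *)
Definition crit (l : C) : C := (l ^ 3 * / (1 + omega l))%C.
Definition corr (s : R) (l : C) : C := (l * / (l * l + s * Ci))%C.

Lemma one_plus_omega_lower z : 0 <= Re (omega z) -> / 2 * (1 + Cmod z ^ 4) <= Cmod (1 + omega z).
Proof.
  intros H. apply Cmod_lower.
  - pose proof (pow_le (Cmod z) 4 (Cmod_ge_0 z)). lra.
  - assert (E := Cmod_sqr (omega z)). rewrite Cmod_omega in E.
    replace (Re (1 + omega z)) with (1 + Re (omega z)) by (unfold Re; simpl; ring).
    replace (Im (1 + omega z)) with (Im (omega z)) by (unfold Im; simpl; ring).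
    set (p := Cmod z ^ 4) in *. assert (0 <= (p - 1) * (p - 1)) by apply Rle_0_sqr. nra.
Qed.

Lemma corr_den_sqr theta r s : s * s = 1 ->
  Cmod (ray theta r * ray theta r + s * Ci) * Cmod (ray theta r * ray theta r + s * Ci) =
  1 + 2 * (r * r) * (s * sin (2 * theta)) + r * r * (r * r).
Proof.
  intros Hs. rewrite ray_sqr, Cmod_sqr. destruct (ray_parts (2 * theta) (r * r)) as [E1 E2]. pose proof (unit_circle (2 * theta)).
  replace (Re (ray (2 * theta) (r * r) + s * Ci)) with (Re (ray (2 * theta) (r * r))) by (unfold Re, Im; simpl; ring).
  replace (Im (ray (2 * theta) (r * r) + s * Ci)) with (s + Im (ray (2 * theta) (r * r))) by (unfold Re, Im; simpl; ring).
  rewrite E1, E2.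
  replace (r * r * cos (2 * theta) * (r * r * cos (2 * theta)) + (s + r * r * sin (2 * theta)) * (s + r * r * sin (2 * theta)))
    with (s * s + 2 * (r * r) * (s * sin (2 * theta)) + r * r * (r * r) * (cos (2 * theta) * cos (2 * theta) + sin (2 * theta) * sin (2 * theta))) by ring.
  rewrite H, Hs. ring.
Qed.

Lemma corr_den_lower theta r s : s * s = 1 -> 0 <= s * sin (2 * theta) ->
  / 2 * (1 + r * r) <= Cmod (ray theta r * ray theta r + s * Ci).
Proof.
  intros Hs Hc. apply Rsqr_le_inv; [apply Cmod_ge_0|]. rewrite corr_den_sqr by auto.
  assert (0 <= r * r * (s * sin (2 * theta))) by (apply Rmult_le_pos; nra).
  pose proof (Rle_0_sqr (r * r - 1)). unfold Rsqr in *. nra.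
Qed.

Lemma cube_le r : 0 <= r -> r ^ 3 <= 1 + r ^ 4 /\ r <= 1 + r ^ 4.
Proof.
  intros Hr. destruct (Rle_dec r 1).
  - assert (r ^ 3 <= 1 ^ 3) by (apply pow_incr; lra). rewrite pow1 in H.
    assert (0 <= r ^ 4) by (apply pow_le; auto). lra.
  - assert (r ^ 3 <= r ^ 4) by (apply Rle_pow; [lra|lia]).
    assert (r ^ 1 <= r ^ 4) by (apply Rle_pow; [lra|lia]). rewrite pow_1 in H0. lra.
Qed.

Lemma crit_bound theta r : 0 <= cos (4 * theta) -> 0 <= r -> Cmod (crit (ray theta r)) <= 2.
Proof.
  intros Hc Hr. assert (L := one_plus_omega_lower _ (Re_omega_ray theta r Hc)). rewrite Cmod_ray in L by auto.
  assert (0 <= r ^ 4) by (apply pow_le; auto). destruct (cube_le r Hr) as [H3 _].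
  unfold crit. rewrite Cmod_mult, Cmod_pow, Cmod_ray by auto.
  rewrite Cmod_inv by (apply (Cmod_pos_neq _ (/ 2 * (1 + r ^ 4))); auto; lra).
  apply Rmult_le_reg_r with (Cmod (1 + omega (ray theta r))); [lra|].
  rewrite Rmult_assoc, Rinv_l by lra. lra.
Qed.

Lemma crit_Hol S : (forall z, S z -> 0 <= Re (omega z)) -> Hol S crit.
Proof.
  intros HS. apply Hol_mult; [apply (Hol_pow _ (fun l => l)), Hol_id|].
  apply (Hol_inv _ (fun l => 1 + omega l)%C (/ 2)); [lra| |apply Hol_plus; [apply Hol_const|apply Hol_omega]].
  intros z Hz. pose proof (one_plus_omega_lower z (HS z Hz)). pose proof (pow_le (Cmod z) 4 (Cmod_ge_0 z)). lra.
Qed.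

Lemma crit_growth theta : 0 <= cos (4 * theta) -> ray_growth theta crit.
Proof.
  intros Hc. split; [apply crit_Hol, on_ray_Re_omega; auto|]. exists 0%nat, 2. split; [lra|].
  intros r Hr. simpl. rewrite Rmult_1_r. apply crit_bound; auto.
Qed.

Lemma corr_Hol a b s : s * s = 1 -> (forall theta, a <= theta <= b -> 0 <= s * sin (2 * theta)) -> Hol (sector a b) (corr s).
Proof.
  intros Hs H. apply Hol_mult; [apply Hol_id|].
  apply (sector_Hol_inv a b (fun l => l * l + s * Ci)%C (/ 2)); [lra| |].
  - intros r theta Hr Ht. pose proof (corr_den_lower theta r s Hs (H theta Ht)). nra.
  - apply Hol_plus; [apply Hol_mult; apply Hol_id|apply Hol_const].
Qed.

Lemma corr_bound theta r s : s * s = 1 -> 0 <= s * sin (2 * theta) -> 0 <= r -> Cmod (corr s (ray theta r)) <= 2.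
Proof.
  intros Hs Hc Hr. assert (L := corr_den_lower theta r s Hs Hc).
  unfold corr. rewrite Cmod_mult, Cmod_ray by auto.
  rewrite Cmod_inv by (apply (Cmod_pos_neq _ (/ 2 * (1 + r * r))); auto; nra).
  apply Rmult_le_reg_r with (Cmod (ray theta r * ray theta r + s * Ci)); [nra|].
  rewrite Rmult_assoc, Rinv_l by nra. nra.
Qed.

Definition crit_corr (s : R) (l : C) : C := (crit l - corr s l)%C.

(** Over the common denominator, of degree 6, the terms of degree 5 cancel. *)
Lemma crit_corr_bound theta r s : s * s = 1 -> 0 <= s * sin (2 * theta) -> 0 <= cos (4 * theta) -> 0 <= r ->
  Cmod (crit_corr s (ray theta r)) <= 8 / (1 + r ^ 2).
Proof.
  intros Hs Hc Hc4 Hr.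
  assert (L1 := corr_den_lower theta r s Hs Hc).
  assert (L2 := one_plus_omega_lower _ (Re_omega_ray theta r Hc4)). rewrite Cmod_ray in L2 by auto.
  assert (P4 : 0 <= r ^ 4) by (apply pow_le; auto). destruct (cube_le r Hr) as [H3 H1].
  set (l := ray theta r) in *.
  assert (N1 : (l * l + s * Ci)%C <> 0%C) by (apply (Cmod_pos_neq _ (/ 2 * (1 + r * r))); auto; nra).
  assert (N2 : (1 + omega l)%C <> 0%C) by (apply (Cmod_pos_neq _ (/ 2 * (1 + r ^ 4))); auto; lra).
  assert (E : crit_corr s l = ((s * Ci * l ^ 3 - l) / ((1 + omega l) * (l * l + s * Ci)))%C).
  { unfold crit_corr, crit, corr, omega in *. field. auto. }
  rewrite E, Cmod_div, Cmod_mult by (apply Cmult_neq_0; auto).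
  assert (Num : Cmod (s * Ci * l ^ 3 - l) <= 2 * (1 + r ^ 4)).
  { eapply Rle_trans; [apply Cmod_triangle_minus|]. rewrite !Cmod_mult, Cmod_Ci, Cmod_R, Cmod_pow.
    unfold l. rewrite !Cmod_ray by auto.
    assert (Rabs s = 1). { assert (Rabs s * Rabs s = 1) by (rewrite <- Rabs_mult, Hs; apply Rabs_R1). pose proof (Rabs_pos s). nra. }
    rewrite H. lra. }
  assert (D : / 4 * ((1 + r ^ 4) * (1 + r ^ 2)) <= Cmod (1 + omega l) * Cmod (l * l + s * Ci)).
  { replace (/ 4 * ((1 + r ^ 4) * (1 + r ^ 2))) with ((/ 2 * (1 + r ^ 4)) * (/ 2 * (1 + r * r))) by field.
    apply Rmult_le_compat; auto; nra. }
  assert (P : 0 < / 4 * ((1 + r ^ 4) * (1 + r ^ 2))).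
  { apply Rmult_lt_0_compat; [lra|]. apply Rmult_lt_0_compat; nra. }
  apply Rmult_le_reg_r with (Cmod (1 + omega l) * Cmod (l * l + s * Ci)); [lra|].
  unfold Rdiv at 1. rewrite Rmult_assoc, Rinv_l, Rmult_1_r by lra.
  eapply Rle_trans; [exact Num|].
  apply Rle_trans with (8 / (1 + r ^ 2) * (/ 4 * ((1 + r ^ 4) * (1 + r ^ 2)))).
  - right. field. nra.
  - apply Rmult_le_compat_l; auto. apply Rmult_le_pos; [lra|]. left; apply Rinv_0_lt_compat; nra.
Qed.

(** The sign s is chosen so that [corr s] has no pole in the wedge. *)
Record contour (b a s : R) : Prop := {
  contour_good : good_wedge b a;
  contour_sign : s * s = 1;
  contour_corr : forall theta, b <= theta <= a -> 0 <= s * sin (2 * theta) }.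

(** For x > 0 the correction integrates to zero. *)
Lemma wedge_crit b a s x : contour b a s -> 0 < x ->
  wedge b a (fun l => osc x l * crit l)%C = wedge b a (fun l => osc x l * crit_corr s l)%C.
Proof.
  intros HC Hx. assert (HC' := HC). destruct HC' as [HW Hs Hc]. assert (HW' := HW). destruct HW' as [Hab [Gb [Ga _]]].
  assert (Z : wedge b a (fun l => osc x l * corr s l)%C = 0%C).
  { apply (wedge_closed b a (corr s) x 0 2 HW Hx); [lra|apply corr_Hol; auto|].
    intros r theta Hr Ht. simpl. rewrite Rmult_1_r. apply corr_bound; auto. }
  assert (RG : forall theta, theta = b \/ theta = a -> ray_growth theta (corr s)).
  { intros theta Ht. assert (b <= theta <= a) by (destruct Ht; subst; lra).
    split; [eapply Hol_subset; [|apply (corr_Hol b a s Hs Hc)]; apply sector_on_ray; auto|].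
    exists 0%nat, 2. split; [lra|]. intros r Hr. simpl. rewrite Rmult_1_r. apply corr_bound; auto. }
  destruct (good_wedge_osc_dominated b a crit x HW Hx (crit_growth b (cos4_good _ Gb)) (crit_growth a (cos4_good _ Ga))) as [M1 [A1 B1]].
  destruct (good_wedge_osc_dominated b a (corr s) x HW Hx (RG b (or_introl eq_refl)) (RG a (or_intror eq_refl))) as [M2 [A2 B2]].
  replace (wedge b a (fun l => osc x l * crit l)%C) with
    (wedge b a (fun l => osc x l * crit l) - wedge b a (fun l => osc x l * corr s l))%C by (rewrite Z; ring).
  rewrite <- (wedge_minus b a M1 M2) by auto.
  apply (wedge_ext b a (M1 + M2)); [apply ray_dominated_minus; auto|apply ray_dominated_minus; auto|].
  intros. unfold crit_corr. ring.
Qed.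

Lemma xlim_mul_cont h v (g : R -> C) : (forall t, Ccont g t) -> xlim h v -> xlim (fun x t => g t * h x t)%C (fun t => g t * v t)%C.
Proof.
  intros Hg H t0 T Ht0 HT eps. destruct (Ccont_bounded g t0 T) as [B [HB0 HB]]; [auto|].
  assert (He : 0 < eps / (B + 1)) by (apply Rdiv_lt_0_compat; [apply cond_pos|lra]).
  specialize (H t0 T Ht0 HT (mkposreal _ He)). unfold at_right, within in *. revert H. apply filter_imp.
  intros x H Hx t Ht. specialize (H Hx t Ht). simpl in H. specialize (HB t Ht).
  replace (g t * h x t - g t * v t)%C with (g t * (h x t - v t))%C by ring. rewrite Cmod_mult.
  apply Rle_lt_trans with ((B + 1) * Cmod (h x t - v t)).
  - apply Rmult_le_compat_r; [apply Cmod_ge_0|lra].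
  - apply Rmult_lt_compat_l with (r := B + 1) in H; [|lra].
    replace ((B + 1) * (eps / (B + 1))) with (pos eps) in H by (field; lra). exact H.
Qed.

(** By [conv_parts], (1+l^4) C[g] = g(t) - e^{-l^4 t} g(0) + C[g - g'], where C[g]
    stands for [conv] at l^4. *)
Lemma wedge_conv_crit b a s G x t : contour b a s -> jet G -> 0 < x -> 0 < t ->
  wedge_conv b a 0 3 G x t =
  (G 0%nat t * wedge b a (fun l => osc x l * crit_corr s l) + - (G 0%nat 0) * wedge_heat b a crit 0 x t
   + wedge b a (fun l => osc x l * (crit l * conv (diff_jet G 0%nat) (omega l) t)))%C.
Proof.
  intros HC HG Hx Ht. rewrite <- (wedge_crit b a s x HC Hx).
  assert (HW := contour_good _ _ _ HC). assert (HW' := HW). destruct HW' as [Hab [Gb [Ga Hs]]].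
  assert (HD : jet (diff_jet G)) by (apply jet_minus; auto; apply jet_shift; auto).
  assert (CG : forall theta, theta = b \/ theta = a -> good_angle theta) by (intros theta [-> | ->]; auto).
  destruct (good_wedge_osc_dominated b a crit x HW Hx (crit_growth b (cos4_good _ Gb)) (crit_growth a (cos4_good _ Ga))) as [M1 [A1 B1]].
  destruct (good_wedge_osc_dominated b a (fun l => (Ci * l) ^ 0 * kernel crit 0 t l)%C x HW Hx) as [M2 [A2 B2]].
  1,2: apply wedge_heat_growth; auto; try lra; apply crit_growth, cos4_good; auto.
  destruct (good_wedge_osc_dominated b a (fun l => crit l * convm 0 (diff_jet G) (omega l) t)%C x HW Hx) as [M3 [A3 B3]].
  1,2: apply (ray_growth_mult _ crit); [apply crit_growth, cos4_good; auto|apply ray_growth_conv; auto; try lra; apply cos4_good; auto].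
  destruct (good_wedge_osc_dominated b a (fun l => l ^ 3 * convm 0 G (omega l) t)%C x HW Hx) as [M0 [A0 B0]].
  1,2: apply wedge_conv_growth; auto; lra.
  unfold wedge_heat, wedge_conv.
  rewrite <- (wedge_scal b a M1 (G 0%nat t)) by auto. rewrite <- (wedge_scal b a M2 (- G 0%nat 0)%C) by auto.
  rewrite <- (wedge_plus b a _ _ _ _ (ray_dominated_scal b M1 (G 0%nat t) _ A1) (ray_dominated_scal a M1 (G 0%nat t) _ B1)
     (ray_dominated_scal b M2 (- G 0%nat 0)%C _ A2) (ray_dominated_scal a M2 (- G 0%nat 0)%C _ B2)).
  cbn [convm] in A3, B3, A0, B0. cbn [convm].
  rewrite <- (wedge_plus b a _ _ _ _
     (ray_dominated_plus b _ _ _ _ (ray_dominated_scal b M1 (G 0%nat t) _ A1) (ray_dominated_scal b M2 (- G 0%nat 0)%C _ A2))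
     (ray_dominated_plus a _ _ _ _ (ray_dominated_scal a M1 (G 0%nat t) _ B1) (ray_dominated_scal a M2 (- G 0%nat 0)%C _ B2))
     A3 B3).
  apply (wedge_ext b a M0); auto.
  intros theta r Hth Hr. set (l := ray theta r). assert (P := conv_parts G (omega l) t HG (Rlt_le _ _ Ht)).
  assert (N : (1 + omega l)%C <> 0%C).
  { apply (Cmod_pos_neq _ (/ 2)); [lra|].
    pose proof (one_plus_omega_lower l (Re_omega_ray theta r (cos4_good _ (CG theta Hth)))).
    pose proof (pow_le (Cmod l) 4 (Cmod_ge_0 l)). lra. }
  assert (Ex : forall k, ex_RInt ((fun s => Cexp (- (omega l * (t - s)%R)) * G k s)%C : R -> CR) 0 t).
  { intros k. apply ex_CInt. intros y _. apply Ccont_mult; [apply Ccont_conv_kernel|apply HG]. }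
  assert (T : conv (diff_jet G 0%nat) (omega l) t = (conv (G 0%nat) (omega l) t - conv (G 1%nat) (omega l) t)%C).
  { unfold conv. rewrite <- CInt_minus by auto. unfold CInt. apply (RInt_ext (V := CR)). intros y _.
    unfold diff_jet, shift. change (@eq C (Cexp (- (omega l * (t - y)%R)) * (G 0%nat y - G 1%nat y))
      (Cexp (- (omega l * (t - y)%R)) * G 0%nat y - Cexp (- (omega l * (t - y)%R)) * G 1%nat y))%C. ring. }
  rewrite T. unfold kernel, crit, heat.
  set (c0 := conv (G 0%nat) (omega l) t) in *. set (c1 := conv (G 1%nat) (omega l) t) in *.
  set (e := Cexp _) in *.
  assert (C1 : c1 = (G 0%nat t - e * G 0%nat 0 - omega l * c0)%C) by (rewrite P; ring).
  rewrite C1. simpl. field. auto.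
Qed.

Lemma crit_conv_bound G T : jet G -> exists M, forall theta t r, 0 <= cos (4 * theta) -> 0 <= t <= T -> 0 <= r ->
  Cmod (crit (ray theta r) * conv (G 0%nat) (omega (ray theta r)) t) <= M / (1 + r ^ 2).
Proof.
  intros HG. destruct (pow_conv_dominated 0 G T ltac:(lia) HG) as [M HM]. exists (2 * M).
  intros theta t r Hc Ht Hr. specialize (HM theta t r Hc Ht Hr). simpl (ray theta r ^ 0)%C in HM. rewrite Cmult_1_l in HM.
  rewrite Cmod_mult. replace (2 * M / (1 + r ^ 2)) with (2 * (M / (1 + r ^ 2))) by (unfold Rdiv; ring).
  apply Rmult_le_compat; try apply Cmod_ge_0; auto. apply crit_bound; auto.
Qed.

Lemma wedge_conv_xlim_3 b a s G : contour b a s -> jet G ->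
  xlim (wedge_conv b a 0 3 G)
    (fun t => G 0%nat t * wedge b a (crit_corr s)
       + - (G 0%nat 0) * wedge b a (fun l => (Ci * l) ^ 0 * kernel crit 0 t l)
       + wedge b a (fun l => crit l * conv (diff_jet G 0%nat) (omega l) t))%C.
Proof.
  intros HC HG. assert (HC' := HC). destruct HC' as [HW Hs Hc]. assert (HW' := HW). destruct HW' as [Hab [Gb [Ga Hsin]]].
  assert (HD : jet (diff_jet G)) by (apply jet_minus; auto; apply jet_shift; auto).
  assert (X1 : xlim (fun x t => wedge b a (fun l => osc x l * crit_corr s l)%C) (fun t => wedge b a (crit_corr s))).
  { apply xlim_minus; apply (ray_xlim _ (fun _ l => crit_corr s l)).
    1: apply Rlt_le, Gb. 3: apply Rlt_le, Ga.
    1,3: intros t Ht; apply Hol_minus; [apply crit_growth, cos4_good; auto|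
      eapply Hol_subset; [|apply (corr_Hol b a s Hs Hc)]; apply sector_on_ray; lra].
    1,2: intros t0 T _ _; exists 8; intros t r _ Hr; apply crit_corr_bound; auto; try (apply Hc; lra); apply cos4_good; auto. }
  assert (X3 : xlim (fun x t => wedge b a (fun l => osc x l * (crit l * conv (diff_jet G 0%nat) (omega l) t))%C)
    (fun t => wedge b a (fun l => crit l * conv (diff_jet G 0%nat) (omega l) t)%C)).
  { apply (wedge_xlim b a (fun t l => crit l * conv (diff_jet G 0%nat) (omega l) t)%C); auto.
    - intros theta t Gt Ht. apply Hol_mult; [apply crit_growth, cos4_good; auto|].
      apply (conv_comp_Hol theta 0 (diff_jet G)); auto; [apply cos4_good; auto|lra].
    - intros T. destruct (crit_conv_bound (diff_jet G) T HD) as [M HM]. exists M.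
      intros theta t r Gt Ht Hr. apply HM; auto; [apply cos4_good; auto|lra]. }
  eapply xlim_ext; [| |apply (xlim_plus _ _ _ _ (xlim_plus _ _ _ _ (xlim_mul_cont _ _ (G 0%nat) (proj1 HG 0%nat) X1)
     (xlim_scal (- (G 0%nat 0))%C _ _
     (wedge_heat_xlim b a crit 0 HW (crit_growth b (cos4_good _ Gb)) (crit_growth a (cos4_good _ Ga))))) X3)]; [|reflexivity].
  intros x t Hx Ht. symmetry. apply wedge_conv_crit; auto.
Qed.

(** Steps of 4 lead down to q <= 2 or q = 3. *)
Lemma wedge_conv_xlim_0 b a s q : contour b a s -> forall G, jet G -> exists v, xlim (wedge_conv b a 0 q G) v.
Proof.
  intros HC. induction q as [q IH] using (well_founded_induction Wf_nat.lt_wf). intros G HG.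
  assert (HW := contour_good _ _ _ HC).
  destruct (Nat.le_gt_cases q 2) as [Hq|Hq].
  - eexists. apply wedge_conv_xlim_low; auto.
  - destruct (Nat.eq_dec q 3) as [->|Hq3].
    + eexists. apply (wedge_conv_xlim_3 b a s); auto.
    + destruct (IH (q - 4)%nat ltac:(lia) (shift G) (jet_shift G HG)) as [v Hv].
      replace q with (4 + (q - 4))%nat by lia. eexists. apply (wedge_conv_xlim_step b a (q - 4) G v); auto.
Qed.

(** By definition of [convm], a derivative in t replaces the datum by its derivative
    and adds a term with [heat], which has a limit for every power of l. *)
Lemma wedge_conv_xlim b a s m q : contour b a s -> forall G, jet G -> exists v, xlim (wedge_conv b a m q G) v.
Proof.
  intros HC. assert (HW := contour_good _ _ _ HC). assert (HW' := HW). destruct HW' as [Hab [Gb [Ga Hsin]]].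
  induction m; intros G HG.
  - apply (wedge_conv_xlim_0 b a s); auto.
  - destruct (IHm (shift G) (jet_shift G HG)) as [v Hv].
    eexists. eapply xlim_ext; [| |apply (xlim_plus _ _ _ _ Hv (xlim_scal (G 0%nat 0) _ _
      (wedge_heat_xlim b a (fun l => l ^ q)%C m HW (ray_growth_pow b q) (ray_growth_pow a q))))]; [|reflexivity].
    intros x t Hx Ht. cbv beta.
    destruct (good_wedge_osc_dominated b a (fun l => l ^ q * convm m (shift G) (omega l) t)%C x HW Hx) as [M1 [A1 B1]].
    1,2: apply wedge_conv_growth; auto; [apply jet_shift; auto|lra].
    destruct (good_wedge_osc_dominated b a (fun l => (Ci * l) ^ 0 * kernel (fun l => l ^ q) m t l)%C x HW Hx) as [M2 [A2 B2]].
    1,2: apply wedge_heat_growth; auto; try lra; apply ray_growth_pow.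
    unfold wedge_conv, wedge_heat.
    rewrite <- (wedge_scal b a M2 (G 0%nat 0)) by auto.
    rewrite <- (wedge_plus b a M1 _ _ _ A1 B1 (ray_dominated_scal b M2 (G 0%nat 0) _ A2) (ray_dominated_scal a M2 (G 0%nat 0) _ B2)).
    eapply wedge_ext.
    + apply (ray_dominated_plus b _ _ _ _ A1 (ray_dominated_scal b M2 (G 0%nat 0) _ A2)).
    + apply (ray_dominated_plus a _ _ _ _ B1 (ray_dominated_scal a M2 (G 0%nat 0) _ B2)).
    + intros theta r _ Hr. cbn [convm]. unfold kernel, heat. simpl. ring.
Qed.

(** * Values on the half-axes *)

Lemma contour_2 : contour (PI / 16) (PI / 2) 1.
Proof.
  pose proof PI_RGT_0. split; [apply good_wedges|ring|].
  intros theta Ht. rewrite Rmult_1_l. apply sin_ge_0; lra.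
Qed.

Lemma contour_1 : contour (PI / 2) (15 * PI / 16) (-1).
Proof.
  pose proof PI_RGT_0. split; [apply good_wedges|ring|].
  intros theta Ht. assert (0 <= sin (2 * theta - PI)) by (apply sin_ge_0; lra).
  rewrite sin_minus, cos_PI, sin_PI in H0. lra.
Qed.

(** What allows the outer rays to be turned onto the real half-axes. *)
Definition near_axis (F : C -> C) (M : R) : Prop :=
  Hol (sector 0 (PI / 16)) F /\ Hol (sector (15 * PI / 16) PI) F /\
  forall theta r, (0 <= theta <= PI / 16 \/ 15 * PI / 16 <= theta <= PI) -> 0 <= r ->
    Cmod (F (ray theta r)) <= M / (1 + r ^ 2).

Lemma rotate_right F M : Hol (sector 0 (PI / 16)) F ->
  (forall theta r, 0 <= theta <= PI / 16 -> 0 <= r -> Cmod (F (ray theta r)) <= M / (1 + r ^ 2)) ->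
  int_ray (PI / 16) F = int_ray 0 F.
Proof. intros H HM. pose proof PI_RGT_0. symmetry. apply (sector_rotate F 0 (PI / 16) M); auto. lra. Qed.

Lemma rotate_left F M : Hol (sector (15 * PI / 16) PI) F ->
  (forall theta r, 15 * PI / 16 <= theta <= PI -> 0 <= r -> Cmod (F (ray theta r)) <= M / (1 + r ^ 2)) ->
  int_ray (15 * PI / 16) F = int_ray PI F.
Proof. intros H HM. pose proof PI_RGT_0. apply (sector_rotate F (15 * PI / 16) PI M); auto. lra. Qed.

Lemma axis_eval theta F phi k M : dominated M phi ->
  (forall r, 0 < r -> F (ray theta r) * Cexp (Ci * theta) = k * phi r)%C ->
  int_ray theta F = (k * half phi)%C.
Proof.
  intros H E. rewrite <- (half_scal M) by auto. rewrite int_ray_half. symmetry.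
  apply (half_ext (Cmod k * M)); [apply dominated_scal; auto|]. intros r Hr. symmetry. apply E; auto.
Qed.

Lemma omega_axis theta r : theta = 0 \/ theta = PI / 2 \/ theta = PI -> omega (ray theta r) = omega r.
Proof.
  intros [-> | [-> | ->]].
  - rewrite ray_0. reflexivity.
  - rewrite ray_PI2. unfold omega. rewrite Cpow_mult_l. replace (Ci ^ 4)%C with (RtoC 1); [ring|apply C_eq; simpl; ring].
  - rewrite ray_PI. unfold omega. ring.
Qed.

Lemma near_cos4 theta : (0 <= theta <= PI / 16 \/ 15 * PI / 16 <= theta <= PI) -> 0 <= cos (4 * theta).
Proof. intros H. pose proof PI_RGT_0. apply cos4_nonneg. lra. Qed.

Lemma axis_cos4 theta : theta = 0 \/ theta = PI / 2 \/ theta = PI -> 0 <= cos (4 * theta).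
Proof. intros H. pose proof PI_RGT_0. apply cos4_nonneg. lra. Qed.

Lemma ray_axis_unit theta r : ray theta r = (r * Cexp (Ci * theta))%C.
Proof. reflexivity. Qed.

(** If e^4 = 1, then l^q f(l^4) dl at l = e r is e^(q+1) times its value at l = r;
    hence such functions have proportional integrals over the half-axes. *)
Lemma axis_power q (F f : C -> C) M : near_axis F M -> ray_dominated (PI / 2) M F ->
  (forall l, F l = l ^ q * f (omega l))%C ->
  exists A, wedge (PI / 16) (PI / 2) F = ((1 - Ci ^ (S q)) * A)%C /\
    wedge (PI / 2) (15 * PI / 16) F = ((Ci ^ (S q) - (- (1)) ^ (S q)) * A)%C.
Proof.
  intros [H1 [H2 HM]] HD E. pose proof PI_RGT_0.
  assert (D0 : ray_dominated 0 M F).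
  { apply ray_dominated_intro; [eapply Hol_subset; [|exact H1]; apply sector_on_ray; lra|].
    intros r Hr. apply HM; auto. lra. }
  set (phi := fun r : R => F (ray 0 r)).
  assert (Dphi : dominated M phi).
  { eapply dominated_ext; [|apply (ray_dominated_half 0 M F D0)].
    intros r Hr. unfold phi. simpl. rewrite Cexp_i_0. ring. }
  assert (Ev : forall theta, theta = 0 \/ theta = PI / 2 \/ theta = PI ->
    int_ray theta F = (Cexp (Ci * theta) ^ (S q) * half phi)%C).
  { intros theta Ht. apply (axis_eval theta F phi _ M Dphi). intros r Hr. unfold phi.
    rewrite !E, !omega_axis by auto. rewrite ray_0, ray_axis_unit, Cpow_mult_l. rewrite Cpow_S. ring. }
  exists (half phi). unfold wedge.
  rewrite (rotate_right F M), (rotate_left F M); auto.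
  rewrite !Ev by auto. rewrite Cexp_i_0, Cexp_i_PI, Cexp_i_PI2, Cpow_1_l. split; ring.
Qed.

Lemma sector_Re_omega a b : (forall theta, a <= theta <= b -> 0 <= cos (4 * theta)) ->
  forall z, sector a b z -> 0 <= Re (omega z).
Proof. intros H z [theta [r [Ht [Hr ->]]]]. apply Re_omega_ray; auto. Qed.

Lemma near_sectors : (forall z, sector 0 (PI / 16) z -> 0 <= Re (omega z)) /\
  (forall z, sector (15 * PI / 16) PI z -> 0 <= Re (omega z)).
Proof. split; apply sector_Re_omega; intros; apply near_cos4; auto. Qed.

Lemma conv_comp_Hol_set S m G t : (forall z, S z -> 0 <= Re (omega z)) -> jet G -> 0 <= t ->
  Hol S (fun l => convm m G (omega l) t).
Proof.
  intros HS HG Ht. apply (Hol_comp S (fun w => 0 <= Re w) (fun w => convm m G w t) omega); auto.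
  - apply Hol_convm; auto.
  - apply Hol_omega.
Qed.

Lemma axis_power_conv q G t : (q <= 2)%nat -> jet G -> 0 <= t ->
  exists A, wedge (PI / 16) (PI / 2) (fun l => l ^ q * conv (G 0%nat) (omega l) t)%C = ((1 - Ci ^ (S q)) * A)%C /\
    wedge (PI / 2) (15 * PI / 16) (fun l => l ^ q * conv (G 0%nat) (omega l) t)%C = ((Ci ^ (S q) - (- (1)) ^ (S q)) * A)%C.
Proof.
  intros Hq HG Ht. destruct near_sectors as [N1 N2].
  destruct (pow_conv_dominated q G t Hq HG) as [M HM].
  apply (axis_power q _ (fun w => conv (G 0%nat) w t) M).
  - split; [|split].
    + apply Hol_mult; [apply (Hol_pow _ (fun l => l)), Hol_id|]. apply (conv_comp_Hol_set _ 0 G t); auto.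
    + apply Hol_mult; [apply (Hol_pow _ (fun l => l)), Hol_id|]. apply (conv_comp_Hol_set _ 0 G t); auto.
    + intros theta r Hth Hr. apply HM; auto; [apply near_cos4; auto|lra].
  - assert (Hc : 0 <= cos (4 * (PI / 2))) by (apply axis_cos4; auto). apply ray_dominated_intro.
    + apply Hol_mult; [apply (Hol_pow _ (fun l => l)), Hol_id|].
      apply (conv_comp_Hol_set _ 0 G t); auto. apply on_ray_Re_omega; auto.
    + intros r Hr. apply HM; auto. lra.
  - reflexivity.
Qed.

(** For q = 3 the factors e^(q+1) of [axis_power] are all equal to 1, and the
    difference of two half-axes vanishes. *)
Lemma axis_crit_conv G t : jet G -> 0 <= t ->
  wedge (PI / 16) (PI / 2) (fun l => crit l * conv (G 0%nat) (omega l) t)%C = 0%C /\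
  wedge (PI / 2) (15 * PI / 16) (fun l => crit l * conv (G 0%nat) (omega l) t)%C = 0%C.
Proof.
  intros HG Ht. destruct near_sectors as [N1 N2].
  destruct (crit_conv_bound G t HG) as [M HM].
  assert (Hc : 0 <= cos (4 * (PI / 2))) by (apply axis_cos4; auto).
  destruct (axis_power 3 (fun l => crit l * conv (G 0%nat) (omega l) t)%C (fun w => / (1 + w) * conv (G 0%nat) w t)%C M) as [A [E1 E2]].
  - split; [|split].
    + apply Hol_mult; [apply crit_Hol; auto|]. apply (conv_comp_Hol_set _ 0 G t); auto.
    + apply Hol_mult; [apply crit_Hol; auto|]. apply (conv_comp_Hol_set _ 0 G t); auto.
    + intros theta r Hth Hr. apply HM; auto; [apply near_cos4; auto|lra].
  - apply ray_dominated_intro.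
    + apply Hol_mult; [apply crit_Hol, on_ray_Re_omega; auto|].
      apply (conv_comp_Hol_set _ 0 G t); auto. apply on_ray_Re_omega; auto.
    + intros r Hr. apply HM; auto. lra.
  - intros l. unfold crit. ring.
  - rewrite E1, E2. replace (Ci ^ 4)%C with (RtoC 1) by (apply C_eq; simpl; ring).
    replace ((- (1)) ^ 4)%C with (RtoC 1) by ring. split; ring.
Qed.

Lemma axis_kernel_dominated (P : R -> Prop) rho n t p B : 0 < t -> 0 <= B ->
  (forall theta, P theta -> cos (PI / 4) <= cos (4 * theta)) ->
  (forall theta r, P theta -> 0 <= r -> Cmod (rho (ray theta r)) <= B * (1 + r) ^ p) ->
  exists M, forall theta r, P theta -> 0 <= r ->
    Cmod ((Ci * ray theta r) ^ n * kernel rho 0 t (ray theta r)) <= M / (1 + r ^ 2).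
Proof.
  intros Ht HB HP Hb. destruct (exp_decay4 (n + p) (cos (PI / 4) * t)) as [M [HM0 HM]].
  { apply Rmult_lt_0_compat; auto. apply cos_PI4_pos. }
  exists (B * M). intros theta r Hth Hr. unfold kernel. rewrite !Cmod_mult, Cmod_iz_pow by auto.
  simpl ((- omega (ray theta r)) ^ 0)%C. rewrite Cmod_1, Cmod_heat.
  assert (Hc := HP theta Hth). specialize (HM r Hr). specialize (Hb theta r Hth Hr).
  assert (Hr4 := pow_le r 4 Hr).
  assert (E : exp (- (cos (4 * theta) * t * r ^ 4)) <= exp (- (cos (PI / 4) * t * r ^ 4))).
  { apply exp_le. assert (0 <= (cos (4 * theta) - cos (PI / 4)) * t * r ^ 4) by (apply Rmult_le_pos; auto; apply Rmult_le_pos; lra). lra. }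
  set (e := exp (- (cos (4 * theta) * t * r ^ 4))) in *. set (e' := exp (- (cos (PI / 4) * t * r ^ 4))) in *.
  assert (0 < e) by apply exp_pos.
  assert (K := pow_mul_1p r n B p _ Hr (Cmod_ge_0 _) Hb). set (v := Cmod (rho (ray theta r))) in *.
  assert (0 <= r ^ n * v) by (apply Rmult_le_pos; [apply pow_le; auto|apply Cmod_ge_0]).
  apply Rle_trans with (e' * (B * (1 + r) ^ (n + p))).
  - replace (r ^ n * (1 * (e * v))) with (e * (r ^ n * v)) by ring. apply Rmult_le_compat; auto; lra.
  - replace (B * M / (1 + r ^ 2)) with (B * (M / (1 + r ^ 2))) by (unfold Rdiv; ring).
    replace (e' * (B * (1 + r) ^ (n + p))) with (B * ((1 + r) ^ (n + p) * e')) by ring.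
    apply Rmult_le_compat_l; auto.
Qed.

Lemma Hol_iz_kernel S rho n m t : Hol S rho -> Hol S (fun l => (Ci * l) ^ n * kernel rho m t l)%C.
Proof. intros; apply Hol_mult; [apply Hol_iz_pow|apply Hol_kernel; auto]. Qed.

Lemma axis_kernel q rho f t B p : 0 < t -> 0 <= B ->
  (forall S, (forall z, S z -> 0 <= Re (omega z)) -> Hol S rho) ->
  (forall theta r, 0 <= cos (4 * theta) -> 0 <= r -> Cmod (rho (ray theta r)) <= B * (1 + r) ^ p) ->
  (forall l, rho l = l ^ q * f (omega l))%C ->
  exists A, wedge (PI / 16) (PI / 2) (fun l => (Ci * l) ^ 0 * kernel rho 0 t l)%C = ((1 - Ci ^ (S q)) * A)%C /\
    wedge (PI / 2) (15 * PI / 16) (fun l => (Ci * l) ^ 0 * kernel rho 0 t l)%C = ((Ci ^ (S q) - (- (1)) ^ (S q)) * A)%C.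
Proof.
  intros Ht HB HH Hb Hf. destruct near_sectors as [N1 N2]. pose proof PI_RGT_0.
  destruct (axis_kernel_dominated (fun theta => 0 <= theta <= PI / 16 \/ theta = PI / 2 \/ 15 * PI / 16 <= theta <= PI)
    rho 0 t p B Ht HB cos4_pos) as [M HM].
  { intros theta r Hth Hr. apply Hb; auto. apply cos4_nonneg. lra. }
  apply (axis_power q _ (fun w => Cexp (- (w * t)) * f w)%C M).
  - split; [|split].
    + apply Hol_iz_kernel; auto.
    + apply Hol_iz_kernel; auto.
    + intros theta r Hth Hr. apply HM; auto. lra.
  - apply ray_dominated_intro.
    + apply Hol_iz_kernel. apply HH. apply on_ray_Re_omega. apply axis_cos4; auto.
    + intros r Hr. apply HM; auto.
  - intros l. unfold kernel, heat. rewrite Hf. simpl. ring.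
Qed.

Lemma axis_crit_heat t : 0 < t ->
  wedge (PI / 16) (PI / 2) (fun l => (Ci * l) ^ 0 * kernel crit 0 t l)%C = 0%C /\
  wedge (PI / 2) (15 * PI / 16) (fun l => (Ci * l) ^ 0 * kernel crit 0 t l)%C = 0%C.
Proof.
  intros Ht. destruct (axis_kernel 3 crit (fun w => / (1 + w))%C t 2 0 Ht ltac:(lra)) as [A [E1 E2]].
  - intros; apply crit_Hol; auto.
  - intros. simpl. rewrite Rmult_1_r. apply crit_bound; auto.
  - reflexivity.
  - rewrite E1, E2. replace (Ci ^ 4)%C with (RtoC 1) by (apply C_eq; simpl; ring).
    replace ((- (1)) ^ 4)%C with (RtoC 1) by ring. split; ring.
Qed.

(** A primitive of r/(1+r^4) is atan(r^2)/2. *)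
Lemma half_crit : half (fun r : R => (2 * Ci) * (r * / (1 + r ^ 4))%R)%C = (Ci * PI / 2)%C.
Proof.
  assert (Der : forall x, is_derive (fun r => atan (r ^ 2) / 2) x (x * / (1 + x ^ 4))).
  { intros x. assert (P : 0 <= x * x * (x * x)) by (pose proof (Rle_0_sqr (x * x)) as Q; exact Q).
    auto_derive; auto. field. simpl. rewrite !Rmult_1_r. rewrite <- !Rmult_assoc in *. lra. }
  assert (CF : forall x, Ccont (fun r : R => (2 * Ci) * (atan (r ^ 2) / 2)%R)%C x).
  { intros x. apply Ccont_mult; [apply Ccont_const|]. apply Ccont_RtoC.
    apply (ex_derive_continuous (fun r => atan (r ^ 2) / 2)). eexists; apply Der. }
  assert (Cf : forall x, Ccont (fun r : R => (2 * Ci) * (r * / (1 + r ^ 4))%R)%C x).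
  { intros x. apply Ccont_mult; [apply Ccont_const|]. apply Ccont_RtoC.
    apply (ex_derive_continuous (fun r => r * / (1 + r ^ 4))). auto_derive.
    assert (0 <= x ^ 4) by (replace (x ^ 4) with ((x ^ 2) ^ 2) by ring; apply pow2_ge_0). nra. }
  rewrite (half_derive (fun r : R => (2 * Ci) * (atan (r ^ 2) / 2)%R)%C _ 8 ((2 * Ci) * ((PI / 2) / 2)%R)%C); auto.
  - replace (0 ^ 2) with 0 by ring. rewrite atan_0. rewrite !RtoC_div by lra. field.
  - intros x Hx. apply Cder_scal. split; [apply Der|]. apply is_derive_Reals. apply derivable_pt_lim_const.
  - apply dominated_cont; auto. intros r Hr.
    assert (P4 : 0 <= r ^ 4) by (apply pow_le; auto). destruct (cube_le r Hr) as [H3 H1].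
    rewrite !Cmod_mult, Cmod_Ci, !Cmod_R, (Rabs_pos_eq 2), Rabs_pos_eq; try lra.
    + apply Rmult_le_reg_r with ((1 + r ^ 4) * (1 + r ^ 2)); [apply Rmult_lt_0_compat; nra|].
      replace (2 * 1 * (r * / (1 + r ^ 4)) * ((1 + r ^ 4) * (1 + r ^ 2))) with (2 * (r + r ^ 3)) by (field; lra).
      replace (8 / (1 + r ^ 2) * ((1 + r ^ 4) * (1 + r ^ 2))) with (8 * (1 + r ^ 4)) by (field; nra). lra.
    + apply Rmult_le_pos; auto. left; apply Rinv_0_lt_compat; lra.
  - intros eps He. destruct (atan_gap (eps / 2)) as [N [HN0 HN]]; [lra|].
    exists (N + 1). intros b Hb. specialize (HN (b ^ 2) ltac:(nra)).
    replace (2 * Ci * (atan (b ^ 2) / 2)%R - 2 * Ci * (PI / 2 / 2)%R)%C with (Ci * (atan (b ^ 2) - PI / 2)%R)%C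
      by (rewrite !RtoC_minus, !RtoC_div by lra; field).
    rewrite Cmod_mult, Cmod_Ci, Cmod_R, Rmult_1_l, Rabs_left by lra. lra.
Qed.

Lemma Ci2 : (Ci * Ci)%C = (- (1))%C.
Proof. apply C_eq; simpl; ring. Qed.

Lemma crit_corr_bound_near s theta r : s * s = 1 ->
  (s = 1 /\ 0 <= theta <= PI / 16 \/ s = -1 /\ 15 * PI / 16 <= theta <= PI \/ theta = PI / 2) -> 0 <= r ->
  Cmod (crit_corr s (ray theta r)) <= 8 / (1 + r ^ 2) /\ 0 <= s * sin (2 * theta).
Proof.
  intros Hs H Hr. pose proof PI_RGT_0.
  assert (G : 0 <= s * sin (2 * theta)).
  { destruct H as [[-> H]|[[-> H]| ->]].
    - rewrite Rmult_1_l. apply sin_ge_0; lra.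
    - assert (0 <= sin (2 * theta - PI)) by (apply sin_ge_0; lra). rewrite sin_minus, cos_PI, sin_PI in H1. lra.
    - replace (2 * (PI / 2)) with PI by field. rewrite sin_PI. lra. }
  split; auto. apply crit_corr_bound; auto. apply cos4_nonneg. lra.
Qed.

Lemma crit_corr_Hol_near s a b : s * s = 1 ->
  (forall theta, a <= theta <= b -> s = 1 /\ 0 <= theta <= PI / 16 \/ s = -1 /\ 15 * PI / 16 <= theta <= PI \/ theta = PI / 2) ->
  Hol (sector a b) (crit_corr s).
Proof.
  intros Hs H. pose proof PI_RGT_0. apply Hol_minus.
  - apply crit_Hol. apply sector_Re_omega. intros theta Ht. apply cos4_nonneg. specialize (H theta Ht). lra.
  - apply corr_Hol; auto. intros theta Ht. apply (crit_corr_bound_near s theta 0 Hs (H theta Ht)). lra.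
Qed.

(** Multiplied by the direction of the half-axis, [crit] takes the same values on both
    of them, and only the corrections remain. *)
Lemma crit_corr_axis_diff s (r : R) : s * s = 1 -> 0 < r ->
  (crit_corr s r - crit_corr s (ray (PI / 2) r) * Ci = 2 * s * Ci * (r * / (1 + r ^ 4))%R)%C.
Proof.
  intros Hs Hr. unfold crit_corr, crit, corr. rewrite omega_axis by auto. rewrite ray_PI2.
  assert (P4 : 0 < 1 + r ^ 4) by (pose proof (pow_lt r 4 Hr); lra).
  assert (N0 : (1 + omega r)%C <> 0%C).
  { unfold omega. rewrite <- RtoC_pow, <- RtoC_plus. intros E. apply RtoC_inj in E. lra. }
  assert (Nz : forall e, e = 1 \/ e = -1 -> (e * (r * r) + s * Ci)%C <> 0%C).
  { intros e He E. apply (f_equal Re) in E. unfold Re in E; simpl in E. destruct He; subst; nra. }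
  assert (N1 := Nz 1 (or_introl eq_refl)). assert (N2 := Nz (-1) (or_intror eq_refl)). clear Nz.
  assert (N1' : (r * r + s * Ci)%C <> 0%C) by (intros E; apply N1; rewrite <- E; ring).
  assert (N2' : (Ci * r * (Ci * r) + s * Ci)%C <> 0%C).
  { intros E; apply N2. rewrite <- E. replace (Ci * r * (Ci * r))%C with ((Ci * Ci) * (r * r))%C by ring. rewrite Ci2. ring. }
  assert (E3 : ((Ci * r) ^ 3 * Ci)%C = (r ^ 3)%C).
  { replace ((Ci * r) ^ 3 * Ci)%C with ((Ci * Ci) * (Ci * Ci) * r ^ 3)%C by ring. rewrite Ci2. ring. }
  replace ((Ci * r) ^ 3 * / (1 + omega r) - Ci * r * / (Ci * r * (Ci * r) + s * Ci))%C
    with ((Ci * r) ^ 3 * / (1 + omega r) - Ci * r * / (Ci * r * (Ci * r) + s * Ci))%C by ring.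
  replace (((Ci * r) ^ 3 * / (1 + omega r) - Ci * r * / (Ci * r * (Ci * r) + s * Ci)) * Ci)%C with
    (((Ci * r) ^ 3 * Ci) * / (1 + omega r) - (Ci * Ci) * r * / (Ci * r * (Ci * r) + s * Ci))%C by ring.
  rewrite E3, Ci2.
  replace (Ci * r * (Ci * r) + s * Ci)%C with (- (r * r) + s * Ci)%C in *
    by (replace (Ci * r * (Ci * r))%C with ((Ci * Ci) * (r * r))%C by ring; rewrite Ci2; ring).
  assert (ss : (s * s)%C = 1%C) by (rewrite <- RtoC_mult, Hs; reflexivity).
  assert (Pr : ((r * r + s * Ci) * (- (r * r) + s * Ci))%C = (- (1 + r ^ 4))%C).
  { replace ((r * r + s * Ci) * (- (r * r) + s * Ci))%C with (- (r ^ 4) + (s * s) * (Ci * Ci))%C by ring.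
    rewrite ss, Ci2. ring. }
  assert (N4 : (1 + r ^ 4)%C <> 0%C).
  { rewrite <- RtoC_pow, <- RtoC_plus. intros E. apply RtoC_inj in E. lra. }
  replace (/ (r * r + s * Ci))%C with ((- (r * r) + s * Ci) * - / (1 + r ^ 4))%C.
  2:{ replace (/ (1 + r ^ 4))%C with (- / ((r * r + s * Ci) * (- (r * r) + s * Ci)))%C by (rewrite Pr; field; auto).
      field. auto. }
  replace (/ (- (r * r) + s * Ci))%C with ((r * r + s * Ci) * - / (1 + r ^ 4))%C.
  2:{ replace (/ (1 + r ^ 4))%C with (- / ((r * r + s * Ci) * (- (r * r) + s * Ci)))%C by (rewrite Pr; field; auto).
      field. auto. }
  rewrite RtoC_mult, RtoC_inv, RtoC_plus, RtoC_pow by lra. ring.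
Qed.

Lemma half_sub_eval F0 F1 e0 e1 theta0 theta1 M (k : C) :
  Cexp (Ci * (theta0 : R)) = e0 -> Cexp (Ci * (theta1 : R)) = e1 ->
  ray_dominated theta0 M F0 -> ray_dominated theta1 M F1 ->
  half (fun r => F0 (ray theta0 r) * e0 - F1 (ray theta1 r) * e1)%C = k ->
  (int_ray theta0 F0 - int_ray theta1 F1)%C = k.
Proof.
  intros <- <- D0 D1 <-. rewrite !int_ray_half. apply ray_dominated_half in D0, D1.
  symmetry. apply (half_minus M M); auto.
Qed.

(** The outer ray is turned onto the real axis, and [crit_corr_axis_diff] gives the
    integrand of [half_crit]. *)
Lemma wedge_crit_corr_2 : wedge (PI / 16) (PI / 2) (crit_corr 1) = (Ci * PI / 2)%C.
Proof.
  pose proof PI_RGT_0. unfold wedge.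
  rewrite (rotate_right (crit_corr 1) 8).
  2: apply crit_corr_Hol_near; [ring|intros; lra].
  2: intros; apply crit_corr_bound_near; [ring|lra|auto].
  assert (D0 : ray_dominated 0 8 (crit_corr 1)).
  { apply ray_dominated_intro; [|intros; apply crit_corr_bound_near; [ring|lra|auto]].
    eapply Hol_subset; [|apply (crit_corr_Hol_near 1 0 0); [ring|intros; lra]]. apply sector_on_ray; lra. }
  assert (D1 : ray_dominated (PI / 2) 8 (crit_corr 1)).
  { apply ray_dominated_intro; [|intros; apply crit_corr_bound_near; [ring|lra|auto]].
    eapply Hol_subset; [|apply (crit_corr_Hol_near 1 (PI / 2) (PI / 2)); [ring|intros; lra]]. apply sector_on_ray; lra. }
  apply (half_sub_eval _ _ 1%C Ci 0 (PI / 2) 8); auto; [apply Cexp_i_0|apply Cexp_i_PI2|].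
  rewrite <- half_crit.
  assert (DD := dominated_minus _ _ _ _ (ray_dominated_half _ _ _ D0) (ray_dominated_half _ _ _ D1)).
  apply (half_ext (8 + 8)).
  - eapply dominated_ext; [|exact DD]. intros r Hr. simpl. rewrite Cexp_i_0, Cexp_i_PI2. reflexivity.
  - intros r Hr. cbv beta. rewrite ray_0, Cmult_1_r. rewrite crit_corr_axis_diff by (auto; ring). ring.
Qed.

Lemma crit_corr_reflect s (r : R) : s * s = 1 -> 0 < r ->
  (crit_corr s (ray PI r) * - (1))%C = crit_corr s r.
Proof.
  intros Hs Hr. unfold crit_corr, crit, corr. rewrite omega_axis by auto. rewrite ray_PI.
  replace (- r * - r)%C with (r * r)%C by ring. replace ((- r) ^ 3)%C with (- (r ^ 3))%C by ring. ring.
Qed.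

Lemma wedge_crit_corr_1 : wedge (PI / 2) (15 * PI / 16) (crit_corr (-1)) = (Ci * PI / 2)%C.
Proof.
  pose proof PI_RGT_0. unfold wedge.
  rewrite (rotate_left (crit_corr (-1)) 8).
  2: apply crit_corr_Hol_near; [ring|intros; lra].
  2: intros; apply crit_corr_bound_near; [ring|lra|auto].
  assert (D0 : ray_dominated PI 8 (crit_corr (-1))).
  { apply ray_dominated_intro; [|intros; apply crit_corr_bound_near; [ring|lra|auto]].
    eapply Hol_subset; [|apply (crit_corr_Hol_near (-1) PI PI); [ring|intros; lra]]. apply sector_on_ray; lra. }
  assert (D1 : ray_dominated (PI / 2) 8 (crit_corr (-1))).
  { apply ray_dominated_intro; [|intros; apply crit_corr_bound_near; [ring|lra|auto]].
    eapply Hol_subset; [|apply (crit_corr_Hol_near (-1) (PI / 2) (PI / 2)); [ring|intros; lra]]. apply sector_on_ray; lra. }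
  apply (half_sub_eval _ _ Ci (- (1))%C (PI / 2) PI 8); auto; [apply Cexp_i_PI2|apply Cexp_i_PI|].
  rewrite <- half_crit.
  assert (DD := dominated_minus _ _ _ _ (ray_dominated_half _ _ _ D1) (ray_dominated_half _ _ _ D0)).
  apply (half_ext (8 + 8)).
  - eapply dominated_ext; [|exact DD]. intros r Hr. simpl. rewrite Cexp_i_PI, Cexp_i_PI2. reflexivity.
  - intros r Hr. cbv beta. rewrite crit_corr_reflect by (auto; ring).
    assert (E := crit_corr_axis_diff (-1) r ltac:(ring) Hr).
    replace (crit_corr (-1) (ray (PI / 2) r) * Ci - crit_corr (-1) r)%C with
      (- (crit_corr (-1) r - crit_corr (-1) (ray (PI / 2) r) * Ci))%C by ring.
    rewrite E. replace (RtoC (-1)) with (- (1))%C by (apply C_eq; simpl; ring). ring.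
Qed.

(** ** Boundary values of the families *)

(** On the half-axes only the term with g(t) survives in [wedge_conv_xlim_3]. *)
Lemma wedge_conv_value_3 G : jet G ->
  xlim (wedge_conv (PI / 16) (PI / 2) 0 3 G) (fun t => Ci * PI / 2 * G 0%nat t)%C /\
  xlim (wedge_conv (PI / 2) (15 * PI / 16) 0 3 G) (fun t => Ci * PI / 2 * G 0%nat t)%C.
Proof.
  intros HG. assert (HD : jet (diff_jet G)) by (apply jet_minus; auto; apply jet_shift; auto).
  split.
  - eapply xlim_ext; [| |apply (wedge_conv_xlim_3 _ _ _ G contour_2 HG)]; [reflexivity|].
    intros t Ht. cbv beta. rewrite wedge_crit_corr_2.
    rewrite (proj1 (axis_crit_heat t Ht)), (proj1 (axis_crit_conv _ t HD (Rlt_le _ _ Ht))). ring.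
  - eapply xlim_ext; [| |apply (wedge_conv_xlim_3 _ _ _ G contour_1 HG)]; [reflexivity|].
    intros t Ht. cbv beta. rewrite wedge_crit_corr_1.
    rewrite (proj2 (axis_crit_heat t Ht)), (proj2 (axis_crit_conv _ t HD (Rlt_le _ _ Ht))). ring.
Qed.

(** The limits for the two contours are proportional, which is what allows them to
    cancel in the formula; for the power 4 likewise. *)
Lemma wedge_conv_value_2 G : jet G -> exists v,
  xlim (wedge_conv (PI / 16) (PI / 2) 0 2 G) v /\
  xlim (wedge_conv (PI / 2) (15 * PI / 16) 0 2 G) (fun t => - Ci * v t)%C.
Proof.
  intros HG. exists (fun t => wedge (PI / 16) (PI / 2) (fun l => l ^ 2 * conv (G 0%nat) (omega l) t)%C). split.
  - apply wedge_conv_xlim_low; auto. apply good_wedges.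
  - eapply xlim_ext; [| |apply (wedge_conv_xlim_low _ _ 2 G (proj1 good_wedges)); auto]; [reflexivity|].
    intros t Ht. cbv beta. destruct (axis_power_conv 2 G t ltac:(lia) HG (Rlt_le _ _ Ht)) as [A [-> ->]].
    replace (Ci ^ 3)%C with (- Ci)%C by (apply C_eq; simpl; ring).
    replace (- Ci * ((1 - - Ci) * A))%C with ((- Ci - Ci * Ci) * A)%C by ring. rewrite Ci2.
    replace ((- (1)) ^ 3)%C with (- (1))%C by ring. ring.
Qed.

Lemma wedge_conv_value_4 G : jet G -> exists v,
  xlim (wedge_conv (PI / 16) (PI / 2) 0 4 G) v /\
  xlim (wedge_conv (PI / 2) (15 * PI / 16) 0 4 G) (fun t => Ci * v t)%C.
Proof.
  intros HG. assert (HS := jet_shift G HG).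
  assert (X2 := wedge_conv_xlim_step _ _ 0 G _ (proj2 good_wedges) HG
    (wedge_conv_xlim_low _ _ 0 (shift G) (proj2 good_wedges) (Nat.le_0_l 2) HS)).
  assert (X1 := wedge_conv_xlim_step _ _ 0 G _ (proj1 good_wedges) HG
    (wedge_conv_xlim_low _ _ 0 (shift G) (proj1 good_wedges) (Nat.le_0_l 2) HS)).
  eexists. split; [exact X2|].
  - eapply xlim_ext; [| |exact X1]; [reflexivity|].
    intros t Ht. cbv beta. 
    destruct (axis_power_conv 0 (shift G) t ltac:(lia) HS (Rlt_le _ _ Ht)) as [A [-> ->]].
    destruct (axis_kernel 0 (fun l => l ^ 0)%C (fun _ => 1%C) t 1 0 Ht ltac:(lra)) as [B [-> ->]].
    + intros; apply (Hol_pow _ (fun l => l)), Hol_id.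
    + intros. simpl. rewrite Cmod_1. lra.
    + intros; simpl; ring.
    + simpl Cpow. rewrite !Cmult_1_r.
      replace (Ci * (- G 0%nat 0 * ((1 - Ci) * B) + - (1) * ((1 - Ci) * A)))%C with
        (- G 0%nat 0 * ((Ci - Ci * Ci) * B) + - (1) * ((Ci - Ci * Ci) * A))%C by ring. rewrite Ci2. ring.
Qed.

(** ** The initial data on the boundary *)

Lemma hat_scaled_Hol S c D : schwartz D -> (forall z, S z -> Im (c * z)%C <= 0) -> Hol S (fun l => hat (D 0%nat) (c * l)%C).
Proof.
  intros HD HS. apply (Hol_comp S (fun z => Im z <= 0) (hat (D 0%nat)) (fun l => c * l)%C); auto.
  - apply hat_Hol; auto.
  - apply Hol_scal, Hol_id.
Qed.

Definition hat_neg (f : R -> C) (l : C) : C := hat f (- l)%C.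
Definition hat_i (f : R -> C) (l : C) : C := hat f (Ci * l)%C.
Definition hat_mi (f : R -> C) (l : C) : C := hat f (- (Ci * l))%C.

Definition left_half (z : C) : Prop := Re z <= 0.
Definition right_half (z : C) : Prop := 0 <= Re z.

Lemma hat_neg_Hol S D : schwartz D -> (forall z, S z -> upper z) -> Hol S (hat_neg (D 0%nat)).
Proof.
  intros HD HS. apply (Hol_ext S (fun l => hat (D 0%nat) (- (1) * l)%C)).
  - intros z _. unfold hat_neg. f_equal. ring.
  - apply hat_scaled_Hol; auto. intros z Hz. specialize (HS z Hz). unfold upper, Im in *. simpl. lra.
Qed.

Lemma hat_i_Hol S D : schwartz D -> (forall z, S z -> left_half z) -> Hol S (hat_i (D 0%nat)).
Proof.
  intros HD HS. apply hat_scaled_Hol; auto. intros z Hz. specialize (HS z Hz). unfold left_half, Re, Im in *. simpl. lra.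
Qed.

Lemma hat_mi_Hol S D : schwartz D -> (forall z, S z -> right_half z) -> Hol S (hat_mi (D 0%nat)).
Proof.
  intros HD HS. apply (Hol_ext S (fun l => hat (D 0%nat) ((- Ci) * l)%C)).
  - intros z _. unfold hat_mi. f_equal. ring.
  - apply hat_scaled_Hol; auto. intros z Hz. specialize (HS z Hz). unfold right_half, Re, Im in *. simpl. lra.
Qed.

Lemma hat_all_bounds D : schwartz D -> exists B, 0 <= B /\
  (forall z, upper z -> Cmod (hat_neg (D 0%nat) z) <= B) /\
  (forall z, left_half z -> Cmod (hat_i (D 0%nat) z) <= B) /\
  (forall z, right_half z -> Cmod (hat_mi (D 0%nat) z) <= B).
Proof.
  intros HD. destruct (hat_bound D HD) as [B [HB0 HB]]. exists B. split; auto.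
  split; [|split]; intros z Hz; apply HB; unfold upper, left_half, right_half, Re, Im in *; simpl; lra.
Qed.

Lemma ray_left theta r : PI / 2 <= theta <= PI -> 0 <= r -> left_half (ray theta r).
Proof.
  intros H Hr. unfold left_half. destruct (ray_parts theta r) as [-> _]. pose proof PI_RGT_0.
  assert (cos theta <= 0) by (apply cos_le_0; lra). nra.
Qed.

Lemma ray_right theta r : 0 <= theta <= PI / 2 -> 0 <= r -> right_half (ray theta r).
Proof.
  intros H Hr. unfold right_half. destruct (ray_parts theta r) as [-> _]. pose proof PI_RGT_0.
  assert (0 <= cos theta) by (apply cos_ge_0; lra). nra.
Qed.

(** The side conditions under which a transform [rho] of the initial data may be used
    on the rays with angle in [a, b]. *)
Definition bounded_on (a b : R) (rho : C -> C) : Prop :=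
  Hol (sector a b) rho /\ exists B, 0 <= B /\ forall theta r, a <= theta <= b -> 0 <= r -> Cmod (rho (ray theta r)) <= B.

Lemma bounded_on_neg D : schwartz D -> bounded_on 0 PI (hat_neg (D 0%nat)).
Proof.
  intros HD. destruct (hat_all_bounds D HD) as [B [HB [H1 _]]]. split.
  - apply hat_neg_Hol; auto. intros z [theta [r [Ht [Hr ->]]]]. apply ray_upper; auto.
  - exists B. split; auto. intros. apply H1. apply ray_upper; auto.
Qed.

Lemma bounded_on_i D : schwartz D -> bounded_on (PI / 2) PI (hat_i (D 0%nat)).
Proof.
  intros HD. destruct (hat_all_bounds D HD) as [B [HB [_ [H1 _]]]]. split.
  - apply hat_i_Hol; auto. intros z [theta [r [Ht [Hr ->]]]]. apply ray_left; auto.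
  - exists B. split; auto. intros. apply H1. apply ray_left; auto.
Qed.

Lemma bounded_on_mi D : schwartz D -> bounded_on 0 (PI / 2) (hat_mi (D 0%nat)).
Proof.
  intros HD. destruct (hat_all_bounds D HD) as [B [HB [_ [_ H1]]]]. split.
  - apply hat_mi_Hol; auto. intros z [theta [r [Ht [Hr ->]]]]. apply ray_right; auto.
  - exists B. split; auto. intros. apply H1. apply ray_right; auto.
Qed.

Lemma bounded_on_sub a b a' b' rho : a <= a' -> b' <= b -> bounded_on a b rho -> bounded_on a' b' rho.
Proof.
  intros Ha Hb [H [B [HB HB']]]. split.
  - eapply Hol_subset; [|exact H]. intros z [theta [r [Ht Hr]]]. exists theta, r. split; [lra|auto].
  - exists B. split; auto. intros; apply HB'; auto; lra.
Qed.

Lemma bounded_on_growth a b rho theta : bounded_on a b rho -> a <= theta <= b -> ray_growth theta rho.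
Proof.
  intros [H [B [HB HB']]] Ht. split; [eapply Hol_subset; [|exact H]; apply sector_on_ray; auto|].
  exists 0%nat, B. split; auto. intros r Hr. simpl. rewrite Rmult_1_r. auto.
Qed.

Lemma hat_right_rotate rho n t : 0 < t -> bounded_on 0 (PI / 16) rho ->
  int_ray (PI / 16) (fun l => (Ci * l) ^ n * kernel rho 0 t l)%C = int_ray 0 (fun l => (Ci * l) ^ n * kernel rho 0 t l)%C.
Proof.
  intros Ht [H [B [HB HB']]].
  destruct (axis_kernel_dominated (fun theta => 0 <= theta <= PI / 16) rho n t 0 B Ht HB) as [M HM].
  - intros; apply cos4_pos; auto.
  - intros. simpl. rewrite Rmult_1_r. auto.
  - apply (rotate_right _ M); auto. apply Hol_iz_kernel; auto.
Qed.

Lemma hat_left_rotate rho n t : 0 < t -> bounded_on (15 * PI / 16) PI rho ->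
  int_ray (15 * PI / 16) (fun l => (Ci * l) ^ n * kernel rho 0 t l)%C = int_ray PI (fun l => (Ci * l) ^ n * kernel rho 0 t l)%C.
Proof.
  intros Ht [H [B [HB HB']]].
  destruct (axis_kernel_dominated (fun theta => 15 * PI / 16 <= theta <= PI) rho n t 0 B Ht HB) as [M HM].
  - intros; apply cos4_pos; auto.
  - intros. simpl. rewrite Rmult_1_r. auto.
  - apply (rotate_left _ M); auto. apply Hol_iz_kernel; auto.
Qed.

Definition axis_moment (n : nat) (t : R) (rho : C -> C) : C := half (fun r : R => r ^ n * (heat t r * rho r))%C.

(** On a half-axis, [hat], [hat_neg], [hat_i] and [hat_mi] take the values of one of
    them on the positive numbers; the direction of the axis comes out with the power n
    + 1. *)
Lemma axis_hat theta rho' rho n t : theta = 0 \/ theta = PI / 2 \/ theta = PI -> 0 < t -> ray_growth 0 rho ->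
  (forall r, 0 < r -> rho' (ray theta r) = rho r) ->
  int_ray theta (fun l => (Ci * l) ^ n * kernel rho' 0 t l)%C = (Ci ^ n * Cexp (Ci * theta) ^ (S n) * axis_moment n t rho)%C.
Proof.
  intros Hth Ht Hr E.
  destruct (ray_family_kernel_dominated 0 rho n 0 0 t) as [M HM]; auto; try lra.
  { rewrite sin_0; lra. } { rewrite Rmult_0_r, cos_0; lra. }
  apply ray_dominated_half in HM.
  apply (axis_eval theta _ _ _ (Cmod ((- Ci) ^ n) * M)).
  - eapply dominated_ext; [|apply (dominated_scal M ((- Ci) ^ n)%C _ HM)].
    intros r Hr0. cbv beta. rewrite ray_0, osc_0, Cexp_i_0. unfold kernel.
    replace ((- Ci) ^ n * (1 * ((Ci * r) ^ n * ((- omega r) ^ 0 * (heat t r * rho r))) * 1))%C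
      with (((- Ci) ^ n * (Ci * r) ^ n) * (heat t r * rho r))%C by (simpl; ring).
    rewrite <- Cpow_mult_l. f_equal. f_equal. replace (- Ci * (Ci * r))%C with (- (Ci * Ci) * r)%C by ring. rewrite Ci2. ring.
  - intros r Hr0. unfold kernel, heat. rewrite E, omega_axis by auto. rewrite ray_axis_unit, !Cpow_mult_l, Cpow_S. simpl. ring.
Qed.

(** The cancellation behind the choice of the coefficients of the transforms of the
    initial data: at x = 0 their total contribution vanishes together with its first
    derivative in x. *)
Lemma initial_cancel D n t : schwartz D -> 0 < t -> (n <= 1)%nat ->
  let H rho := fun l => ((Ci * l) ^ n * kernel rho 0 t l)%C in
  ((int_ray 0 (H (hat (D 0%nat))) - int_ray PI (H (hat (D 0%nat))))
   + - Ci * wedge (PI / 2) (15 * PI / 16) (H (hat_neg (D 0%nat)))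
   + (Ci - 1) * wedge (PI / 2) (15 * PI / 16) (H (hat_i (D 0%nat)))
   + Ci * wedge (PI / 16) (PI / 2) (H (hat_neg (D 0%nat)))
   + - (Ci + 1) * wedge (PI / 16) (PI / 2) (H (hat_mi (D 0%nat))) = 0)%C.
Proof.
  intros HD Ht Hn H. pose proof PI_RGT_0. unfold wedge, H.
  assert (Bn := bounded_on_neg D HD). assert (Bi := bounded_on_i D HD). assert (Bm := bounded_on_mi D HD).
  rewrite (hat_right_rotate (hat_neg (D 0%nat))) by (auto; apply (bounded_on_sub 0 PI); auto; lra).
  rewrite (hat_right_rotate (hat_mi (D 0%nat))) by (auto; apply (bounded_on_sub 0 (PI / 2)); auto; lra).
  rewrite (hat_left_rotate (hat_neg (D 0%nat))) by (auto; apply (bounded_on_sub 0 PI); auto; lra).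
  rewrite (hat_left_rotate (hat_i (D 0%nat))) by (auto; apply (bounded_on_sub (PI / 2) PI); auto; lra).
  assert (G0 := ray_growth_hat D 0 (or_introl eq_refl) HD).
  assert (G1 := bounded_on_growth _ _ _ 0 Bn ltac:(lra)).
  assert (G2 := bounded_on_growth _ _ _ 0 Bm ltac:(lra)).
  set (P := axis_moment n t (hat (D 0%nat))). set (M := axis_moment n t (hat_neg (D 0%nat))).
  set (J := axis_moment n t (hat_mi (D 0%nat))).
  assert (E1 := axis_hat 0 (hat (D 0%nat)) (hat (D 0%nat)) n t (or_introl eq_refl) Ht G0 ltac:(intros; rewrite ray_0; reflexivity)).
  assert (E2 := axis_hat PI (hat (D 0%nat)) (hat_neg (D 0%nat)) n t (or_intror (or_intror eq_refl)) Ht G1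
    ltac:(intros; rewrite ray_PI; reflexivity)).
  assert (E3 := axis_hat 0 (hat_neg (D 0%nat)) (hat_neg (D 0%nat)) n t (or_introl eq_refl) Ht G1 ltac:(intros; rewrite ray_0; reflexivity)).
  assert (E4 := axis_hat (PI / 2) (hat_neg (D 0%nat)) (hat_mi (D 0%nat)) n t (or_intror (or_introl eq_refl)) Ht G2
    ltac:(intros; rewrite ray_PI2; reflexivity)).
  assert (E5 := axis_hat PI (hat_neg (D 0%nat)) (hat (D 0%nat)) n t (or_intror (or_intror eq_refl)) Ht G0
    ltac:(intros; rewrite ray_PI; unfold hat_neg; f_equal; ring)).
  assert (E6 := axis_hat (PI / 2) (hat_i (D 0%nat)) (hat_neg (D 0%nat)) n t (or_intror (or_introl eq_refl)) Ht G1
    ltac:(intros; rewrite ray_PI2; unfold hat_neg, hat_i; f_equal; rewrite Cmult_assoc, Ci2; ring)).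
  assert (E7 := axis_hat PI (hat_i (D 0%nat)) (hat_mi (D 0%nat)) n t (or_intror (or_intror eq_refl)) Ht G2
    ltac:(intros; rewrite ray_PI; unfold hat_mi, hat_i; f_equal; ring)).
  assert (E8 := axis_hat 0 (hat_mi (D 0%nat)) (hat_mi (D 0%nat)) n t (or_introl eq_refl) Ht G2 ltac:(intros; rewrite ray_0; reflexivity)).
  assert (E9 := axis_hat (PI / 2) (hat_mi (D 0%nat)) (hat (D 0%nat)) n t (or_intror (or_introl eq_refl)) Ht G0
    ltac:(intros; rewrite ray_PI2; unfold hat_mi; f_equal; rewrite Cmult_assoc, Ci2; ring)).
  fold P M J in E1, E2, E3, E4, E5, E6, E7, E8, E9.
  rewrite Cexp_i_0 in E1, E3, E8. rewrite Cexp_i_PI in E2, E5, E7. rewrite Cexp_i_PI2 in E4, E6, E9.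
  cut (forall i1 i2 i3 i4 i5 i6 i7 i8 i9 : C,
    i1 = (Ci ^ n * 1 ^ S n * P)%C -> i2 = (Ci ^ n * (- (1)) ^ S n * M)%C -> i3 = (Ci ^ n * 1 ^ S n * M)%C ->
    i4 = (Ci ^ n * Ci ^ S n * J)%C -> i5 = (Ci ^ n * (- (1)) ^ S n * P)%C -> i6 = (Ci ^ n * Ci ^ S n * M)%C ->
    i7 = (Ci ^ n * (- (1)) ^ S n * J)%C -> i8 = (Ci ^ n * 1 ^ S n * J)%C -> i9 = (Ci ^ n * Ci ^ S n * P)%C ->
    (i1 - i2 + - Ci * (i4 - i5) + (Ci - 1) * (i6 - i7) + Ci * (i3 - i4) + - (Ci + 1) * (i8 - i9))%C = 0%C).
  { intros K. exact (K _ _ _ _ _ _ _ _ _ E1 E2 E3 E4 E5 E6 E7 E8 E9). }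
  intros i1 i2 i3 i4 i5 i6 i7 i8 i9 -> -> -> -> -> -> -> -> ->.
  (* All the integrals are multiples of the three moments P, M and J, and the
     coefficients of each of them cancel for n = 0 and for n = 1. *)
  generalize P M J. intros [p1 p2] [m1 m2] [j1 j2].
  destruct n as [|[|]]; [| |lia]; apply C_eq; simpl; ring.
Qed.

(** * Pieces of the solution *)

(** What the extension up to the boundary requires of a family of derivatives; it is
    stable under linear combinations. *)
Definition piece (D : nat -> nat -> R -> R -> C) : Prop :=
  regular D /\ (forall n m, exists a, tlim (D n m) a) /\ (forall n m, exists b, xlim (D n m) b).

Lemma piece_plus D E : piece D -> piece E -> piece (fun n m x t => D n m x t + E n m x t)%C.
Proof.
  intros [A1 [A2 A3]] [B1 [B2 B3]]. split; [apply regular_plus; auto|]. split; intros n m.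
  - destruct (A2 n m) as [a Ha], (B2 n m) as [b Hb]. eexists. exact (tlim_plus _ _ _ _ Ha Hb).
  - destruct (A3 n m) as [a Ha], (B3 n m) as [b Hb]. eexists. exact (xlim_plus _ _ _ _ Ha Hb).
Qed.

Lemma piece_scal c D : piece D -> piece (fun n m x t => c * D n m x t)%C.
Proof.
  intros [A1 [A2 A3]]. split; [apply regular_scal; auto|]. split; intros n m.
  - destruct (A2 n m) as [a Ha]. eexists. exact (tlim_scal c _ _ Ha).
  - destruct (A3 n m) as [a Ha]. eexists. exact (xlim_scal c _ _ Ha).
Qed.

Definition conv_family (b a : R) (p : nat) (G : nat -> R -> C) (n m : nat) (x t : R) : C :=
  (ray_family b (bdata p G) n m x t - ray_family a (bdata p G) n m x t)%C.

Definition hat_family (b a : R) (rho : C -> C) (n m : nat) (x t : R) : C :=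
  (ray_family b (kernel rho) n m x t - ray_family a (kernel rho) n m x t)%C.

Lemma conv_family_wedge b a p G n m x t : good_wedge b a -> jet G -> 0 < x -> 0 < t ->
  conv_family b a p G n m x t = (Ci ^ n * wedge_conv b a m (p + n) G x t)%C.
Proof.
  intros HW HG Hx Ht. assert (HW' := HW). destruct HW' as [_ [Gb [Ga _]]].
  destruct (good_wedge_osc_dominated b a (fun l => l ^ (p + n) * convm m G (omega l) t)%C x HW Hx) as [M [A B]].
  1,2: apply wedge_conv_growth; auto; lra.
  unfold wedge_conv. rewrite <- (wedge_scal b a M) by auto. unfold conv_family, ray_family.
  symmetry. apply (wedge_ext b a (Cmod (Ci ^ n) * M)).
  - exact (ray_dominated_scal b M (Ci ^ n)%C _ A).
  - exact (ray_dominated_scal a M (Ci ^ n)%C _ B).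
  - intros theta r _ _. unfold bdata. rewrite Cpow_mult_l, Cpow_add_r. ring.
Qed.

Lemma conv_family_piece b a s p G : contour b a s -> jet G -> piece (conv_family b a p G).
Proof.
  intros HC HG. assert (HW := contour_good _ _ _ HC). assert (HW' := HW). destruct HW' as [_ [[Sb Cb] [[Sa Ca] _]]].
  split; [|split].
  - apply regular_minus; apply bdata_regular; auto; lra.
  - intros n m. eexists. exact (tlim_minus _ _ _ _ (bdata_tlim b p G n m Sb (Rlt_le _ _ Cb) HG) (bdata_tlim a p G n m Sa (Rlt_le _ _ Ca) HG)).
  - intros n m. destruct (wedge_conv_xlim b a s m (p + n) HC G HG) as [v Hv].
    eexists. eapply xlim_ext; [| |apply (xlim_scal (Ci ^ n)%C _ _ Hv)]; [|reflexivity].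
    intros x t Hx Ht. symmetry. apply conv_family_wedge; auto.
Qed.

(** [conv] vanishes at t = 0. *)
Lemma conv_family_tlim_0 b a p G : good_wedge b a -> jet G -> tlim (conv_family b a p G 0 0) (fun _ => 0%C).
Proof.
  intros [_ [[Sb Cb] [[Sa Ca] _]]] HG.
  eapply tlim_ext; [| |exact (tlim_minus _ _ _ _ (bdata_tlim b p G 0 0 Sb (Rlt_le _ _ Cb) HG) (bdata_tlim a p G 0 0 Sa (Rlt_le _ _ Ca) HG))];
    [reflexivity|].
  intros x Hx. cbv beta.
  assert (Z : forall theta, int_ray theta (fun l => osc x l * ((Ci * l) ^ 0 * bdata p G 0 0 l))%C = 0%C).
  { intros theta. assert (D0 : ray_dominated theta 0 (fun _ => 0%C)).
    { apply ray_dominated_intro; [apply Hol_const|]. intros r Hr. rewrite Cmod_0. unfold Rdiv. lra. }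
    rewrite <- (int_ray_ext theta 0 (fun _ => 0%C)); auto.
    - assert (H := int_ray_bound theta 0 _ D0). apply Cmod_eq_0. pose proof (Cmod_ge_0 (int_ray theta (fun _ => 0%C))). lra.
    - intros r Hr. unfold bdata. cbn [convm]. rewrite conv_0. ring. }
  rewrite !Z. ring.
Qed.

Lemma hat_family_piece b a rho : good_angle b -> good_angle a -> ray_growth b rho -> ray_growth a rho ->
  piece (hat_family b a rho).
Proof.
  intros [Sb Cb] [Sa Ca] H1 H2. split; [|split].
  - apply regular_minus; apply kernel_regular_osc; auto; lra.
  - intros n m. eexists. exact (tlim_minus _ _ _ _ (kernel_tlim b rho n m Sb (Rlt_le _ _ Cb) H1) (kernel_tlim a rho n m Sa (Rlt_le _ _ Ca) H2)).
  - intros n m. eexists. exact (xlim_minus _ _ _ _ (kernel_xlim b rho n m (Rlt_le _ _ Sb) Cb H1) (kernel_xlim a rho n m (Rlt_le _ _ Sa) Ca H2)).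
Qed.

Lemma hat_family_xlim b a rho n : good_angle b -> good_angle a -> ray_growth b rho -> ray_growth a rho ->
  xlim (hat_family b a rho n 0) (fun t => wedge b a (fun l => (Ci * l) ^ n * kernel rho 0 t l)%C).
Proof.
  intros [Sb Cb] [Sa Ca] H1 H2.
  exact (xlim_minus _ _ _ _ (kernel_xlim b rho n 0 (Rlt_le _ _ Sb) Cb H1) (kernel_xlim a rho n 0 (Rlt_le _ _ Sa) Ca H2)).
Qed.

(** At t = 0 the heat factor disappears and [wedge_closed] applies. *)
Lemma hat_family_tlim_0 b a rho : good_wedge b a -> bounded_on b a rho -> tlim (hat_family b a rho 0 0) (fun _ => 0%C).
Proof.
  intros HW HB. assert (HW' := HW). destruct HW' as [Hab [[Sb Cb] [[Sa Ca] _]]].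
  assert (H1 := bounded_on_growth b a rho b HB ltac:(lra)). assert (H2 := bounded_on_growth b a rho a HB ltac:(lra)).
  eapply tlim_ext; [| |exact (tlim_minus _ _ _ _ (kernel_tlim b rho 0 0 Sb (Rlt_le _ _ Cb) H1) (kernel_tlim a rho 0 0 Sa (Rlt_le _ _ Ca) H2))];
    [reflexivity|].
  intros x Hx. cbv beta. destruct HB as [HH [B [HB0 HB1]]].
  apply (wedge_closed b a (fun l => (Ci * l) ^ 0 * kernel rho 0 0 l)%C x 0 B HW Hx HB0).
  - apply Hol_iz_kernel; auto.
  - intros r theta Hr Ht. unfold kernel. rewrite heat_0. simpl. rewrite !Cmult_1_l, Rmult_1_r. auto.
Qed.

Lemma line_family_piece D : schwartz D -> piece (line_family (hat (D 0%nat))).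
Proof.
  intros HD. assert (G0 := ray_growth_hat D 0 (or_introl eq_refl) HD). assert (GP := ray_growth_hat D PI (or_intror eq_refl) HD).
  assert (S0 := real_ray_lower 0 (or_introl eq_refl)). assert (SP := real_ray_lower PI (or_intror eq_refl)).
  assert (C0 := real_ray_cos4 0 (or_introl eq_refl)). assert (CP := real_ray_cos4 PI (or_intror eq_refl)).
  split; [|split].
  - apply regular_minus; apply kernel_regular_heat; auto; lra.
  - intros n m. apply line_family_tlim; auto.
  - intros n m. eexists. exact (xlim_minus _ _ _ _ (kernel_xlim 0 _ n m (Req_le _ _ (eq_sym S0)) ltac:(lra) G0)
      (kernel_xlim PI _ n m (Req_le _ _ (eq_sym SP)) ltac:(lra) GP)).
Qed.

Lemma line_family_xlim D n : schwartz D -> xlim (line_family (hat (D 0%nat)) n 0)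
  (fun t => int_ray 0 (fun l => (Ci * l) ^ n * kernel (hat (D 0%nat)) 0 t l) - int_ray PI (fun l => (Ci * l) ^ n * kernel (hat (D 0%nat)) 0 t l))%C.
Proof.
  intros HD. assert (G0 := ray_growth_hat D 0 (or_introl eq_refl) HD). assert (GP := ray_growth_hat D PI (or_intror eq_refl) HD).
  assert (S0 := real_ray_lower 0 (or_introl eq_refl)). assert (SP := real_ray_lower PI (or_intror eq_refl)).
  assert (C0 := real_ray_cos4 0 (or_introl eq_refl)). assert (CP := real_ray_cos4 PI (or_intror eq_refl)).
  exact (xlim_minus _ _ _ _ (kernel_xlim 0 _ n 0 (Req_le _ _ (eq_sym S0)) ltac:(lra) G0)
      (kernel_xlim PI _ n 0 (Req_le _ _ (eq_sym SP)) ltac:(lra) GP)).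
Qed.

Definition initial_part (D : nat -> R -> C) (n m : nat) (x t : R) : C :=
  (line_family (hat (D 0%nat)) n m x t
   + - Ci * hat_family (PI / 2) (15 * PI / 16) (hat_neg (D 0%nat)) n m x t
   + (Ci - 1) * hat_family (PI / 2) (15 * PI / 16) (hat_i (D 0%nat)) n m x t
   + Ci * hat_family (PI / 16) (PI / 2) (hat_neg (D 0%nat)) n m x t
   + - (Ci + 1) * hat_family (PI / 16) (PI / 2) (hat_mi (D 0%nat)) n m x t)%C.

Definition boundary_part (k1 k2 : C) (p : nat) (G : nat -> R -> C) (n m : nat) (x t : R) : C :=
  (k1 * conv_family (PI / 2) (15 * PI / 16) p G n m x t + k2 * conv_family (PI / 16) (PI / 2) p G n m x t)%C.

(** The solution and its derivatives, of order n in x and m in t, with the contours in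
    the position where the exponentials decay. *)
Definition solution (D G0 G1 : nat -> R -> C) (n m : nat) (x t : R) : C :=
  (/ (2 * PI) * (initial_part D n m x t + boundary_part (2 - 2 * Ci) (- (2) - 2 * Ci) 3 G0 n m x t
     + boundary_part (- (2) + 2 * Ci) (- (2) - 2 * Ci) 2 G1 n m x t))%C.

Lemma transform_growth D : schwartz D ->
  ray_growth (PI / 2) (hat_neg (D 0%nat)) /\ ray_growth (15 * PI / 16) (hat_neg (D 0%nat)) /\ ray_growth (PI / 16) (hat_neg (D 0%nat)) /\
  ray_growth (PI / 2) (hat_i (D 0%nat)) /\ ray_growth (15 * PI / 16) (hat_i (D 0%nat)) /\
  ray_growth (PI / 2) (hat_mi (D 0%nat)) /\ ray_growth (PI / 16) (hat_mi (D 0%nat)).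
Proof.
  intros HD. pose proof PI_RGT_0.
  assert (Bn := bounded_on_neg D HD). assert (Bi := bounded_on_i D HD). assert (Bm := bounded_on_mi D HD).
  split; [apply (bounded_on_growth _ _ _ _ Bn); lra|]. split; [apply (bounded_on_growth _ _ _ _ Bn); lra|].
  split; [apply (bounded_on_growth _ _ _ _ Bn); lra|]. split; [apply (bounded_on_growth _ _ _ _ Bi); lra|].
  split; [apply (bounded_on_growth _ _ _ _ Bi); lra|].
  split; apply (bounded_on_growth _ _ _ _ Bm); lra.
Qed.

Lemma initial_part_piece D : schwartz D -> piece (initial_part D).
Proof.
  intros HD. destruct (transform_growth D HD) as [T1 [T2 [T3 [T4 [T5 [T6 T7]]]]]]. destruct good_angles as [A1 [A2 A3]].
  exact (piece_plus _ _ (piece_plus _ _ (piece_plus _ _ (piece_plus _ _ (line_family_piece D HD)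
    (piece_scal _ _ (hat_family_piece _ _ _ A2 A3 T1 T2))) (piece_scal _ _ (hat_family_piece _ _ _ A2 A3 T4 T5)))
    (piece_scal _ _ (hat_family_piece _ _ _ A1 A2 T3 T1))) (piece_scal _ _ (hat_family_piece _ _ _ A1 A2 T7 T6))).
Qed.

Lemma boundary_part_piece k1 k2 p G : jet G -> piece (boundary_part k1 k2 p G).
Proof.
  intros HG. exact (piece_plus _ _ (piece_scal _ _ (conv_family_piece _ _ _ p G contour_1 HG))
    (piece_scal _ _ (conv_family_piece _ _ _ p G contour_2 HG))).
Qed.

Lemma solution_piece D G0 G1 : schwartz D -> jet G0 -> jet G1 -> piece (solution D G0 G1).
Proof.
  intros HD H0 H1. exact (piece_scal _ _ (piece_plus _ _ (piece_plus _ _ (initial_part_piece D HD) (boundary_part_piece _ _ 3 G0 H0))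
    (boundary_part_piece _ _ 2 G1 H1))).
Qed.

Lemma two_PI_neq : (2 * PI)%C <> 0%C.
Proof.
  pose proof PI_RGT_0. rewrite <- RtoC_mult. intros E. apply RtoC_inj in E. lra.
Qed.

(** Only the line integral contributes, by Fourier inversion. *)
Lemma solution_tlim D G0 G1 : schwartz D -> jet G0 -> jet G1 -> tlim (solution D G0 G1 0 0) (D 0%nat).
Proof.
  intros HD H0 H1. pose proof PI_RGT_0. destruct good_wedges as [W1 W2].
  assert (Bn := bounded_on_neg D HD). assert (Bi := bounded_on_i D HD). assert (Bm := bounded_on_mi D HD).
  assert (T := tlim_scal (/ (2 * PI))%C _ _ (tlim_plus _ _ _ _ (tlim_plus _ _ _ _
    (tlim_plus _ _ _ _ (tlim_plus _ _ _ _ (tlim_plus _ _ _ _ (tlim_plus _ _ _ _ (line_tlim_value D HD)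
      (tlim_scal (- Ci)%C _ _ (hat_family_tlim_0 _ _ _ W1 (bounded_on_sub 0 PI (PI / 2) (15 * PI / 16) _ ltac:(lra) ltac:(lra) Bn))))
      (tlim_scal (Ci - 1)%C _ _ (hat_family_tlim_0 _ _ _ W1 (bounded_on_sub (PI / 2) PI (PI / 2) (15 * PI / 16) _ ltac:(lra) ltac:(lra) Bi))))
      (tlim_scal Ci _ _ (hat_family_tlim_0 _ _ _ W2 (bounded_on_sub 0 PI (PI / 16) (PI / 2) _ ltac:(lra) ltac:(lra) Bn))))
      (tlim_scal (- (Ci + 1))%C _ _ (hat_family_tlim_0 _ _ _ W2 (bounded_on_sub 0 (PI / 2) (PI / 16) (PI / 2) _ ltac:(lra) ltac:(lra) Bm))))
    (tlim_plus _ _ _ _ (tlim_scal (2 - 2 * Ci)%C _ _ (conv_family_tlim_0 _ _ 3 G0 W1 H0))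
      (tlim_scal (- (2) - 2 * Ci)%C _ _ (conv_family_tlim_0 _ _ 3 G0 W2 H0))))
    (tlim_plus _ _ _ _ (tlim_scal (- (2) + 2 * Ci)%C _ _ (conv_family_tlim_0 _ _ 2 G1 W1 H1))
      (tlim_scal (- (2) - 2 * Ci)%C _ _ (conv_family_tlim_0 _ _ 2 G1 W2 H1))))).
  eapply tlim_ext; [| |exact T]; [reflexivity|].
  intros x Hx. cbv beta. 
  replace (/ (2 * PI) * (2 * PI * D 0%nat x + - Ci * 0 + (Ci - 1) * 0 + Ci * 0 + - (Ci + 1) * 0 +
     ((2 - 2 * Ci) * 0 + (- (2) - 2 * Ci) * 0) + ((- (2) + 2 * Ci) * 0 + (- (2) - 2 * Ci) * 0)))%C
    with (/ (2 * PI) * (2 * PI) * D 0%nat x)%C by ring.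
  rewrite Cinv_l by apply two_PI_neq. ring.
Qed.

Lemma initial_part_xlim D n : schwartz D -> (n <= 1)%nat -> xlim (initial_part D n 0) (fun _ => 0%C).
Proof.
  intros HD Hn. destruct (transform_growth D HD) as [T1 [T2 [T3 [T4 [T5 [T6 T7]]]]]]. destruct good_angles as [A1 [A2 A3]].
  assert (X := xlim_plus _ _ _ _ (xlim_plus _ _ _ _ (xlim_plus _ _ _ _ (xlim_plus _ _ _ _ (line_family_xlim D n HD)
    (xlim_scal (- Ci)%C _ _ (hat_family_xlim _ _ _ n A2 A3 T1 T2))) (xlim_scal (Ci - 1)%C _ _ (hat_family_xlim _ _ _ n A2 A3 T4 T5)))
    (xlim_scal Ci _ _ (hat_family_xlim _ _ _ n A1 A2 T3 T1))) (xlim_scal (- (Ci + 1))%C _ _ (hat_family_xlim _ _ _ n A1 A2 T7 T6))).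
  eapply xlim_ext; [| |exact X]; [reflexivity|].
  intros t Ht. cbv beta. apply (initial_cancel D n t HD Ht Hn).
Qed.

Lemma boundary_part_xlim k1 k2 p G n v1 v2 : jet G ->
  xlim (wedge_conv (PI / 2) (15 * PI / 16) 0 (p + n) G) v1 -> xlim (wedge_conv (PI / 16) (PI / 2) 0 (p + n) G) v2 ->
  xlim (boundary_part k1 k2 p G n 0) (fun t => Ci ^ n * (k1 * v1 t + k2 * v2 t))%C.
Proof.
  intros HG X1 X2. destruct good_wedges as [W1 W2].
  eapply xlim_ext; [| |exact (xlim_scal (Ci ^ n)%C _ _ (xlim_plus _ _ _ _ (xlim_scal k1 _ _ X1) (xlim_scal k2 _ _ X2)))]; [|reflexivity].
  intros x t Hx Ht. unfold boundary_part. rewrite !conv_family_wedge by auto. ring.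
Qed.

(** The integrals with l^3 contribute [i PI/2 g0] for each contour, with coefficients
    of sum [- 4 i]; those with l^2 cancel. *)
Lemma solution_xlim_0 D G0 G1 : schwartz D -> jet G0 -> jet G1 -> xlim (solution D G0 G1 0 0) (G0 0%nat).
Proof.
  intros HD H0 H1. destruct (wedge_conv_value_3 G0 H0) as [X2 X1]. destruct (wedge_conv_value_2 G1 H1) as [v [Y2 Y1]].
  assert (X := xlim_scal (/ (2 * PI))%C _ _ (xlim_plus _ _ _ _ (xlim_plus _ _ _ _ (initial_part_xlim D 0 HD (Nat.le_0_l 1))
    (boundary_part_xlim (2 - 2 * Ci)%C (- (2) - 2 * Ci)%C 3 G0 0 _ _ H0 X1 X2))
    (boundary_part_xlim (- (2) + 2 * Ci)%C (- (2) - 2 * Ci)%C 2 G1 0 _ _ H1 Y1 Y2))).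
  eapply xlim_ext; [| |exact X]; [reflexivity|].
  intros t Ht. cbv beta. simpl (Ci ^ 0)%C.
  match goal with |- @eq _ (Cmult _ ?e) _ => replace e with ((2 * PI) * G0 0%nat t)%C end.
  - rewrite Cmult_assoc, Cinv_l by apply two_PI_neq. ring.
  - match goal with |- _ = ?e => replace e with
      (- (2) * (Ci * Ci) * PI * G0 0%nat t + 2 * ((- (1) - Ci * Ci) * v t))%C by field end.
    rewrite Ci2. ring.
Qed.

(** The derivative in x raises the powers by one: now g1 comes with the critical power
    l^3, and the integrals with l^4 g0 cancel. *)
Lemma solution_xlim_1 D G0 G1 : schwartz D -> jet G0 -> jet G1 -> xlim (solution D G0 G1 1 0) (G1 0%nat).
Proof.
  intros HD H0 H1. destruct (wedge_conv_value_3 G1 H1) as [X2 X1]. destruct (wedge_conv_value_4 G0 H0) as [v [Y2 Y1]].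
  assert (X := xlim_scal (/ (2 * PI))%C _ _ (xlim_plus _ _ _ _ (xlim_plus _ _ _ _ (initial_part_xlim D 1 HD (le_n 1))
    (boundary_part_xlim (2 - 2 * Ci)%C (- (2) - 2 * Ci)%C 3 G0 1 _ _ H0 Y1 Y2))
    (boundary_part_xlim (- (2) + 2 * Ci)%C (- (2) - 2 * Ci)%C 2 G1 1 _ _ H1 X1 X2))).
  eapply xlim_ext; [| |exact X]; [reflexivity|].
  intros t Ht. cbv beta. rewrite Cpow_1_r.
  match goal with |- @eq _ (Cmult _ ?e) _ => replace e with ((2 * PI) * G1 0%nat t)%C end.
  - rewrite Cmult_assoc, Cinv_l by apply two_PI_neq. ring.
  - match goal with |- _ = ?e => replace e with
      (2 * Ci * ((- (1) - Ci * Ci) * v t) - 2 * (Ci * Ci) * PI * G1 0%nat t)%C by field end.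
    rewrite Ci2. ring.
Qed.

(** * The formula for the solution on the deformed contours *)

Definition sector_growth (a b : R) (F : C -> C) : Prop :=
  Hol (sector a b) F /\ exists q B, 0 <= B /\
    forall theta r, a <= theta <= b -> 0 <= r -> Cmod (F (ray theta r)) <= B * (1 + r) ^ q.

Lemma sector_growth_plus a b F G : sector_growth a b F -> sector_growth a b G -> sector_growth a b (fun l => F l + G l)%C.
Proof.
  intros [H1 [q1 [B1 [HB1 HB1']]]] [H2 [q2 [B2 [HB2 HB2']]]]. split; [apply Hol_plus; auto|].
  exists (q1 + q2)%nat, (B1 + B2). split; [lra|]. intros theta r Ht Hr.
  eapply Rle_trans; [apply Cmod_triangle|].
  specialize (HB1' theta r Ht Hr). specialize (HB2' theta r Ht Hr).
  assert ((1 + r) ^ q1 <= (1 + r) ^ (q1 + q2)) by (apply Rle_pow; [lra|lia]).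
  assert ((1 + r) ^ q2 <= (1 + r) ^ (q1 + q2)) by (apply Rle_pow; [lra|lia]).
  assert (B1 * (1 + r) ^ q1 <= B1 * (1 + r) ^ (q1 + q2)) by (apply Rmult_le_compat_l; auto).
  assert (B2 * (1 + r) ^ q2 <= B2 * (1 + r) ^ (q1 + q2)) by (apply Rmult_le_compat_l; auto).
  lra.
Qed.

Lemma sector_growth_scal a b c F : sector_growth a b F -> sector_growth a b (fun l => c * F l)%C.
Proof.
  intros [H1 [q1 [B1 [HB1 HB1']]]]. split; [apply Hol_scal; auto|].
  exists q1, (Cmod c * B1). split; [apply Rmult_le_pos; auto; apply Cmod_ge_0|]. intros theta r Ht Hr.
  rewrite Cmod_mult, Rmult_assoc. apply Rmult_le_compat_l; [apply Cmod_ge_0|]. auto.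
Qed.

Lemma sector_growth_kernel a b rho t : 0 <= t -> (forall theta, a <= theta <= b -> 0 <= cos (4 * theta)) ->
  bounded_on a b rho -> sector_growth a b (kernel rho 0 t).
Proof.
  intros Ht Hc [H [B [HB HB']]]. split; [apply Hol_kernel; auto|]. exists 0%nat, B. split; auto.
  intros theta r Hth Hr. unfold kernel. simpl. rewrite Cmult_1_l, Cmod_mult, Rmult_1_r.
  specialize (HB' theta r Hth Hr). pose proof (Cmod_heat_le_1 theta r t (Hc theta Hth) Hr Ht).
  eapply Rle_trans; [apply mul_le_1; auto using Cmod_ge_0|auto].
Qed.

Lemma sector_growth_bdata a b p G t : 0 <= t -> (forall theta, a <= theta <= b -> 0 <= cos (4 * theta)) ->
  jet G -> sector_growth a b (bdata p G 0 t).
Proof.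
  intros Ht Hc HG. split.
  - apply Hol_bdata; auto. intros z [theta [r [Hth [Hr ->]]]]. apply Re_omega_ray; auto.
  - destruct (convm_bound 0 G t HG) as [q [B [HB0 HB]]]. exists (p + 4 * q)%nat, B. split; auto.
    intros theta r Hth Hr. unfold bdata. rewrite Cmod_mult, Cmod_pow, Cmod_ray by auto.
    apply pow_mul_1p; auto; [apply Cmod_ge_0|].
    eapply Rle_trans; [apply HB; [apply Re_omega_ray; auto|lra]|].
    apply Rmult_le_compat_l; auto. rewrite pow_mult. apply pow_incr.
    rewrite Cmod_omega, Cmod_ray by auto. split; [pose proof (pow_le r 4 Hr); lra|].
    assert (0 <= r * r) by nra. assert (0 <= r * r * r) by nra. simpl. nra.
Qed.

(** In a sector of the open upper half-plane [osc] decays faster than any power. *)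
Lemma sector_growth_rotate a b F x : a <= b -> 0 < x ->
  (forall theta, a <= theta <= b -> sin (PI / 16) <= sin theta) -> sector_growth a b F ->
  int_ray a (fun l => osc x l * F l)%C = int_ray b (fun l => osc x l * F l)%C /\
  exists M, forall theta, a <= theta <= b -> ray_dominated theta M (fun l => osc x l * F l)%C.
Proof.
  intros Hab Hx Hs [H [q [B [HB HB']]]].
  destruct (osc_sector_bound a b q x B _ sin_PI16_pos Hx HB Hs) as [M HM].
  assert (HH : Hol (sector a b) (fun l => osc x l * F l)%C) by (apply Hol_mult; [apply Hol_osc|auto]).
  assert (HBd : forall r theta, 0 <= r -> a <= theta <= b -> Cmod (osc x (ray theta r) * F (ray theta r)) <= M / (1 + r ^ 2)).
  { intros r theta Hr Ht. rewrite Cmod_mult. apply HM; auto. }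
  split.
  - apply (sector_rotate _ a b M); auto.
  - exists M. intros theta Ht. apply ray_dominated_intro; auto.
    eapply Hol_subset; [apply sector_on_ray, Ht|]. exact HH.
Qed.

(** The bracket of the formula on one contour, multiplied by the heat factor. *)
Definition combination (k1 k2 k3 k4 : C) (G0 G1 : nat -> R -> C) (r3 r4 : C -> C) (t : R) (l : C) : C :=
  (k1 * bdata 3 G0 0 t l + k2 * bdata 2 G1 0 t l + k3 * kernel r3 0 t l + k4 * kernel r4 0 t l)%C.

Lemma sector_growth_combination a b k1 k2 k3 k4 G0 G1 r3 r4 t : 0 <= t ->
  (forall theta, a <= theta <= b -> 0 <= cos (4 * theta)) -> jet G0 -> jet G1 ->
  bounded_on a b r3 -> bounded_on a b r4 -> sector_growth a b (combination k1 k2 k3 k4 G0 G1 r3 r4 t).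
Proof.
  intros Ht Hc H0 H1 H3 H4.
  exact (sector_growth_plus _ _ _ _ (sector_growth_plus _ _ _ _ (sector_growth_plus _ _ _ _
    (sector_growth_scal _ _ k1 _ (sector_growth_bdata a b 3 G0 t Ht Hc H0))
    (sector_growth_scal _ _ k2 _ (sector_growth_bdata a b 2 G1 t Ht Hc H1)))
    (sector_growth_scal _ _ k3 _ (sector_growth_kernel a b r3 t Ht Hc H3)))
    (sector_growth_scal _ _ k4 _ (sector_growth_kernel a b r4 t Ht Hc H4))).
Qed.

Lemma combination_split theta k1 k2 k3 k4 G0 G1 r3 r4 x t : good_angle theta -> 0 < x -> 0 < t -> jet G0 -> jet G1 ->
  ray_growth theta r3 -> ray_growth theta r4 ->
  int_ray theta (fun l => osc x l * combination k1 k2 k3 k4 G0 G1 r3 r4 t l)%C =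
  (k1 * ray_family theta (bdata 3 G0) 0 0 x t + k2 * ray_family theta (bdata 2 G1) 0 0 x t
   + k3 * ray_family theta (kernel r3) 0 0 x t + k4 * ray_family theta (kernel r4) 0 0 x t)%C.
Proof.
  intros Ha Hx Ht H0 H1 H3 H4.
  assert (Dm : forall F, ray_growth theta F -> exists M, ray_dominated theta M (fun l => osc x l * F l)%C).
  { intros F [A [q [B [HB HB']]]]. apply (good_ray_osc_dominated theta F x q B); auto. }
  assert (K : forall r, ray_growth theta r -> ray_growth theta (fun l => (Ci * l) ^ 0 * kernel r 0 t l)%C).
  { intros r Hr. apply (ray_growth_mult theta (fun l => (Ci * l) ^ 0)%C); [apply (ray_growth_const theta 1)|].
    apply (ray_growth_mult theta (fun l => (- omega l) ^ 0)%C); [apply (ray_growth_const theta 1)|].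
    apply ray_growth_mult; auto. apply ray_growth_heat; [apply cos4_good; auto|lra]. }
  assert (L : forall p G, jet G -> ray_growth theta (fun l => (Ci * l) ^ 0 * bdata p G 0 t l)%C).
  { intros p G HG. apply (ray_growth_mult theta (fun l => (Ci * l) ^ 0)%C); [apply (ray_growth_const theta 1)|].
    apply wedge_conv_growth; auto; lra. }
  destruct (Dm _ (L 3%nat G0 H0)) as [M1 D1]. destruct (Dm _ (L 2%nat G1 H1)) as [M2 D2].
  destruct (Dm _ (K r3 H3)) as [M3 D3]. destruct (Dm _ (K r4 H4)) as [M4 D4].
  unfold ray_family.
  rewrite <- (int_ray_scal theta M1 k1), <- (int_ray_scal theta M2 k2), <- (int_ray_scal theta M3 k3), <- (int_ray_scal theta M4 k4) by auto.
  apply (ray_dominated_scal theta M1 k1) in D1. apply (ray_dominated_scal theta M2 k2) in D2.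
  apply (ray_dominated_scal theta M3 k3) in D3. apply (ray_dominated_scal theta M4 k4) in D4.
  assert (P1 := ray_dominated_plus _ _ _ _ _ D1 D2). assert (P2 := ray_dominated_plus _ _ _ _ _ P1 D3).
  assert (P3 := ray_dominated_plus _ _ _ _ _ P2 D4).
  rewrite <- (int_ray_plus _ _ _ _ _ D1 D2). rewrite <- (int_ray_plus _ _ _ _ _ P1 D3). rewrite <- (int_ray_plus _ _ _ _ _ P2 D4).
  symmetry. eapply int_ray_ext; [exact P3|]. intros r Hr. cbv beta. unfold combination. cbn [Cpow]. ring.
Qed.

(** A contour coming in from infinity along the ray of angle [b] and leaving along the
    ray of angle [a] is moved to the good rays [b'] and [a']; [r3] and [r4] have to be
    defined on the whole region swept. *)
Lemma combination_rotate a a' b b' k1 k2 k3 k4 G0 G1 r3 r4 x t F : 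
  0 < x -> 0 < t -> jet G0 -> jet G1 -> good_angle a' -> good_angle b' ->
  (forall theta, Rmin a a' <= theta <= Rmax a a' \/ Rmin b b' <= theta <= Rmax b b' ->
     sin (PI / 16) <= sin theta /\ 0 <= cos (4 * theta)) ->
  (forall c d, Rmin a a' <= c -> d <= Rmax b b' -> bounded_on c d r3 /\ bounded_on c d r4) ->
  a <= b -> a' <= b' ->
  (forall theta r, 0 < r -> theta = a \/ theta = b ->
     F (ray theta r) = (osc x (ray theta r) * combination k1 k2 k3 k4 G0 G1 r3 r4 t (ray theta r))%C) ->
  (- int_ray b F + int_ray a F =
   k1 * conv_family a' b' 3 G0 0 0 x t + k2 * conv_family a' b' 2 G1 0 0 x t
   + k3 * hat_family a' b' r3 0 0 x t + k4 * hat_family a' b' r4 0 0 x t)%C.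
Proof.
  intros Hx Ht H0 H1 Ga Gb Hang Hb Hab Hab' E.
  set (Psi := combination k1 k2 k3 k4 G0 G1 r3 r4 t).
  assert (R : forall c c', (forall theta, Rmin c c' <= theta <= Rmax c c' -> sin (PI / 16) <= sin theta /\ 0 <= cos (4 * theta)) ->
    bounded_on (Rmin c c') (Rmax c c') r3 -> bounded_on (Rmin c c') (Rmax c c') r4 ->
    good_angle c' ->
    (forall r, 0 < r -> F (ray c r) = (osc x (ray c r) * Psi (ray c r))%C) ->
    int_ray c F = (k1 * ray_family c' (bdata 3 G0) 0 0 x t + k2 * ray_family c' (bdata 2 G1) 0 0 x t
      + k3 * ray_family c' (kernel r3) 0 0 x t + k4 * ray_family c' (kernel r4) 0 0 x t)%C).
  { intros c c' Hc B3 B4 Gc EF.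
    assert (Hmm : Rmin c c' <= Rmax c c') by (apply Rle_trans with c; [apply Rmin_l|apply Rmax_l]).
    assert (Ic : Rmin c c' <= c <= Rmax c c') by (split; [apply Rmin_l|apply Rmax_l]).
    assert (Ic' : Rmin c c' <= c' <= Rmax c c') by (split; [apply Rmin_r|apply Rmax_r]).
    destruct (sector_growth_rotate (Rmin c c') (Rmax c c') Psi x Hmm Hx) as [Rot [M HM]].
    { intros; apply Hc; auto. }
    { apply sector_growth_combination; auto; [lra|]. intros; apply Hc; auto. }
    rewrite <- (combination_split c' k1 k2 k3 k4 G0 G1 r3 r4 x t) by
      (auto; first [exact (bounded_on_growth _ _ _ _ B3 Ic')|exact (bounded_on_growth _ _ _ _ B4 Ic')]).
    fold Psi. transitivity (int_ray c (fun l => osc x l * Psi l)%C).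
    - symmetry. apply (int_ray_ext c M); [apply HM; auto|]. intros r Hr. symmetry. apply EF; auto.
    - revert Rot. unfold Rmin, Rmax. destruct (Rle_dec c c'); auto. }
  assert (Hm : Rmin a a' <= Rmin b b') by (unfold Rmin; destruct (Rle_dec a a'), (Rle_dec b b'); lra).
  assert (HM : Rmax a a' <= Rmax b b') by (unfold Rmax; destruct (Rle_dec a a'), (Rle_dec b b'); lra).
  destruct (Hb (Rmin a a') (Rmax a a') (Rle_refl _) HM) as [B1 B2].
  destruct (Hb (Rmin b b') (Rmax b b') Hm (Rle_refl _)) as [B3 B4].
  rewrite (R a a'), (R b b') by auto.
  unfold conv_family, hat_family. ring.
Qed.

Lemma osc_heat (x t : R) (l : C) : Cexp (Ci * l * x - omega l * t)%C = (osc x l * heat t l)%C.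
Proof. unfold osc, heat. rewrite <- Cexp_plus. reflexivity. Qed.

Lemma conv_heat (g : R -> C) (w : C) (t : R) : (forall x, Ccont g x) -> conv g (omega w) t = (heat t w * tilde g (omega w) t)%C.
Proof. intros; rewrite conv_tilde by auto. reflexivity. Qed.

(** The contours of the representation formula bound sectors where Re l^4 < 0, and may
    be moved away from these sectors as long as Re l^4 >= 0 and Im l > 0. *)
Lemma solution_formula D G0 G1 (u0 g0 g1 : R -> C) x t : schwartz D -> jet G0 -> jet G1 -> 0 < x -> 0 < t ->
  (forall z, Im z <= 0 -> hat u0 z = hat (D 0%nat) z) ->
  (forall w, tilde g0 w t = tilde (G0 0%nat) w t) -> (forall w, tilde g1 w t = tilde (G1 0%nat) w t) ->
  (int_line (fun l => Cexp (Ci * l * x - omega l * t) * hat u0 l)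
     + int_Gamma1 (fun l => Cexp (Ci * l * x - omega l * t) *
         ( (2 - 2 * Ci) * l ^ 3 * tilde g0 (omega l) t
         + (- (2) + 2 * Ci) * l ^ 2 * tilde g1 (omega l) t
         - Ci * hat u0 (- l)
         + (Ci - 1) * hat u0 (Ci * l)))
     + int_Gamma2 (fun l => Cexp (Ci * l * x - omega l * t) *
         ( (- (2) - 2 * Ci) * l ^ 3 * tilde g0 (omega l) t
         + (- (2) - 2 * Ci) * l ^ 2 * tilde g1 (omega l) t
         + Ci * hat u0 (- l)
         - (Ci + 1) * hat u0 (- (Ci * l)))) = 2 * PI * solution D G0 G1 0 0 x t)%C.
Proof.
  intros HD H0 H1 Hx Ht Eu E0 E1. pose proof PI_RGT_0.
  assert (Bn := bounded_on_neg D HD). assert (Bi := bounded_on_i D HD). assert (Bm := bounded_on_mi D HD).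
  destruct good_angles as [A1 [A2 A3]].
  assert (L : int_line (fun l => Cexp (Ci * l * x - omega l * t) * hat u0 l)%C = line_family (hat (D 0%nat)) 0 0 x t).
  { assert (Gr0 := ray_growth_hat D 0 (or_introl eq_refl) HD). assert (GrP := ray_growth_hat D PI (or_intror eq_refl) HD).
    destruct (ray_family_kernel_dominated 0 (hat (D 0%nat)) 0 0 x t) as [M0 D0]; auto; try lra.
    { rewrite sin_0; lra. } { rewrite Rmult_0_r, cos_0; lra. }
    destruct (ray_family_kernel_dominated PI (hat (D 0%nat)) 0 0 x t) as [MP DP]; auto; try lra.
    { rewrite sin_PI; lra. } { rewrite (real_ray_cos4 PI); auto; lra. }
    transitivity (int_line (fun l => osc x l * ((Ci * l) ^ 0 * kernel (hat (D 0%nat)) 0 t l))%C).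
    - unfold int_line. apply (f_equal (fun f : R -> CR => RInt_gen f _ _)), functional_extensionality. intros r.
      unfold kernel. rewrite osc_heat, Eu by (simpl; lra).
      match goal with |- @eq _ ?a ?b => change (@eq C a b) end. cbn [Cpow]. ring.
    - apply (int_line_real (Rmax M0 MP)).
      + eapply ray_dominated_le; [apply Rmax_l|exact D0].
      + eapply ray_dominated_le; [apply Rmax_r|exact DP]. }
  rewrite L. unfold int_Gamma1, int_Gamma2.
  rewrite (combination_rotate (5 * PI / 8) (PI / 2) (7 * PI / 8) (15 * PI / 16)
    (2 - 2 * Ci)%C (- (2) + 2 * Ci)%C (- Ci)%C (Ci - 1)%C G0 G1 (hat_neg (D 0%nat)) (hat_i (D 0%nat)) x t); auto; try lra.
  2: { intros theta Hth. rewrite Rmin_right, Rmax_left, Rmin_left, Rmax_right in Hth by lra.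
       split; [apply sin_sector; lra|apply cos4_nonneg; lra]. }
  2: { intros c d Hc Hd. rewrite Rmin_right in Hc by lra. rewrite Rmax_right in Hd by lra.
       split; [apply (bounded_on_sub 0 PI)|apply (bounded_on_sub (PI / 2) PI)]; auto; lra. }
  2: { intros theta r Hr Hth. assert (PI / 2 <= theta <= PI) by (destruct Hth; subst; lra).
       assert (U := ray_upper theta r ltac:(lra) ltac:(lra)). assert (Lf := ray_left theta r ltac:(lra) ltac:(lra)).
       unfold combination, kernel, bdata, hat_neg, hat_i. cbn [convm]. rewrite osc_heat, !conv_heat, E0, E1 by (apply H0 || apply H1).
       rewrite (Eu (- _)%C), (Eu (Ci * _)%C); [change ((- omega (ray theta r)) ^ 0)%C with (RtoC 1); ring| |];
       revert U Lf; unfold upper, left_half, Re, Im; simpl; lra. }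
  rewrite (combination_rotate (PI / 8) (PI / 16) (3 * PI / 8) (PI / 2)
    (- (2) - 2 * Ci)%C (- (2) - 2 * Ci)%C Ci (- (Ci + 1))%C G0 G1 (hat_neg (D 0%nat)) (hat_mi (D 0%nat)) x t); auto; try lra.
  2: { intros theta Hth. rewrite Rmin_right, Rmax_left, Rmin_left, Rmax_right in Hth by lra.
       split; [apply sin_sector; lra|apply cos4_nonneg; lra]. }
  2: { intros c d Hc Hd. rewrite Rmin_right in Hc by lra. rewrite Rmax_right in Hd by lra.
       split; [apply (bounded_on_sub 0 PI)|apply (bounded_on_sub 0 (PI / 2))]; auto; lra. }
  2: { intros theta r Hr Hth. assert (0 <= theta <= PI / 2) by (destruct Hth; subst; lra).
       assert (U := ray_upper theta r ltac:(lra) ltac:(lra)). assert (Rg := ray_right theta r ltac:(lra) ltac:(lra)).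
       unfold combination, kernel, bdata, hat_neg, hat_mi. cbn [convm]. rewrite osc_heat, !conv_heat, E0, E1 by (apply H0 || apply H1).
       rewrite (Eu (- ray _ _)%C), (Eu (- (Ci * _))%C); [change ((- omega (ray theta r)) ^ 0)%C with (RtoC 1); ring| |];
       revert U Rg; unfold upper, right_half, Re, Im; simpl; lra. }
  unfold solution, initial_part, boundary_part.
  rewrite Cmult_assoc, Cinv_r by apply two_PI_neq. ring.
Qed.

(** * Relative derivatives *)

(** The epsilon-delta form of [is_derive_within]. *)
Definition rder (A : R -> Prop) (f : R -> C) (x : R) (l : C) : Prop :=
  forall eps, 0 < eps -> exists d, 0 < d /\ forall y, A y -> Rabs (y - x) < d ->
    Cmod (f y - f x - (y - x) * l) <= eps * Rabs (y - x).

Lemma remainder_norm (f : R -> C) (x y : R) (l : C) :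
  norm (minus (minus (f y : CR) (f x : CR)) (scal (minus y x) (l : CR))) = Cmod (f y - f x - (y - x) * l).
Proof.
  rewrite <- norm_CR. f_equal.
  destruct (f y) as [a b], (f x) as [a' b'], l as [l1 l2].
  unfold minus, plus, opp, scal; simpl. unfold prod_plus, prod_opp, prod_scal, plus, opp, scal; simpl.
  unfold mult, plus, opp; simpl. unfold Cminus, Cplus, Copp, Cmult; simpl. f_equal; ring.
Qed.

Lemma is_derive_within_rder A f x l : A x -> (is_derive_within A f x l <-> rder A f x l).
Proof.
  intros HA. split.
  - intros [_ H] eps He.
    assert (Hlim : is_filter_lim (within A (locally x)) x).
    { intros P HP. unfold within. revert HP. apply filter_imp. auto. }
    destruct (H x Hlim (mkposreal eps He)) as [d Hd]. exists d. split; [apply cond_pos|].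
    intros y Hy Hyx. specialize (Hd y Hyx Hy). cbv beta in Hd. rewrite remainder_norm in Hd. exact Hd.
  - intros H. split; [exact (is_linear_scal_l (K := R_AbsRing) (V := CR) l)|]. intros z Hz.
    assert (E : x = z).
    { destruct (Req_dec x z) as [E|E]; auto. exfalso.
      assert (P : 0 < Rabs (x - z)) by (apply Rabs_pos_lt; lra).
      destruct (Hz (fun y => Rabs (y - z) < Rabs (x - z))) as [d Hd]; [exists (mkposreal _ P); auto|].
      specialize (Hd x (ball_center x d) HA). cbv beta in Hd. lra. }
    subst z. intros eps. destruct (H eps (cond_pos eps)) as [d [Hd0 Hd]].
    exists (mkposreal d Hd0). intros y Hy HAy. cbv beta. rewrite remainder_norm. apply Hd; auto.
Qed.

Lemma rder_subset (A B : R -> Prop) f x l : (forall y, B y -> A y) -> rder A f x l -> rder B f x l.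
Proof.
  intros HS H eps He. destruct (H eps He) as [d [Hd0 Hd]]. exists d. split; auto.
Qed.

Lemma rder_ext (A : R -> Prop) f g x l : (forall y, A y -> f y = g y) -> A x -> rder A f x l -> rder A g x l.
Proof.
  intros E HA H eps He. destruct (H eps He) as [d [Hd0 Hd]]. exists d. split; auto.
  intros y Hy Hyx. rewrite <- !E by auto. auto.
Qed.

Lemma is_derive_eps (f : R -> R) x l : (forall eps, 0 < eps -> exists d, 0 < d /\ forall y, Rabs (y - x) < d ->
    Rabs (f y - f x - (y - x) * l) <= eps * Rabs (y - x)) -> is_derive f x l.
Proof.
  intros H. split; [exact (is_linear_scal_l (K := R_AbsRing) (V := R_NormedModule) l)|]. intros z Hz.
  rewrite <- (is_filter_lim_locally_unique _ _ Hz). intros eps.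
  destruct (H eps (cond_pos eps)) as [d [Hd0 Hd]]. exists (mkposreal d Hd0). intros y Hy. apply Hd; auto.
Qed.

Lemma rder_Cder A f x l d : 0 < d -> (forall y, Rabs (y - x) < d -> A y) -> rder A f x l -> Cder f x l.
Proof.
  intros Hd HA H. split; apply is_derive_eps; intros eps He; destruct (H eps He) as [e [He0 Hee]];
    exists (Rmin d e); (split; [apply Rmin_pos; auto|]); intros y Hy;
    assert (Hy1 := Rlt_le_trans _ _ _ Hy (Rmin_l d e)); assert (Hy2 := Rlt_le_trans _ _ _ Hy (Rmin_r d e));
    (eapply Rle_trans; [|exact (Hee y (HA y Hy1) Hy2)]).
  - replace (Re (f y) - Re (f x) - (y - x) * Re l) with (Re (f y - f x - (y - x) * l)) by (unfold Re; simpl; ring).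
    apply re_le_Cmod.
  - replace (Im (f y) - Im (f x) - (y - x) * Im l) with (Im (f y - f x - (y - x) * l)) by (unfold Im; simpl; ring).
    apply im_le_Cmod.
Qed.

Lemma rder_continuous A f x l : rder A f x l -> forall eps, 0 < eps ->
  exists d, 0 < d /\ forall y, A y -> Rabs (y - x) < d -> Cmod (f y - f x) < eps.
Proof.
  intros H eps He. destruct (H 1 Rlt_0_1) as [d [Hd0 Hd]].
  assert (HC := Cmod_ge_0 l).
  assert (Hp : 0 < Rmin d (eps / (2 + Cmod l))) by (apply Rmin_pos; auto; apply Rdiv_lt_0_compat; lra).
  exists (Rmin d (eps / (2 + Cmod l))). split; auto. intros y HA Hy.
  assert (H1 := Hd y HA (Rlt_le_trans _ _ _ Hy (Rmin_l _ _))).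
  assert (H2 := Rlt_le_trans _ _ _ Hy (Rmin_r _ _)).
  replace (f y - f x)%C with ((f y - f x - (y - x) * l) + (y - x) * l)%C by ring.
  eapply Rle_lt_trans; [apply Cmod_triangle|]. rewrite Cmod_mult, <- RtoC_minus, Cmod_R.
  assert (Hlt : Rabs (y - x) * (2 + Cmod l) < eps).
  { apply (Rmult_lt_compat_r (2 + Cmod l)) in H2; [|lra]. unfold Rdiv in H2. rewrite Rmult_assoc, Rinv_l, Rmult_1_r in H2 by lra. auto. }
  rewrite <- RtoC_minus in H1. pose proof (Rabs_pos (y - x)). lra.
Qed.

Lemma Ccont_of_eps f x : (forall eps, 0 < eps -> exists d, 0 < d /\ forall y, Rabs (y - x) < d -> Cmod (f y - f x) < eps) -> Ccont f x.
Proof.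
  intros H. apply continuous_CR. apply filterlim_locally. intros eps.
  destruct (H eps (cond_pos eps)) as [d [Hd0 Hd]]. exists (mkposreal d Hd0). intros y Hy. apply ball_CR. apply Hd, Hy.
Qed.

(** Composing with [Rmax 0] keeps the continuity at 0 and changes nothing on the open
    half-line. *)
Lemma jet_of_derivatives f E : derivatives_on nonneg_half_line f E -> jet (fun k x => E k (Rmax 0 x)).
Proof.
  intros [_ H].
  assert (H' : forall k x, 0 <= x -> rder nonneg_half_line (E k) x (E (S k) x)).
  { intros k x Hx. apply is_derive_within_rder; [exact Hx|]. apply H. exact Hx. }
  split.
  - intros k x. apply Ccont_of_eps. intros eps He.
    destruct (rder_continuous _ _ _ _ (H' k (Rmax 0 x) (Rmax_l _ _)) eps He) as [d [Hd0 Hd]].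
    exists d. split; auto. intros y Hy. apply Hd; [apply Rmax_l|]. eapply Rle_lt_trans; [apply Rmax_lip|auto].
  - intros k x Hx. rewrite (Rmax_right 0 x) by lra. apply (Cder_ext_loc (E k)).
    + exists (mkposreal x Hx). intros y Hy. change (Rabs (y - x) < x) in Hy. rewrite Rmax_right; auto.
      unfold Rabs in Hy. destruct Rcase_abs in Hy; lra.
    + apply (rder_Cder nonneg_half_line _ _ _ x Hx); [|apply H'; lra].
      intros y Hy. unfold nonneg_half_line. unfold Rabs in Hy. destruct Rcase_abs in Hy; lra.
Qed.

Lemma Derive_n_seq (f : R -> R) (e : nat -> R -> R) : (forall x, 0 < x -> f x = e 0%nat x) ->
  (forall k x, 0 < x -> is_derive (e k) x (e (S k) x)) -> forall n x, 0 < x -> Derive_n f n x = e n x.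
Proof.
  intros H0 H. induction n; intros x Hx; [apply H0; auto|].
  simpl. rewrite (Derive_ext_loc _ (e n)).
  - apply is_derive_unique. apply H; auto.
  - exists (mkposreal x Hx). intros y Hy. change (Rabs (y - x) < x) in Hy. apply IHn.
    unfold Rabs in Hy. destruct Rcase_abs in Hy; lra.
Qed.

Lemma CDerive_n_seq (f : R -> C) (E : nat -> R -> C) : (forall x, 0 < x -> f x = E 0%nat x) ->
  (forall k x, 0 < x -> Cder (E k) x (E (S k) x)) -> forall n x, 0 < x -> CDerive_n f n x = E n x.
Proof.
  intros H0 H n x Hx. unfold CDerive_n.
  rewrite (Derive_n_seq (fun y => Re (f y)) (fun k y => Re (E k y))), (Derive_n_seq (fun y => Im (f y)) (fun k y => Im (E k y))); auto.
  - symmetry; apply surjective_pairing.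
  - intros; rewrite H0; auto.
  - intros; apply H; auto.
  - intros; rewrite H0; auto.
  - intros; apply H; auto.
Qed.

(** * Smoothness up to the boundary *)

Definition punctured := closed_quadrant_minus_origin.

Lemma punctured_swap x t : punctured x t -> punctured t x.
Proof. intros [H1 [H2 H3]]. split; [|split]; auto. intros E. apply H3. injection E as -> ->. reflexivity. Qed.

Lemma punctured_pos_l x t : 0 < x -> 0 <= t -> punctured x t.
Proof. intros. split; [lra|split; auto]. intros E. injection E as E1 E2. lra. Qed.

Lemma punctured_pos_r x t : 0 <= x -> 0 < t -> punctured x t.
Proof. intros. apply punctured_swap, punctured_pos_l; auto. Qed.

Lemma punctured_cases x t : punctured x t -> (0 < x /\ 0 < t) \/ (0 < x /\ t = 0) \/ (x = 0 /\ 0 < t).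
Proof.
  intros [H1 [H2 H3]]. destruct (Rle_lt_or_eq_dec _ _ H1) as [Hx|Hx], (Rle_lt_or_eq_dec _ _ H2) as [Ht|Ht]; auto.
  exfalso. apply H3. subst. reflexivity.
Qed.

(** Joint continuity relative to the quadrant without its corner. *)
Definition jcont (K : R -> R -> C) (x t : R) : Prop :=
  forall eps, 0 < eps -> exists d, 0 < d /\ forall y s, punctured y s -> Rabs (y - x) < d -> Rabs (s - t) < d ->
    Cmod (K y s - K x t) < eps.

Lemma jcont_swap K x t : jcont K x t -> jcont (fun s y => K y s) t x.
Proof.
  intros H eps He. destruct (H eps He) as [d [Hd0 Hd]]. exists d. split; auto.
  intros s y Hp Hs Hy. apply Hd; auto. apply punctured_swap; auto.
Qed.

(** Two applications of the mean value inequality, along the sides of a rectangle. *)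
Lemma jcont_interior K L M : 
  (forall x t, 0 < x -> 0 < t -> Cder (fun y => K y t) x (L x t)) ->
  (forall x t, 0 < x -> 0 < t -> Cder (fun s => K x s) t (M x t)) ->
  (forall x0 t0 T, 0 < x0 -> 0 < t0 -> exists B, forall x t, x0 <= x -> t0 <= t <= T -> Cmod (L x t) <= B /\ Cmod (M x t) <= B) ->
  forall x t, 0 < x -> 0 < t -> jcont K x t.
Proof.
  intros HL HM HB x t Hx Ht eps He.
  destruct (HB (x / 2) (t / 2) (2 * t) ltac:(lra) ltac:(lra)) as [B HB'].
  assert (B0 : 0 <= B) by (destruct (HB' x t ltac:(lra) ltac:(lra)); pose proof (Cmod_ge_0 (L x t)); lra).
  assert (Inc : forall (f f' : R -> C) a b, (forall z, Rmin a b <= z <= Rmax a b -> Cder f z (f' z) /\ Cmod (f' z) <= B) ->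
    Cmod (f b - f a) <= 2 * B * Rabs (b - a)).
  { assert (W : forall (f f' : R -> C) a b, a <= b -> (forall z, a <= z <= b -> Cder f z (f' z) /\ Cmod (f' z) <= B) ->
      Cmod (f b - f a) <= 2 * B * (b - a)).
    { intros f f' a b Hab Hf. apply (mean_value_ineq f f'); auto; intros z Hz.
      - apply Hf; lra.
      - eapply Cder_Ccont, Hf; auto.
      - apply Hf; lra. }
    intros f f' a b Hf. destruct (Rle_dec a b) as [Hab|Hab].
    - rewrite Rabs_pos_eq by lra. apply (W f f'); auto. intros; apply Hf. rewrite Rmin_left, Rmax_right; lra.
    - rewrite Cmod_minus_sym, Rabs_minus_sym, Rabs_pos_eq by lra. apply (W f f'); [lra|]. intros; apply Hf.
      rewrite Rmin_right, Rmax_left; lra. }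
  set (e := eps / (4 * B + 1)). assert (He0 : 0 < e) by (apply Rdiv_lt_0_compat; lra).
  assert (Ee : e * (4 * B + 1) = eps) by (unfold e; field; lra).
  exists (Rmin e (Rmin (x / 2) (t / 2))). split; [repeat apply Rmin_pos; lra|].
  intros y s _ Hy Hs.
  assert (y1 := Rlt_le_trans _ _ _ Hy (Rmin_l _ _)). assert (y2 := Rlt_le_trans _ _ _ Hy (Rle_trans _ _ _ (Rmin_r _ _) (Rmin_l _ _))).
  assert (s1 := Rlt_le_trans _ _ _ Hs (Rmin_l _ _)). assert (s2 := Rlt_le_trans _ _ _ Hs (Rle_trans _ _ _ (Rmin_r _ _) (Rmin_r _ _))).
  apply Rabs_def2 in y2. apply Rabs_def2 in s2.
  replace (K y s - K x t)%C with ((K y s - K x s) + (K x s - K x t))%C by ring.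
  eapply Rle_lt_trans; [apply Cmod_triangle|].
  assert (I1 := Inc (fun y => K y s) (fun y => L y s) x y). assert (I2 := Inc (fun s => K x s) (fun s => M x s) t s).
  cbv beta in I1, I2.
  assert (J1 : Cmod (K y s - K x s) <= 2 * B * Rabs (y - x)).
  { apply I1. intros z Hz. assert (x / 2 <= z) by (apply Rle_trans with (Rmin x y); [apply Rmin_glb|]; lra).
    split; [apply HL|apply HB']; lra. }
  assert (J2 : Cmod (K x s - K x t) <= 2 * B * Rabs (s - t)).
  { apply I2. intros z Hz. assert (t / 2 <= z) by (apply Rle_trans with (Rmin t s); [apply Rmin_glb|]; lra).
    assert (z <= 2 * t) by (apply Rle_trans with (Rmax t s); [|apply Rmax_lub]; lra).
    split; [apply HM|apply HB']; lra. }
  assert (B * Rabs (y - x) <= B * e) by (apply Rmult_le_compat_l; lra).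
  assert (B * Rabs (s - t) <= B * e) by (apply Rmult_le_compat_l; lra). lra.
Qed.

(** A locally uniform limit of continuous functions is continuous, and so is the
    function of two variables made of both. *)
Lemma jcont_edge K x : 0 < x -> (forall y s, 0 < y -> 0 < s -> jcont K y s) ->
  (forall p P, 0 < p -> p <= P -> unif_lim_at_0 (fun y => p <= y <= P) (fun s y => K y s) (fun y => K y 0)) ->
  jcont K x 0.
Proof.
  intros Hx HK HU eps He.
  assert (He' : 0 < eps / 4) by lra.
  destruct (HU (x / 2) (2 * x) ltac:(lra) ltac:(lra) (mkposreal _ He')) as [d Hd].
  assert (U : forall s y, 0 < s < d -> x / 2 <= y <= 2 * x -> Cmod (K y s - K y 0) < eps / 4).
  { intros s y Hs Hy. apply (Hd s); auto; [|lra]. change (Rabs (s - 0) < d). rewrite Rminus_0_r, Rabs_pos_eq; lra. }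
  assert (Hdp := cond_pos d).
  destruct (HK x (d / 2) Hx ltac:(lra) (eps / 4) He') as [c [Hc0 Hc]].
  exists (Rmin (Rmin c d) (x / 2)). split; [repeat apply Rmin_pos; lra|].
  intros y s Hp Hy Hs.
  assert (y1 := Rlt_le_trans _ _ _ Hy (Rle_trans _ _ _ (Rmin_l _ _) (Rmin_l _ _))).
  assert (y2 := Rlt_le_trans _ _ _ Hy (Rmin_r _ _)). assert (s1 := Rlt_le_trans _ _ _ Hs (Rle_trans _ _ _ (Rmin_l _ _) (Rmin_r _ _))).
  apply Rabs_def2 in y2. rewrite Rminus_0_r in s1. apply Rabs_def2 in s1.
  assert (Hs0 : 0 <= s) by apply Hp.
  assert (T1 : Cmod (K y s - K y 0) < eps / 4).
  { destruct (Rle_lt_or_eq_dec _ _ Hs0) as [Hs1|Hs1]; [apply U; lra|].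
    rewrite <- Hs1. replace (K y 0 - K y 0)%C with (RtoC 0) by ring. rewrite Cmod_0. lra. }
  assert (T2 : Cmod (K y 0 - K y (d / 2)) < eps / 4) by (rewrite Cmod_minus_sym; apply U; lra).
  assert (T3 : Cmod (K y (d / 2) - K x (d / 2)) < eps / 4).
  { apply Hc; auto; [apply punctured_pos_l; lra|]. rewrite Rminus_diag, Rabs_R0. auto. }
  assert (T4 : Cmod (K x (d / 2) - K x 0) < eps / 4) by (apply U; lra).
  replace (K y s - K x 0)%C with ((K y s - K y 0) + (K y 0 - K y (d / 2)%R) + (K y (d / 2)%R - K x (d / 2)%R) + (K x (d / 2)%R - K x 0))%C by ring.
  eapply Rle_lt_trans; [apply Cmod_triangle|].
  eapply Rle_lt_trans; [apply Rplus_le_compat_r, Cmod_triangle|].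
  eapply Rle_lt_trans; [apply Rplus_le_compat_r, Rplus_le_compat_r, Cmod_triangle|]. lra.
Qed.

(** The mean value inequality on interior segments, passed to the limit: where the
    derivative extends continuously to the boundary, the extension is the
    derivative. *)
Lemma rder_boundary K L : (forall x t, punctured x t -> jcont K x t) -> (forall x t, punctured x t -> jcont L x t) ->
  (forall x t, 0 < x -> 0 < t -> Cder (fun y => K y t) x (L x t)) ->
  forall x t, punctured x t -> rder (fun y => punctured y t) (fun y => K y t) x (L x t).
Proof.
  intros HK HL HD x t Hp eps He.
  destruct (HL x t Hp (eps / 2) ltac:(lra)) as [d [Hd0 Hd]].
  exists d. split; auto. intros y Hy Hyx.
  assert (Hp' := Hp). destruct Hp as [Hx [Ht _]].
  assert (Slice : forall s, 0 < s -> Rabs (s - t) < d ->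
    Cmod (K y s - K x s - (y - x) * L x t) <= eps * Rabs (y - x)).
  { intros s Hs Hst.
    (* [Rmax 0] makes the slice continuous on both sides of 0. *)
    set (G := fun z : R => (K (Rmax 0 z) s - z * L x t)%C).
    assert (GC : forall z, Ccont G z).
    { intros z. apply Ccont_minus.
      - apply Ccont_of_eps. intros e He'. destruct (HK (Rmax 0 z) s (punctured_pos_r _ _ (Rmax_l _ _) Hs) e He') as [c [Hc0 Hc]].
        exists c. split; auto. intros w Hw. apply Hc; [apply punctured_pos_r; auto; apply Rmax_l| |].
        + eapply Rle_lt_trans; [apply Rmax_lip|auto].
        + rewrite Rminus_diag, Rabs_R0; auto.
      - apply Ccont_mult; [|apply Ccont_const]. apply (Cder_Ccont _ _ _ (Cder_id z)). }
    assert (GD : forall z, 0 < z -> Cder G z (L z s - L x t)%C).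
    { intros z Hz. apply Cder_minus.
      - apply (Cder_ext_loc (fun y => K y s)); [|apply HD; auto].
        exists (mkposreal z Hz). intros w Hw. change (Rabs (w - z) < z) in Hw. apply Rabs_def2 in Hw. rewrite Rmax_right; auto; lra.
      - eapply Cder_eq; [apply (Cder_mult_l _ (L x t) _ _ (Cder_id z))|]. ring. }
    assert (Inc : forall a b, 0 <= a -> a <= b -> Rabs (a - x) < d -> Rabs (b - x) < d -> Cmod (G b - G a) <= eps * (b - a)).
    { intros a b Ha Hab Hax Hbx. apply Rabs_def2 in Hax, Hbx. replace (eps * (b - a)) with (2 * (eps / 2) * (b - a)) by field.
      apply (mean_value_ineq G (fun z => L z s - L x t)%C); auto; intros z Hz.
      - apply GD; lra.
      - left. apply Hd; [apply punctured_pos_l; lra| |auto]. apply Rabs_def1; lra. }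
    assert (Hy0 : 0 <= y) by apply Hy.
    assert (Hxx : Rabs (x - x) < d) by (rewrite Rminus_diag, Rabs_R0; auto).
    replace (K y s - K x s - (y - x) * L x t)%C with (G y - G x)%C
      by (unfold G; rewrite !Rmax_right by auto; ring).
    destruct (Rle_dec x y) as [Hxy|Hxy].
    - rewrite (Rabs_pos_eq (y - x)) by lra. apply Inc; auto.
    - rewrite Cmod_minus_sym, Rabs_minus_sym, (Rabs_pos_eq (x - y)) by lra. apply Inc; auto; lra. }
  (* The slice at height t + h is interior even if t = 0. *)
  apply le_epsilon. intros eta Heta.
  destruct (HK y t Hy (eta / 2) ltac:(lra)) as [c1 [Hc1 C1]]. destruct (HK x t Hp' (eta / 2) ltac:(lra)) as [c2 [Hc2 C2]].
  set (h := Rmin d (Rmin c1 c2) / 2).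
  assert (Hm : 0 < Rmin d (Rmin c1 c2)) by (repeat apply Rmin_pos; auto).
  assert (m1 := Rmin_l d (Rmin c1 c2)). assert (m2 := Rmin_r d (Rmin c1 c2)).
  assert (m3 := Rmin_l c1 c2). assert (m4 := Rmin_r c1 c2).
  assert (Hh : Rabs (t + h - t) = h) by (replace (t + h - t) with h by ring; apply Rabs_pos_eq; unfold h; lra).
  assert (Hh0 : 0 < h < Rmin d (Rmin c1 c2)) by (unfold h; lra).
  assert (S1 := Slice (t + h) ltac:(lra) ltac:(rewrite Hh; lra)).
  assert (Z : forall z, Rabs (z - z) = 0) by (intros; rewrite Rminus_diag; apply Rabs_R0).
  assert (Hy0 : 0 <= y) by apply Hy. assert (Hth : 0 < t + h) by lra.
  assert (K1 := C1 y (t + h) (punctured_pos_r y (t + h) Hy0 Hth) ltac:(rewrite Z; lra) ltac:(rewrite Hh; lra)).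
  assert (K2 := C2 x (t + h) (punctured_pos_r x (t + h) Hx Hth) ltac:(rewrite Z; lra) ltac:(rewrite Hh; lra)).
  replace (K y t - K x t - (y - x) * L x t)%C with
    ((K y (t + h)%R - K x (t + h)%R - (y - x) * L x t) - (K y (t + h)%R - K y t) + (K x (t + h)%R - K x t))%C by ring.
  eapply Rle_trans; [apply Cmod_triangle|].
  eapply Rle_trans; [apply Rplus_le_compat_r, Cmod_triangle_minus|]. lra.
Qed.

Lemma jcont_continuous_on K : (forall x t, punctured x t -> jcont K x t) ->
  continuous_on (fun p : R * R => punctured (fst p) (snd p)) (fun p : R * R => K (fst p) (snd p) : CR).
Proof.
  intros H [x t] Hp. apply filterlim_locally. intros eps.
  destruct (H x t Hp eps (cond_pos eps)) as [d [Hd0 Hd]].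
  exists (mkposreal d Hd0). intros [y s] [H1 H2] Hys. apply ball_CR. apply Hd; auto.
Qed.

Definition glue (a b : R -> C) (h : R -> R -> C) (x t : R) : C :=
  if Req_EM_T t 0 then a x else if Req_EM_T x 0 then b t else h x t.

Lemma glue_interior a b h x t : 0 < x -> 0 < t -> glue a b h x t = h x t.
Proof. intros. unfold glue. destruct (Req_EM_T t 0); [lra|]. destruct (Req_EM_T x 0); [lra|reflexivity]. Qed.

Lemma glue_bottom a b h x : glue a b h x 0 = a x.
Proof. unfold glue. destruct (Req_EM_T 0 0); [reflexivity|lra]. Qed.

Lemma glue_left a b h t : 0 < t -> glue a b h 0 t = b t.
Proof. intros. unfold glue. destruct (Req_EM_T t 0); [lra|]. destruct (Req_EM_T 0 0); [reflexivity|lra]. Qed.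

Lemma jcont_glue a b h : (forall x t, 0 < x -> 0 < t -> jcont (glue a b h) x t) -> tlim h a -> xlim h b ->
  forall x t, punctured x t -> jcont (glue a b h) x t.
Proof.
  intros Hi Ha Hb x t Hp. destruct (punctured_cases x t Hp) as [[Hx Ht]|[[Hx ->]|[-> Ht]]]; auto.
  - apply jcont_edge; auto. intros p P Hp0 HpP.
    intros eps. destruct (Ha p Hp0 eps) as [d Hd]. exists d. intros s Hs Hs0 y Hy.
    rewrite glue_interior, glue_bottom by lra. apply Hd; auto; lra.
  - apply (jcont_swap (fun s y => glue a b h y s) t 0). apply jcont_edge; auto.
    + intros y s Hy Hs. apply jcont_swap. auto.
    + intros p P Hp0 HpP eps. destruct (Hb p P Hp0 HpP eps) as [d Hd]. exists d. intros s Hs Hs0 y Hy.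
      rewrite glue_interior, glue_left by lra. apply Hd; auto; lra.
Qed.

Lemma glue_Cder_x a b h L x t : 0 < x -> 0 < t -> Cder (fun y => h y t) x L -> Cder (fun y => glue a b h y t) x L.
Proof.
  intros Hx Ht. apply Cder_ext_loc. exists (mkposreal x Hx). intros y Hy. change (Rabs (y - x) < x) in Hy.
  apply Rabs_def2 in Hy. symmetry. apply glue_interior; lra.
Qed.

Lemma glue_Cder_t a b h L x t : 0 < x -> 0 < t -> Cder (fun s => h x s) t L -> Cder (fun s => glue a b h x s) t L.
Proof.
  intros Hx Ht. apply Cder_ext_loc. exists (mkposreal t Ht). intros y Hy. change (Rabs (y - t) < t) in Hy.
  apply Rabs_def2 in Hy. symmetry. apply glue_interior; lra.
Qed.

(** The functions glued from the derivatives and their limits are continuous by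
    [jcont_glue], and are the relative derivatives of each other by
    [rder_boundary]. *)
Lemma piece_smooth D a b : regular D -> (forall n m, tlim (D n m) (a n m)) -> (forall n m, xlim (D n m) (b n m)) ->
  let K n m := glue (a n m) (b n m) (D n m) in
  (forall n m x t, punctured x t -> jcont (K n m) x t) /\
  (forall n m x t, punctured x t -> rder (fun y => punctured y t) (fun y => K n m y t) x (K (S n) m x t)) /\
  (forall n m x t, punctured x t -> rder (fun s => punctured x s) (fun s => K n m x s) t (K n (S m) x t)).
Proof.
  intros [R1 [R2 R3]] Ha Hb K.
  assert (Dx : forall n m x t, 0 < x -> 0 < t -> Cder (fun y => K n m y t) x (K (S n) m x t)).
  { intros n m x t Hx Ht. unfold K at 2. rewrite glue_interior by auto. apply glue_Cder_x; auto. }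
  assert (Dt : forall n m x t, 0 < x -> 0 < t -> Cder (fun s => K n m x s) t (K n (S m) x t)).
  { intros n m x t Hx Ht. unfold K at 2. rewrite glue_interior by auto. apply glue_Cder_t; auto. }
  assert (J : forall n m x t, punctured x t -> jcont (K n m) x t).
  { intros n m. refine (jcont_glue _ _ _ (jcont_interior (K n m) (K (S n) m) (K n (S m)) (Dx n m) (Dt n m) _) (Ha n m) (Hb n m)).
    intros x0 t0 T Hx0 Ht0. destruct (R3 (S n) m x0 t0 T Hx0 Ht0) as [B1 HB1]. destruct (R3 n (S m) x0 t0 T Hx0 Ht0) as [B2 HB2].
    exists (Rmax B1 B2). intros x t Hx Ht. unfold K. rewrite !glue_interior by lra.
    split; [apply Rle_trans with B1; [auto|apply Rmax_l]|apply Rle_trans with B2; [auto|apply Rmax_r]]. }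
  split; [exact J|]. split; intros n m x t Hp.
  - apply (rder_boundary (K n m) (K (S n) m)); auto.
  - assert (H := rder_boundary (fun s y => K n m y s) (fun s y => K n (S m) y s)
      (fun s y Q => jcont_swap _ _ _ (J n m y s (punctured_swap _ _ Q))) (fun s y Q => jcont_swap _ _ _ (J n (S m) y s (punctured_swap _ _ Q)))
      (fun s y Hs Hy => Dt n m y s Hy Hs) t x (punctured_swap _ _ Hp)).
    revert H. apply rder_subset. intros s. apply punctured_swap.
Qed.

(** * The boundary value problem *)

Lemma hat_agree u0 D z : schwartz D -> (forall y, 0 < y -> D 0%nat y = u0 y) -> Im z <= 0 -> hat u0 z = hat (D 0%nat) z.
Proof.
  intros HD E Hz. destruct (hat_dominated D HD) as [M [_ HM]]. symmetry. rewrite !hat_half.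
  apply (half_ext M); auto. intros r Hr. rewrite E by auto. reflexivity.
Qed.

Lemma tilde_agree g h w t : 0 < t -> (forall y, 0 < y -> h y = g y) -> tilde g w t = tilde h w t.
Proof.
  intros Ht E. unfold tilde. apply (RInt_ext (V := CR)). intros s Hs. rewrite Rmin_left in Hs by lra.
  rewrite E by lra. reflexivity.
Qed.

Lemma choose_limits (P : nat -> nat -> (R -> C) -> Prop) : (forall n m, exists a, P n m a) ->
  exists a : nat -> nat -> R -> C, forall n m, P n m (a n m).
Proof.
  intros H. destruct (functional_choice (fun (p : nat * nat) a => P (fst p) (snd p) a)) as [a Ha].
  - intros [n m]; apply H.
  - exists (fun n m => a (n, m)). intros n m. apply (Ha (n, m)).
Qed.

Lemma jets_of_smooth g : smooth_on nonneg_half_line g -> exists G, jet G /\ forall y, 0 < y -> G 0%nat y = g y.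
Proof.
  intros [E HE]. exists (fun k x => E k (Rmax 0 x)). split; [eapply jet_of_derivatives; eauto|].
  intros y Hy. rewrite Rmax_right by lra. apply HE. unfold nonneg_half_line; lra.
Qed.

Lemma jets_of_schwartz u0 : schwartz_half_line u0 -> exists D, schwartz D /\ forall y, 0 < y -> D 0%nat y = u0 y.
Proof.
  intros [E [HE HM]]. exists (fun k x => E k (Rmax 0 x)). split; [split; [eapply jet_of_derivatives; eauto|]|].
  - intros j k. destruct (HM j k) as [M H]. exists M. intros x Hx. rewrite Rmax_right by lra. auto.
  - intros y Hy. rewrite Rmax_right by lra. apply HE. unfold nonneg_half_line; lra.
Qed.

(** Both orders of differentiation occur in the theorem: in x after t for the limits,
    and in t after x for the second boundary condition. *)
Lemma regular_partials D u : regular D -> (forall x t, 0 < x -> 0 < t -> u x t = D 0%nat 0%nat x t) ->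
  (forall n m x t, 0 < x -> 0 < t -> dx n (dt m u) x t = D n m x t) /\
  (forall n m x t, 0 < x -> 0 < t -> dt m (dx n u) x t = D n m x t).
Proof.
  intros [R1 [R2 _]] E. split; intros n m x t Hx Ht.
  - apply (CDerive_n_seq (fun y => dt m u y t) (fun k y => D k m y t)); auto. intros y Hy.
    apply (CDerive_n_seq (fun s => u y s) (fun k s => D 0%nat k y s)); auto.
  - apply (CDerive_n_seq (fun s => dx n u x s) (fun k s => D n k x s)); auto. intros s Hs.
    apply (CDerive_n_seq (fun y => u y s) (fun k y => D k 0%nat y s)); auto.
Qed.

Lemma two_PI_cancel (z w : C) : (2 * PI * z = 2 * PI * w -> z = w)%C.
Proof.
  intros E. rewrite <- (Cmult_1_l z), <- (Cmult_1_l w), <- (Cinv_l (2 * PI)%C two_PI_neq), <- !(Cmult_assoc (/ _)%C).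
  rewrite E. reflexivity.
Qed.

Lemma pos_interior x : 0 < x -> forall y, Rabs (y - x) < x -> pos_half_line y.
Proof. intros Hx y Hy. apply Rabs_def2 in Hy. unfold pos_half_line; lra. Qed.

Theorem theorem2 (u0 g0 g1 : R -> C) (u : R -> R -> C)
  (hu0 : schwartz_half_line u0)
  (hg0 : smooth_on nonneg_half_line g0)
  (hg1 : smooth_on nonneg_half_line g1)
  (hu : forall x t : R, 0 < x -> 0 < t ->
    (2 * PI * u x t =
       int_line (fun l => Cexp (Ci * l * x - omega l * t) * hat u0 l)
     + int_Gamma1 (fun l => Cexp (Ci * l * x - omega l * t) *
         ( (2 - 2 * Ci) * l ^ 3 * tilde g0 (omega l) t
         + (- (2) + 2 * Ci) * l ^ 2 * tilde g1 (omega l) t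
         - Ci * hat u0 (- l)
         + (Ci - 1) * hat u0 (Ci * l)))
     + int_Gamma2 (fun l => Cexp (Ci * l * x - omega l * t) *
         ( (- (2) - 2 * Ci) * l ^ 3 * tilde g0 (omega l) t
         + (- (2) - 2 * Ci) * l ^ 2 * tilde g1 (omega l) t
         + Ci * hat u0 (- l)
         - (Ci + 1) * hat u0 (- (Ci * l)))))%C) :
  (forall n m : nat, exists W : R -> C,
     (forall x0 : R, 0 < x0 ->
        unif_lim_at_0 (fun x => x0 <= x) (fun t x => dx n (dt m u) x t) W) /\
     smooth_on pos_half_line W) /\
  (forall n m : nat, exists V : R -> C,
     (forall t0 T : R, 0 < t0 -> t0 <= T ->
        unif_lim_at_0 (fun t => t0 <= t <= T) (fun x t => dx n (dt m u) x t) V) /\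
     smooth_on pos_half_line V) /\
  smooth2_on closed_quadrant_minus_origin (extend u0 g0 u) /\
  (forall (n : nat) (x0 : R), 0 < x0 ->
     unif_lim_at_0 (fun x => x0 <= x) (fun t x => dx n u x t) (CDerive_n u0 n)) /\
  (forall (m : nat) (t0 T : R), 0 < t0 -> t0 <= T ->
     unif_lim_at_0 (fun t => t0 <= t <= T) (fun x t => dt m u x t) (CDerive_n g0 m)) /\
  (forall (m : nat) (t0 T : R), 0 < t0 -> t0 <= T ->
     unif_lim_at_0 (fun t => t0 <= t <= T) (fun x t => dt m (dx 1 u) x t) (CDerive_n g1 m)).

Proof.
  destruct (jets_of_schwartz u0 hu0) as [D [HD Eu]].
  destruct (jets_of_smooth g0 hg0) as [G0 [H0 E0]]. destruct (jets_of_smooth g1 hg1) as [G1 [H1 E1]].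
  set (U := solution D G0 G1).
  assert (EU : forall x t, 0 < x -> 0 < t -> u x t = U 0%nat 0%nat x t).
  { intros x t Hx Ht. specialize (hu x t Hx Ht).
    rewrite (solution_formula D G0 G1) in hu; auto.
    - exact (two_PI_cancel _ _ hu).
    - intros z Hz. apply hat_agree; auto.
    - intros w. apply tilde_agree; auto.
    - intros w. apply tilde_agree; auto. }
  destruct (solution_piece D G0 G1 HD H0 H1) as [HR [Ha Hb]]. fold U in HR, Ha, Hb.
  apply choose_limits in Ha. destruct Ha as [a Ha]. apply choose_limits in Hb. destruct Hb as [b Hb].
  destruct (regular_partials U u HR EU) as [P1 P2].
  destruct (piece_smooth U a b HR Ha Hb) as [J [Kx Kt]].
  assert (A0 : forall x, 0 < x -> a 0%nat 0%nat x = u0 x).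
  { intros x Hx. rewrite <- Eu by auto. apply (tlim_unique (U 0%nat 0%nat)); auto. apply solution_tlim; auto. }
  assert (B0 : forall t, 0 < t -> b 0%nat 0%nat t = g0 t).
  { intros t Ht. rewrite <- E0 by auto. apply (xlim_unique (U 0%nat 0%nat)); auto. apply solution_xlim_0; auto. }
  assert (B1 : forall t, 0 < t -> b 1%nat 0%nat t = g1 t).
  { intros t Ht. rewrite <- E1 by auto. apply (xlim_unique (U 1%nat 0%nat)); auto. apply solution_xlim_1; auto. }
  (* The limits are differentiated by looking at the glued functions on the axes. *)
  assert (Da : forall n m x, 0 < x -> rder pos_half_line (a n m) x (a (S n) m x)).
  { intros n m x Hx. assert (H := Kx n m x 0 (punctured_pos_l x 0 Hx (Rle_refl 0))). rewrite glue_bottom in H.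
    apply (rder_subset _ pos_half_line) in H; [|intros y Hy; apply punctured_pos_l; [exact Hy|lra]].
    revert H. apply rder_ext; [|exact Hx]. intros y _. apply glue_bottom. }
  assert (Db : forall n m t, 0 < t -> rder pos_half_line (b n m) t (b n (S m) t)).
  { intros n m t Ht. assert (H := Kt n m 0 t (punctured_pos_r 0 t (Rle_refl 0) Ht)). rewrite glue_left in H by auto.
    apply (rder_subset _ pos_half_line) in H; [|intros y Hy; apply punctured_pos_r; [lra|exact Hy]].
    revert H. apply rder_ext; [|exact Ht]. intros y Hy. apply glue_left; auto. }
  assert (Ca : forall n m x, 0 < x -> Cder (a n m) x (a (S n) m x)).
  { intros n m x Hx. apply (rder_Cder pos_half_line _ _ _ x Hx (pos_interior x Hx)). auto. }
  assert (Cb : forall n m t, 0 < t -> Cder (b n m) t (b n (S m) t)).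
  { intros n m t Ht. apply (rder_Cder pos_half_line _ _ _ t Ht (pos_interior t Ht)). auto. }
  split; [|split; [|split; [|split; [|split]]]].
  - intros n m. exists (a n m). split.
    + exact (tlim_ext (U n m) _ _ _ (fun x t Hx Ht => eq_sym (P1 n m x t Hx Ht)) (fun x _ => eq_refl) (Ha n m)).
    + exists (fun k => a (k + n)%nat m). split; [reflexivity|]. intros k x Hx.
      apply is_derive_within_rder; [exact Hx|]. apply Da; exact Hx.
  - intros n m. exists (b n m). split.
    + exact (xlim_ext (U n m) _ _ _ (fun x t Hx Ht => eq_sym (P1 n m x t Hx Ht)) (fun x _ => eq_refl) (Hb n m)).
    + exists (fun k => b n (k + m)%nat). split; [reflexivity|]. intros k x Hx.
      apply is_derive_within_rder; [exact Hx|]. apply Db; exact Hx.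
  - exists (fun n m => glue (a n m) (b n m) (U n m)). split; [|split].
    + intros x t Hp. unfold extend. destruct (punctured_cases x t Hp) as [[Hx Ht]|[[Hx ->]|[-> Ht]]].
      * rewrite glue_interior by auto. destruct (Req_EM_T t 0); [lra|]. destruct (Req_EM_T x 0); [lra|]. symmetry; auto.
      * rewrite glue_bottom. destruct (Req_EM_T 0 0); [auto|lra].
      * rewrite glue_left by auto. destruct (Req_EM_T t 0); [lra|]. destruct (Req_EM_T 0 0); [auto|lra].
    + intros n m. exact (jcont_continuous_on _ (J n m)).
    + intros n m x t Hp. split; apply is_derive_within_rder; try exact Hp; [apply Kx|apply Kt]; exact Hp.
  - intros n. refine (tlim_ext (U n 0%nat) _ _ _ _ _ (Ha n 0%nat)).
    + intros x t Hx Ht. symmetry. exact (P2 n 0%nat x t Hx Ht).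
    + intros x Hx. symmetry. apply (CDerive_n_seq u0 (fun k => a k 0%nat)); auto. intros; symmetry; auto.
  - intros m. refine (xlim_ext (U 0%nat m) _ _ _ _ _ (Hb 0%nat m)).
    + intros x t Hx Ht. symmetry. exact (P1 0%nat m x t Hx Ht).
    + intros t Ht. symmetry. apply (CDerive_n_seq g0 (fun k => b 0%nat k)); auto. intros; symmetry; auto.
  - intros m. refine (xlim_ext (U 1%nat m) _ _ _ _ _ (Hb 1%nat m)).
    + intros x t Hx Ht. symmetry. exact (P2 1%nat m x t Hx Ht).
    + intros t Ht. symmetry. apply (CDerive_n_seq g1 (fun k => b 1%nat k)); auto. intros; symmetry; auto.
Qed.
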